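(* Let $p\in(0,1]$, $q\in[p,1]$, and let $\mathcal B_q$ be a $q$-quasi-Banach space. Let $s_1,s_2\in\mathbb Z_+$ with $s_1\ge\lfloor n(1/p-1)\rfloor$ and $s_2\ge\lfloor m(1/p-1)\rfloor$, and let $T$ be a $\mathcal B_q$-sublinear operator from $\mathcal D_{s_1,s_2}(\mathbb R^n\times\mathbb R^m)$ to $\mathcal B_q$. Then $T$ can be extended to a bounded $\mathcal B_q$-sublinear operator from $H^p(\mathbb R^n\times\mathbb R^m)$ to $\mathcal B_q$ (i.e. there is $C>0$ with $\|Tf\|_{\mathcal B_q}\le C\|f\|_{H^p(\mathbb R^n\times\mathbb R^m)}$ for all $f\in\mathcal D_{s_1,s_2}(\mathbb R^n\times\mathbb R^m)$) if and only if $$\sup\{\|Ta\|_{\mathcal B_q}:\ a\in\mathcal D_{s_1,s_2}(\mathbb R^n\times\mathbb R^m)\text{ is a }(p,2,s_1,s_2)\text{-atom}\}<\infty.$$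
   Context: $\mathcal D(\mathbb R^n\times\mathbb R^m)$ denotes smooth compactly supported functions on $\mathbb R^n\times\mathbb R^m$. For $s_1,s_2\in\mathbb Z_+$, $\mathcal D_{s_1,s_2}(\mathbb R^n\times\mathbb R^m)$ is the set of $f\in\mathcal D(\mathbb R^n\times\mathbb R^m)$ such that $\int_{\mathbb R^n}f(x_1,x_2)x_1^{\alpha_1}dx_1=0$ for all $x_2\in\mathbb R^m$ and all multi-indices $|\alpha_1|\le s_1$, and $\int_{\mathbb R^m}f(x_1,x_2)x_2^{\alpha_2}dx_2=0$ for all $x_1\in\mathbb R^n$ and all $|\alpha_2|\le s_2$. $(p,2,s_1,s_2)$-atom (for $p\in(0,1]$, $s_1\ge\lfloor n(1/p-1)\rfloor$, $s_2\ge\lfloor m(1/p-1)\rfloor$): a function $a$ supported in an open set $\Omega\subset\mathbb R^n\times\mathbb R^m$ of finite measure such that (AI) $a=\sum_{R\in\mathcal M(\Omega)}a_R$, where $\mathcal M(\Omega)$ is the set of maximal dyadic subrectangles $R=I\times J$ of $\Omega$ ($I,J$ dyadic cubes in $\mathbb R^n,\mathbb R^m$), each $a_R$ is supported in $2R=2I\times 2J$ (same center, doubled side lengths), and $\int_{2I}a_R(x_1,x_2)x_1^{\alpha_1}dx_1=0$ for all $x_2\in 2J$, $|\alpha_1|\le s_1$, and $\int_{2J}a_R(x_1,x_2)x_2^{\alpha_2}dx_2=0$ for all $x_1\in 2I$, $|\alpha_2|\le s_2$; (AII) $\|a\|_{L^2}\le|\Omega|^{1/2-1/p}$ and $(\sum_{R\in\mathcal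 M(\Omega)}\|a_R\|_{L^2}^2)^{1/2}\le|\Omega|^{1/2-1/p}$. $H^p(\mathbb R^n\times\mathbb R^m)$: the set of $f\in\mathcal S'(\mathbb R^n\times\mathbb R^m)$ such that $f=\sum_k\lambda_ka_k$ in $\mathcal S'$ with $(p,2,s_1,s_2)$-atoms $a_k$ and $\sum_k|\lambda_k|^p<\infty$, with quasi-norm $\|f\|_{H^p}=\inf(\sum_k|\lambda_k|^p)^{1/p}$ over all such decompositions; it is independent (up to equivalent quasi-norms) of the admissible $s_1,s_2$. A $q$-quasi-Banach space ($q\in(0,1]$) is a quasi-Banach space $\mathcal B_q$ whose quasi-norm satisfies $\|f+g\|^q_{\mathcal B_q}\le\|f\|^q_{\mathcal B_q}+\|g\|^q_{\mathcal B_q}$. An operator $T$ from a linear space $\mathcal Y$ into $\mathcal B_q$ is $\mathcal B_q$-sublinear if for all $f,g\in\mathcal Y$ and $\lambda,\nu\in\mathbb C$: $\|T(\lambda f+\nu g)\|_{\mathcal B_q}\le(|\lambda|^q\|Tf\|^q_{\mathcal B_q}+|\nu|^q\|Tg\|^q_{\mathcal B_q})^{1/q}$ and $\|Tf-Tg\|_{\mathcal B_q}\le\|T(f-g)\|_{\mathcal B_q}$. *)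

(* Defs.v *)
From HB Require Import structures.
From mathcomp Require Import all_boot all_order all_algebra.
From mathcomp Require Import all_classical all_reals all_analysis.
From mathcomp Require Import complex.
Set Implicit Arguments. Unset Strict Implicit. Unset Printing Implicit Defensive.
Import Order.TTheory GRing.Theory Num.Theory.
Import numFieldNormedType.Exports.
Local Open Scope classical_set_scope.
Local Open Scope ring_scope.

Section ProductHardy.
Variable R : realType.
Local Notation C := R[i].

Definition cre (z : C) : R := complex.Re z.
Definition cim (z : C) : R := complex.Im z.
Definition cmod (z : C) : R := Num.sqrt (cre z ^+ 2 + cim z ^+ 2).

(* R^k is k.-tuple R, with its product (= Borel) sigma-algebra from the
   library.  The k-dimensional Lebesgue measure of a Borel set is given by
   iterated one-dimensional Lebesgue integrals of indicators (Tonelli). *)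
Fixpoint lebn (k : nat) : set (k.-tuple R) -> \bar R :=
  match k return set (k.-tuple R) -> \bar R with
  | 0 => fun A => (\1_A [tuple] : R)%:E
  | k'.+1 => fun A =>
      (\int[@lebesgue_measure R]_x lebn [set t | A (cons_tuple x t)])%E
  end.

Definition pt (n m : nat) := (n.-tuple R * m.-tuple R)%type.
Definition leb2 (n m : nat) : set (pt n m) -> \bar R :=
  (lebn (k := n) \x lebn (k := m))%E.

Definition cmeasurable n m (g : pt n m -> C) :=
  measurable_fun [set: pt n m] (fun x => cre (g x)) /\
  measurable_fun [set: pt n m] (fun x => cim (g x)).

Definition esqrt (x : \bar R) : \bar R :=
  match x with
  | EFin r => (Num.sqrt r)%:E
  | +oo%E => +oo%E
  | -oo%E => 0%E
  end.

Definition L2sq n m (g : pt n m -> C) : \bar R :=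
  (\int[leb2 (n:=n) (m:=m)]_x (cmod (g x) ^+ 2)%:E)%E.
Definition L2norm n m (g : pt n m -> C) : \bar R := esqrt (L2sq g).

Definition open_set n m (O : set (pt n m)) :=
  forall x, O x -> exists2 d : R, 0 < d &
    forall y : pt n m, (forall i, `|tnth y.1 i - tnth x.1 i| < d) ->
                       (forall j, `|tnth y.2 j - tnth x.2 j| < d) -> O y.

(* A dyadic cube of R^k is coded by (e, j) : int * k.-tuple int and is
   prod_i [j_i 2^e, (j_i + 1) 2^e). *)
Definition dcube (k : nat) := (int * k.-tuple int)%type.
Definition dside k (Q : dcube k) : R := (2%:R : R) ^ Q.1.
Definition cube_set k (Q : dcube k) : set (k.-tuple R) :=
  [set x | forall i, (tnth Q.2 i)%:~R * dside Q <= tnth x i /\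
                     tnth x i < ((tnth Q.2 i)%:~R + 1) * dside Q].
Definition dbl_cube_set k (Q : dcube k) : set (k.-tuple R) :=
  [set x | forall i,
     ((tnth Q.2 i)%:~R + 2^-1) * dside Q - dside Q <= tnth x i /\
     tnth x i < ((tnth Q.2 i)%:~R + 2^-1) * dside Q + dside Q].

Definition drect n m := (dcube n * dcube m)%type.
Definition rect_set n m (Q : drect n m) : set (pt n m) :=
  [set x | cube_set Q.1 x.1 /\ cube_set Q.2 x.2].
Definition dbl_rect_set n m (Q : drect n m) : set (pt n m) :=
  [set x | dbl_cube_set Q.1 x.1 /\ dbl_cube_set Q.2 x.2].

Definition maxrect n m (O : set (pt n m)) (Q : drect n m) :=
  rect_set Q `<=` O /\
  forall Q' : drect n m, rect_set Q `<=` rect_set Q' -> rect_set Q' `<=` O ->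
                         rect_set Q' = rect_set Q.

Definition mabs k (al : k.-tuple nat) : nat := \sum_(i < k) tnth al i.
Definition mono k (al : k.-tuple nat) (x : k.-tuple R) : R :=
  \prod_(i < k) tnth x i ^+ tnth al i.

Definition coord n m := ('I_n + 'I_m)%type.
Definition shift n m (x : pt n m) (c : coord n m) (t : R) : pt n m :=
  match c with
  | inl i => ([tuple tnth x.1 j + (if j == i then t else 0) | j < n], x.2)
  | inr i => (x.1, [tuple tnth x.2 j + (if j == i then t else 0) | j < m])
  end.
Definition pderiv n m (g : pt n m -> R) (c : coord n m) : pt n m -> R :=
  fun x => derive1 (fun t => g (shift x c t)) 0.
Definition pderivable n m (g : pt n m -> R) (c : coord n m) :=
  forall x, derivable (fun t => g (shift x c t)) 0 1.
Fixpoint iter_pd n m (s : seq (coord n m)) (g : pt n m -> R) : pt n m -> R :=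
  match s with
  | [::] => g
  | c :: s' => pderiv (iter_pd s' g) c
  end.
Definition pt_continuous n m (g : pt n m -> R) :=
  forall (x : pt n m) (e : R), 0 < e -> exists2 d : R, 0 < d &
    forall y : pt n m, (forall i, `|tnth y.1 i - tnth x.1 i| < d) ->
                       (forall j, `|tnth y.2 j - tnth x.2 j| < d) ->
                       `|g y - g x| < e.
Definition smooth n m (g : pt n m -> R) :=
  forall s : seq (coord n m),
    pt_continuous (iter_pd s g) /\ forall c, pderivable (iter_pd s g) c.

Definition bounded_support n m (f : pt n m -> C) :=
  exists r : R, forall x : pt n m,
    ((exists i, r < `|tnth x.1 i|) \/ (exists j, r < `|tnth x.2 j|)) -> f x = 0.

Definition Dtest n m (f : pt n m -> C) :=
  smooth (fun x => cre (f x)) /\ smooth (fun x => cim (f x)) /\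
  bounded_support f.

Definition Dss n m (s1 s2 : nat) (f : pt n m -> C) :=
  Dtest f /\
  (forall (x2 : m.-tuple R) (al : n.-tuple nat), (mabs al <= s1)%N ->
     (\int[lebn (k:=n)]_x1 (cre (f (x1, x2)) * mono al x1)%:E = 0)%E /\
     (\int[lebn (k:=n)]_x1 (cim (f (x1, x2)) * mono al x1)%:E = 0)%E) /\
  (forall (x1 : n.-tuple R) (al : m.-tuple nat), (mabs al <= s2)%N ->
     (\int[lebn (k:=m)]_x2 (cre (f (x1, x2)) * mono al x2)%:E = 0)%E /\
     (\int[lebn (k:=m)]_x2 (cim (f (x1, x2)) * mono al x2)%:E = 0)%E).

Definition schwartz n m (phi : pt n m -> C) :=
  smooth (fun x => cre (phi x)) /\ smooth (fun x => cim (phi x)) /\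
  forall (s : seq (coord n m)) (b1 : n.-tuple nat) (b2 : m.-tuple nat),
    exists M : R, forall x : pt n m,
      `|mono b1 x.1 * mono b2 x.2 * iter_pd s (fun y => cre (phi y)) x| <= M /\
      `|mono b1 x.1 * mono b2 x.2 * iter_pd s (fun y => cim (phi y)) x| <= M.

Definition cintegral n m (g : pt n m -> C) : C :=
  Complex (fine (\int[leb2 (n:=n) (m:=m)]_x (cre (g x))%:E)%E)
          (fine (\int[leb2 (n:=n) (m:=m)]_x (cim (g x))%:E)%E).
Definition pairing n m (g phi : pt n m -> C) : C :=
  cintegral (fun x => g x * phi x).

Definition Sconv n m (lam : nat -> C) (a : nat -> pt n m -> C) (f : pt n m -> C) :=
  forall phi, schwartz phi ->
    ((fun N => cre (\sum_(k < N) lam k * pairing (a k) phi)) @ \oo -->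
      (cre (pairing f phi) : R)) /\
    ((fun N => cim (\sum_(k < N) lam k * pairing (a k) phi)) @ \oo -->
      (cim (pairing f phi) : R)).

Definition atom n m (p : R) (s1 s2 : nat) (a : pt n m -> C) :=
  exists (O : set (pt n m)) (aR : drect n m -> pt n m -> C),
    let bound := (fine (leb2 O)) `^ (2^-1 - p^-1) in
    [/\ open_set O, (leb2 O < +oo)%E, cmeasurable a,
        (forall x, ~ O x -> a x = 0) &
     [/\
     forall Q, maxrect O Q ->
       [/\ cmeasurable (aR Q),
           (forall x, ~ dbl_rect_set Q x -> aR Q x = 0),
           (forall (x2 : m.-tuple R) (al : n.-tuple nat),
              dbl_cube_set Q.2 x2 -> (mabs al <= s1)%N ->
              (\int[lebn (k:=n)]_(x1 in dbl_cube_set Q.1)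
                  (cre (aR Q (x1, x2)) * mono al x1)%:E = 0)%E /\
              (\int[lebn (k:=n)]_(x1 in dbl_cube_set Q.1)
                  (cim (aR Q (x1, x2)) * mono al x1)%:E = 0)%E) &
           (forall (x1 : n.-tuple R) (al : m.-tuple nat),
              dbl_cube_set Q.1 x1 -> (mabs al <= s2)%N ->
              (\int[lebn (k:=m)]_(x2 in dbl_cube_set Q.2)
                  (cre (aR Q (x1, x2)) * mono al x2)%:E = 0)%E /\
              (\int[lebn (k:=m)]_(x2 in dbl_cube_set Q.2)
                  (cim (aR Q (x1, x2)) * mono al x2)%:E = 0)%E)],
     (* (AI) a = sum_{R in M(Omega)} a_R, the sum converging
        (unconditionally) in L^2 *)
     (forall e : R, 0 < e -> exists s0 : seq (drect n m),
        (forall Q, Q \in s0 -> maxrect O Q) /\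
        forall s : seq (drect n m), uniq s -> {subset s0 <= s} ->
          (forall Q, Q \in s -> maxrect O Q) ->
          (L2norm (fun x => (a x - \sum_(Q <- s) aR Q x)%R) <= e%:E)%E),
     (L2norm a <= bound%:E)%E &
     (esqrt (\esum_(Q in maxrect O) L2sq (aR Q)) <= bound%:E)%E]].

Definition Hp_norm n m (p : R) (s1 s2 : nat) (f : pt n m -> C) : \bar R :=
  ereal_inf [set e : \bar R | exists (lam : nat -> C) (a : nat -> pt n m -> C),
    [/\ forall k, atom p s1 s2 (a k),
        (\sum_(0 <= k <oo) ((cmod (lam k)) `^ p)%:E < +oo)%E,
        Sconv lam a f &
        e = ((fine (\sum_(0 <= k <oo) ((cmod (lam k)) `^ p)%:E)%E) `^ p^-1)%:E]].

Definition qQuasiBanach (q : R) (V : lmodType C) (nrm : V -> R) :=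
  [/\ forall x, 0 <= nrm x,
      forall x, nrm x = 0 <-> x = 0,
      forall (c : C) x, nrm (c *: x) = cmod c * nrm x,
      forall x y, nrm (x + y) `^ q <= nrm x `^ q + nrm y `^ q &
      forall u : nat -> V,
        (forall e : R, 0 < e -> exists N, forall i j, (N <= i)%N -> (N <= j)%N ->
            nrm (u i - u j) < e) ->
        exists l : V, (fun k => nrm (u k - l)) @ \oo --> (0 : R)].

Definition lincomb n m (lam nu : C) (f g : pt n m -> C) : pt n m -> C :=
  fun x => lam * f x + nu * g x.

Definition sublinear_on n m (Y : (pt n m -> C) -> Prop) (q : R) (V : lmodType C)
    (nrm : V -> R) (T : (pt n m -> C) -> V) :=
  forall f g, Y f -> Y g ->
    (forall lam nu : C,
       nrm (T (lincomb lam nu f g)) <=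
       (cmod lam `^ q * nrm (T f) `^ q + cmod nu `^ q * nrm (T g) `^ q) `^ q^-1) /\
    nrm (T f - T g) <= nrm (T (lincomb 1 (-1) f g)).

End ProductHardy.

(* Main.v *)
Require Import Defs.
From HB Require Import structures.
From mathcomp Require Import all_boot all_order all_algebra.
From mathcomp Require Import all_classical all_reals all_analysis.
From mathcomp Require Import measurable_realfun complex.
From mathcomp Require Import ring lra zify.
Set Implicit Arguments. Unset Strict Implicit. Unset Printing Implicit Defensive.
Import Order.TTheory GRing.Theory Num.Theory.
Import numFieldNormedType.Exports.
Local Open Scope classical_set_scope.
Local Open Scope ring_scope.

(** Testing on the decomposition with the single coefficient 1 shows that boundedness on H^p bounds
    T on atoms. For the converse, a real bump u with the moments of the Dirac mass up to order s
    yields, by h(X) - h(Y) = (X - Y)(3(X + Y) - 2(X^2 + XY + Y^2)) for h(x) = 3x^2 - 2x^3 and the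
    convolutions X, Y by two consecutive dilates of u^(x)n, kernels A_e, B_e of compact support,
    with A_e orthogonal to polynomials, such that the sums over e of A_e B_e telescope to an
    approximate identity. Cutting the tensor product of two such formulas along dyadic rectangles Q
    gives operators P_F g = sum_(Q in F) A_Q (1_Q B_Q g), F finite, which map everything to
    D_(s1,s2).

    The core is a bound nu(P_F a) <= C M for atoms a, uniform in F and a, for every p-subadditive nu
    that is bounded by M on smooth atoms. If a lives on Omega, the rectangles Q that are near an
    enlargement of Omega contribute one multiple of an atom (almost orthogonality in L^2); the others
    are grouped, for each maximal rectangle R of Omega, by the size of Q relative to R: each group
    lives on one dyadic rectangle, its size is controlled by the moments of a_R and Taylor expansion
    of B_Q, and the measures of the rectangles R that occur are summable by Journe's covering lemma.

    If f = sum lambda_k a_k in S', then P_F f = sum lambda_k P_F a_k pointwise, the kernels of P_F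
    being test functions; the same bound with nu the L^2 norm gives convergence in L^2, and what is
    left over is a small multiple of an atom because F is finite. Finally f - P_F f splits into
    finitely many functions on large dyadic rectangles whose atomic norm tends to 0. *)

(** [T] carries no continuity: a convergent series cannot be pushed through it, and its values are
    constrained only by finite combinations inside D_(s1,s2). Hence the finite families F, and hence
    the arbitrary functional nu: one theorem, read once with g |-> ||T g|| and once with the L^2
    norm, supplies both the estimate and the convergence that the first reading lacks. The cubic h
    is dictated by the kernels. h(0) = 0 and h(1) = 1 make h(X) a function that approximates the
    identity, h'(0) = 0 keeps a Dirac mass out of B = (h(X) - h(Y)) / (X - Y), and h'(1) = 0 gives B
    integral zero, which almost orthogonality needs. Moments beyond the total mass are required of u
    for the sake of A, whose range must lie in D_(s1,s2), and of h(X), which must hand on the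
    moments of f. B has no higher vanishing moments: against a_R it is its smoothness that is used,
    the cancellation being that of a_R. All estimates are made for real functions; splitting f and
    the a_k into real and imaginary parts costs the factors 2 and 4. *)

Lemma sigma_finite_prod d1 d2 (T1 : measurableType d1) (T2 : measurableType d2)
    (R : realType) (m1 : {sigma_finite_measure set T1 -> \bar R})
    (m2 : {sigma_finite_measure set T2 -> \bar R}) :
  sigma_finite setT (m1 \x m2)%E.
Proof.
have /sigma_finiteP[F [TF ndF Foo]] := sigma_finiteT m1.
have /sigma_finiteP[G [TG ndG Goo]] := sigma_finiteT m2.
exists (fun n => F n `*` G n).
  rewrite -setXTT TF TG predeqE => -[x y]; split.
    move=> [/= [n _ Fnx] [k _ Gky]]; exists (maxn n k) => //; split.
    - by move: x Fnx; exact/subsetPset/ndF/leq_maxl.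
    - by move: y Gky; exact/subsetPset/ndG/leq_maxr.
  by move=> [n _ []/= ? ?]; split; exists n.
move=> k; have [? ?] := Foo k; have [? ?] := Goo k.
split; first exact: measurableX.
by rewrite product_measure1E// lte_mul_pinfty// ge0_fin_numE.
Qed.

Section SigmaFinitePack.
Context d (T : measurableType d) (R : realType) (mu : {measure set T -> \bar R}).
(** The proof of sigma-finiteness is an argument of the name, so that structure inference can
    recover it from the measure alone. *)
Definition sfm (_ : sigma_finite setT mu) : set T -> \bar R := mu.
Variable sf : sigma_finite setT mu.
HB.instance Definition _ := Measure.copy (sfm sf) mu.
HB.instance Definition _ := Measure_isSigmaFinite.Build _ _ _ (sfm sf) sf.
End SigmaFinitePack.

(** * Lebesgue measure on tuples *)

Section LebesgueTuple.
Variable R : realType.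
Local Open Scope ereal_scope.
Notation leb := (@lebesgue_measure R).

Let consp k (z : measurableTypeR R * k.-tuple R) : k.+1.-tuple R := cons_tuple z.1 z.2.

Lemma measurable_consp k : measurable_fun setT (@consp k).
Proof.
by apply: measurable_cons.
Qed.

Lemma lebn_step k (mu : {sigma_finite_measure set (k.-tuple R) -> \bar R}) :
  (mu : set _ -> \bar R) = @lebn R k ->
  (@lebn R k.+1) = pushforward (leb \x mu) (@consp k).
Proof.
move=> E; apply/funext => A; rewrite /pushforward /product_measure1 /=.
apply: eq_integral => x _; rewrite -E /=; congr (mu _).
by apply/seteqP; split => t /=; rewrite /xsection /= inE.
Qed.

(** [lebn] is only a recursive set function. It is a measure because it equals one on all sets,
    measurable or not: the product measure is defined by the same integral of sections, so
    [lebn_step] asks for no measurability. The exhaustion of the product, transported along consing,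
    keeps sigma-finiteness through the induction. *)
Lemma lebn_exists k : exists mu : {sigma_finite_measure set (k.-tuple R) -> \bar R},
  (mu : set _ -> \bar R) = @lebn R k.
Proof.
elim: k => [|k [mu IH]].
  by exists (dirac ([tuple] : 0.-tuple R)); apply/funext => A; rewrite /= /dirac.
have E := lebn_step IH.
pose nu : {measure set (k.+1.-tuple R) -> \bar R} :=
  measure_function_pushforward__canonical__measure_function_Measure
    (leb \x mu)%E (@measurable_consp k).
have sf : sigma_finite setT nu.
  have [F FT Foo] := sigma_finite_prod (@lebesgue_measure R) mu.
  have cK : cancel (fun t : k.+1.-tuple R => (thead t, [tuple of behead t])) (@consp k).
    by move=> t; rewrite /consp /=; apply: val_inj => /=; case: t => -[].
  have pK : cancel (@consp k) (fun t : k.+1.-tuple R => (thead t, [tuple of behead t])).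
    by move=> [x t]; rewrite /consp /=; congr pair; apply: val_inj.
  have im i : consp (k:=k) @^-1` ((fun t : k.+1.-tuple R =>
      (thead t, [tuple of behead t])) @^-1` F i) = F i.
    by apply/seteqP; split=> z /=; rewrite pK.
  exists (fun i => (fun t : k.+1.-tuple R => (thead t, [tuple of behead t])) @^-1` F i).
    by rewrite -preimage_bigcup -FT preimage_setT.
  move=> i; split; last by rewrite /nu /= /pushforward im; have [] := Foo i.
  rewrite -[X in measurable X]setTI.
  apply: (measurable_fun_pair (f:=fun t : k.+1.-tuple R => thead t)
    (g:=fun t : k.+1.-tuple R => [tuple of behead t])) => //.
  - exact: measurable_tnth.
  - exact: measurable_behead.
  - by have [] := Foo i.
by exists (sfm sf); rewrite E.
Qed.

Definition lebn_sf k : {sigma_finite_measure set (k.-tuple R) -> \bar R} :=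
  sval (cid (lebn_exists k)).

Lemma lebn_sfE k : (lebn_sf k : set _ -> \bar R) = @lebn R k.
Proof. exact: (svalP (cid (lebn_exists k))). Qed.

Let lebn0 k : @lebn R k set0 = 0.
Proof. by rewrite -lebn_sfE measure0. Qed.
Let lebn_ge0 k A : 0 <= @lebn R k A.
Proof. by rewrite -lebn_sfE. Qed.
Let lebn_sa k : semi_sigma_additive (@lebn R k).
Proof. by rewrite -lebn_sfE; exact: measure_semi_sigma_additive. Qed.
Let lebn_sft k : sigma_finite setT (@lebn R k).
Proof. by rewrite -lebn_sfE; exact: sigma_finiteT. Qed.

HB.instance Definition _ k := isMeasure.Build _ _ _ (@lebn R k)
  (lebn0 k) (@lebn_ge0 k) (@lebn_sa k).
HB.instance Definition _ k := Measure_isSigmaFinite.Build _ _ _ (@lebn R k) (lebn_sft k).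

HB.instance Definition _ n m := Measure.copy (@leb2 R n m) (@lebn R n \x @lebn R m)%E.
HB.instance Definition _ n m := Measure_isSigmaFinite.Build _ _ _ (@leb2 R n m)
  (sigma_finite_prod (@lebn R n) (@lebn R m)).

Lemma ge0_integral_lebnS k (f : k.+1.-tuple R -> \bar R) :
  measurable_fun [set: k.+1.-tuple R] f -> (forall x, 0 <= f x) ->
  \int[@lebn R k.+1]_x f x = \int[leb]_x \int[@lebn R k]_t f (cons_tuple x t).
Proof.
move=> mf f0.
rewrite (_ : @lebn R k.+1 = pushforward (leb \x @lebn R k)%E (@consp k)); last first.
  exact: lebn_step.
rewrite (ge0_integral_pushforward (@measurable_consp k))// preimage_setT.
have mfc : measurable_fun setT (f \o @consp k).
  by apply: measurableT_comp => //; exact: measurable_consp.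
by rewrite (fubini_tonelli1 (f \o @consp k)) // => x; exact: f0.
Qed.

Lemma integral_lebnS k (f : k.+1.-tuple R -> \bar R) :
  (@lebn R k.+1).-integrable setT f ->
  \int[@lebn R k.+1]_x f x = \int[leb]_x \int[@lebn R k]_t f (cons_tuple x t).
Proof.
move=> intf; have mf := measurable_int _ intf.
have E : @lebn R k.+1 = pushforward (leb \x @lebn R k)%E (@consp k) by exact: lebn_step.
have mfc : measurable_fun setT (f \o @consp k).
  by apply: measurableT_comp => //; exact: measurable_consp.
have ic : (leb \x @lebn R k)%E.-integrable setT (f \o @consp k).
  apply/integrableP; split => //.
  move/integrableP : intf => [_]; rewrite E.
  rewrite (ge0_integral_pushforward (@measurable_consp k))//.
  exact: measurableT_comp.
rewrite E (integral_pushforward (@measurable_consp k))// preimage_setT.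
by rewrite -integral12_prod_meas1.
Qed.

Lemma integral_lebn0 (f : 0.-tuple R -> \bar R) : \int[@lebn R 0]_x f x = f [tuple].
Proof.
rewrite (_ : @lebn R 0 = dirac ([tuple] : 0.-tuple R)); last by apply/funext.
have mf : measurable_fun [set: 0.-tuple R] f.
  move=> _ Y _; rewrite setTI.
  have [h|h] := pselect (Y (f [tuple])).
    rewrite (_ : _ @^-1` _ = setT)//; apply/seteqP; split => // t _ /=.
    by rewrite (tuple0 t).
  rewrite (_ : _ @^-1` _ = set0)//; apply/seteqP; split => // t /=.
  by rewrite (tuple0 t).
by rewrite integral_dirac// diracT mul1e.
Qed.

Lemma prod_cons_tuple k (g : 'I_k.+1 -> R -> R) x (t : k.-tuple R) :
  (\prod_(i < k.+1) g i (tnth (cons_tuple x t) i) =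
   g ord0 x * \prod_(i < k) g (lift ord0 i) (tnth t i))%R.
Proof. by rewrite big_ord_recl; congr (_ * _)%R; apply: eq_bigr => i _; rewrite tnthS. Qed.

Lemma measurable_tens k (g : 'I_k -> R -> R) : (forall i, measurable_fun setT (g i)) ->
  measurable_fun setT (fun x : k.-tuple R => \prod_(i < k) g i (tnth x i))%R.
Proof.
move=> mg; apply: measurable_prod => i _.
by apply: measurableT_comp => //; exact: measurable_tnth.
Qed.

Lemma ge0_integral_tens k (g : 'I_k -> R -> R) : (forall i, measurable_fun setT (g i)) ->
  (forall i x, 0 <= g i x)%R ->
  \int[@lebn R k]_x (\prod_(i < k) g i (tnth x i))%:E =
  \prod_(i < k) \int[leb]_x (g i x)%:E.
Proof.
elim: k g => [|k IH] g mg g0; first by rewrite integral_lebn0 !big_ord0.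
rewrite ge0_integral_lebnS; last 2 first.
- by apply/measurable_EFinP; apply: measurable_tens => i; exact: mg.
- by move=> x; rewrite lee_fin; apply: prodr_ge0.
transitivity (\int[leb]_x ((g ord0 x)%:E *
    \int[@lebn R k]_t (\prod_(i < k) g (lift ord0 i) (tnth t i))%:E)).
  apply: eq_integral => x _.
  under eq_integral => t _ do rewrite prod_cons_tuple EFinM.
  rewrite ge0_integralZl_EFin//.
  - by move=> t _; rewrite lee_fin; apply: prodr_ge0.
  - by apply/measurable_EFinP; exact: (measurable_tens (g := fun i => g (lift ord0 i))).
rewrite ge0_integralZr//.
- by rewrite big_ord_recl; congr mule; exact: IH.
- by apply/measurable_EFinP; exact: mg.
- by move=> x _; rewrite lee_fin.
- by apply: integral_ge0 => t _; rewrite lee_fin; apply: prodr_ge0.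
Qed.

Lemma integrable_tens k (g : 'I_k -> R -> R) :
  (forall i, leb.-integrable setT (EFin \o g i)) ->
  (@lebn R k).-integrable setT (fun x => (\prod_(i < k) g i (tnth x i))%:E).
Proof.
move=> ig.
have mg i : measurable_fun setT (g i) by apply/measurable_EFinP; exact: measurable_int (ig i).
apply/integrableP; split.
  by apply/measurable_EFinP; apply: measurable_tens => i; exact: mg.
under eq_integral => x _ do rewrite /= normr_prod.
rewrite (ge0_integral_tens (g := fun i x => `|g i x|%R))//; last first.
  by move=> i; apply: measurableT_comp.
rewrite -(@fineK _ (\prod_(_ < _) _)) ?ltry//.
apply: (big_ind (fun x : \bar R => x \is a fin_num)) => //=.
  by move=> x y; exact: fin_numM.
move=> i _; have /integrableP[_ h] := ig i.
by rewrite ge0_fin_numE ?integral_ge0// => x _; rewrite lee_fin.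
Qed.

Lemma Rintegral_tens k (g : 'I_k -> R -> R) :
  (forall i, leb.-integrable setT (EFin \o g i)) ->
  (\int[@lebn R k]_x (\prod_(i < k) g i (tnth x i)) =
   \prod_(i < k) \int[leb]_x g i x)%R.
Proof.
elim: k g => [|k IH] g ig; first by rewrite /Rintegral integral_lebn0 !big_ord0.
rewrite /Rintegral integral_lebnS; last exact: integrable_tens.
have it := integrable_tens (fun i => ig (lift ord0 i)).
transitivity (fine (\int[leb]_x ((g ord0 x)%:E *
    (\prod_(i < k) \int[leb]_x g (lift ord0 i) x)%R%:E))).
  congr fine; apply: eq_integral => x _.
  under eq_integral => t _ do rewrite prod_cons_tuple EFinM.
  rewrite integralZl//; congr mule.
  rewrite -IH; last by move=> i; exact: ig.
  by rewrite /Rintegral fineK//; exact: integrable_fin_num.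
rewrite integralZr//; last exact: ig.
by rewrite fineM//; [rewrite big_ord_recl|apply: integrable_fin_num => //; exact: ig].
Qed.

Lemma measurable_hbox k (a b : 'I_k -> R) :
  measurable [set x : k.-tuple R | forall i, (a i <= tnth x i < b i)%R].
Proof.
rewrite (_ : [set x | _] = \bigcap_(i in [set: 'I_k]) ((fun x => tnth x i) @^-1` `[a i, b i[%classic)).
  apply: fin_bigcap_measurable => // i _; rewrite -[X in measurable X]setTI.
  by apply: measurable_tnth => //; exact: measurable_itv.
apply/seteqP; split => x /=; first by move=> h i _ /=; rewrite in_itv /=.
by move=> h i; have := h i I; rewrite /= in_itv /=.
Qed.

Lemma lebn_hbox k (a b : 'I_k -> R) : (forall i, a i <= b i)%R ->
  @lebn R k [set x | forall i, (a i <= tnth x i < b i)%R] = (\prod_(i < k) (b i - a i))%:E.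
Proof.
move=> ab.
have mA := measurable_hbox a b.
rewrite -[X in lebn X]setIT -integral_indic//.
rewrite (eq_integral (fun x : k.-tuple R =>
  (\prod_(i < k) (\1_(`[a i, b i[%classic) (tnth x i) : R))%:E)); last first.
  move=> x _; congr EFin; rewrite indicE.
  have [/set_mem xA|xA] := boolP (x \in _).
    by rewrite big1// => i _; rewrite indicE mem_set//= in_itv /=; exact: xA.
  move/negP : xA; rewrite inE /= => /existsNP[i xi].
  by rewrite (bigD1 i)//= indicE memNset ?mul0r//= in_itv /=.
rewrite (ge0_integral_tens (g := fun i => \1_(`[a i, b i[%classic)))//.
rewrite -prodEFin; apply: eq_bigr => i _.
rewrite integral_indic//= setIT lebesgue_measure_itv/= lte_fin.
case: ltP => // ba; have -> : a i = b i by apply/eqP; rewrite eq_le ab ba.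
by rewrite subrr.
Qed.

End LebesgueTuple.

(** * Bounded functions on sets of finite measure *)

Section BoundedFunctions.
Context d (T : measurableType d) (R : realType) (mu : {measure set T -> \bar R}).

Definition bfun (D : set T) (g : T -> R) :=
  [/\ measurable_fun setT g, exists M : R, forall x, `|g x| <= M & forall x, ~ D x -> g x = 0].

Lemma bfun_ge0_bound D g : bfun D g -> exists2 M, 0 <= M & forall x, `|g x| <= M.
Proof.
move=> [_ [M hM] _]; exists (Num.max 0 M); first by rewrite le_max lexx.
by move=> x; rewrite le_max hM orbT.
Qed.

Lemma integrable_indicT (D : set T) : measurable D -> (mu D < +oo)%E ->
  mu.-integrable setT (EFin \o (\1_D : T -> R)).
Proof.
move=> mD fD; apply/integrableP; split; first exact/measurable_EFinP.
under eq_integral => x _ do rewrite /= ger0_norm//.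
by rewrite integral_indic// setIT.
Qed.

Lemma bfun_integrable D g : measurable D -> (mu D < +oo)%E -> bfun D g ->
  mu.-integrable setT (EFin \o g).
Proof.
move=> mD fD bg; have [M M0 hM] := bfun_ge0_bound bg; have [mg _ g0] := bg.
apply: (@le_integrable _ _ _ mu setT measurableT _ (EFin \o (fun x => M * \1_D x))).
- exact/measurable_EFinP.
- move=> x _ /=; rewrite lee_fin normrM [X in _ <= X * _]ger0_norm// indicE.
  have [xD|/negP xD] := boolP (x \in D); first by rewrite normr1 mulr1.
  by rewrite g0 ?normr0 ?mulr0//; apply: contra_not xD; rewrite inE.
- have := integrableZl measurableT M (integrable_indicT mD fD).
  by apply: eq_integrable => // x _.
Qed.

Lemma Rintegral_le_bound D g (M : R) : measurable D -> (mu D < +oo)%E -> bfun D g ->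
  (forall x, `|g x| <= M) -> `| \int[mu]_x g x | <= M * fine (mu D).
Proof.
move=> mD fD bg hM; have [mg _ g0] := bg.
have M0 : 0 <= M.
  have [//|M0] := leP 0 M.
  by have := le_lt_trans (hM point) M0; rewrite normr_lt0.
have ig := bfun_integrable mD fD bg.
apply: (le_trans (le_normr_Rintegral measurableT ig)).
have -> : M * fine (mu D) = \int[mu]_x (M * \1_D x).
  rewrite RintegralZl//; last exact: integrable_indicT.
  by rewrite /Rintegral integral_indic// setIT.
apply: le_Rintegral => //.
- exact: integrable_norm.
- have := integrableZl measurableT M (integrable_indicT mD fD).
  by apply: eq_integrable => // x _.
move=> x _; rewrite indicE.
have [xD|/negP xD] := boolP (x \in D); first by rewrite mulr1.
by rewrite g0 ?normr0 ?mulr0//; apply: contra_not xD; rewrite inE.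
Qed.

Lemma bfunZ D c g : bfun D g -> bfun D (fun x => c * g x).
Proof.
move=> [mg [M hM] g0]; split; first exact: measurable_funM.
- by exists (`|c| * M) => x; rewrite normrM ler_wpM2l.
- by move=> x /g0 ->; rewrite mulr0.
Qed.

Lemma bfunD D g h : bfun D g -> bfun D h -> bfun D (fun x => g x + h x).
Proof.
move=> [mg [M hM] g0] [mh [N hN] h0]; split; first exact: measurable_funD.
- by exists (M + N) => x; rewrite (le_trans (ler_normD _ _))// lerD.
- by move=> x Dx; rewrite g0// h0// addr0.
Qed.

Lemma bfunM D g (h : T -> R) : bfun D g -> measurable_fun setT h -> (exists M : R, forall x, `|h x| <= M) ->
  bfun D (fun x => h x * g x).
Proof.
move=> [mg [M hM] g0] mh [N hN]; split; first exact: measurable_funM.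
- exists (N * M) => x; rewrite normrM ler_pM//.
- by move=> x /g0 ->; rewrite mulr0.
Qed.

Lemma bfun0 D : bfun D (fun=> 0).
Proof. by split => //; exists 0 => x; rewrite normr0. Qed.

Lemma bfunS D D' g : D `<=` D' -> bfun D g -> bfun D' g.
Proof. by move=> DD [mg bg g0]; split => // x D'x; apply: g0 => /DD. Qed.

Lemma integrable_Rsum (I : Type) (s : seq I) (g : I -> T -> R) :
  (forall i, mu.-integrable setT (EFin \o g i)) ->
  mu.-integrable setT (EFin \o (fun x => \sum_(i <- s) g i x)).
Proof.
move=> ig; elim: s => [|i s IH].
  rewrite (_ : EFin \o _ = cst 0%E); first exact: integrable0.
  by apply/funext => x /=; rewrite big_nil.
rewrite (_ : EFin \o _ = ((EFin \o g i) \+ (EFin \o (fun x => (\sum_(i <- s) g i x)%R)))%E).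
  exact: integrableD.
by apply/funext => x /=; rewrite big_cons EFinD.
Qed.

Lemma Rintegral_sum (I : Type) (s : seq I) (g : I -> T -> R) :
  (forall i, mu.-integrable setT (EFin \o g i)) ->
  \int[mu]_x (\sum_(i <- s) g i x) = \sum_(i <- s) \int[mu]_x g i x.
Proof.
move=> ig; elim: s => [|i s IH].
  under eq_Rintegral do rewrite big_nil; rewrite big_nil.
  by rewrite Rintegral_cst// mul0r.
under eq_Rintegral do rewrite big_cons; rewrite big_cons RintegralD//; first by rewrite IH.
exact: integrable_Rsum.
Qed.

End BoundedFunctions.

(** * Fubini for a bounded kernel against an integrable function *)

Section Fubini.
Context d1 d2 (X : measurableType d1) (Y : measurableType d2) (R : realType).
Variables (mu : {sigma_finite_measure set X -> \bar R})
  (nu : {sigma_finite_measure set Y -> \bar R}).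
Variables (th : X * Y -> R) (b : Y -> R) (D : set X) (M : R).
Hypotheses (mD : measurable D) (fD : (mu D < +oo)%E).
Hypothesis mth : measurable_fun setT th.
Hypothesis thM : forall z, `|th z| <= M.
Hypothesis th0 : forall x y, ~ D x -> th (x, y) = 0.
Hypothesis ib : nu.-integrable setT (EFin \o b).

Let mb : measurable_fun setT b.
Proof. by apply/measurable_EFinP; exact: measurable_int ib. Qed.

Let M0 : 0 <= M.
Proof. exact: le_trans (thM (point, point)). Qed.

Lemma integrable_thb x : nu.-integrable setT (fun y => (th (x, y) * b y)%:E).
Proof.
apply: (@le_integrable _ _ _ nu setT measurableT _ (EFin \o (fun y => M * b y))).
- apply/measurable_EFinP; apply: measurable_funM => //.
  by apply: measurableT_comp.
- by move=> y _ /=; rewrite lee_fin !normrM ler_wpM2r// (ger0_norm M0).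
- by have := integrableZl measurableT M ib; apply: eq_integrable.
Qed.

Lemma integrable_thb2 : (mu \x nu)%E.-integrable setT (fun z => (th z * b z.2)%:E).
Proof.
have mF : measurable_fun setT (fun z => (th z * b z.2)).
  by apply: measurable_funM => //; apply: measurableT_comp.
apply/integrableP; split; first exact/measurable_EFinP.
rewrite fubini_tonelli1//=; last by apply/measurable_EFinP; apply: measurableT_comp.
have Cb : (\int[nu]_y `|b y|%:E < +oo)%E by have /integrableP[] := ib.
have C0 : (0 <= \int[nu]_y `|b y|%:E)%E by apply: integral_ge0 => y _; rewrite lee_fin.
apply: (@le_lt_trans _ _ (\int[mu]_x ((\1_D x)%:E * (M%:E * \int[nu]_y `|b y|%:E)))%E).
  apply: ge0_le_integral => //.
  - by move=> x _; apply: integral_ge0.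
  - apply: (measurable_fun_fubini_tonelli_F (fun z => `|(th z * b z.2)%:E|)%E) => //.
    by apply/measurable_EFinP; apply: measurableT_comp.
  - by apply: emeasurable_funM => //; exact/measurable_EFinP.
  move=> x _; rewrite indicE.
  have [xD|/negP xD] := boolP (x \in D).
    rewrite mul1e -ge0_integralZl_EFin//; last first.
      by apply/measurable_EFinP; apply: measurableT_comp.
    apply: ge0_le_integral => //.
    - apply/measurable_EFinP; apply: measurableT_comp => //.
      by apply: measurable_funM => //; apply: measurableT_comp.
    - by apply: emeasurable_funM => //; apply/measurable_EFinP; apply: measurableT_comp.
    - by move=> y _; rewrite lee_fin normrM ler_wpM2r.
  rewrite mul0e /fubini_F integral0_eq// => y _ /=; rewrite th0 ?mul0r ?normr0//.
  by apply: contra_not xD; rewrite inE.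
rewrite ge0_integralZr//; [|by apply/measurable_EFinP|by rewrite mule_ge0].
rewrite integral_indic// setIT lte_mul_pinfty//.
- by rewrite ge0_fin_numE.
- by rewrite lte_mul_pinfty.
Qed.

Let EFinR x : ((\int[nu]_y (th (x, y) * b y))%R)%:E = (\int[nu]_y (th (x, y) * b y)%:E)%E.
Proof. by rewrite /Rintegral fineK//; apply: integrable_fin_num => //; exact: integrable_thb. Qed.

Lemma bfun_inner : bfun D (fun x => \int[nu]_y (th (x, y) * b y)).
Proof.
split.
- apply/measurable_EFinP.
  rewrite (_ : EFin \o _ = fubini_F nu (fun z => (th z * b z.2)%:E)); last first.
    by apply/funext => x; exact: EFinR.
  exact: (measurable_fubini_F integrable_thb2).
- exists (M * \int[nu]_y `|b y|) => x.
  apply: (le_trans (le_normr_Rintegral measurableT (integrable_thb x))).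
  rewrite -RintegralZl//; last exact: integrable_norm.
  apply: le_Rintegral => //.
  + exact: integrable_norm (integrable_thb x).
  + by have := integrableZl measurableT M (integrable_norm ib); apply: eq_integrable.
  + by move=> y _; rewrite normrM ler_wpM2r.
- move=> x Dx; under eq_Rintegral do rewrite th0// mul0r.
  by rewrite Rintegral_cst// mul0r.
Qed.

(** The integrand is a bounded factor [th], localised in x, times an integrable function of y. This
    form covers bounded [b] as well as an L^2 function cut to a box, which is the case needed for
    duality in [Op2_dual]. *)
Lemma Rfubini : \int[mu]_x \int[nu]_y (th (x, y) * b y) =
  \int[nu]_y (b y * \int[mu]_x th (x, y)).
Proof.
have ith y : mu.-integrable setT (EFin \o (fun x => th (x, y))).
  apply: (bfun_integrable mD fD); split; first exact: measurableT_comp.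
  - by exists M.
  - by move=> x; exact: th0.
rewrite /Rintegral; congr fine.
under eq_integral => x _ do rewrite EFinR.
have -> : (\int[nu]_x (b x * fine (\int[mu]_x0 (th (x0, x))%:E))%:E =
           \int[nu]_y \int[mu]_x (th (x, y) * b y)%:E)%E.
  apply: eq_integral => y _.
  rewrite [RHS](eq_integral (fun x => (th (x, y))%:E * (b y)%:E)%E)//.
  rewrite integralZr//; last exact: ith.
  by rewrite EFinM muleC fineK//; apply: integrable_fin_num => //; exact: ith.
exact: (Fubini integrable_thb2).
Qed.

Lemma Rintegral_prod : \int[(mu \x nu)%E]_z (th z * b z.2) = \int[mu]_x \int[nu]_y (th (x, y) * b y).
Proof.
rewrite /Rintegral; congr fine; under [RHS]eq_integral => x _ do rewrite EFinR.
exact/esym/(integral12_prod_meas1 integrable_thb2).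
Qed.

End Fubini.

(** * Test functions of one variable *)

Section OneDim.
Variable R : realType.
Notation leb := (@lebesgue_measure R).
Local Notation int1 := (fun f : R -> R => (\int[leb]_t f t)).
Local Notation ig1 := (fun f : R -> R => leb.-integrable setT (EFin \o f)).

(** A quadratic bound on the remainder, unlike a limit of difference quotients, passes under an
    integral at once; this is how integrals depending on a parameter are differentiated below. *)
Lemma quad_is_derive (f : R -> R) (x l M : R) :
  (forall h, `|f (x + h) - f x - h * l| <= M * h ^+ 2) -> is_derive x (1 : R) f l.
Proof.
move=> H.
have C : h^-1 *: ((f \o shift x) (h *: 1) - f x) @[h --> (0 : R)^'] --> l.
  apply/cvgrPdist_le => e e0; near=> h.
  have h0 : h != 0 by near: h; exact: nbhs_dnbhs_neq.
  have hM : `|h| <= e / (`|M| + 1).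
    near: h; apply: dnbhs0_le; rewrite divr_gt0//.
  rewrite /= [h *: 1]mulr1 /shift /=.
  have -> : l - h^-1 *: (f (h + x) - f x) = - (h^-1 * (f (x + h) - f x - h * l)).
    by rewrite [h^-1 *: _]mulrC [h + x]addrC mulrBr mulrA mulVf// mul1r mulrC opprB.
  rewrite normrN normrM normfV mulrC ler_pdivrMr ?normr_gt0//.
  apply: le_trans (H h) _; rewrite -real_normK ?num_real// expr2 mulrA ler_wpM2r//.
  apply: (@le_trans _ _ ((`|M| + 1) * `|h|)).
    by rewrite ler_wpM2r// (le_trans (ler_norm M))// lerDl.
  by rewrite mulrC -ler_pdivlMr// ltr_wpDl.
split; first by apply/cvg_ex; exists l.
exact/cvg_lim.
Unshelve. all: by end_near. Qed.

Lemma MVT_between (f f' : R -> R) : (forall x, is_derive x (1 : R) f (f' x)) ->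
  forall a b, exists2 c, `|c - a| <= `|b - a| & f b - f a = f' c * (b - a).
Proof.
move=> df a b.
have cf x : {for x, continuous f}.
  by apply/differentiable_continuous/derivable1_diffP; case: (df x).
have [ab|/ltW ba] := leP a b.
  have [c cab E] := MVT_segment ab (fun x _ => df x) (continuous_subspaceT cf).
  exists c => //; move: cab; rewrite in_itv /= => /andP[ac cb].
  by rewrite !ger0_norm ?subr_ge0// lerB.
have [c cab E] := MVT_segment ba (fun x _ => df x) (continuous_subspaceT cf).
exists c; last by rewrite -opprB E -mulrN opprB.
move: cab; rewrite in_itv /= => /andP[ac cb].
by rewrite !ler0_norm ?subr_le0// lerN2 lerB.
Qed.

(* Smooth functions supported in [-r, r], with the sequence of derivatives as witness. *)
Definition tst (r : R) (w : R -> R) := exists U : nat -> R -> R,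
  [/\ U 0%N = w, forall k x, is_derive x (1 : R) (U k) (U k.+1 x),
      forall k, exists M : R, forall x, `|U k x| <= M &
      forall k x, r < `|x| -> U k x = 0].

Lemma tst_deriv r w : tst r w ->
  exists2 w', tst r w' & forall x, is_derive x (1 : R) w (w' x).
Proof.
move=> [U [U0 dU bU sU]]; exists (U 1%N); last by rewrite -U0.
exists (fun k => U k.+1).
by split=> [//|k x|k|k x]; [exact: dU|exact: bU|exact: sU].
Qed.

Lemma tst_continuous r w : tst r w -> continuous w.
Proof.
move=> [U [<- dU _ _]] x.
by apply/differentiable_continuous/derivable1_diffP; case: (dU 0%N x).
Qed.

Lemma tst_measurable r w : tst r w -> measurable_fun setT w.
Proof. by move=> /tst_continuous; exact: continuous_measurable_fun. Qed.

Lemma tst_bounded r w : tst r w -> exists2 M : R, 0 <= M & forall x, `|w x| <= M.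
Proof.
move=> [U [<- _ bU _]]; have [M hM] := bU 0%N; exists M => //.
exact: le_trans (hM 0).
Qed.

Lemma tst_supp r w x : tst r w -> r < `|x| -> w x = 0.
Proof. by move=> [U [<- _ _ sU]]; exact: sU. Qed.

Lemma tst_lipschitz r w : tst r w -> exists2 M : R, 0 <= M &
  forall x y, `|w x - w y| <= M * `|x - y|.
Proof.
move=> tw; have [w' tw' dw] := tst_deriv tw; have [M M0 hM] := tst_bounded tw'.
exists M => // x y; have [c _ ->] := MVT_between dw y x.
by rewrite normrM ler_wpM2r.
Qed.

(** By induction on s: the derivative in h of the remainder of order s + 1 is the remainder of order
    s of the next derivative, and the remainder vanishes at h = 0. The mean value theorem then gains
    one power of |h| with the same constant. The coefficients are derivatives divided by factorials,
    hence test functions again. *)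
Lemma tst_taylor r w s : tst r w -> exists (U : nat -> R -> R) (M : R),
  [/\ 0 <= M, forall a, tst r (U a) & forall z h,
    `|w (z + h) - \sum_(a < s) U a z * h ^+ a| <= M * `|h| ^+ s].
Proof.
move=> [U [<- dU bU sU]].
have tU a : tst r (U a).
  exists (fun k => U (a + k)%N); split => [|k x|k|k x]; rewrite ?addn0//.
  - by rewrite addnS; exact: dU.
  - exact: sU.
suff [M M0 hM] : exists2 M : R, 0 <= M & forall z h,
    `|U 0%N (z + h) - \sum_(a < s) (a`!%:R^-1 * U a z) * h ^+ a| <= M * `|h| ^+ s.
  exists (fun a x => a`!%:R^-1 * U a x), M; split => // a.
  have [U' [U'0 dU' bU' sU']] := tU a.
  exists (fun k x => a`!%:R^-1 * U' k x); split.
  - by rewrite U'0.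
  - by move=> k x; exact: (@is_deriveZ _ _ _ (U' k) (a`!%:R^-1) x 1 _ (dU' k x)).
  - move=> k; have [M' hM'] := bU' k; exists (a`!%:R^-1 * M') => x.
    by rewrite normrM [X in X * _]ger0_norm ?invr_ge0// ler_wpM2l// invr_ge0.
  - by move=> k x rx; rewrite sU'// mulr0.
move: {sU tU} U dU bU; have : forall U : nat -> R -> R,
    (forall k x, is_derive x (1 : R) (U k) (U k.+1 x)) ->
    (forall k, exists M : R, forall x, `|U k x| <= M) ->
    exists2 M : R, 0 <= M & forall z h,
    `|U 0%N (z + h) - \sum_(a < s) (a`!%:R^-1 * U a z) * h ^+ a| <= M * `|h| ^+ s.
  elim: s => [|s IH] U dU bU.
    have [M hM] := bU 0%N; exists M; first exact: le_trans (hM 0).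
    by move=> z h; rewrite big_ord0 subr0 expr0 mulr1.
  have [M M0 hM] := IH (fun k => U k.+1) (fun k => dU k.+1) (fun k => bU k.+1).
  exists M => // z h.
  pose g y := U 0%N (z + y) - \sum_(a < s.+1) (a`!%:R^-1 * U a z) * y ^+ a.
  pose g' y := U 1%N (z + y) - \sum_(a < s) (a`!%:R^-1 * U a.+1 z) * y ^+ a.
  have dg y : is_derive y (1 : R) g (g' y).
    have d1 : is_derive y (1 : R) (fun y => U 0%N (z + y)) (U 1%N (z + y)).
      have dz : is_derive y (1 : R) (fun y => z + y) 1.
        have := @is_deriveD _ _ _ (cst z) id y 1 _ _ (is_derive_cst _ _ _) (is_derive_id _ _).
        by rewrite add0r.
      have := @is_derive1_comp _ (U 0%N) (fun y => z + y) y _ _ (dU 0%N (z + y)) dz.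
      by rewrite mulr1.
    have d2 : is_derive y (1 : R) (fun y => \sum_(a < s.+1) (a`!%:R^-1 * U a z) * y ^+ a)
        (\sum_(a < s) (a`!%:R^-1 * U a.+1 z) * y ^+ a).
      rewrite (_ : (fun y => _) = \sum_(a < s.+1) (fun y => (a`!%:R^-1 * U a z) * y ^+ a)); last first.
        by apply/funext => t; rewrite fct_sumE.
      rewrite (_ : \sum_(a < s) _ = \sum_(a < s.+1) ((a`!%:R^-1 * U a z) * (a%:R * y ^+ a.-1))); last first.
        rewrite [RHS]big_ord_recl /= mul0r mulr0 add0r; apply: eq_bigr => a _ /=.
        rewrite /bump /= add1n factS natrM; field.
        by rewrite ?pnatr_eq0 -?lt0n ?fact_gt0 !nat1r ?pnatr_eq0.
      apply: is_derive_sum => a.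
      have dX := @is_deriveX _ _ (@id R) a y 1 _ (is_derive_id _ _).
      rewrite (_ : (@id R ^+ a) = (fun y => y ^+ a)) in dX; last first.
        by apply/funext => t; rewrite exprfctE.
      have := @is_deriveZ _ _ _ (fun y : R => y ^+ a) (a`!%:R^-1 * U a z) y 1 _ dX.
      by rewrite [X in _ *: X]mulr1.
    exact: (is_deriveB d1 d2).
  have [c ch E] := MVT_between dg 0 h.
  have g0 : g 0 = 0.
    rewrite /g addr0 big_ord_recl /= expr0 mulr1 invr1 mul1r big1 ?addr0 ?subrr// => a _.
    by rewrite /bump /= add1n expr0n /= mulr0.
  rewrite -/(g h) -[g h]subr0 -g0 E normrM subr0 exprS mulrCA mulrC ler_wpM2l//.
  rewrite !subr0 in ch.
  apply: le_trans (hM z c) _; rewrite ler_wpM2l// lerXn2r// nnegrE//.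
by move=> H U dU bU; exact: H.
Qed.

Lemma tst_scale r w c : 0 < c -> tst r w -> tst (r / c) (fun x => c * w (c * x)).
Proof.
move=> c0 [U [U0 dU bU sU]]; exists (fun k x => c ^+ k.+1 * U k (c * x)); split.
- by apply/funext => x; rewrite U0 expr1.
- move=> k x.
  have dz : is_derive x (1 : R) (fun y => c * y) c.
    have := @is_deriveZ _ _ _ (@id R) c x 1 _ (is_derive_id _ _).
    by rewrite [_ *: _]mulr1.
  have d1 := @is_derive1_comp _ (U k) (fun y => c * y) x _ _ (dU k (c * x)) dz.
  have := @is_deriveZ _ _ _ (U k \o (fun y => c * y)) (c ^+ k.+1) x 1 _ d1.
  by rewrite [_ *: _]mulrA [_ * c]mulrC mulrA -exprS.
- move=> k; have [M hM] := bU k; exists (c ^+ k.+1 * M) => x.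
  by rewrite normrM [X in X * _]ger0_norm ?exprn_ge0 ?(ltW c0)// ler_wpM2l// exprn_ge0// ltW.
- move=> k x; rewrite ltr_pdivrMr// => rx; rewrite sU ?mulr0//.
  by rewrite normrM gtr0_norm// mulrC.
Qed.

Lemma tst_opp r w : tst r w -> tst r (fun x => w (- x)).
Proof.
move=> [U [U0 dU bU sU]]; exists (fun k x => (-1) ^+ k * U k (- x)); split.
- by apply/funext => x; rewrite U0 expr0 mul1r.
- move=> k x.
  have dz : is_derive x (1 : R) (fun y : R => - y) (-1).
    exact: (@is_deriveN _ _ _ (@id R) x 1 _ (is_derive_id _ _)).
  have d1 := @is_derive1_comp _ (U k) (fun y => - y) x _ _ (dU k (- x)) dz.
  have := @is_deriveZ _ _ _ (U k \o (fun y => - y)) ((-1) ^+ k) x 1 _ d1.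
  by rewrite [_ *: _]mulrA [_ * -1]mulrC mulrA -exprS.
- move=> k; have [M hM] := bU k; exists M => x.
  by rewrite normrM normrX normrN1 expr1n mul1r.
- by move=> k x rx; rewrite sU ?mulr0// normrN.
Qed.

Lemma tst_lin r a b u v : tst r u -> tst r v -> tst r (fun x => a * u x + b * v x).
Proof.
move=> [U [U0 dU bU sU]] [V [V0 dV bV sV]].
exists (fun k x => a * U k x + b * V k x); split.
- by rewrite U0 V0.
- move=> k x.
  exact: (is_deriveD (@is_deriveZ _ _ _ (U k) a x 1 _ (dU k x))
    (@is_deriveZ _ _ _ (V k) b x 1 _ (dV k x))).
- move=> k; have [M hM] := bU k; have [N hN] := bV k; exists (`|a| * M + `|b| * N) => x.
  by rewrite (le_trans (ler_normD _ _))// !normrM lerD// ler_wpM2l.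
- by move=> k x rx; rewrite sU// sV// !mulr0 addr0.
Qed.

Lemma tst_weaken r r' w : r <= r' -> tst r w -> tst r' w.
Proof.
move=> rr [U [U0 dU bU sU]]; exists U; split => // k x r'x.
by apply: sU; exact: le_lt_trans r'x.
Qed.

End OneDim.

(** * Differentiation under the integral and affine changes of variable *)

Section DiffUnderIntegral.
Context d (T : measurableType d) (R : realType) (mu : {measure set T -> \bar R}).

Lemma is_derive_integral (D : set T) (g : T -> R) (F F' : R -> T -> R) (x M : R) :
  measurable D -> (mu D < +oo)%E -> bfun D g ->
  (forall t, measurable_fun setT (F t)) -> (forall t, measurable_fun setT (F' t)) ->
  (forall t, exists B : R, forall y, `|F t y| <= B) ->
  (forall t, exists B : R, forall y, `|F' t y| <= B) ->
  (forall h y, `|F (x + h) y - F x y - h * F' x y| <= M * h ^+ 2) ->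
  is_derive x (1 : R) (fun t => \int[mu]_y (F t y * g y)) (\int[mu]_y (F' x y * g y)).
Proof.
move=> mD fD bg mF mF' bF bF' H.
have [N N0 hN] := bfun_ge0_bound bg.
apply: (@quad_is_derive _ _ _ _ (M * N * fine (mu D))) => h.
have b1 t : bfun D (fun y => F t y * g y) by apply: bfunM.
have b2 t : bfun D (fun y => F' t y * g y) by apply: bfunM.
have i1 t := bfun_integrable mD fD (b1 t); have i2 t := bfun_integrable mD fD (b2 t).
have b3 : bfun D (fun y => F (x + h) y * g y - F x y * g y).
  have := bfunD (b1 (x + h)) (bfunZ (-1) (b1 x)).
  by under eq_fun do rewrite mulN1r.
have b4 := bfunZ h (b2 x).
have i3 := bfun_integrable mD fD b3; have i4 := bfun_integrable mD fD b4.
have -> : \int[mu]_y (F (x + h) y * g y) - \int[mu]_y (F x y * g y) -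
    h * \int[mu]_y (F' x y * g y) =
    \int[mu]_y (F (x + h) y * g y - F x y * g y - h * (F' x y * g y)).
  by rewrite RintegralB// RintegralB// RintegralZl.
have b5 : bfun D (fun y => F (x + h) y * g y - F x y * g y - h * (F' x y * g y)).
  have := bfunD b3 (bfunZ (-1) b4).
  by under eq_fun do rewrite mulN1r.
apply: le_trans (Rintegral_le_bound mD fD b5 (M := M * h ^+ 2 * N) _) _.
  move=> y; rewrite (_ : _ - _ = (F (x + h) y - F x y - h * F' x y) * g y); last by ring.
  by rewrite normrM ler_pM.
by rewrite (_ : M * N * _ * _ = M * h ^+ 2 * N * fine (mu D))//; ring.
Qed.

End DiffUnderIntegral.

Section ChangeOfVariables.
Variable R : realType.
Notation leb := (@lebesgue_measure R).

Let aff (a b : R) : measurableTypeR R -> measurableTypeR R := fun t => a * t + b.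

Let measurable_aff a b : measurable_fun setT (aff a b).
Proof. by apply: measurable_funD => //; apply: measurable_funM. Qed.

(** By uniqueness of Lebesgue measure: a times the pushforward has the right value on half-open
    intervals. *)
Lemma lebesgue_measure_affine (a b : R) (A : set R) : 0 < a -> measurable A ->
  (pushforward leb (aff a b) A = a^-1%:E * leb A)%E.
Proof.
move=> a0 mA.
pose P : {measure set (measurableTypeR R) -> \bar R} :=
  measure_function_pushforward__canonical__measure_function_Measure leb (measurable_aff a b).
have a0' : 0 <= a by exact: ltW.
have E : leb A = mscale (NngNum a0') P A.
  apply: lebesgue_measure_unique => //= _ [[x y]] xy <-.
  rewrite /mscale /= /pushforward.
  rewrite (_ : aff a b @^-1` _ = `](x - b) / a, (y - b) / a]%classic); last first.
    apply/seteqP; split => t /=; rewrite !in_itv/= /aff ltr_pdivrMr// ler_pdivlMr//.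
      by rewrite ltrBlDr lerBrDr [t * a]mulrC.
    by rewrite ltrBlDr lerBrDr [t * a]mulrC.
  rewrite !lebesgue_measure_itv/= !lte_fin ltr_pM2r ?invr_gt0// ltrD2r.
  case: ifPn => _; last by rewrite mule0.
  by rewrite -EFinB -EFinM; congr EFin; field; rewrite gt_eqF.
rewrite E /mscale /= muleA -EFinM mulVf ?gt_eqF// mul1e.
by rewrite /P.
Qed.

Lemma Rintegral_affine (a b : R) (f : R -> R) : 0 < a ->
  leb.-integrable setT (EFin \o f) ->
  leb.-integrable setT (EFin \o (fun t => f (a * t + b))) /\
  \int[leb]_t f (a * t + b) = a^-1 * \int[leb]_t f t.
Proof.
move=> a0 intf; have mf : measurable_fun setT f by apply/measurable_EFinP; exact: measurable_int intf.
have ai0 : 0 <= a^-1 by rewrite invr_ge0 ltW.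
have mfa : measurable_fun setT (f \o aff a b) := measurableT_comp mf (measurable_aff a b).
have G (g : R -> \bar R) : measurable_fun setT g -> (forall x, 0 <= g x)%E ->
    (\int[leb]_t g (aff a b t) = a^-1%:E * \int[leb]_t g t)%E.
  move=> mg g0.
  rewrite -(ge0_integral_mscale leb measurableT (NngNum ai0))//.
  have := ge0_integral_pushforward (measurable_aff a b) leb measurableT mg (fun x _ => g0 x).
  rewrite preimage_setT /comp => <-.
  apply: eq_measure_integral => A mA _.
  exact: lebesgue_measure_affine.
have I : leb.-integrable setT (EFin \o (f \o aff a b)).
  apply/integrableP; split; first exact/measurable_EFinP.
  rewrite /= (G (fun t => `|f t|%:E))//; last by apply/measurable_EFinP; apply: measurableT_comp.
  by have /integrableP[_ h] := intf; rewrite lte_mul_pinfty.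
split => //.
rewrite /Rintegral [in LHS]integralE [in RHS]integralE.
have -> : ((EFin \o f \o aff a b)^\+ = fun t => (EFin \o f)^\+ (aff a b t))%E.
  by rewrite funepos_comp.
have -> : ((EFin \o f \o aff a b)^\- = fun t => (EFin \o f)^\- (aff a b t))%E.
  by rewrite funeneg_comp.
have mE : measurable_fun setT (EFin \o f) by exact/measurable_EFinP.
rewrite (G (EFin \o f)^\+%E)//; last exact: measurable_funepos.
rewrite (G (EFin \o f)^\-%E)//; last exact: measurable_funeneg.
have f1 : (\int[leb]_t (EFin \o f)^\+ t \is a fin_num)%E.
  by apply: integrable_fin_num => //; exact: integrable_funepos.
have f2 : (\int[leb]_t (EFin \o f)^\- t \is a fin_num)%E.
  by apply: integrable_fin_num => //; exact: integrable_funeneg.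
rewrite -(fineK f1) -(fineK f2) -!EFinM -EFinB /= -mulrBr; congr (_ * _).
Qed.

Lemma Rintegral_opp (f : R -> R) : leb.-integrable setT (EFin \o f) ->
  leb.-integrable setT (EFin \o (fun t => f (- t))) /\
  \int[leb]_t f (- t) = \int[leb]_t f t.
Proof.
move=> intf; have mf : measurable_fun setT f by apply/measurable_EFinP; exact: measurable_int intf.
have mo : measurable_fun setT (-%R : measurableTypeR R -> measurableTypeR R) by [].
have E := @lebesgue_measureN R.
have I : leb.-integrable setT (EFin \o (fun t => f (- t))).
  apply/integrableP; split; first by apply/measurable_EFinP; apply: measurableT_comp.
  have /integrableP[_] := intf.
  have := @ge0_integral_pushforward _ _ _ _ _ _ mo leb setT (fun t => `|f t|%:E)%E measurableT.
  rewrite preimage_setT /comp /= => <-//.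
  - move=> h; apply: le_lt_trans h; rewrite le_eqVlt; apply/orP; left; apply/eqP.
    by apply: eq_measure_integral => A mA _; exact: E.
  - by apply/measurable_EFinP; apply: measurableT_comp.
split => //; rewrite /Rintegral; congr fine.
have := @integral_pushforward _ _ _ _ _ _ mo leb setT (EFin \o f).
rewrite preimage_setT /comp /= => <-//.
- by apply: eq_measure_integral => A mA _; exact: E.
- exact/measurable_EFinP.
Qed.

Lemma Rintegral_sub (f : R -> R) (x : R) : leb.-integrable setT (EFin \o f) ->
  leb.-integrable setT (EFin \o (fun t => f (x - t))) /\
  \int[leb]_t f (x - t) = \int[leb]_t f t.
Proof.
move=> /(Rintegral_affine x ltr01)[I1 E1].
have [I2 E2] := Rintegral_opp I1.
have e : (fun t => f (1 * - t + x)) = (fun t => f (x - t)).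
  by apply/funext => t; rewrite mul1r addrC.
by rewrite e in I2 E2; rewrite E2 E1 invr1 mul1r.
Qed.

Lemma Rintegral_shift (f : R -> R) (x : R) : leb.-integrable setT (EFin \o f) ->
  leb.-integrable setT (EFin \o (fun t => f (t - x))) /\
  \int[leb]_t f (t - x) = \int[leb]_t f t.
Proof.
move=> /(Rintegral_affine (- x) ltr01)[].
have -> : (fun t => f (1 * t + - x)) = (fun t => f (t - x)) by apply/funext => t; rewrite mul1r.
by rewrite invr1 mul1r.
Qed.

Lemma lebesgue_itv_lty (a b : R) : (leb `[a, b]%classic < +oo)%E.
Proof. by rewrite lebesgue_measure_itv/=; case: ifPn => _; rewrite ?ltry// -EFinB ltry. Qed.

Lemma tst_bfun r w : tst r w -> bfun (d := _) (T := measurableTypeR R) `[(- r)%R, r]%classic w.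
Proof.
move=> tw; split.
- exact: tst_measurable tw.
- by have [M _ hM] := tst_bounded tw; exists M.
- move=> x /= xr; apply: (tst_supp tw); rewrite ltNge ler_norml.
  by apply/negP => h; apply: xr; rewrite in_itv.
Qed.

Lemma bfun_itv_integrable (a b : R) (g : R -> R) :
  bfun (d := _) (T := measurableTypeR R) `[a, b]%classic g ->
  leb.-integrable setT (EFin \o g).
Proof. by apply: bfun_integrable => //; exact: lebesgue_itv_lty. Qed.

Lemma tst_integrable r w : tst r w -> leb.-integrable setT (EFin \o w).
Proof. by move=> /tst_bfun; apply: bfun_integrable => //; exact: lebesgue_itv_lty. Qed.

Definition cnv (u v : R -> R) : R -> R := fun x => \int[leb]_t (u (x - t) * v t).

Lemma tst_quad r w w' : tst r w -> (forall x, is_derive x (1 : R) w (w' x)) ->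
  exists2 M : R, 0 <= M & forall x h, `|w (x + h) - w x - h * w' x| <= M * h ^+ 2.
Proof.
move=> [U [U0 dU bU sU]] dw.
have w'E x : w' x = U 1%N x.
  have [_ <-] := dw x; have [_ <-] := dU 0%N x; by rewrite U0.
have [w2 tw2 dw2] : exists2 w2, tst r w2 & forall x, is_derive x (1 : R) (U 1%N) (w2 x).
  by apply: tst_deriv; exists (fun k => U k.+1); split=> [//|k x|k|k x]; [exact: dU|exact: bU|exact: sU].
have [M M0 hM] := tst_bounded tw2.
exists M => // x h.
have d1 y : is_derive y (1 : R) (fun h => w (x + h) - h * w' x) (w' (x + y) - w' x).
  have dz : is_derive y (1 : R) (fun y => x + y) 1.
    have := @is_deriveD _ _ _ (cst x) id y 1 _ _ (is_derive_cst _ _ _) (is_derive_id _ _).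
    by rewrite add0r.
  have d1 := @is_derive1_comp _ w (fun y => x + y) y _ _ (dw (x + y)) dz.
  have d2 := @is_deriveZ _ _ _ (@id R) (w' x) y 1 _ (is_derive_id _ _).
  have := is_deriveB d1 d2; rewrite mulr1 [_ *: 1]mulr1.
  rewrite (_ : _ - _ = (fun h => w (x + h) - h * w' x))//.
  by apply/funext => t; rewrite [t * _]mulrC.
have [c ch E] := MVT_between d1 0 h.
move: E ch; rewrite !subr0 addr0 mul0r subr0 => E ch.
rewrite (_ : _ - _ = (w (x + h) - h * w' x) - w x); last by ring.
have dw2' y : is_derive y (1 : R) w' (w2 y) by rewrite (_ : w' = U 1%N)//; apply/funext.
have [c' _ E'] := MVT_between dw2' x (x + c).
rewrite E E' normrM normrM -real_normK ?num_real// expr2 mulrA ler_wpM2r//.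
by rewrite ler_pM// (_ : x + c - x = c)//; ring.
Qed.

(** All derivatives are put on [u]: the witness is the sequence of derivatives of [u], each
    convolved with [v]. *)
Lemma tst_conv r r' u v : tst r u -> tst r' v -> tst (r + r') (cnv u v).
Proof.
move=> [U [U0 dU bU sU]] tv.
have bv := tst_bfun tv; have fl := lebesgue_itv_lty (- r') r'.
have tU k : tst r (U k).
  exists (fun j => U (k + j)%N); split => [|j x|j|j x]; rewrite ?addn0//.
  - by rewrite addnS; exact: dU.
  - exact: sU.
have mU k t : measurable_fun setT (fun y : measurableTypeR R => U k (t - y)).
  by apply: measurableT_comp; [exact: tst_measurable (tU k)|apply: measurable_funB].
have bUk k t : exists B : R, forall y, `|U k (t - y)| <= B.
  by have [M hM] := bU k; exists M.
have bb k t : bfun (d := _) (T := measurableTypeR R) `[(- r')%R, r']%classic (fun y => U k (t - y) * v y).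
  by apply: bfunM.
exists (fun k => cnv (U k) v); split.
- by rewrite U0.
- move=> k x.
  have [M M0 hM] := tst_quad (tU k) (dU k).
  apply: (is_derive_integral (M := M) (D := `[(- r')%R, r']%classic) (mu := leb)
    (F := fun t y => U k (t - y)) (F' := fun t y => U k.+1 (t - y))) => //.
  by move=> h y; rewrite [x + h - y]addrAC; exact: hM.
- move=> k; have [M hM] := bU k; have [N N0 hN] := tst_bounded tv.
  eexists => x; apply: (Rintegral_le_bound _ fl (bb k x) (M := M * N)) => // y.
  by rewrite normrM ler_pM.
- move=> k x rx; rewrite /cnv.
  rewrite (_ : (fun t => _) = cst 0); first by rewrite Rintegral_cst// mul0r.
  apply/funext => t /=; have [tr|tr] := leP `|t| r'; last by rewrite (tst_supp tv tr) mulr0.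
  rewrite sU ?mul0r//; have := ler_normD (x - t) t; rewrite subrK => h.
  by move: rx tr h; lra.
Qed.

End ChangeOfVariables.

(** * Convolutions, dilations and reproduction of polynomials *)

Section Conv.
Variable R : realType.
Notation leb := (@lebesgue_measure R).
Implicit Types (u v w : R -> R) (r c x y : R).

Lemma measurable_tst_sub r u x : tst r u ->
  measurable_fun setT (fun t : measurableTypeR R => u (x - t)).
Proof. by move=> tu; apply: measurableT_comp; [exact: tst_measurable tu|apply: measurable_funB]. Qed.

Lemma integrable_convx r r' u v x : tst r u -> tst r' v ->
  leb.-integrable setT (EFin \o (fun t => u (x - t) * v t)).
Proof.
move=> tu tv; have [M _ hM] := tst_bounded tu.
apply: (@bfun_itv_integrable _ (- r') r').
apply: bfunM (tst_bfun tv) _ _; first exact: measurable_tst_sub tu.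
by exists M => t.
Qed.

Lemma cnvC r r' u v : tst r u -> tst r' v -> cnv u v = cnv v u.
Proof.
move=> tu tv; apply/funext => x.
have [_] := Rintegral_sub x (integrable_convx x tu tv).
rewrite /cnv => <-; congr Rintegral; apply/funext => t.
by rewrite mulrC (_ : x - (x - t) = t)//; ring.
Qed.

Lemma Rintegral_conv r r' u v x z : tst r u -> tst r' v ->
  \int[leb]_y (u (x - y) * v (y - z)) = cnv u v (x - z).
Proof.
move=> tu tv.
have [_] := Rintegral_shift z (integrable_convx (x - z) tu tv).
rewrite /cnv => <-; congr Rintegral; apply/funext => t.
by rewrite (_ : x - z - (t - z) = x - t)//; ring.
Qed.

Lemma measurable_fun_sub2 r u : tst r u ->
  measurable_fun setT (fun z : measurableTypeR R * measurableTypeR R => u (z.1 - z.2)).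
Proof.
move=> tu; apply: measurableT_comp; first exact: tst_measurable tu.
by apply: measurable_funB.
Qed.

Lemma cnvA r r' r'' u v w : tst r u -> tst r' v -> tst r'' w ->
  cnv u (cnv v w) = cnv (cnv u v) w.
Proof.
move=> tu tv tw; apply/funext => x.
have [M M0 hM] := tst_bounded tu; have [N N0 hN] := tst_bounded tv.
pose th (z : measurableTypeR R * measurableTypeR R) := u (x - z.1) * v (z.1 - z.2).
have mth : measurable_fun setT th.
  apply: measurable_funM; last exact: measurable_fun_sub2 tv.
  exact: (measurableT_comp (measurable_tst_sub x tu) measurable_fst).
have bth z : `|th z| <= M * N by rewrite normrM ler_pM.
have sth t s : ~ `[x - r, x + r]%classic t -> th (t, s) = 0.
  move=> /= h; rewrite /th /= (tst_supp tu) ?mul0r// ltNge; apply/negP => h'; apply: h.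
  by rewrite in_itv /=; move: h'; rewrite ler_norml; lra.
have fD := lebesgue_itv_lty (x - r) (x + r).
have F := Rfubini (mu := leb) (nu := leb) (measurable_itv _) fD mth bth sth (tst_integrable tw).
transitivity (\int[leb]_t \int[leb]_s (th (t, s) * w s)).
  rewrite /cnv; congr Rintegral; apply/funext => t.
  rewrite -RintegralZl//; last exact: integrable_convx tv tw.
  by congr Rintegral; apply/funext => s; rewrite /th /= mulrA.
rewrite F /cnv; congr Rintegral; apply/funext => s; rewrite mulrC; congr (_ * _).
exact: Rintegral_conv tu tv.
Qed.

(** The dilate normalised in L^1, of scale 1/c. *)
Definition dil c w : R -> R := fun x => c * w (c * x).

Lemma tst_dil r c w : 0 < c -> tst r w -> tst (r / c) (dil c w).
Proof. exact: tst_scale. Qed.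

Lemma conv_dil r r' c u v : 0 < c -> tst r u -> tst r' v ->
  cnv (dil c u) (dil c v) = dil c (cnv u v).
Proof.
move=> c0 tu tv; apply/funext => x; rewrite /dil /cnv.
have [I E] := Rintegral_affine 0 c0 (integrable_convx (c * x) tu tv).
rewrite (_ : (fun t => _) = (fun t => c ^+ 2 * (u (c * x - (c * t + 0)) * v (c * t + 0)))); last first.
  by apply/funext => t; rewrite addr0 mulrBr; ring.
rewrite RintegralZl// E mulrA; congr (_ * _).
by rewrite expr2 -mulrA divff ?mulr1// gt_eqF.
Qed.

(* Convolution with u reproduces the polynomials of degree at most s. *)
Definition mr (s : nat) u := forall a y, (a <= s)%N ->
  \int[leb]_t (u (t - y) * t ^+ a) = y ^+ a.

Lemma integrable_mom r u y a : tst r u ->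
  leb.-integrable setT (EFin \o (fun t => u (t - y) * t ^+ a)).
Proof.
move=> tu; have [M M0 hM] := tst_bounded tu.
have fD := lebesgue_itv_lty (y - r) (y + r).
have s0 t : ~ `[y - r, y + r]%classic t -> u (t - y) = 0.
  move=> /= h; rewrite (tst_supp tu)// ltNge; apply/negP => h'; apply: h.
  by rewrite in_itv /=; move: h'; rewrite ler_norml; lra.
apply: (@bfun_itv_integrable _ (y - r) (y + r)); split.
- apply: measurable_funM; last exact: measurable_funX.
  by apply: measurableT_comp; [exact: tst_measurable tu|apply: measurable_funB].
- exists (M * (`|y| + `|r|) ^+ a) => t.
  have [h|h] := pselect (`[y - r, y + r]%classic t); last first.
    by rewrite s0// mul0r normr0 mulr_ge0// exprn_ge0// addr_ge0.
  rewrite normrM ler_pM// normrX lerXn2r ?nnegrE ?addr_ge0//.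
  move: h => /=; rewrite in_itv /= => h.
  have := ler_norm y; have := ler_norm (- y); have := ler_norm r; rewrite normrN.
  by rewrite ler_norml; move: h; lra.
- by move=> t /s0 ->; rewrite mul0r.
Qed.

Lemma mr_dil s r c u : 0 < c -> tst r u -> mr s u -> mr s (dil c u).
Proof.
move=> c0 tu mu a y ha; have c1 : c != 0 by rewrite gt_eqF.
have [I E] := Rintegral_affine 0 c0 (integrable_mom (c * y) a tu).
transitivity (\int[leb]_t (c * c ^- a * (u (c * t + 0 - c * y) * (c * t + 0) ^+ a))).
  congr Rintegral; apply/funext => t; rewrite /dil addr0 -mulrBr exprMn.
  by rewrite -!mulrA; congr (_ * _); rewrite mulrCA; congr (_ * _); rewrite mulKf// expf_neq0.
rewrite RintegralZl// E mu// exprMn.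
by field; rewrite c1 expf_neq0.
Qed.

Lemma mr_conv s r r' u v : tst r u -> tst r' v -> mr s u -> mr s v -> mr s (cnv u v).
Proof.
move=> tu tv mu mv a y ha.
have [M M0 hM] := tst_bounded tu.
set D := `[y - (`|r| + `|r'|), y + (`|r| + `|r'|)]%classic : set R.
(* The indicator confines the second variable to the support of [v]. It changes nothing after
   multiplication by [v], and it gives [th] the bounded support in the first variable that [Rfubini]
   asks for. *)
pose th (z : measurableTypeR R * measurableTypeR R) :=
  (u (z.1 - y - z.2) * z.1 ^+ a) * \1_(`[- r', r']%classic) z.2.
have sth t q : ~ D t -> th (t, q) = 0.
  move=> h; rewrite /th /= indicE; case: (boolP (q \in _)) => [|_]; last by rewrite mulr0.
  rewrite inE /= in_itv /= => hq; rewrite (tst_supp tu) ?mul0r// ltNge; apply/negP => h'; apply: h.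
  rewrite /D /= in_itv /=; move: h'; rewrite ler_norml.
  have := ler_norm r; have := ler_norm r'; by lra.
have bth z : `|th z| <= M * (`|y| + (`|r| + `|r'|)) ^+ a.
  have Z : 0 <= M * (`|y| + (`|r| + `|r'|)) ^+ a by rewrite mulr_ge0// exprn_ge0// !addr_ge0.
  have [h|h] := pselect (D z.1); last first.
    by rewrite (surjective_pairing z) sth ?normr0.
  rewrite /th normrM -[leRHS]mulr1 ler_pM//; last first.
    by rewrite indicE; case: (_ \in _); rewrite ?normr1 ?normr0.
  rewrite normrM ler_pM// normrX lerXn2r ?nnegrE ?addr_ge0//.
  move: h; rewrite /D /= in_itv /= => h.
  have := ler_norm y; have := ler_norm (- y); rewrite normrN.
  by rewrite ler_norml; move: h; lra.
have mth : measurable_fun setT th.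
  apply: measurable_funM; last by apply: measurableT_comp.
  apply: measurable_funM; last by apply: measurable_funX.
  apply: measurableT_comp; first exact: tst_measurable tu.
  by apply: measurable_funB => //; apply: measurable_funB.
have fD := lebesgue_itv_lty (y - (`|r| + `|r'|)) (y + (`|r| + `|r'|)).
have F := Rfubini (mu := leb) (nu := leb) (measurable_itv _) fD mth bth sth (tst_integrable tv).
have thv t q : th (t, q) * v q = (u (t - y - q) * t ^+ a) * v q.
  rewrite /th /= indicE; case: (boolP (q \in _)) => [|/negP h]; first by rewrite mulr1.
  rewrite (tst_supp tv) ?mulr0// ltNge; apply/negP => h'; apply: h.
  by rewrite inE /= in_itv /= -ler_norml.
transitivity (\int[leb]_t \int[leb]_q (th (t, q) * v q)).
  congr Rintegral; apply/funext => t; rewrite /cnv -RintegralZr//; last exact: integrable_convx tu tv.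
  by congr Rintegral; apply/funext => q; rewrite thv mulrAC.
rewrite F; have [I E] := Rintegral_affine y ltr01 (integrable_mom y a tv).
rewrite -(mv a y ha) -[RHS]mul1r -[in RHS]invr1 -E; congr Rintegral; apply/funext => q.
rewrite mul1r addrK -[RHS]mulr1.
have -> : \int[leb]_t th (t, q) = \1_(`[- r', r']%classic) q * (q + y) ^+ a.
  rewrite /th /= RintegralZr//; last first.
    have -> : (fun t => u (t - y - q) * t ^+ a) = (fun t => u (t - (q + y)) * t ^+ a).
      by apply/funext => t; congr (u _ * _); ring.
    exact: integrable_mom tu.
  have -> : (fun t => u (t - y - q) * t ^+ a) = (fun t => u (t - (q + y)) * t ^+ a).
    by apply/funext => t; congr (u _ * _); ring.
  by rewrite mu// mulrC.
rewrite indicE mulr1; case: (boolP (q \in _)) => [|/negP h]; first by rewrite mul1r.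
rewrite (tst_supp tv) ?mul0r// ltNge; apply/negP => h'; apply: h.
by rewrite inE /= in_itv /= -ler_norml.
Qed.

End Conv.

(** * A bump with the moments of the Dirac mass *)

Section Bump.
Variable R : realType.
Notation leb := (@lebesgue_measure R).

(** The family is closed under differentiation, F_k' = F_(k+2) - k F_(k+1), and each member is
    O(x^2) at 0, which settles the derivative there by [quad_is_derive]. *)
Let Fk (k : nat) (x : R) : R := if 0 < x then x^-1 ^+ k * expR (- x^-1) else 0.

Let Fk_le k (x : R) : `|Fk k x| <= (k.+2)`!%:R * x ^+ 2.
Proof.
rewrite /Fk; case: ifPn => x0; last by rewrite normr0 mulr_ge0// sqr_ge0.
have y0 : 0 < x^-1 by rewrite invr_gt0.
rewrite ger0_norm; last by rewrite mulr_ge0 ?expR_ge0// exprn_ge0// ltW.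
have := expR_ge1Dxn k.+1 (ltW y0); rewrite expRN => h.
rewrite ler_pdivrMr ?expR_gt0//.
apply: (@le_trans _ _ ((k.+2)`!%:R * x ^+ 2 * (x^-1 ^+ k.+2 / (k.+2)`!%:R))); last first.
  apply: ler_wpM2l; first by rewrite mulr_ge0// sqr_ge0.
  by apply: le_trans h; rewrite lerDr.
rewrite le_eqVlt; apply/orP; left; apply/eqP.
have n0 : (k.+2)`!%:R != 0 :> R by rewrite pnatr_eq0 -lt0n fact_gt0.
rewrite !exprS; field.
by rewrite n0 gt_eqF.
Qed.

Let dFk k (x : R) : is_derive x (1 : R) (Fk k) (Fk k.+2 x - k%:R * Fk k.+1 x).
Proof.
have [x0|x0|->] := ltgtP x 0.
- have -> : Fk k.+2 x - k%:R * Fk k.+1 x = 0.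
    by rewrite /Fk ltNge (ltW x0) /= mulr0 subr0.
  have h : \near x, cst 0 x = Fk k x.
    near=> y; rewrite /Fk ltNge (_ : y <= 0)//; apply: ltW.
    by near: y; exact: lt_nbhsl.
  by apply: near_eq_is_derive h _; exact: (@is_derive_cst R R R 0 x 1).
- have nx : x != 0 by rewrite gt_eqF.
  have dV : is_derive x (1 : R) (fun y : R => y^-1) (- x ^- 2).
    have := @is_deriveV _ (@id R) x 1 1 nx (is_derive_id _ _).
    by rewrite [_ *: 1]mulr1.
  have dX := @is_deriveX _ _ (fun y : R => y^-1) k x 1 _ dV.
  have dN := @is_deriveN _ _ _ (fun y : R => y^-1) x 1 _ dV.
  have dE := @is_derive1_comp _ expR (- (fun y : R => y^-1)) x _ _ (is_derive_expR _) dN.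
  have dM := @is_deriveM _ _ _ _ x 1 _ _ dX dE.
  have dM' : is_derive x (1 : R) (((fun y : R => y^-1) ^+ k) * (expR \o (- (fun y : R => y^-1))))
      (x^-1 ^+ k * (expR (- x^-1) * (- (- x ^- 2))) +
       expR (- x^-1) * (k%:R * x^-1 ^+ k.-1 * (- x ^- 2))).
    by move: dM; rewrite exprfctE.
  apply: (@near_eq_is_derive _ _ _
    (((fun y : R => y^-1) ^+ k) * (expR \o (- (fun y : R => y^-1)))) (Fk k)).
    near=> y; rewrite /Fk (_ : 0 < y); last by near: y; exact: lt_nbhsr.
    by rewrite [LHS]/GRing.mul /= exprfctE.
  apply: is_derive_eq dM' _.
  rewrite /Fk x0; move: (expR (- x^-1)) => E.
  case: k dX dM => [|k] _ _; rewrite /=.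
    by field.
  by rewrite !exprS; field.
- have -> : Fk k.+2 0 - k%:R * Fk k.+1 0 = 0 by rewrite /Fk ltxx mulr0 subr0.
  apply: (@quad_is_derive _ _ _ _ ((k.+2)`!%:R)) => h.
  by rewrite mulr0 subr0 add0r {2}/Fk ltxx subr0; exact: Fk_le.
Unshelve. all: by end_near. Qed.

Variable rho : R.

(** [tst] asks for the whole sequence of derivatives. This algebra is closed under differentiation,
    so the sequence arises by iterating one choice of derivative, without explicit formulas. *)
Inductive bumpgen : (R -> R) -> Prop :=
| bg_l k : bumpgen (fun x => Fk k (x + rho))
| bg_r k : bumpgen (fun x => Fk k (rho - x))
| bg_add f g : bumpgen f -> bumpgen g -> bumpgen (fun x => f x + g x)
| bg_scale c f : bumpgen f -> bumpgen (fun x => c * f x)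
| bg_mul f g : bumpgen f -> bumpgen g -> bumpgen (fun x => f x * g x).

Lemma bumpgen_derive f : bumpgen f ->
  exists2 f', bumpgen f' & forall x, is_derive x (1 : R) f (f' x).
Proof.
elim=> {f} [k|k|f g bf [f' bf' df] bg [g' bg' dg]|c f bf [f' bf' df]|f g bf [f' bf' df] bg [g' bg' dg]].
- exists (fun x => Fk k.+2 (x + rho) + (- k%:R) * Fk k.+1 (x + rho)).
    exact: bg_add (bg_l _) (bg_scale _ (bg_l _)).
  move=> x; have dz : is_derive x (1 : R) (fun y => y + rho) 1.
    have := @is_deriveD _ _ _ id (cst rho) x 1 _ _ (is_derive_id _ _) (is_derive_cst _ _ _).
    by rewrite addr0.
  have := @is_derive1_comp _ (Fk k) (fun y => y + rho) x _ _ (dFk k _) dz.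
  by rewrite mulr1 mulNr.
- exists (fun x => (-1) * (Fk k.+2 (rho - x) + (- k%:R) * Fk k.+1 (rho - x))).
    exact: bg_scale (bg_add (bg_r _) (bg_scale _ (bg_r _))).
  move=> x; have dz : is_derive x (1 : R) (fun y => rho - y) (-1).
    have := @is_deriveB _ _ _ (cst rho) id x 1 _ _ (is_derive_cst _ _ _) (is_derive_id _ _).
    by rewrite sub0r.
  have := @is_derive1_comp _ (Fk k) (fun y => rho - y) x _ _ (dFk k _) dz.
  by rewrite mulrC -mulNr.
- exists (fun x => f' x + g' x); first exact: bg_add.
  by move=> x; exact: is_deriveD.
- exists (fun x => c * f' x); first exact: bg_scale.
  by move=> x; exact: is_deriveZ.
- exists (fun x => f x * g' x + g x * f' x).
    exact: bg_add (bg_mul bf bg') (bg_mul bg bf').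
  by move=> x; exact: is_deriveM.
Qed.

Lemma bumpgen_tst f : 0 < rho -> bumpgen f -> (forall x, rho < `|x| -> f x = 0) -> tst rho f.
Proof.
move=> rho0 bf sf.
pose S := {f : R -> R | bumpgen f}.
pose nxt (g : S) : S := exist _ _ (s2valP (cid2 (bumpgen_derive (svalP g)))).
have nxtP (g : S) x : is_derive x (1 : R) (sval g) (sval (nxt g) x).
  exact: (s2valP' (cid2 (bumpgen_derive (svalP g)))).
pose U k := sval (iter k nxt (exist _ f bf)).
have dU k x : is_derive x (1 : R) (U k) (U k.+1 x) by exact: nxtP.
have sU k x : rho < `|x| -> U k x = 0.
  elim: k x => [|k IH] x hx; first exact: sf.
  have [_ <-] := dU k x.
  rewrite (@near_eq_derive _ _ _ _ (cst 0)) ?derive_cst//.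
  near=> y; apply: IH; near: y.
  have : `|y| @[y --> x] --> `|x| by apply: cvg_norm; exact: cvg_id.
  by move=> /cvgr_gt; apply.
exists U; split => // k.
have cU : {within `[- rho, rho], continuous (U k)}.
  apply: continuous_subspaceT => x.
  by apply/differentiable_continuous/derivable1_diffP; case: (dU k x).
have le : - rho <= rho by lra.
have cN : {within `[- rho, rho], continuous (fun x => - U k x)}.
  apply: continuous_subspaceT => x; apply: cvgN.
  by apply/differentiable_continuous/derivable1_diffP; case: (dU k x).
have [c1 _ h1] := EVT_max le cU; have [c2 _ h2] := EVT_max le cN.
exists (`|U k c1| + `|U k c2|) => x.
have [hx|hx] := leP `|x| rho; last by rewrite sU// normr0 addr_ge0.
have xI : x \in `[- rho, rho] by rewrite in_itv /= -ler_norml.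
have := h1 _ xI; have := h2 _ xI => /= a b.
have := ler_norm (U k c1); have := ler_norm (- U k c2); rewrite normrN.
have := normr_ge0 (U k c1); have := normr_ge0 (U k c2).
by rewrite ler_norml; lra.
Unshelve. all: by end_near. Qed.

Lemma exists_bump : 0 < rho -> exists2 u, tst rho u & \int[leb]_t u t = 1.
Proof.
move=> rho0.
pose f x := Fk 0 (x + rho) * Fk 0 (rho - x).
have f0 x : 0 <= f x by rewrite /f /Fk; case: ifP => _; case: ifP => _; rewrite ?mul0r ?mulr0// mulr_ge0// expr0 mul1r expR_ge0.
have sf x : rho < `|x| -> f x = 0.
  move=> hx; rewrite /f /Fk; case: ifPn => h1; last by rewrite mul0r.
  case: ifPn => h2; last by rewrite mulr0.
  by move: hx; rewrite ltNge ler_norml; case/negP; lra.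
have tf : tst rho f by apply: bumpgen_tst => //; exact: bg_mul (bg_l _) (bg_r _).
have If := tst_integrable tf.
have pos : 0 < \int[leb]_t f t.
  (* On the half interval both x + rho and rho - x are at least rho / 2, so each of the two factors
     is at least e^(-2 / rho). *)
  set c := expR (- (2 / rho)) ^+ 2.
  have c0 : 0 < c by rewrite exprn_gt0// expR_gt0.
  apply: (@lt_le_trans _ _ (\int[leb]_t (c * \1_(`[- (rho / 2), rho / 2]%classic) t))).
    rewrite RintegralZl//; last first.
      exact: (integrable_indicT (mu := leb) (measurable_itv _) (lebesgue_itv_lty _ _)).
    rewrite /Rintegral integral_indic//= setIT lebesgue_measure_itv /= lte_fin.
    rewrite (_ : - (rho / 2) < rho / 2); last by lra.
    by rewrite -EFinB /= mulr_gt0//; lra.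
  apply: le_Rintegral => //.
    have := integrableZl measurableT c (integrable_indicT (mu := leb) (measurable_itv _) (lebesgue_itv_lty (- (rho / 2)) (rho / 2))).
    by apply: eq_integrable.
  move=> x _; rewrite indicE; case: (boolP (x \in _)) => [|_]; last by rewrite mulr0.
  rewrite inE /= in_itv /= => /andP[h1 h2]; rewrite mulr1 /f /Fk.
  rewrite (_ : 0 < x + rho); last by lra.
  rewrite (_ : 0 < rho - x); last by lra.
  rewrite !expr0 !mul1r /c expr2 ler_pM ?expR_ge0// ler_expR lerN2.
    rewrite invf_ple ?posrE//; [|by lra|by rewrite divr_gt0].
    by rewrite invf_div; lra.
  rewrite invf_ple ?posrE//; [|by lra|by rewrite divr_gt0].
  by rewrite invf_div; lra.
exists (fun x => (\int[leb]_t f t)^-1 * f x + 0 * f x); first exact: tst_lin.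
under eq_Rintegral do rewrite mul0r addr0.
by rewrite RintegralZl// mulVf// gt_eqF.
Qed.

(** Richardson extrapolation. The moment of order a of [dil 2 u] is 2^(-a) times that of [u], so
    (2^(s+1) dil 2 u - u) / (2^(s+1) - 1) keeps mass 1 and the moments that already vanish, and
    loses the moment of order s + 1. Mass 1 and vanishing moments of orders 1 to s give [mr s] by
    the binomial formula. *)
Lemma exists_mr_bump (s : nat) : 0 < rho -> exists2 u, tst rho u & mr s u.
Proof.
move=> rho0.
have ip r u a : tst r u -> leb.-integrable setT (EFin \o (fun t => u t * t ^+ a)).
  by move=> tu; have := integrable_mom 0 a tu; under eq_fun do rewrite subr0.
suff [u tu [u1 mu]] : exists2 u, tst rho u &
    (\int[leb]_t u t = 1 /\ forall a, (0 < a <= s)%N -> \int[leb]_t (u t * t ^+ a) = 0).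
  exists u => // a y ha.
  have [I E] := Rintegral_affine y ltr01 (integrable_mom y a tu).
  rewrite -[LHS]mul1r -[in LHS]invr1 -E.
  transitivity (\int[leb]_t \sum_(i < a.+1) (u t * t ^+ (a - i)) * (y ^+ i *+ 'C(a, i))).
    congr Rintegral; apply/funext => t; rewrite mul1r addrK exprDn mulr_sumr.
    by apply: eq_bigr => i _; rewrite -mulrnAr mulrA.
  rewrite Rintegral_sum; last first.
    move=> i; have := integrableZr measurableT (y ^+ i *+ 'C(a, i)) (ip _ _ (a - i)%N tu).
    by apply: eq_integrable.
  rewrite big_ord_recr /= big1 ?add0r.
    rewrite subnn RintegralZr//; last exact: ip tu.
    under eq_Rintegral do rewrite expr0 mulr1.
    by rewrite u1 mul1r binn mulr1n.
  move=> i _; rewrite RintegralZr//; last exact: ip tu.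
  by rewrite mu ?mul0r// subn_gt0 ltn_ord /= (leq_trans (leq_subr _ _)).
elim: s => [|s [u tu [u1 mu]]].
  have [u tu u1] := exists_bump rho0; exists u => //; split => // a; case: a => //.
pose w x := (2 ^+ s.+1 / (2 ^+ s.+1 - 1)) * dil 2 u x + (- (2 ^+ s.+1 - 1)^-1) * u x.
have p1 : (2 : R) ^+ s.+1 - 1 != 0.
  by rewrite subr_eq0 gt_eqF// exprn_egt1// ltr1n.
have tdu : tst rho (dil 2 u).
  by apply: tst_weaken (tst_dil _ tu) => //; rewrite ler_pdivrMr//; lra.
have dm a : \int[leb]_t (dil 2 u t * t ^+ a) = 2 ^- a * \int[leb]_t (u t * t ^+ a).
  have [I E] := Rintegral_affine 0 (ltr0n R 2) (ip _ _ a tu).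
  transitivity (\int[leb]_t (2 * 2 ^- a * (u (2 * t + 0) * (2 * t + 0) ^+ a))).
    congr Rintegral; apply/funext => t; rewrite /dil addr0 exprMn; field.
    by rewrite expf_neq0// pnatr_eq0.
  by rewrite RintegralZl// E; field; rewrite expf_neq0// pnatr_eq0.
have wm a : \int[leb]_t (w t * t ^+ a) =
    (2 ^+ s.+1 * 2 ^- a - 1) / (2 ^+ s.+1 - 1) * \int[leb]_t (u t * t ^+ a).
  transitivity (\int[leb]_t ((2 ^+ s.+1 / (2 ^+ s.+1 - 1)) * (dil 2 u t * t ^+ a) +
     (- (2 ^+ s.+1 - 1)^-1) * (u t * t ^+ a))).
    by congr Rintegral; apply/funext => t; rewrite /w; ring.
  rewrite RintegralD//; last 2 first.
  - by have := integrableZl measurableT (2 ^+ s.+1 / (2 ^+ s.+1 - 1)) (ip _ _ a tdu); apply: eq_integrable.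
  - by have := integrableZl measurableT (- (2 ^+ s.+1 - 1)^-1) (ip _ _ a tu); apply: eq_integrable.
  rewrite !RintegralZl ?dm//; [|exact: ip tu|exact: ip tdu].
  by ring.
exists w; first exact: tst_lin.
split.
  have := wm 0%N; under eq_Rintegral do rewrite expr0 mulr1.
  move=> ->; under eq_Rintegral do rewrite expr0 mulr1.
  by rewrite u1 expr0 invr1 !mulr1 divff.
move=> a /andP[a0]; rewrite leq_eqVlt => /orP[/eqP ->|ha]; rewrite wm.
  by rewrite divff ?expf_neq0 ?pnatr_eq0// subrr !mul0r.
by rewrite mu ?mulr0// a0.
Qed.

End Bump.

Ltac nng := repeat (first [by [] | by apply: ltW | apply: mulr_ge0 | apply: addr_ge0 |
  apply: exprn_ge0 | rewrite invr_ge0 | apply: sumr_ge0 => ? _ ]).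

(** * Functions supported in boxes *)

Section Boxed.
Context d (T : measurableType d) (R : realType) (mu : {measure set T -> \bar R}).
Variable B : R -> set T.

(** The boxes are abstract so that the same lemmas serve R^n, R^m and their product. *)
Definition boxes := [/\ forall r, measurable (B r), forall r, (mu (B r) < +oo)%E &
  forall r r', r <= r' -> B r `<=` B r'].
Definition bxd (g : T -> R) := exists r, bfun (B r) g.
Definition L2f (a : T -> R) :=
  measurable_fun setT a /\ mu.-integrable setT (EFin \o (fun x => a x ^+ 2)).

Hypothesis hB : boxes.

Lemma bxd_integrable g : bxd g -> mu.-integrable setT (EFin \o g).
Proof. by case: hB => mB fB _ [r]; exact: bfun_integrable. Qed.

Lemma bxd_ext f g : (forall x, f x = g x) -> bxd f -> bxd g.
Proof. by move=> /funext ->. Qed.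

Lemma bxd_measurable g : bxd g -> measurable_fun setT g.
Proof. by move=> [r []]. Qed.

Lemma bxdZ c g : bxd g -> bxd (fun x => c * g x).
Proof. by move=> [r bg]; exists r; exact: bfunZ. Qed.

Lemma bxdM (h g : T -> R) : measurable_fun setT h -> (exists M : R, forall x, `|h x| <= M) ->
  bxd g -> bxd (fun x => h x * g x).
Proof. by move=> mh bh [r bg]; exists r; exact: bfunM. Qed.

Lemma bxd_common g h : bxd g -> bxd h -> exists r, bfun (B r) g /\ bfun (B r) h.
Proof.
case: hB => _ _ mon [r bg] [r' bh]; exists (Num.max r r'); split.
  by apply: bfunS bg; apply: mon; rewrite le_max lexx.
by apply: bfunS bh; apply: mon; rewrite le_max lexx orbT.
Qed.

Lemma bxdD g h : bxd g -> bxd h -> bxd (fun x => g x + h x).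
Proof. by move=> bg bh; have [r [? ?]] := bxd_common bg bh; exists r; exact: bfunD. Qed.

Lemma bxdB g h : bxd g -> bxd h -> bxd (fun x => g x - h x).
Proof.
move=> bg bh; have := bxdD bg (bxdZ (-1) bh).
by under eq_fun do rewrite mulN1r.
Qed.

Lemma bxd0 : bxd (fun=> 0).
Proof. by exists 0; exact: bfun0. Qed.

Lemma bxd_sum (I : Type) (s : seq I) (g : I -> T -> R) :
  (forall i, bxd (g i)) -> bxd (fun x => \sum_(i <- s) g i x).
Proof.
move=> bg; elim: s => [|i s IH].
  by under eq_fun do rewrite big_nil; exact: bxd0.
by under eq_fun do rewrite big_cons; exact: bxdD.
Qed.

Lemma bxd_mul g h : bxd g -> bxd h -> bxd (fun x => g x * h x).
Proof. by move=> [r [mg bg _]] bh; apply: bxdM. Qed.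

Lemma bxd_sqr g : bxd g -> bxd (fun x => g x ^+ 2).
Proof. by move=> bg; under eq_fun do rewrite expr2; exact: bxd_mul. Qed.

Lemma bxd_norm g : bxd g -> bxd (fun x => `|g x|).
Proof.
move=> [r [mg [M hM] g0]]; exists r; split.
- exact: measurableT_comp.
- by exists M => x; rewrite normr_id.
- by move=> x /g0 ->; rewrite normr0.
Qed.

Lemma bxd_L2 g : bxd g -> L2f g.
Proof. by move=> bg; split; [exact: bxd_measurable|exact: bxd_integrable (bxd_sqr bg)]. Qed.

Lemma le_Rint f g : bxd f -> bxd g -> (forall x, f x <= g x) ->
  \int[mu]_x f x <= \int[mu]_x g x.
Proof.
by move=> /bxd_integrable bf /bxd_integrable bg fg; apply: le_Rintegral.
Qed.

Lemma RintD f g : bxd f -> bxd g -> \int[mu]_x (f x + g x) = \int[mu]_x f x + \int[mu]_x g x.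
Proof. by move=> /bxd_integrable bf /bxd_integrable bg; rewrite RintegralD. Qed.

Lemma RintB f g : bxd f -> bxd g -> \int[mu]_x (f x - g x) = \int[mu]_x f x - \int[mu]_x g x.
Proof. by move=> /bxd_integrable bf /bxd_integrable bg; rewrite RintegralB. Qed.

Lemma RintZ c f : bxd f -> \int[mu]_x (c * f x) = c * \int[mu]_x f x.
Proof. by move=> /bxd_integrable bf; rewrite RintegralZl. Qed.

Lemma RintZr c f : bxd f -> \int[mu]_x (f x * c) = \int[mu]_x f x * c.
Proof. by move=> /bxd_integrable bf; rewrite RintegralZr. Qed.

Lemma Rint_sum (I : Type) (s : seq I) (g : I -> T -> R) :
  (forall i, bxd (g i)) ->
  \int[mu]_x (\sum_(i <- s) g i x) = \sum_(i <- s) \int[mu]_x g i x.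
Proof. by move=> bg; rewrite Rintegral_sum// => i; exact: bxd_integrable. Qed.

Lemma Rint_le_norm f : bxd f -> `|\int[mu]_x f x| <= \int[mu]_x `|f x|.
Proof. by move=> /bxd_integrable bf; exact: le_normr_Rintegral. Qed.

Lemma Rint_eq f g : (forall x, f x = g x) -> \int[mu]_x f x = \int[mu]_x g x.
Proof. by move=> fg; apply: eq_Rintegral => x _. Qed.

(** From |a| <= 1 + a^2 on the box of [h]. *)
Lemma bxd_L2_integrable h a : bxd h -> L2f a ->
  mu.-integrable setT (EFin \o (fun x => h x * a x)).
Proof.
move=> [r bh] [ma ia]; have [mB fB _] := hB; have [mh _ h0] := bh.
have [M M0 hM] := bfun_ge0_bound bh.
have i1 := integrable_indicT (mB r) (fB r).
have := integrableD measurableT (integrableZl measurableT M i1) (integrableZl measurableT M ia).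
apply: le_integrable => //.
- by apply/measurable_EFinP; exact: measurable_funM.
move=> x _ /=; rewrite lee_fin normrM indicE -mulrDr normrM [X in _ <= X * _]ger0_norm//.
have [xB|/negP xB] := boolP (x \in B r); last first.
  by rewrite h0 ?normr0 ?mul0r ?mulr_ge0//; apply: contra_not xB; rewrite inE.
apply: ler_pM => //; rewrite [X in _ <= X]ger0_norm ?addr_ge0 ?sqr_ge0//.
rewrite -real_normK ?num_real//; move: (normr_ge0 (a x)).
by rewrite (_ : true%:R = 1)//; nra.
Qed.

End Boxed.

Section BoxedFubini.
Context d1 d2 (X : measurableType d1) (Y : measurableType d2) (R : realType).
Variables (mu : {sigma_finite_measure set X -> \bar R})
  (nu : {sigma_finite_measure set Y -> \bar R}).
Variables (B1 : R -> set X) (B2 : R -> set Y).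
Hypotheses (hB1 : boxes mu B1) (hB2 : boxes nu B2).
Definition Bprod r := B1 r `*` B2 r.

Lemma boxes_prod : boxes (mu \x nu)%E Bprod.
Proof.
have [m1 f1 s1] := hB1; have [m2 f2 s2] := hB2; split.
- by move=> r; exact: measurableX.
- move=> r; apply: (@le_lt_trans _ _ (mu (B1 r) * nu (B2 r))%E).
    by rewrite -(product_measure1E mu nu (m1 r) (m2 r)).
  have a1 : mu (B1 r) \is a fin_num by rewrite ge0_fin_numE//; exact: f1.
  have a2 : nu (B2 r) \is a fin_num by rewrite ge0_fin_numE//; exact: f2.
  by rewrite -(fineK a1) -(fineK a2) -EFinM ltry.
- by move=> r r' rr [x y] [/= hx hy]; split => /=; [exact: s1 hx|exact: s2 hy].
Qed.

Variable F : X * Y -> R.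
Hypothesis bF : bxd Bprod F.

Let key : exists (r : R) (M : R), [/\ measurable_fun setT F, forall z, `|F z| <= M,
  forall x y, ~ B1 r x -> F (x, y) = 0 & forall x y, ~ B2 r y -> F (x, y) = 0].
Proof.
have [r [mF [M hM] F0]] := bF; exists r, M; split => //.
- by move=> x y h; apply: F0 => -[].
- by move=> x y h; apply: F0 => -[].
Qed.

Lemma bxd_section1 x : bxd B2 (fun y => F (x, y)).
Proof.
have [r [M [mF hM F1 F2]]] := key; exists r; split.
- exact: measurableT_comp.
- by exists M.
- by move=> y; exact: F2.
Qed.

Lemma bxd_section2 y : bxd B1 (fun x => F (x, y)).
Proof.
have [r [M [mF hM F1 F2]]] := key; exists r; split.
- exact: measurableT_comp.
- by exists M.
- by move=> x; exact: F1.
Qed.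

Let ind r (F2 : forall x y, ~ B2 r y -> F (x, y) = 0) z : F z * \1_(B2 r) z.2 = F z.
Proof.
case: z => x y /=; rewrite indicE; case: (boolP (_ \in _)) => [_|/negP h]; first by rewrite mulr1.
by rewrite F2 ?mul0r//; apply: contra_not h; rewrite inE.
Qed.

Lemma bxd_inner1 : bxd B1 (fun x => \int[nu]_y F (x, y)).
Proof.
have [r [M [mF hM F1 F2]]] := key; have [m1 f1 s1] := hB1; have [m2 f2 s2] := hB2.
exists r; have := bfun_inner (m1 r) (f1 r) mF hM F1 (integrable_indicT (m2 r) (f2 r)).
by under eq_fun => x do under eq_Rintegral => y _ do rewrite (ind F2 (x, y)).
Qed.

Lemma Rint_prod : \int[(mu \x nu)%E]_z F z = \int[mu]_x \int[nu]_y F (x, y).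
Proof.
have [r [M [mF hM F1 F2]]] := key; have [m1 f1 s1] := hB1; have [m2 f2 s2] := hB2.
have := Rintegral_prod (m1 r) (f1 r) mF hM F1 (integrable_indicT (m2 r) (f2 r)).
under eq_Rintegral => z _ do rewrite (ind F2 z).
by under [in RHS]eq_Rintegral => x _ do under eq_Rintegral => y _ do rewrite (ind F2 (x, y)).
Qed.

Lemma Rint_swap : \int[mu]_x \int[nu]_y F (x, y) = \int[nu]_y \int[mu]_x F (x, y).
Proof.
have [r [M [mF hM F1 F2]]] := key; have [m1 f1 s1] := hB1; have [m2 f2 s2] := hB2.
have := Rfubini (m1 r) (f1 r) mF hM F1 (integrable_indicT (m2 r) (f2 r)).
under eq_Rintegral => x _ do under eq_Rintegral => y _ do rewrite (ind F2 (x, y)).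
move=> ->; apply: eq_Rintegral => y _.
rewrite -(RintZ hB1); last exact: bxd_section2.
by apply: eq_Rintegral => x _; rewrite mulrC (ind F2 (x, y)).
Qed.

End BoxedFubini.

Section BoxedFubini2.
Context d1 d2 (X : measurableType d1) (Y : measurableType d2) (R : realType).
Variables (mu : {sigma_finite_measure set X -> \bar R})
  (nu : {sigma_finite_measure set Y -> \bar R}).
Variables (B1 : R -> set X) (B2 : R -> set Y).
Hypotheses (hB1 : boxes mu B1) (hB2 : boxes nu B2).

Lemma bxd_swap (F : X * Y -> R) : bxd (Bprod B1 B2) F ->
  bxd (Bprod B2 B1) (fun z => F (z.2, z.1)).
Proof.
move=> [r [mF [M hM] F0]]; exists r; split.
- apply: (measurableT_comp (f := F) (g := fun z : Y * X => (z.2, z.1))) => //.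
  exact: measurable_fun_pair.
- by exists M.
- by move=> [y x] h; apply: F0 => -[/= ? ?]; apply: h.
Qed.

Lemma bxd_inner2 (F : X * Y -> R) : bxd (Bprod B1 B2) F -> bxd B2 (fun y => \int[mu]_x F (x, y)).
Proof. by move=> /bxd_swap /(bxd_inner1 hB2 hB1). Qed.

Lemma bxd_prod (f : X -> R) (g : Y -> R) : bxd B1 f -> bxd B2 g ->
  bxd (Bprod B1 B2) (fun z => f z.1 * g z.2).
Proof.
move=> [r [mf [M hM] f0]] [r' [mg [N hN] g0]].
have [m1 f1 s1] := hB1; have [m2 f2 s2] := hB2.
exists (Num.max r r'); split.
- by apply: measurable_funM; apply: measurableT_comp.
- by exists (M * N) => z; rewrite normrM ler_pM.
- move=> [x y] /= h; have [hx|hx] := pselect (B1 r x); last by rewrite f0 ?mul0r.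
  rewrite g0 ?mulr0// => hy; apply: h; split => /=.
    by apply: s1 hx; rewrite le_max lexx.
  by apply: s2 hy; rewrite le_max lexx orbT.
Qed.

End BoxedFubini2.

Section TupleBoxes.
Variable R : realType.

Definition bbox n (r : R) : set (n.-tuple R) := [set x | forall i, `|tnth x i| <= r].

Definition cbox n (c : n.-tuple R) (r : R) : set (n.-tuple R) :=
  [set x | forall i, `|tnth x i - tnth c i| <= r].

Lemma measurable_cbox n (c : n.-tuple R) r : measurable (cbox c r).
Proof.
rewrite (_ : cbox c r = \bigcap_(i in [set: 'I_n]) ((fun x => tnth x i) @^-1` `[tnth c i - r, tnth c i + r]%classic)).
  apply: fin_bigcap_measurable => // i _; rewrite -[X in measurable X]setTI.
  by apply: measurable_tnth => //; exact: measurable_itv.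
apply/seteqP; split => x /=.
  by move=> h i _ /=; rewrite in_itv /=; have := h i; rewrite ler_norml; lra.
by move=> h i; have := h i I; rewrite /= in_itv /= ler_norml; lra.
Qed.

Lemma lebn_cbox n (c : n.-tuple R) r : 0 < r ->
  (lebn (cbox c r) <= ((4 * r) ^+ n)%:E)%E.
Proof.
move=> r0.
apply: (@le_trans _ _ (lebn [set x : n.-tuple R | forall i, (tnth c i - 2 * r <= tnth x i < tnth c i + 2 * r)])).
  apply: le_measure; rewrite ?inE; [exact: measurable_cbox|exact: measurable_hbox|].
  by move=> x h i; have := h i; rewrite ler_norml; lra.
rewrite lebn_hbox; last by move=> i; lra.
rewrite lee_fin (eq_bigr (fun=> 4 * r)); last by move=> i _; lra.
by rewrite prodr_const card_ord.
Qed.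

Lemma lebn_cbox_fin n (c : n.-tuple R) r : 0 < r -> fine (lebn (cbox c r)) <= (4 * r) ^+ n.
Proof.
move=> r0; have h := lebn_cbox c r0.
rewrite -lee_fin fineK// ge0_fin_numE//.
by apply: le_lt_trans h _; rewrite ltry.
Qed.

Lemma bbox_cbox n r : bbox r = cbox [tuple (0 : R) | i < n] r.
Proof.
by apply/seteqP; split => x h i; have := h i; rewrite tnth_mktuple subr0.
Qed.

Lemma boxes_n n : boxes (@lebn R n) (@bbox n).
Proof.
split.
- by move=> r; rewrite bbox_cbox; exact: measurable_cbox.
- move=> r; rewrite bbox_cbox.
  apply: (@le_lt_trans _ _ (lebn (cbox [tuple (0 : R) | i < n] (`|r| + 1)))).
    apply: le_measure; rewrite ?inE; [exact: measurable_cbox|exact: measurable_cbox|].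
    move=> x h i; apply: le_trans (h i) _.
    by have := ler_norm r; lra.
  apply: le_lt_trans (lebn_cbox _ _) _; last by rewrite ltry.
  by rewrite ltr_wpDl.
- by move=> r r' rr x h i; exact: le_trans (h i) rr.
Qed.

Definition bx1 n (g : n.-tuple R -> R) := bxd (@bbox n) g.
Definition bbox2 n m := Bprod (@bbox n) (@bbox m).
Definition bx2 n m (g : pt R n m -> R) := bxd (@bbox2 n m) g.

Lemma boxes_pt n m : boxes (@leb2 R n m) (@bbox2 n m).
Proof. exact: boxes_prod (boxes_n n) (boxes_n m). Qed.

End TupleBoxes.

(** * Kernels of product type and almost orthogonality *)

Section Kernels.
Variable R : realType.
Implicit Types n m : nat.

(** Bounded kernels of finite range: they map functions supported in a box to such functions, and
    the class is closed under transposition, so that duality arguments stay inside it. *)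
Definition kern n (K : n.-tuple R -> n.-tuple R -> R) :=
  [/\ measurable_fun setT (fun z : n.-tuple R * n.-tuple R => K z.1 z.2),
      exists M : R, forall x y, `|K x y| <= M &
      exists rho : R, forall x y, (exists i, rho < `|tnth x i - tnth y i|) -> K x y = 0].

Lemma kern_tr n (K : n.-tuple R -> n.-tuple R -> R) : kern K -> kern (fun x y => K y x).
Proof.
move=> [mK [M hM] [rho hr]]; split.
- apply: (measurableT_comp (f := fun z : n.-tuple R * n.-tuple R => K z.1 z.2)
    (g := fun z : n.-tuple R * n.-tuple R => (z.2, z.1))) => //.
  exact: measurable_fun_pair.
- by exists M.
- by exists rho => x y [i hi]; apply: hr; exists i; rewrite distrC.
Qed.

Lemma kern_bx n (K : n.-tuple R -> n.-tuple R -> R) x : kern K -> bx1 (K x).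
Proof.
move=> [mK [M hM] [rho hr]]; exists (\sum_i `|tnth x i| + `|rho|); split.
- apply: (measurableT_comp (f := fun z : n.-tuple R * n.-tuple R => K z.1 z.2)
    (g := fun y : n.-tuple R => (x, y))) => //.
  exact: measurable_fun_pair.
- by exists M.
- move=> y /existsNP[i /negP]; rewrite -ltNge => hi; apply: hr; exists i.
  have h1 : `|tnth x i| <= \sum_i `|tnth x i|.
    by rewrite (bigD1 i)//= lerDl sumr_ge0.
  have h2 := ler_normD (tnth y i - tnth x i) (tnth x i); rewrite subrK in h2.
  rewrite distrC in h2; have h3 := ler_norm rho; lra.
Qed.

Section Pt.
Variables n m : nat.
Local Notation X := (n.-tuple R).
Local Notation Y := (m.-tuple R).
Local Notation mu := (@lebn R n).
Local Notation nu := (@lebn R m).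
Local Notation P := (@leb2 R n m).

Lemma kern_far (K : X -> X -> R) : kern K -> exists2 rho : R, 0 <= rho &
  forall r x y, bbox r y -> ~ bbox (r + rho) x -> K x y = 0.
Proof.
move=> [_ _ [rho hr]]; exists `|rho| => // r x y hy /existsNP[i /negP].
rewrite -ltNge => hi; apply: hr; exists i.
have h2 := ler_normD (tnth x i - tnth y i) (tnth y i); rewrite subrK in h2.
have := hy i; have := ler_norm rho; lra.
Qed.

Lemma kern_bx2 (K : X -> X -> R) g : kern K -> bx1 g ->
  bx2 (fun z : pt R n n => K z.1 z.2 * g z.2).
Proof.
move=> kK [r [mg [M hM] g0]]; have [rho rho0 far] := kern_far kK.
have [mK [N hN] _] := kK.
exists (r + rho); split.
- by apply: measurable_funM => //; apply: measurableT_comp.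
- by exists (N * M) => z; rewrite normrM ler_pM.
- move=> [x y] /= h; have [hy|hy] := pselect (bbox r y); last by rewrite g0 ?mulr0.
  rewrite (far r x y) ?mul0r// => hx; apply: h; split => //= i.
  by apply: le_trans (hy i) _; rewrite lerDl.
Qed.

Lemma kern_op (K : X -> X -> R) g : kern K -> bx1 g -> bx1 (fun x => \int[mu]_y (K x y * g y)).
Proof.
move=> kK bg; exact: (bxd_inner1 (boxes_n R n) (boxes_n R n) (kern_bx2 kK bg)).
Qed.

Lemma bx_K1 (K : X -> X -> R) (g : pt R n m -> R) x1 : kern K -> bx2 g ->
  bx2 (fun z => K x1 z.1 * g z).
Proof.
move=> kK bg; have [mK [N hN] _] := kK; apply: bxdM => //; last by exists N.
apply: (measurableT_comp (f := fun z : X * X => K z.1 z.2) (g := fun z : X * Y => (x1, z.1))) => //.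
exact: measurable_fun_pair.
Qed.

Lemma bx2_K2 (K : Y -> Y -> R) (g : pt R n m -> R) x2 : kern K -> bx2 g ->
  bx2 (fun z => K x2 z.2 * g z).
Proof.
move=> kK bg; have [mK [N hN] _] := kK; apply: bxdM => //; last by exists N.
apply: (measurableT_comp (f := fun z : Y * Y => K z.1 z.2) (g := fun z : X * Y => (x2, z.2))) => //.
exact: measurable_fun_pair.
Qed.

Lemma kern_op_r (K : Y -> Y -> R) (g : pt R n m -> R) : kern K -> bx2 g ->
  bx2 (fun x => \int[nu]_y (K x.2 y * g (x.1, y))).
Proof.
move=> kK [r [mg [M hM] g0]]; have [mK [N hN] [rho hr]] := kK.
have Bp := boxes_prod (boxes_n R n) (boxes_n R m).
apply: (bxd_inner1 (mu := P) (nu := nu) (F := fun z : pt R n m * Y => K z.1.2 z.2 * g (z.1.1, z.2))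
  (boxes_pt R n m) (boxes_n R m)).
exists (r + `|rho|); split.
- apply: measurable_funM => //.
    apply: (measurableT_comp (f := fun z : Y * Y => K z.1 z.2)
       (g := fun z : pt R n m * Y => (z.1.2, z.2))) => //.
    by apply: measurable_fun_pair => //; apply: measurableT_comp.
  apply: (measurableT_comp (f := g) (g := fun z : pt R n m * Y => (z.1.1, z.2))) => //.
  by apply: measurable_fun_pair => //; apply: measurableT_comp.
- by exists (N * M) => z; rewrite normrM ler_pM.
- move=> [[x1 x2] y] /= h; have [hy|hy] := pselect (bbox2 r (x1, y)); last by rewrite g0 ?mulr0.
  have [hy1 hy2] := hy.
  rewrite hr ?mul0r//; apply: contrapT => hn; apply: h; split; last first.
    by move=> i; apply: le_trans (hy2 i) _; rewrite lerDl.
  split => i /=; first by apply: le_trans (hy1 i) _; rewrite lerDl.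
  have [//|hi] := leP `|tnth x2 i| (r + `|rho|); case: hn; exists i.
  have h2 := ler_normD (tnth x2 i - tnth y i) (tnth y i); rewrite subrK in h2.
  have := hy2 i; have := ler_norm rho => /=; lra.
Qed.

End Pt.

(** Schur's test in additive form: |g(y)| |h(z)| <= (g(y)^2 + h(z)^2) / 2 is integrated against U,
    and each square meets one of the two marginal bounds. *)
Lemma kern_schur n (U : n.-tuple R -> n.-tuple R -> R) (V : R) g h : kern U ->
  (forall x y, 0 <= U x y) -> 0 <= V ->
  (forall y, \int[@lebn R n]_z U y z <= V) -> (forall z, \int[@lebn R n]_y U y z <= V) ->
  bx1 g -> bx1 h ->
  \int[@lebn R n]_y (`|g y| * \int[@lebn R n]_z (U y z * `|h z|)) <=
  V / 2 * (\int[@lebn R n]_y g y ^+ 2 + \int[@lebn R n]_y h y ^+ 2).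
Proof.
move=> kU U0 V0 h1 h2 bg bh; have hn := boxes_n R n.
have bg2 := bxd_sqr bg; have bh2 := bxd_sqr bh; have bhn := bxd_norm bh; have bgn := bxd_norm bg.
have bU2 := kern_op kU bh2.
apply: (@le_trans _ _ (\int[@lebn R n]_y (V / 2 * g y ^+ 2 + 2^-1 * \int[@lebn R n]_z (U y z * h z ^+ 2)))).
  apply: (le_Rint hn).
  - exact: bxd_mul bgn (kern_op kU bhn).
  - by apply: (bxdD hn); exact: bxdZ.
  move=> y; rewrite -(RintZ hn); last exact: bxd_mul (kern_bx y kU) bhn.
  apply: (@le_trans _ _ (\int[@lebn R n]_z (g y ^+ 2 / 2 * U y z + 2^-1 * (U y z * h z ^+ 2)))).
    apply: (le_Rint hn).
    - by apply: bxdZ; exact: bxd_mul (kern_bx y kU) bhn.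
    - by apply: (bxdD hn); apply: bxdZ; [exact: kern_bx|exact: bxd_mul (kern_bx y kU) bh2].
    move=> z; rewrite -subr_ge0 -[g y ^+ 2]real_normK ?num_real// -[h z ^+ 2]real_normK ?num_real//.
    rewrite (_ : _ - _ = U y z / 2 * (`|g y| - `|h z|) ^+ 2); last by field.
    by rewrite mulr_ge0 ?sqr_ge0// divr_ge0.
  rewrite (RintD hn); last 2 first.
  - by apply: bxdZ; exact: kern_bx.
  - by apply: bxdZ; exact: bxd_mul (kern_bx y kU) bh2.
  rewrite (RintZ hn _ (kern_bx y kU)) (RintZ hn _ (bxd_mul (kern_bx y kU) bh2)).
  apply: lerD => //; rewrite (_ : V / 2 * _ = g y ^+ 2 / 2 * V); last by ring.
  by apply: ler_wpM2l => //; rewrite mulr_ge0 ?sqr_ge0.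
rewrite (RintD hn); [|exact: bxdZ|exact: bxdZ].
rewrite (RintZ hn _ bg2) (RintZ hn _ bU2).
have bF := kern_bx2 kU bh2.
suff : \int[@lebn R n]_y \int[@lebn R n]_z (U y z * h z ^+ 2) <= V * \int[@lebn R n]_y h y ^+ 2 by lra.
rewrite (Rint_swap (mu := @lebn R n) (nu := @lebn R n) hn hn bF) /=.
rewrite -(RintZ hn _ bh2); apply: (le_Rint hn).
- exact: (bxd_inner2 hn hn bF).
- exact: bxdZ.
move=> z; rewrite (RintZr hn); last exact: (kern_bx z (kern_tr kU)).
by apply: ler_wpM2r; rewrite ?sqr_ge0.
Qed.

(* Almost orthogonality of the operators with kernels K e. *)
Definition famE1 n (I : Type) (K : I -> n.-tuple R -> n.-tuple R -> R) (es : seq I) (C : R) :=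
  (forall e, kern (K e)) /\
  forall g : I -> n.-tuple R -> R, (forall e, bx1 (g e)) ->
    \int[@lebn R n]_x (\sum_(e <- es) \int[@lebn R n]_y (K e x y * g e y)) ^+ 2 <=
    C * \sum_(e <- es) \int[@lebn R n]_y (g e y) ^+ 2.

Lemma bx2_swap n m (F : pt R n m -> R) : bx2 F -> bx2 (fun z : pt R m n => F (z.2, z.1)).
Proof. exact: bxd_swap. Qed.

Lemma Rint_pt n m (F : pt R n m -> R) : bx2 F ->
  \int[@leb2 R n m]_z F z = \int[@lebn R n]_x \int[@lebn R m]_y F (x, y).
Proof.
by move=> bF; exact: (Rint_prod (mu := @lebn R n) (nu := @lebn R m) (boxes_n R n) (boxes_n R m) bF).
Qed.

Lemma Rint_pt_swap n m (F : pt R n m -> R) : bx2 F ->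
  \int[@leb2 R n m]_z F z = \int[@lebn R m]_y \int[@lebn R n]_x F (x, y).
Proof. by move=> bF; rewrite Rint_pt//; exact: (Rint_swap (mu := @lebn R n) (nu := @lebn R m) (boxes_n R n) (boxes_n R m)). Qed.

Definition Op2 n m (K1 : n.-tuple R -> n.-tuple R -> R) (K2 : m.-tuple R -> m.-tuple R -> R)
    (g : pt R n m -> R) (x : pt R n m) : R :=
  \int[@leb2 R n m]_y (K1 x.1 y.1 * K2 x.2 y.2 * g y).

Section Op2.
Variables n m : nat.
Local Notation X := (n.-tuple R).
Local Notation Y := (m.-tuple R).
Variables (K1 : X -> X -> R) (K2 : Y -> Y -> R).
Hypotheses (k1 : kern K1) (k2 : kern K2).

Lemma bx2_KK x : bx2 (fun y : pt R n m => K1 x.1 y.1 * K2 x.2 y.2).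
Proof. exact: bxd_prod (boxes_n R n) (boxes_n R m) _ _ (kern_bx _ k1) (kern_bx _ k2). Qed.

Lemma Op2_iter g x : bx2 g -> Op2 K1 K2 g x =
  \int[@lebn R n]_y1 (K1 x.1 y1 * \int[@lebn R m]_y2 (K2 x.2 y2 * g (y1, y2))).
Proof.
move=> bg.
have b2 := bx2_K2 x.2 k2 bg.
have b : bx2 (fun y : pt R n m => K1 x.1 y.1 * K2 x.2 y.2 * g y).
  by have := bx_K1 x.1 k1 b2; under eq_fun do rewrite mulrA.
rewrite /Op2 Rint_pt//; apply: eq_Rintegral => y1 _.
rewrite -(RintZ (boxes_n R m)); last exact: (bxd_section1 b2).
by apply: eq_Rintegral => y2 _; rewrite mulrA.
Qed.

Lemma bx2_Op2 g : bx2 g -> bx2 (Op2 K1 K2 g).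
Proof.
move=> bg; have b1 := kern_op_r k2 bg.
have := bx2_swap (kern_op_r (n := m) k1 (bx2_swap b1)).
rewrite (_ : (fun z => _) = Op2 K1 K2 g)//; apply/funext => -[x1 x2] /=.
by rewrite Op2_iter.
Qed.

End Op2.

Section PtE1.
Variables (n m : nat) (I J : Type).
Local Notation X := (n.-tuple R).
Local Notation Y := (m.-tuple R).
Variables (K1 : I -> X -> X -> R) (K2 : J -> Y -> Y -> R) (es : seq I) (fs : seq J) (C1 C2 : R).
Hypotheses (hK1 : famE1 K1 es C1) (hK2 : famE1 K2 fs C2) (C10 : 0 <= C1) (C20 : 0 <= C2).

(** The one-parameter bounds are used one variable at a time: for fixed x2 on the partial integrals
    [G e], then for fixed first variable on the inner sum. No genuinely two-parameter orthogonality
    enters. *)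
Lemma Op2_E1 (g : I -> J -> pt R n m -> R) : (forall e f, bx2 (g e f)) ->
  \int[@leb2 R n m]_x (\sum_(e <- es) \sum_(f <- fs) Op2 (K1 e) (K2 f) (g e f) x) ^+ 2 <=
  C1 * C2 * \sum_(e <- es) \sum_(f <- fs) \int[@leb2 R n m]_y (g e f y) ^+ 2.
Proof.
move=> bg; have [k1 H1] := hK1; have [k2 H2] := hK2.
have hn := boxes_n R n; have hm := boxes_n R m.
pose G e (z : pt R n m) := \sum_(f <- fs) \int[@lebn R m]_y (K2 f z.2 y * g e f (z.1, y)).
have bG e : bx2 (G e) by apply: (bxd_sum (boxes_pt R n m)) => f; exact: kern_op_r.
have GE x : \sum_(e <- es) \sum_(f <- fs) Op2 (K1 e) (K2 f) (g e f) x =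
    \sum_(e <- es) \int[@lebn R n]_y1 (K1 e x.1 y1 * G e (y1, x.2)).
  apply: eq_bigr => e _; rewrite /G.
  transitivity (\int[@lebn R n]_y1 \sum_(f <- fs)
      (K1 e x.1 y1 * \int[@lebn R m]_y (K2 f x.2 y * g e f (y1, y)))); last first.
    by apply: eq_Rintegral => y1 _; rewrite mulr_sumr.
  rewrite (Rint_sum hn); last first.
    move=> f; have := bxd_section2 (bx_K1 x.1 (k1 e) (kern_op_r (k2 f) (bg e f))) x.2.
    by [].
  by apply: eq_bigr => f _; rewrite Op2_iter.
have bS : bx2 (fun x => (\sum_(e <- es) \sum_(f <- fs) Op2 (K1 e) (K2 f) (g e f) x) ^+ 2).
  apply: bxd_sqr; do 2 (apply: (bxd_sum (boxes_pt R n m)) => ?).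
  exact: bx2_Op2.
have bG2 e : bx2 (fun z => G e z ^+ 2) := bxd_sqr (bG e).
rewrite Rint_pt_swap//.
apply: (@le_trans _ _ (\int[@lebn R m]_x2 (C1 * \sum_(e <- es) \int[@lebn R n]_y1 (G e (y1, x2)) ^+ 2))).
  apply: (le_Rint hm).
  - exact: (bxd_inner2 hn hm bS).
  - apply: bxdZ; apply: (bxd_sum hm) => e; exact: (bxd_inner2 hn hm (bG2 e)).
  move=> x2; under eq_Rintegral => x1 _ do rewrite (GE (x1, x2)).
  apply: (H1 (fun e y1 => G e (y1, x2))) => e; exact: bxd_section2 (bG e) x2.
rewrite (RintZ hm); last by apply: (bxd_sum hm) => e; exact: (bxd_inner2 hn hm (bG2 e)).
rewrite -mulrA ler_wpM2l// (Rint_sum hm); last by move=> e; exact: (bxd_inner2 hn hm (bG2 e)).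
rewrite mulr_sumr; apply: ler_sum => e _.
rewrite -(Rint_pt_swap (bG2 e)) Rint_pt//.
apply: (@le_trans _ _ (\int[@lebn R n]_x1 (C2 * \sum_(f <- fs) \int[@lebn R m]_y2 (g e f (x1, y2)) ^+ 2))).
  have bg2 f : bx2 (fun z => g e f z ^+ 2) := bxd_sqr (bg e f).
  apply: (le_Rint hn).
  - exact: (bxd_inner1 hn hm (bG2 e)).
  - apply: bxdZ; apply: (bxd_sum hn) => f; exact: (bxd_inner1 hn hm (bg2 f)).
  move=> x1; apply: (H2 (fun f y2 => g e f (x1, y2))) => f; exact: bxd_section1 (bg e f) x1.
have bg2 f : bx2 (fun z => g e f z ^+ 2) := bxd_sqr (bg e f).
rewrite (RintZ hn); last by apply: (bxd_sum hn) => f; exact: (bxd_inner1 hn hm (bg2 f)).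
rewrite ler_wpM2l// (Rint_sum hn); last by move=> f; exact: (bxd_inner1 hn hm (bg2 f)).
by apply: ler_sum => f _; rewrite -(Rint_pt (bg2 f)).
Qed.

End PtE1.

Section PtE2.
Variables (n m : nat) (I J : Type).
Local Notation X := (n.-tuple R).
Local Notation Y := (m.-tuple R).
Variables (K1 : I -> X -> X -> R) (K2 : J -> Y -> Y -> R) (es : seq I) (fs : seq J) (C1 C2 : R).
Hypotheses (hK1 : famE1 (fun e x y => K1 e y x) es C1) (hK2 : famE1 (fun e x y => K2 e y x) fs C2).
Hypotheses (C10 : 0 < C1) (C20 : 0 < C2).

Lemma Op2_bounded (L1 : X -> X -> R) (L2 : Y -> Y -> R) (a : pt R n m -> R) (h : pt R n m -> R) :
  kern L1 -> kern L2 -> L2f (@leb2 R n m) a -> bx2 h ->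
  bx2 (fun x => h x * Op2 L1 L2 a x).
Proof.
move=> k1 k2 La [r [mh [M hM] h0]].
have [m1 [N1 hN1] [rho1 hr1]] := k1; have [m2 [N2 hN2] [rho2 hr2]] := k2.
have [ma _] := La.
(* [a] is square integrable but need not live in a box; it is cut to the box that the kernels can
   reach from the box of [h], which leaves the integral unchanged. *)
pose r' := r + (`|rho1| + `|rho2|).
have rho0 : 0 <= `|rho1| + `|rho2| by rewrite addr_ge0.
have [mB fB sB] := boxes_pt R n m.
have bI : bx2 (\1_(bbox2 r') : pt R n m -> R).
  exists r'; split => //; last by move=> x hx; rewrite indicE memNset.
  by exists 1 => x; rewrite indicE; case: (_ \in _); rewrite ?normr1 ?normr0.
have ib := bxd_L2_integrable (boxes_pt R n m) bI La.
pose th (z : pt R n m * pt R n m) := h z.1 * (L1 z.1.1 z.2.1 * L2 z.1.2 z.2.2).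
have mth : measurable_fun setT th.
  apply: measurable_funM; first by apply: measurableT_comp.
  apply: measurable_funM.
    apply: (measurableT_comp (f := fun z : X * X => L1 z.1 z.2)
       (g := fun z : pt R n m * pt R n m => (z.1.1, z.2.1))) => //.
    by apply: measurable_fun_pair => //; apply: measurableT_comp.
  apply: (measurableT_comp (f := fun z : Y * Y => L2 z.1 z.2)
       (g := fun z : pt R n m * pt R n m => (z.1.2, z.2.2))) => //.
  by apply: measurable_fun_pair => //; apply: measurableT_comp.
have bth z : `|th z| <= M * (N1 * N2) by rewrite !normrM; do 2 (apply: ler_pM => //); rewrite mulr_ge0.
have sth x y : ~ bbox2 r x -> th (x, y) = 0 by move=> hx; rewrite /th /= h0 ?mul0r.
have bi := bfun_inner (mu := @leb2 R n m) (nu := @leb2 R n m) (mB r) (fB r) mth bth sth ib.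
exists r; rewrite (_ : (fun x => _) = (fun x => \int[@leb2 R n m]_y (th (x, y) * (\1_(bbox2 r') y * a y))))//.
apply/funext => x; have [hx|hx] := pselect (bbox2 r x); last first.
  rewrite h0// mul0r; under eq_Rintegral do rewrite sth// mul0r.
  by rewrite Rintegral_cst// mul0r.
rewrite /Op2 -RintegralZl//; last first.
  exact: (bxd_L2_integrable (boxes_pt R n m) (bx2_KK k1 k2 x) La).
apply: eq_Rintegral => y _; rewrite /th /= -!mulrA; congr (_ * _).
rewrite indicE; case: (boolP (_ \in _)) => [_|/negP hy]; first by rewrite mul1r.
have [hx1 hx2] := hx.
have : (~ bbox r' y.1) \/ (~ bbox r' y.2).
  by apply/not_andP => hh; apply: hy; rewrite inE.
move=> [] /existsNP[i /negP]; rewrite -ltNge => hi.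
  rewrite hr1 ?mul0r//; exists i.
  have h2 := ler_normD (tnth y.1 i - tnth x.1 i) (tnth x.1 i); rewrite subrK distrC in h2.
  have := hx1 i; have := ler_norm rho1; have := normr_ge0 rho2; rewrite /r' in hi; lra.
rewrite hr2 ?mul0r ?mulr0//; exists i.
have h2 := ler_normD (tnth y.2 i - tnth x.2 i) (tnth x.2 i); rewrite subrK distrC in h2.
have := hx2 i; have := ler_norm rho2; have := normr_ge0 rho1; rewrite /r' in hi; lra.
Qed.

Lemma Op2_dual (L1 : X -> X -> R) (L2 : Y -> Y -> R) (a : pt R n m -> R) (h : pt R n m -> R) :
  kern L1 -> kern L2 -> L2f (@leb2 R n m) a -> bx2 h ->
  \int[@leb2 R n m]_x (h x * Op2 L1 L2 a x) =
  \int[@leb2 R n m]_y (a y * Op2 (fun x y => L1 y x) (fun x y => L2 y x) h y).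
Proof.
move=> k1 k2 La bh; have [r [mh [M hM] h0]] := bh.
have [m1 [N1 hN1] [rho1 hr1]] := k1; have [m2 [N2 hN2] [rho2 hr2]] := k2.
have [ma _] := La.
pose r' := r + (`|rho1| + `|rho2|).
have [mB fB sB] := boxes_pt R n m.
have bI : bx2 (\1_(bbox2 r') : pt R n m -> R).
  exists r'; split => //; last by move=> x hx; rewrite indicE memNset.
  by exists 1 => x; rewrite indicE; case: (_ \in _); rewrite ?normr1 ?normr0.
have ib := bxd_L2_integrable (boxes_pt R n m) bI La.
pose th (z : pt R n m * pt R n m) := h z.1 * (L1 z.1.1 z.2.1 * L2 z.1.2 z.2.2).
have mth : measurable_fun setT th.
  apply: measurable_funM; first by apply: measurableT_comp.
  apply: measurable_funM.
    apply: (measurableT_comp (f := fun z : X * X => L1 z.1 z.2)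
       (g := fun z : pt R n m * pt R n m => (z.1.1, z.2.1))) => //.
    by apply: measurable_fun_pair => //; apply: measurableT_comp.
  apply: (measurableT_comp (f := fun z : Y * Y => L2 z.1 z.2)
       (g := fun z : pt R n m * pt R n m => (z.1.2, z.2.2))) => //.
  by apply: measurable_fun_pair => //; apply: measurableT_comp.
have bth z : `|th z| <= M * (N1 * N2) by rewrite !normrM; do 2 (apply: ler_pM => //); rewrite mulr_ge0.
have sth x y : ~ bbox2 r x -> th (x, y) = 0 by move=> hx; rewrite /th /= h0 ?mul0r.
have zero x y : ~ bbox2 r' y -> th (x, y) = 0.
  move=> hy; have [hx|/sth ->//] := pselect (bbox2 r x).
  have [hx1 hx2] := hx.
  have : (~ bbox r' y.1) \/ (~ bbox r' y.2) by apply/not_andP => hh; apply: hy.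
  move=> [] /existsNP[i /negP]; rewrite -ltNge => hi; rewrite /th /=.
    rewrite hr1 ?mul0r ?mulr0//; exists i.
    have h2 := ler_normD (tnth y.1 i - tnth x.1 i) (tnth x.1 i); rewrite subrK distrC in h2.
    have := hx1 i; have := ler_norm rho1; have := normr_ge0 rho2; rewrite /r' in hi; lra.
  rewrite hr2 ?mul0r ?mulr0//; exists i.
  have h2 := ler_normD (tnth y.2 i - tnth x.2 i) (tnth x.2 i); rewrite subrK distrC in h2.
  have := hx2 i; have := ler_norm rho2; have := normr_ge0 rho1; rewrite /r' in hi; lra.
have thI x y : th (x, y) * (\1_(bbox2 r') y * a y) = th (x, y) * a y.
  rewrite indicE; case: (boolP (_ \in _)) => [_|/negP hy]; first by rewrite mul1r.
  by rewrite zero ?mul0r//; apply: contra_not hy; rewrite inE.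
have F := Rfubini (mu := @leb2 R n m) (nu := @leb2 R n m) (mB r) (fB r) mth bth sth ib.
transitivity (\int[@leb2 R n m]_x \int[@leb2 R n m]_y (th (x, y) * (\1_(bbox2 r') y * a y))).
  apply: eq_Rintegral => x _; rewrite /Op2 -RintegralZl//; last first.
    exact: (bxd_L2_integrable (boxes_pt R n m) (bx2_KK k1 k2 x) La).
  by apply: eq_Rintegral => y _; rewrite thI /th /= !mulrA.
rewrite F; apply: eq_Rintegral => y _.
have -> : Op2 (fun x y => L1 y x) (fun x y => L2 y x) h y = \int[@leb2 R n m]_x th (x, y).
  by apply: eq_Rintegral => x _; rewrite /th mulrC.
rewrite indicE; case: (boolP (_ \in _)) => [_|/negP hy]; first by rewrite mul1r.
rewrite (_ : \int[_]_x _ = 0) ?mulr0//.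
have z x : th (x, y) = 0 by apply: zero => h'; apply: hy; rewrite inE.
by under eq_Rintegral => x _ do rewrite z; rewrite Rintegral_cst// mul0r.
Qed.

(** Dual to [Op2_E1]. The left side S is the pairing of a with H, the adjoint sum applied to the
    coefficients, and [Op2_E1] bounds ||H||^2 by C S. Since a H <= C a^2 / 2 + H^2 / (2 C), half of
    S is absorbed and S <= C ||a||^2 remains. *)
Lemma Op2_E2 (D : I -> J -> set (pt R n m)) (a : pt R n m -> R) :
  (forall e f, bx2 (\1_(D e f) : pt R n m -> R)) -> L2f (@leb2 R n m) a ->
  \sum_(e <- es) \sum_(f <- fs) \int[@leb2 R n m]_x (\1_(D e f) x * Op2 (K1 e) (K2 f) a x) ^+ 2
  <= C1 * C2 * \int[@leb2 R n m]_x (a x) ^+ 2.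
Proof.
move=> bD La; have [k1t _] := hK1; have [k2t _] := hK2.
have k1 e : kern (K1 e) := kern_tr (k1t e); have k2 e : kern (K2 e) := kern_tr (k2t e).
have hp := boxes_pt R n m.
pose g e f x := \1_(D e f) x * Op2 (K1 e) (K2 f) a x.
have bg e f : bx2 (g e f) by exact: Op2_bounded.
have E1 := Op2_E1 hK1 hK2 (ltW C10) (ltW C20) bg.
set S := (X in X <= _); pose C := C1 * C2; have C0 : 0 < C by rewrite mulr_gt0.
pose H x := \sum_(e <- es) \sum_(f <- fs)
  Op2 (fun x y => K1 e y x) (fun x y => K2 f y x) (g e f) x.
have bH : bx2 H by do 2 (apply: (bxd_sum hp) => ?); exact: bx2_Op2.
have ia : (@leb2 R n m).-integrable setT (EFin \o (fun x => a x ^+ 2)) by case: La.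
have SE : S = \int[@leb2 R n m]_y (a y * H y).
  transitivity (\int[@leb2 R n m]_y \sum_(e <- es) \sum_(f <- fs)
     (Op2 (fun x y => K1 e y x) (fun x y => K2 f y x) (g e f) y * a y)); last first.
    apply: eq_Rintegral => y _; rewrite /H mulr_sumr; apply: eq_bigr => e _.
    by rewrite mulr_sumr; apply: eq_bigr => f _; rewrite mulrC.
  have iO e f := bxd_L2_integrable hp (bx2_Op2 (k1t e) (k2t f) (bg e f)) La.
  rewrite Rintegral_sum; last by move=> e; apply: integrable_Rsum => f; exact: iO.
  apply: eq_bigr => e _; rewrite Rintegral_sum; last by move=> f; exact: iO.
  apply: eq_bigr => f _; transitivity (\int[@leb2 R n m]_x (g e f x * Op2 (K1 e) (K2 f) a x)).
    apply: eq_Rintegral => x _; rewrite /g indicE expr2.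
    by case: (_ \in _); rewrite ?mul1r ?mul0r.
  rewrite Op2_dual//; by apply: eq_Rintegral => y _; rewrite mulrC.
have iH : (@leb2 R n m).-integrable setT (EFin \o (fun x => H x ^+ 2)).
  exact: bxd_integrable (bxd_sqr bH).
have iC : (@leb2 R n m).-integrable setT (EFin \o (fun x => C / 2 * a x ^+ 2)).
  by have := integrableZl measurableT (C / 2) ia; apply: eq_integrable.
have iC' : (@leb2 R n m).-integrable setT (EFin \o (fun x => (2 * C)^-1 * H x ^+ 2)).
  by have := integrableZl measurableT (2 * C)^-1 iH; apply: eq_integrable.
have : S <= C / 2 * \int[@leb2 R n m]_x (a x) ^+ 2 + (2 * C)^-1 * \int[@leb2 R n m]_x (H x) ^+ 2.
  rewrite -!RintegralZl// -RintegralD// SE.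
  apply: le_Rintegral => //.
  - have := bxd_L2_integrable hp bH La; apply: eq_integrable => // x _ /=; by rewrite mulrC.
  - have := integrableD measurableT iC iC'; by apply: eq_integrable.
  move=> x _; rewrite -subr_ge0.
  rewrite (_ : _ - _ = (2 * C)^-1 * (C * a x - H x) ^+ 2); last first.
    by field; rewrite gt_eqF.
  by rewrite mulr_ge0 ?sqr_ge0// invr_ge0 mulr_ge0// ltW.
have : (2 * C)^-1 * \int[@leb2 R n m]_x (H x) ^+ 2 <= S / 2.
  rewrite invfM -mulrA mulrC ler_pM2r ?invr_gt0//.
  rewrite mulrC ler_pdivrMr// mulrC; exact: E1.
by rewrite -/C; lra.
Qed.

End PtE2.

End Kernels.

(** * Finite sums, Cauchy-Schwarz and bounds for a single kernel *)

Section FiniteSums.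
Variable R : realType.

Lemma sum_sub_uniq (I : eqType) (s t : seq I) (F : I -> R) : uniq s -> uniq t ->
  {subset s <= t} -> (forall i, 0 <= F i) -> \sum_(i <- s) F i <= \sum_(i <- t) F i.
Proof.
move=> us ut st F0.
have pe : perm_eq s [seq i <- t | i \in s].
  apply: uniq_perm => //; first exact: filter_uniq.
  by move=> i; rewrite mem_filter; case: (boolP (i \in s)) => //= /st ->.
rewrite (perm_big _ pe) /= big_filter big_mkcond /=.
by apply: ler_sum => i _; case: ifP.
Qed.

Lemma sum_geo_nat (s : seq nat) : uniq s -> \sum_(k <- s) (2^-1 : R) ^+ k <= 2.
Proof.
move=> us; pose N := (\max_(k <- s) k).+1.
apply: (@le_trans _ _ (\sum_(k <- iota 0 N) (2^-1 : R) ^+ k)).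
  apply: sum_sub_uniq => //; first exact: iota_uniq.
  by move=> k ks; rewrite mem_iota /= add0n ltnS; exact: leq_bigmax_seq.
have -> : \sum_(k <- iota 0 N) (2^-1 : R) ^+ k = 2 - 2 * (2^-1) ^+ N.
  elim: N => [|M IH]; first by rewrite big_nil expr0 mulr1 subrr.
  rewrite -addn1 iotaD add0n big_cat big_seq1 /= IH addn1 exprS.
  by field.
by rewrite gerBl mulr_ge0// exprn_ge0// invr_ge0.
Qed.

Lemma sum_geo_int (s : seq int) (e : int) : uniq s ->
  \sum_(f <- s) (2^-1 : R) ^+ `|(f - e)%R|%N <= 4.
Proof.
move=> us; rewrite (bigID (fun f => (e <= f)%R)) /=.
have H (P : pred int) : {in P &, injective (fun f : int => `|(f - e)%R|%N)} ->
    \sum_(f <- s | P f) (2^-1 : R) ^+ `|(f - e)%R|%N <= 2.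
  move=> inj; rewrite -big_filter -(big_map (fun f : int => `|(f - e)%R|%N) xpredT (fun k => (2^-1 : R) ^+ k)).
  apply: sum_geo_nat; rewrite map_inj_in_uniq ?filter_uniq//.
  by move=> x y; rewrite !mem_filter => /andP[Px _] /andP[Py _]; exact: inj.
rewrite (_ : 4 = 2 + 2 :> R); last by lra.
by apply: lerD; apply: H => x y; rewrite /in_mem /= => hx hy; lia.
Qed.

Lemma prod_diff n (a b : 'I_n -> R) (M : R) : 1 <= M ->
  (forall i, `|a i| <= M) -> (forall i, `|b i| <= M) ->
  `|\prod_i a i - \prod_i b i| <= M ^+ n * \sum_i `|a i - b i|.
Proof.
move=> M1; have M0 : 0 <= M by lra.
elim: n a b => [|n IH] a b ha hb; first by rewrite !big_ord0 subrr normr0 mulr0.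
rewrite !big_ord_recl.
have -> : a ord0 * \prod_(i < n) a (lift ord0 i) - b ord0 * \prod_(i < n) b (lift ord0 i) =
   (a ord0 - b ord0) * \prod_(i < n) a (lift ord0 i) +
   b ord0 * (\prod_(i < n) a (lift ord0 i) - \prod_(i < n) b (lift ord0 i)) by ring.
apply: le_trans (ler_normD _ _) _; rewrite [leRHS]mulrDr.
apply: lerD; rewrite normrM.
  rewrite mulrC; apply: ler_wpM2r => //; rewrite normr_prod.
  apply: (@le_trans _ _ (\prod_(i < n) M)); first by apply: ler_prod => i _; rewrite normr_ge0 ha.
  by rewrite prodr_const card_ord exprS ler_peMl// exprn_ge0.
rewrite exprS -mulrA; apply: ler_pM => //; exact: IH.
Qed.

End FiniteSums.

Section SquareIntegrals.
Context d (T : measurableType d) (R : realType) (mu : {measure set T -> \bar R}) (B : R -> set T).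
Hypothesis hB : boxes mu B.

Lemma Rint_CS (g : T -> R) (D : set T) (V : R) : bxd B g -> bxd B (\1_D : T -> R) ->
  (forall x, ~ D x -> g x = 0) -> \int[mu]_x \1_D x <= V -> 0 < V ->
  (\int[mu]_x `|g x|) ^+ 2 <= V * \int[mu]_x g x ^+ 2.
Proof.
move=> bg bD g0 hV V0; have bn := bxd_norm bg; have bs := bxd_sqr bg.
set S := \int[mu]_x `|g x|; set Q := \int[mu]_x g x ^+ 2.
pose t := S / V.
have : 0 <= \int[mu]_x (g x ^+ 2 - (2 * t * `|g x| - t ^+ 2 * \1_D x)).
  apply: Rintegral_ge0 => x _; rewrite indicE; case: (boolP (_ \in _)) => [_|/negP h].
    rewrite mulr1 -[g x ^+ 2]real_normK ?num_real//.
    by rewrite (_ : _ - _ = (`|g x| - t) ^+ 2) ?sqr_ge0//; ring.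
  rewrite g0 ?normr0 ?mulr0 ?expr0n ?subr0//.
  by apply: contra_not h; rewrite inE.
rewrite (RintB hB) ?(RintB hB) ?(RintZ hB)//; last 3 first.
- exact: bxdZ.
- exact: bxdZ.
- by apply: (bxdB hB); exact: bxdZ.
rewrite -/S -/Q => h.
have h2 : t ^+ 2 * \int[mu]_x \1_D x <= t ^+ 2 * V by rewrite ler_wpM2l// sqr_ge0.
have : Q - (2 * t * S - t ^+ 2 * V) >= 0 by lra.
have -> : Q - (2 * t * S - t ^+ 2 * V) = Q - S ^+ 2 / V by rewrite /t; field; rewrite gt_eqF.
by rewrite subr_ge0 ler_pdivrMr// mulrC.
Qed.

End SquareIntegrals.

Section SingleKernel.
Variables (R : realType) (n : nat).
Local Notation X := (n.-tuple R).

(** Cauchy-Schwarz in y over D1, then a constant is integrated over D2. It serves the Taylor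
    remainders, whose size alone is small enough. *)
Lemma famE1_single (I : Type) (i0 : I) (K : X -> X -> R) (D1 D2 : set X) (V1 V2 k : R) : kern K ->
  bx1 (\1_D1 : X -> R) -> bx1 (\1_D2 : X -> R) -> 0 < V1 -> 0 <= V2 -> 0 <= k ->
  \int[@lebn R n]_x \1_D1 x <= V1 -> \int[@lebn R n]_x \1_D2 x <= V2 ->
  (forall x y, `|K x y| <= k) -> (forall x y, ~ D1 y -> K x y = 0) ->
  (forall x y, ~ D2 x -> K x y = 0) ->
  famE1 (fun _ : I => K) [:: i0] (k ^+ 2 * V1 * V2).
Proof.
move=> kK b1 b2 V10 V20 k0 h1 h2 hk K1 K2; split=> // g bg.
have hn := boxes_n R n.
under eq_Rintegral => x _ do rewrite big_seq1; rewrite big_seq1.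
move: (g i0) (bg i0) => {bg}{}g bg.
set Q := (X in _ <= _ * X).
have Q0 : 0 <= Q by apply: Rintegral_ge0 => x _; exact: sqr_ge0.
have P x : (\int[@lebn R n]_y (K x y * g y)) ^+ 2 <= k ^+ 2 * V1 * Q * \1_D2 x.
  rewrite [X in _ <= _ * X]indicE; case: (boolP (_ \in _)) => [_|/negP h]; last first.
    have z y : K x y = 0 by apply: K2 => h'; apply: h; rewrite inE.
    under eq_Rintegral => y _ do rewrite z mul0r.
    by rewrite Rintegral_cst// mul0r expr0n mulr0.
  rewrite mulr1.
  have bD : bx1 (fun y => \1_D1 y * g y) by exact: bxd_mul.
  apply: (@le_trans _ _ ((k * \int[@lebn R n]_y `|\1_D1 y * g y|) ^+ 2)).
    rewrite -[leLHS]real_normK ?num_real// lerXn2r ?nnegrE ?mulr_ge0//.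
      by apply: Rintegral_ge0 => y _.
    have bKg : bx1 (fun y => K x y * g y) by exact: bxd_mul (kern_bx x kK) bg.
    apply: le_trans (Rint_le_norm hn bKg) _.
    rewrite -(RintZ hn); last exact: bxd_norm.
    apply: (le_Rint hn); [exact: bxd_norm|by apply: bxdZ; exact: bxd_norm|].
    move=> y; rewrite !normrM mulrA ler_wpM2r// indicE.
    case: (boolP (_ \in _)) => [_|/negP h]; first by rewrite normr1 mulr1.
    rewrite K1 ?normr0 ?mulr0//; by apply: contra_not h; rewrite inE.
  rewrite exprMn -[k ^+ 2 * _ * _]mulrA ler_wpM2l ?sqr_ge0//.
  apply: (@le_trans _ _ (V1 * \int[@lebn R n]_y (\1_D1 y * g y) ^+ 2)).
    apply: (Rint_CS hn bD b1) => // y h; by rewrite indicE memNset// mul0r.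
  rewrite ler_wpM2l ?(ltW V10)//; apply: (le_Rint hn); [exact: bxd_sqr|exact: bxd_sqr|].
  move=> y; rewrite indicE; case: (_ \in _); rewrite ?mul1r// mul0r expr0n sqr_ge0//.
apply: le_trans (le_Rint hn _ _ P) _.
- exact: bxd_sqr (kern_op kK bg).
- exact: bxdZ.
rewrite (RintZ hn)//.
rewrite (_ : k ^+ 2 * V1 * V2 * Q = k ^+ 2 * V1 * Q * V2); last by ring.
by rewrite ler_wpM2l// !mulr_ge0// ?sqr_ge0// ltW.
Qed.

End SingleKernel.

(** * Almost orthogonality of dilated tensor kernels *)

Section Spec.
Variables (R : realType) (n N : nat) (cf : 'I_N -> R) (w : 'I_N -> R -> R) (rho : R).
Hypothesis rho0 : 0 < rho.
Hypothesis tw : forall t, tst rho (w t).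
Local Notation X := (n.-tuple R).
Local Notation mu := (@lebn R n).
Local Notation hn := (boxes_n R n).
Local Notation leb := (@lebesgue_measure R).

(** Finite combinations of tensor powers of one-dimensional profiles at scale 1/c. All the kernels
    needed later have this form, so moments, supports and compositions reduce to one variable. *)
Definition Ksp (c : R) (x y : X) : R :=
  \sum_t cf t * \prod_i dil c (w t) (tnth x i - tnth y i).

Lemma Ksp_bound_w : exists2 M : R, 1 <= M & forall t x, `|w t x| <= M.
Proof.
have /choice[M hM] : forall t, exists M : R, 0 <= M /\ forall x, `|w t x| <= M.
  by move=> t; have [M M0 hM] := tst_bounded (tw t); exists M.
exists (1 + \sum_t M t); first by rewrite lerDl sumr_ge0// => t _; case: (hM t).
move=> t x; have [M0 h] := hM t; apply: le_trans (h x) _.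
have : M t <= \sum_t M t by rewrite (bigD1 t)//= lerDl sumr_ge0// => t' _; case: (hM t').
by lra.
Qed.

Lemma Ksp_lip_w : exists2 L : R, 0 <= L & forall t x y, `|w t x - w t y| <= L * `|x - y|.
Proof.
have /choice[M hM] : forall t, exists M : R, 0 <= M /\ forall x y, `|w t x - w t y| <= M * `|x - y|.
  by move=> t; have [M M0 hM] := tst_lipschitz (tw t); exists M.
exists (\sum_t M t); first by apply: sumr_ge0 => t _; case: (hM t).
move=> t x y; have [M0 h] := hM t; apply: le_trans (h x y) _; rewrite ler_wpM2r//.
by rewrite (bigD1 t)//= lerDl sumr_ge0// => t' _; case: (hM t').
Qed.

Lemma Ksp_dil c t (z : 'I_n -> R) :
  \prod_i dil c (w t) (z i) = c ^+ n * \prod_i w t (c * z i).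
Proof. by rewrite /dil big_split /= prodr_const card_ord. Qed.

Lemma measurable_Ksp c : measurable_fun setT (fun z : X * X => Ksp c z.1 z.2).
Proof.
apply: measurable_sum => t; apply: measurable_funM => //; apply: measurable_prod => i _.
apply: measurable_funM => //.
apply: measurableT_comp; first exact: tst_measurable (tw t).
apply: measurable_funM => //; apply: measurable_funB.
  by apply: (measurableT_comp (f := fun x : X => tnth x i)) => //; exact: measurable_tnth.
by apply: (measurableT_comp (f := fun x : X => tnth x i)) => //; exact: measurable_tnth.
Qed.

Lemma Ksp_size : exists2 C : R, 0 <= C & forall c x y, 0 < c -> `|Ksp c x y| <= C * c ^+ n.
Proof.
have [M M1 hM] := Ksp_bound_w; have M0 : 0 <= M by lra.
exists (\sum_t `|cf t| * M ^+ n); first by apply: sumr_ge0 => t _; rewrite mulr_ge0// exprn_ge0.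
move=> c x y c0; rewrite mulr_suml; apply: le_trans (ler_norm_sum _ _ _) _.
apply: ler_sum => t _; rewrite Ksp_dil !normrM -mulrA ler_wpM2l//.
have cn : 0 <= c ^+ n by rewrite exprn_ge0// ltW.
rewrite mulrC (ger0_norm cn) ler_wpM2r// normr_prod.
apply: (@le_trans _ _ (\prod_(i < n) M)).
  by apply: ler_prod => i _; rewrite normr_ge0 hM.
by rewrite prodr_const card_ord.
Qed.

Lemma Ksp_supp c x y : 0 < c -> (exists i, rho / c < `|tnth x i - tnth y i|) -> Ksp c x y = 0.
Proof.
move=> c0 [i hi]; rewrite /Ksp big1// => t _; rewrite (bigD1 i)//= /dil.
rewrite (tst_supp (tw t)) ?mulr0 ?mul0r ?mulr0//.
by rewrite normrM gtr0_norm// mulrC -ltr_pdivrMr.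
Qed.

Lemma kern_Ksp c : 0 < c -> kern (Ksp c).
Proof.
move=> c0; split; first exact: measurable_Ksp.
- by have [C C0 hC] := Ksp_size; exists (C * c ^+ n) => x y; exact: hC.
- by exists (rho / c) => x y; exact: Ksp_supp.
Qed.

Lemma Ksp_lip : exists2 C : R, 0 <= C & forall c x y z, 0 < c ->
  `|Ksp c x z - Ksp c y z| <= C * c ^+ n * (c * \sum_i `|tnth x i - tnth y i|).
Proof.
have [M M1 hM] := Ksp_bound_w; have [L L0 hL] := Ksp_lip_w; have M0 : 0 <= M by lra.
exists (\sum_t `|cf t| * M ^+ n * L).
  by apply: sumr_ge0 => t _; rewrite !mulr_ge0// exprn_ge0.
move=> c x y z c0; rewrite /Ksp -sumrB !mulr_suml; apply: le_trans (ler_norm_sum _ _ _) _.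
apply: ler_sum => t _; rewrite !Ksp_dil -mulrBr -mulrBr !normrM -!mulrA ler_wpM2l//.
have cn : 0 <= c ^+ n by rewrite exprn_ge0// ltW.
rewrite (ger0_norm cn).
apply: (@le_trans _ _ (c ^+ n * (M ^+ n * \sum_i `|w t (c * (tnth x i - tnth z i)) - w t (c * (tnth y i - tnth z i))|))).
  rewrite ler_wpM2l//.
  by apply: (prod_diff (a := fun i => w t (c * (tnth x i - tnth z i))) (b := fun i => w t (c * (tnth y i - tnth z i)))).
rewrite mulrCA ler_wpM2l ?exprn_ge0// [L * _]mulrCA ler_wpM2l//.
rewrite mulr_sumr mulr_sumr; apply: ler_sum => i _; apply: le_trans (hL _ _ _) _.
rewrite -mulrBr (_ : tnth x i - tnth z i - _ = tnth x i - tnth y i); last by ring.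
by rewrite normrM gtr0_norm.
Qed.

Lemma Rintegral_dil_shift c t (y : R) : 0 < c -> \int[leb]_s w t s = 1 ->
  leb.-integrable setT (EFin \o (fun s => dil c (w t) (s - y))) /\
  \int[leb]_s dil c (w t) (s - y) = 1.
Proof.
move=> c0 iw.
have td := tst_dil c0 (tw t).
have [I ->] := Rintegral_shift y (tst_integrable td); split => //.
have [I2 E] := Rintegral_affine 0 c0 (tst_integrable (tw t)).
have e : (fun s => w t (c * s + 0)) = (fun s => w t (c * s)) by apply/funext => s; rewrite addr0.
rewrite e in I2 E; rewrite /dil RintegralZl// E iw mulr1 divff// gt_eqF//.
Qed.

Hypothesis iw : forall t, \int[leb]_s w t s = 1.

Lemma Rint_Ksp c y : 0 < c -> \int[mu]_x Ksp c x y = \sum_t cf t.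
Proof.
move=> c0; rewrite /Ksp Rintegral_sum; last first.
  move=> t; have := integrableZl measurableT (cf t) (integrable_tens
    (fun i => (Rintegral_dil_shift (tnth y i) c0 (iw t)).1)).
  by apply: eq_integrable.
apply: eq_bigr => t _; rewrite RintegralZl//; last first.
  exact: (integrable_tens (fun i => (Rintegral_dil_shift (tnth y i) c0 (iw t)).1)).
rewrite (Rintegral_tens (fun i => (Rintegral_dil_shift (tnth y i) c0 (iw t)).1)).
by rewrite big1 ?mulr1// => i _; have [] := Rintegral_dil_shift (tnth y i) c0 (iw t).
Qed.

Hypothesis cf0 : \sum_t cf t = 0.

Lemma Rint_Ksp0 c y : 0 < c -> \int[mu]_x Ksp c x y = 0.
Proof. by move=> c0; rewrite Rint_Ksp. Qed.

Definition Wsp c c' (y z : X) := \int[mu]_x (Ksp c x y * Ksp c' x z).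

Lemma bx1_Ksp c y : 0 < c -> bx1 (fun x => Ksp c x y).
Proof. by move=> c0; exact: (kern_bx y (kern_tr (kern_Ksp c0))). Qed.

(** [Wsp] is the kernel of the transpose of K_c composed with K_c'. The finer kernel K_c has
    integral zero in x, so K_c'(x, z) may be replaced by its increment from y; the Lipschitz bound
    of the coarser kernel over the distance rho / c gives the gain c' / c. *)
Lemma Wsp_bound : exists2 C : R, 0 <= C & forall c c' y z, 0 < c' -> c' <= c ->
  `|Wsp c c' y z| <= C * c' ^+ n * (c' / c).
Proof.
have [C C0 hC] := Ksp_size; have [L L0 hL] := Ksp_lip.
exists (C * (4 * rho) ^+ n * (L * (n%:R * rho))).
  by nng.
move=> c c' y z c'0 cc; have c0 : 0 < c := lt_le_trans c'0 cc.
have cn0 : c != 0 by rewrite gt_eqF.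
have rc0 : 0 < rho / c by rewrite divr_gt0.
have b1 := bx1_Ksp y c0; have b2 := bx1_Ksp z c'0.
have -> : Wsp c c' y z = \int[mu]_x (Ksp c x y * (Ksp c' x z - Ksp c' y z)).
  have -> : Wsp c c' y z = Wsp c c' y z - (\int[mu]_x Ksp c x y) * Ksp c' y z.
    by rewrite Rint_Ksp0// mul0r subr0.
  rewrite -(RintZr hn)// /Wsp -(RintB hn); last 2 first.
  - exact: bxd_mul.
  - by have := bxdZ (Ksp c' y z) b1; under eq_fun do rewrite mulrC.
  by apply: Rint_eq => x; rewrite mulrBr.
have mDb := measurable_cbox y (rho / c); have vD := lebn_cbox y rc0.
have fD : (lebn (cbox y (rho / c)) < +oo)%E by apply: le_lt_trans vD _; rewrite ltry.
have bf : bfun (cbox y (rho / c)) (fun x => Ksp c x y * (Ksp c' x z - Ksp c' y z)).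
  have [mK [MK hMK] _] := kern_Ksp c'0; have [r [m1 [M1 hM1] _]] := b1; have [r2 [m2 _ _]] := b2.
  split.
  - by apply: measurable_funM => //; apply: measurable_funB.
  - exists (M1 * (MK + MK)) => x; rewrite normrM ler_pM//.
    by apply: le_trans (ler_normB _ _) _; rewrite lerD.
  - by move=> x /existsNP[i /negP]; rewrite -ltNge => hi; rewrite Ksp_supp ?mul0r//; exists i.
apply: le_trans (Rintegral_le_bound mDb fD bf (M := C * c ^+ n * (L * c' ^+ n * (c' * (n%:R * (rho / c))))) _) _.
  move=> x; have [hx|/existsNP[i /negP]] := pselect (cbox y (rho / c) x); last first.
    rewrite -ltNge => hi; rewrite Ksp_supp ?mul0r ?normr0//; last by exists i.
    by nng.
  rewrite normrM ler_pM ?hC//; apply: le_trans (hL c' x y z c'0) _.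
  rewrite ler_wpM2l ?mulr_ge0 ?exprn_ge0 ?(ltW c'0)// ler_wpM2l ?(ltW c'0)//.
  apply: (@le_trans _ _ (\sum_(i < n) rho / c)); first by apply: ler_sum => i _; exact: hx.
  by rewrite sumr_const card_ord mulr_natl.
apply: (@le_trans _ _ (C * c ^+ n * (L * c' ^+ n * (c' * (n%:R * (rho / c)))) * (4 * (rho / c)) ^+ n)).
  rewrite ler_wpM2l ?lebn_cbox_fin//.
  by nng.
rewrite (_ : (4 * (rho / c)) ^+ n = (4 * rho) ^+ n / c ^+ n); last by rewrite mulrA expr_div_n.
rewrite le_eqVlt; apply/orP; left; apply/eqP; field.
by rewrite cn0 expf_neq0.
Qed.

Lemma Wsp_supp c c' y z : 0 < c' -> c' <= c ->
  (exists i, 2 * rho / c' < `|tnth y i - tnth z i|) -> Wsp c c' y z = 0.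
Proof.
move=> c'0 cc [i hi]; have c0 : 0 < c := lt_le_trans c'0 cc.
rewrite /Wsp (_ : (fun x => _) = cst 0); first by rewrite Rintegral_cst// mul0r.
apply/funext => x /=.
have [h1|h1] := leP `|tnth x i - tnth y i| (rho / c); last first.
  by rewrite Ksp_supp ?mul0r//; exists i.
rewrite [Ksp c' x z]Ksp_supp ?mulr0//; exists i.
have h2 : rho / c <= rho / c' by rewrite ler_pM2l// lef_pV2// posrE.
have h3 := ler_distD (tnth x i) (tnth y i) (tnth z i).
rewrite (distrC (tnth y i) (tnth x i)) in h3.
have : 2 * rho / c' = rho / c' + rho / c' by lra.
by move: hi h1 h2 h3; lra.
Qed.

Lemma Ksp_pair : exists2 C : R, 0 <= C & forall c c' g h, 0 < c' -> c' <= c -> bx1 g -> bx1 h ->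
  `|\int[mu]_x ((\int[mu]_y (Ksp c x y * g y)) * (\int[mu]_z (Ksp c' x z * h z)))| <=
  C * (c' / c) * (\int[mu]_y g y ^+ 2 + \int[mu]_y h y ^+ 2).
Proof.
have [C C0 hC] := Wsp_bound.
exists (C * (8 * rho) ^+ n / 2); first by nng.
move=> c c' g h c'0 cc bg bh; have c0 : 0 < c := lt_le_trans c'0 cc.
have kc := kern_Ksp c0; have kc' := kern_Ksp c'0.
pose h' x := \int[mu]_z (Ksp c' x z * h z).
have bh' : bx1 h' by exact: kern_op.
have [mK [M hM] [rK sK]] := kc; have [mK' [M' hM'] _] := kc'.
have bF1 : bx2 (fun z : pt R n n => Ksp c z.1 z.2 * h' z.1 * g z.2).
  have [r hr] := bxdM mK (ex_intro _ M (fun z => hM z.1 z.2)) (bxd_prod hn hn bh' bg).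
  by exists r; move: hr; under eq_fun do rewrite mulrA.
have -> : \int[mu]_x ((\int[mu]_y (Ksp c x y * g y)) * h' x) =
    \int[mu]_y (g y * \int[mu]_z (h z * Wsp c c' y z)).
  transitivity (\int[mu]_x \int[mu]_y (Ksp c x y * h' x * g y)).
    apply: Rint_eq => x; rewrite -(RintZr hn); last exact: bxd_mul (kern_bx x kc) bg.
    by apply: Rint_eq => y; rewrite mulrAC.
  rewrite (Rint_swap (mu := mu) (nu := mu) hn hn bF1); apply: Rint_eq => y /=.
  rewrite (RintZr hn); last exact: bxd_mul (bx1_Ksp y c0) bh'.
  rewrite mulrC; congr (_ * _).
  transitivity (\int[mu]_x \int[mu]_z (Ksp c x y * Ksp c' x z * h z)).
    apply: Rint_eq => x; rewrite /h' -(RintZ hn); last exact: bxd_mul (kern_bx x kc') bh.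
    by apply: Rint_eq => z; rewrite mulrA.
  have bF2 : bx2 (fun z : pt R n n => Ksp c z.1 y * Ksp c' z.1 z.2 * h z.2).
    have [r hr] := bxdM mK' (ex_intro _ M' (fun z => hM' z.1 z.2)) (bxd_prod hn hn (bx1_Ksp y c0) bh).
    by exists r; move: hr; under eq_fun do rewrite mulrCA mulrA.
  rewrite (Rint_swap (mu := mu) (nu := mu) hn hn bF2); apply: Rint_eq => z /=.
  by rewrite (RintZr hn) 1?mulrC//; exact: bxd_mul (bx1_Ksp y c0) (bx1_Ksp z c'0).
set k := C * c' ^+ n * (c' / c); have k0 : 0 <= k by rewrite /k; nng.
pose D : set (X * X) := [set z | forall i, `|tnth z.1 i - tnth z.2 i| <= 2 * rho / c'].
have r2 : 0 < 2 * rho / c' by rewrite divr_gt0// mulr_gt0.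
have mD : measurable D.
  rewrite (_ : D = \bigcap_(i in [set: 'I_n]) ((fun z : X * X => tnth z.1 i - tnth z.2 i) @^-1` `[- (2 * rho / c'), 2 * rho / c']%classic)).
    apply: fin_bigcap_measurable => // i _; rewrite -[Z in measurable Z]setTI.
    apply: measurable_funB => //.
      by apply: (measurableT_comp (f := fun x : X => tnth x i)) => //; exact: measurable_tnth.
    by apply: (measurableT_comp (f := fun x : X => tnth x i)) => //; exact: measurable_tnth.
  apply/seteqP; split => z /=; first by move=> hz i _ /=; rewrite in_itv /= -ler_norml.
  by move=> hz i; have := hz i I; rewrite /= in_itv /= -ler_norml.
pose U (y z : X) := k * (\1_D (y, z) : R).
have U0 y z : 0 <= U y z by rewrite mulr_ge0.
have kU : kern U.
  split.
  - apply: measurable_funM => //.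
    rewrite (_ : (fun z : X * X => _) = (\1_D : X * X -> R))//; by apply/funext => -[].
  - by exists k => y z; rewrite ger0_norm// ler_piMr// indicE ler_nat leq_b1.
  - exists (2 * rho / c') => y z [i hi]; rewrite /U indicE memNset ?mulr0// => /(_ i) /=.
    by rewrite leNgt hi.
have Wk y z : `|Wsp c c' y z| <= U y z.
  rewrite /U indicE; case: (boolP (_ \in _)) => [_|/negP hD]; first by rewrite mulr1; exact: hC.
  rewrite Wsp_supp ?normr0 ?mulr0//; apply: contrapT => hn'; apply: hD; rewrite inE => i /=.
  by rewrite leNgt; apply/negP => hi; apply: hn'; exists i.
have Dsym y z : \1_D (y, z) = \1_D (z, y) :> R.
  rewrite !indicE; congr (_%:R); congr nat_of_bool.
  by apply/idP/idP; rewrite !inE => hh i /=; rewrite distrC; exact: hh.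
have sec y : \int[mu]_z U y z <= k * ((8 * rho) ^+ n / c' ^+ n).
  have mc := measurable_cbox y (2 * rho / c'); have fc := lebn_cbox y r2.
  have e z : (\1_D (y, z) : R) = \1_(cbox y (2 * rho / c')) z.
    rewrite !indicE; congr (_%:R); congr nat_of_bool; apply/idP/idP; rewrite !inE => hh i.
      by rewrite distrC; exact: hh.
    by rewrite /= distrC; exact: hh.
  rewrite /U RintegralZl//; last first.
    have : mu.-integrable setT (EFin \o (\1_(cbox y (2 * rho / c')) : X -> R)).
      by apply: integrable_indicT => //; apply: le_lt_trans fc _; rewrite ltry.
    by apply: eq_integrable => // z _ /=; rewrite e.
  rewrite ler_wpM2l// (Rint_eq _ e) /Rintegral integral_indic// setIT.
  apply: le_trans (lebn_cbox_fin y r2) _.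
  by rewrite -expr_div_n le_eqVlt; apply/orP; left; apply/eqP; congr (_ ^+ _); field; rewrite gt_eqF.
have sec' z : \int[mu]_y U y z <= k * ((8 * rho) ^+ n / c' ^+ n).
  by rewrite (Rint_eq _ (g := U z)) => // y; rewrite /U Dsym.
have V0 : 0 <= k * ((8 * rho) ^+ n / c' ^+ n) by nng.
have S := kern_schur kU U0 V0 sec sec' bg bh.
have bW y : bx1 (fun z => h z * Wsp c c' y z).
  have [rh [mh [Mh hMh] h0]] := bh; exists rh; split.
  - apply: measurable_funM => //.
    have : bx1 (fun z => \int[mu]_x (Ksp c' x z * Ksp c x y)).
      exact: (kern_op (kern_tr kc') (bx1_Ksp y c0)).
    move=> /bxd_measurable; apply: eq_measurable_fun => z _.
    by apply: Rint_eq => x; rewrite mulrC.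
  - exists (Mh * k) => z; rewrite normrM ler_pM//; apply: le_trans (Wk y z) _.
    by rewrite ler_piMr// indicE ler_nat leq_b1.
  - by move=> z /h0 ->; rewrite mul0r.
have bO : bx1 (fun y => g y * \int[mu]_z (h z * Wsp c c' y z)).
  suff e y : \int[mu]_x (Ksp c x y * h' x) = \int[mu]_z (h z * Wsp c c' y z).
    have := bxd_mul bg (kern_op (kern_tr kc) bh').
    by apply: bxd_ext => y; rewrite e.
  transitivity (\int[mu]_x \int[mu]_z (Ksp c x y * Ksp c' x z * h z)).
    apply: Rint_eq => x; rewrite /h' -(RintZ hn); last exact: bxd_mul (kern_bx x kc') bh.
    by apply: Rint_eq => z; rewrite mulrA.
  have bF2 : bx2 (fun z : pt R n n => Ksp c z.1 y * Ksp c' z.1 z.2 * h z.2).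
    have [r hr] := bxdM mK' (ex_intro _ M' (fun z => hM' z.1 z.2)) (bxd_prod hn hn (bx1_Ksp y c0) bh).
    by exists r; move: hr; under eq_fun do rewrite mulrCA mulrA.
  rewrite (Rint_swap (mu := mu) (nu := mu) hn hn bF2); apply: Rint_eq => z /=.
  by rewrite (RintZr hn) 1?mulrC//; exact: bxd_mul (bx1_Ksp y c0) (bx1_Ksp z c'0).
apply: le_trans (Rint_le_norm hn bO) _.
apply: (@le_trans _ _ (\int[mu]_y (`|g y| * \int[mu]_z (U y z * `|h z|)))).
  apply: (le_Rint hn); first exact: bxd_norm bO.
    exact: bxd_mul (bxd_norm bg) (kern_op kU (bxd_norm bh)).
  move=> y; rewrite normrM; apply: ler_wpM2l; first by [].
  apply: le_trans (Rint_le_norm hn (bW y)) _.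
  apply: (le_Rint hn (f := fun z => `|h z * Wsp c c' y z|) (g := fun z => U y z * `|h z|)).
  - exact: bxd_norm (bW y).
  - exact: bxd_mul (kern_bx y kU) (bxd_norm bh).
  - by move=> z; rewrite normrM mulrC; apply: ler_wpM2r.
apply: le_trans S _; rewrite le_eqVlt; apply/orP; left; apply/eqP; rewrite /k.
by field; rewrite expf_neq0 ?gt_eqF.
Qed.

Lemma Ksp_E1 : exists2 C : R, 0 < C & forall es : seq int, uniq es ->
  famE1 (fun e => Ksp (2 ^ (- e))) es C.
Proof.
have [C C0 hC] := Ksp_pair.
have p2 (e : int) : 0 < (2 : R) ^ e by rewrite exprz_gt0.
(* The geometric series over all integers is at most 4, and each pair of scales contributes the
   energies of both members; the summand 1 makes the constant positive. *)
exists (8 * C + 1); first by lra.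
move=> es ues; split; first by move=> e; exact: kern_Ksp.
move=> g bg; pose G e := \int[mu]_y g e y ^+ 2.
have G0 e : 0 <= G e by apply: Rintegral_ge0 => x _; exact: sqr_ge0.
pose O e x := \int[mu]_y (Ksp (2 ^ (- e)) x y * g e y).
have bO e : bx1 (O e) by apply: kern_op => //; exact: kern_Ksp.
have pr e f : `|\int[mu]_x (O e x * O f x)| <= C * (2^-1) ^+ `|(f - e)%R|%N * (G e + G f).
  wlog ef : e f / (e <= f)%R => [H|].
    have [ef|/ltW fe] := leP e f; first exact: H.
    rewrite (Rint_eq _ (g := fun x => O f x * O e x)); last by move=> x; rewrite mulrC.
    rewrite [G e + _]addrC (_ : `|(f - e)%R|%N = `|(e - f)%R|%N); last by lia.
    exact: H.
  apply: le_trans (hC _ (2 ^ (- f)) (g e) (g f) _ _ (bg e) (bg f)) _ => //.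
    by rewrite ler_weXz2l ?ler1n// lerN2.
  rewrite (_ : 2 ^ (- f) / 2 ^ (- e) = (2^-1 : R) ^+ `|(f - e)%R|%N)//.
  rewrite -[X in _ / X]invrK invr_expz opprK invrK -expfzDr ?pnatr_eq0//.
  have -> : (- f + e)%R = - (`|(f - e)%R|%N : int) by lia.
  by rewrite -exprnN exprVn.
rewrite (Rint_eq _ (g := fun x => \sum_(e <- es) \sum_(f <- es) O e x * O f x)); last first.
  move=> x; rewrite expr2 mulr_suml; apply: eq_bigr => e _; by rewrite mulr_sumr.
rewrite (Rint_sum hn); last by move=> e; apply: (bxd_sum hn) => f; exact: bxd_mul (bO e) (bO f).
apply: (@le_trans _ _ (\sum_(e <- es) \sum_(f <- es) C * (2^-1) ^+ `|(f - e)%R|%N * (G e + G f))).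
  apply: ler_sum => e _; rewrite (Rint_sum hn); last by move=> f; exact: bxd_mul (bO e) (bO f).
  by apply: ler_sum => f _; apply: le_trans (ler_norm _) (pr e f).
have half : \sum_(e <- es) \sum_(f <- es) C * (2^-1) ^+ `|(f - e)%R|%N * G e <= 4 * C * \sum_(e <- es) G e.
  rewrite mulr_sumr; apply: ler_sum => e _; rewrite -mulr_suml -mulr_sumr ler_wpM2r//.
  by rewrite mulrC ler_wpM2r//; exact: sum_geo_int.
have -> : \sum_(e <- es) \sum_(f <- es) C * (2^-1) ^+ `|(f - e)%R|%N * (G e + G f) =
   \sum_(e <- es) \sum_(f <- es) C * (2^-1) ^+ `|(f - e)%R|%N * G e +
   \sum_(e <- es) \sum_(f <- es) C * (2^-1) ^+ `|(f - e)%R|%N * G e.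
  rewrite [X in _ = _ + X]exchange_big -big_split /=; apply: eq_bigr => e _.
  rewrite -big_split /=; apply: eq_bigr => f _.
  by rewrite mulrDr (_ : `|(f - e)%R|%N = `|(e - f)%R|%N)//; lia.
have S0 : 0 <= \sum_(e <- es) G e by apply: sumr_ge0.
rewrite mulrDl mul1r; apply: le_trans (lerD half half) _; lra.
Qed.

End Spec.

(** * Moments and Taylor expansion of kernels *)

Section TensorTaylor.
Variables (R : realType) (n : nat).

(** Each factor is expanded to order s and the product multiplied out. Monomials of total degree
    above s are moved to the remainder, which is where l <= 1 is used: all their powers of l are at
    most l^(s+1). *)
Lemma tens_taylor r (w : R -> R) s : tst r w -> exists (V : nat -> R -> R) (C : R),
  [/\ 0 <= C, forall a, measurable_fun setT (V a) &
   forall (l : R) (z h : 'I_n -> R), l <= 1 -> (forall i, `|h i| <= l) -> 0 <= l ->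
   `|\prod_i w (z i + h i) - \sum_(al : {ffun 'I_n -> 'I_s.+1} | (\sum_i al i <= s)%N)
      (\prod_i V (al i) (z i)) * \prod_i h i ^+ al i| <= C * l ^+ s.+1].
Proof.
move=> tw; have [U [M [M0 tU hM]]] := tst_taylor s.+1 tw.
have [W W0 hW] := tst_bounded tw.
have /choice[B hB] : forall a, exists B : R, 0 <= B /\ forall x, `|U a x| <= B.
  by move=> a; have [B B0 hB] := tst_bounded (tU a); exists B.
pose MU := 1 + \sum_(a < s.+1) B a.
have sB0 : 0 <= \sum_(a < s.+1) B a by apply: sumr_ge0 => a _; case: (hB a).
have MU1 : 1 <= MU by rewrite lerDl.
have hU (a : 'I_s.+1) x : `|U a x| <= MU.
  have [B0 h] := hB a; apply: le_trans (h x) _.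
  have : B a <= \sum_(a < s.+1) B a.
    by rewrite (bigD1 a)//= lerDl sumr_ge0// => t' _; case: (hB t').
  by rewrite /MU; lra.
(* N bounds the factors and also their Taylor polynomials, which differ from them by at most M. *)
pose N := 1 + W + M; have N1 : 1 <= N by rewrite /N; lra.
have N0 : 0 <= N by lra.
exists U, (N ^+ n * (n%:R * M) + \sum_(al : {ffun 'I_n -> 'I_s.+1}) MU ^+ n); split.
- apply: addr_ge0; first by nng.
  by apply: sumr_ge0 => al _; rewrite exprn_ge0//; lra.
- by move=> a; exact: tst_measurable (tU a).
move=> l z h l1 hl l0.
pose b i := \sum_(a < s.+1) U a (z i) * h i ^+ a.
have ab i : `|w (z i + h i) - b i| <= M * l ^+ s.+1.
  by apply: le_trans (hM _ _) _; apply: ler_wpM2l => //; rewrite lerXn2r ?nnegrE.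
have l2 : l ^+ s.+1 <= 1 by rewrite exprn_ile1.
have E : \prod_i b i = \sum_(al : {ffun 'I_n -> 'I_s.+1})
    (\prod_i U (al i) (z i)) * \prod_i h i ^+ al i.
  by rewrite bigA_distr_bigA /=; apply: eq_bigr => al _; rewrite big_split.
have -> : \prod_i w (z i + h i) - \sum_(al : {ffun 'I_n -> 'I_s.+1} | (\sum_i al i <= s)%N)
      (\prod_i U (al i) (z i)) * \prod_i h i ^+ al i =
   (\prod_i w (z i + h i) - \prod_i b i) +
   \sum_(al : {ffun 'I_n -> 'I_s.+1} | ~~ (\sum_i al i <= s)%N)
      (\prod_i U (al i) (z i)) * \prod_i h i ^+ al i.
  rewrite E [X in _ = (_ - X) + _](bigID (fun al : {ffun 'I_n -> 'I_s.+1} => (\sum_i al i <= s)%N)) /=.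
  by rewrite opprD addrA subrK.
apply: le_trans (ler_normD _ _) _; rewrite mulrDl; apply: lerD.
  apply: le_trans (prod_diff (M := N) _ _ _) _ => //.
  - by move=> i; apply: le_trans (hW _) _; rewrite /N; lra.
  - move=> i; have := ler_normD (b i - w (z i + h i)) (w (z i + h i)); rewrite subrK distrC.
    have := hW (z i + h i); have := ab i; have : M * l ^+ s.+1 <= M by rewrite ler_piMr.
    by rewrite /N; lra.
  rewrite -mulrA; apply: ler_wpM2l; first by rewrite exprn_ge0.
  apply: (@le_trans _ _ (\sum_(i < n) M * l ^+ s.+1)); first by apply: ler_sum => i _; exact: ab.
  by rewrite sumr_const card_ord mulr_natl mulrnAl.
apply: le_trans (ler_norm_sum _ _ _) _; rewrite mulr_suml big_mkcond /=.
apply: ler_sum => al _; have MUn : 0 <= MU ^+ n by rewrite exprn_ge0//; lra.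
case: ifP => [hal|_]; last by rewrite mulr_ge0// exprn_ge0.
rewrite normrM; apply: ler_pM => //.
  rewrite normr_prod; apply: (@le_trans _ _ (\prod_(i < n) MU)).
    by apply: ler_prod => i _; rewrite normr_ge0 hU.
  by rewrite prodr_const card_ord.
rewrite normr_prod; apply: (@le_trans _ _ (\prod_(i < n) l ^+ al i)).
  by apply: ler_prod => i _; rewrite normr_ge0 normrX lerXn2r ?nnegrE.
rewrite -expr_sum; move: hal; rewrite -ltnNge => hal.
by apply: ler_wiXn2l.
Qed.

End TensorTaylor.

Section Moments.
Variables (R : realType) (n : nat).
Local Notation X := (n.-tuple R).
Local Notation mu := (@lebn R n).

Definition rmz (s : nat) (a : X -> R) := forall al : n.-tuple nat, (mabs al <= s)%N ->
  mu.-integrable setT (EFin \o (fun x => a x * mono al x)) /\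
  \int[mu]_x (a x * mono al x) = 0.

Lemma measurable_mono (al : n.-tuple nat) : measurable_fun setT (@mono R n al).
Proof.
by apply: measurable_prod => i _; apply: measurable_funX; exact: measurable_tnth.
Qed.

(** With the convention that [+oo - +oo] is [-oo], an extended integral with value 0 has finite
    positive and negative parts. So the moment conditions of an atom, stated with extended
    integrals, already contain the integrability of its slices. *)
Lemma rmz_ereal s (a : X -> R) : measurable_fun setT a ->
  (forall al : n.-tuple nat, (mabs al <= s)%N -> (\int[mu]_x (a x * mono al x)%:E = 0)%E) ->
  rmz s a.
Proof.
move=> ma h al hal; have E := h al hal; split; last by rewrite /Rintegral E.
have mf : measurable_fun setT (EFin \o (fun x => a x * mono al x)).
  by apply/measurable_EFinP; apply: measurable_funM => //; exact: measurable_mono.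
move: E; rewrite integralE.
set p := (\int[_]_x _)%E; set q := (\int[_]_x _)%E => E.
have p0 : (0 <= p)%E by apply: integral_ge0 => x _; exact: funepos_ge0.
have q0 : (0 <= q)%E by apply: integral_ge0 => x _; exact: funeneg_ge0.
have [pf qf] : (p < +oo)%E /\ (q < +oo)%E.
  by move: E p0 q0; case: p => [p| |]; case: q => [q| |]//=; rewrite ?ltry.
apply/integrableP; split => //.
have -> : (\int[mu]_x `|(EFin \o (fun x => a x * mono al x)%R) x| = p + q)%E.
  rewrite /p /q -ge0_integralD//.
  - by apply: eq_integral => x _; rewrite -/((abse \o (EFin \o (fun x => a x * mono al x))) x) fune_abse.
  - by apply: measurable_funepos; exact: mf.
  - by apply: measurable_funeneg; exact: mf.
exact: lte_add_pinfty.
Qed.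

Lemma mono_incr (al : n.-tuple nat) (i : 'I_n) (x : X) :
  mono [tuple (tnth al j + (j == i))%N | j < n] x = mono al x * tnth x i.
Proof.
rewrite /mono (bigD1 i)//= [in RHS](bigD1 i)//= tnth_mktuple eqxx exprD expr1.
rewrite mulrAC; congr (_ * _ * _); apply: eq_bigr => j /negbTE ji.
by rewrite tnth_mktuple ji addn0.
Qed.

Lemma mabs_incr (al : n.-tuple nat) (i : 'I_n) :
  mabs [tuple (tnth al j + (j == i))%N | j < n] = (mabs al).+1.
Proof.
rewrite /mabs; under eq_bigr do rewrite tnth_mktuple.
rewrite big_split /= (bigD1 i (P := xpredT) (F := fun j => (j == i) : nat))//= eqxx.
by rewrite [X in (true + X)%N]big1 ?addn0 ?addn1// => j /negbTE ->.
Qed.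

Lemma rmz_mulX s (a : X -> R) i c : rmz s.+1 a -> rmz s (fun y => a y * (tnth y i - c)).
Proof.
move=> h al hal.
have [i1 e1] := h al (leqW hal).
have [|i2 e2] := h [tuple (tnth al j + (j == i))%N | j < n]; first by rewrite mabs_incr.
have E : (fun y => a y * (tnth y i - c) * mono al y) =
  (fun y => a y * mono [tuple (tnth al j + (j == i))%N | j < n] y - c * (a y * mono al y)).
  by apply/funext => y; rewrite mono_incr; ring.
have i3 : mu.-integrable setT (EFin \o (fun y => c * (a y * mono al y))).
  by have := integrableZl measurableT c i1; apply: eq_integrable.
rewrite E; split.
  by have := integrableB measurableT i2 i3; apply: eq_integrable.
by rewrite RintegralB// e2 RintegralZl// e1 mulr0 subr0.
Qed.

(** Moments about another centre vanish too: multiplying by one factor y_i - c_i costs one order of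
    vanishing moments, so the monomial is peeled off factor by factor. *)
Lemma rmz_prod s (a : X -> R) (al : 'I_n -> nat) (c : X) : rmz s a -> (\sum_i al i <= s)%N ->
  mu.-integrable setT (EFin \o (fun y => a y * \prod_i (tnth y i - tnth c i) ^+ al i)) /\
  \int[mu]_y (a y * \prod_i (tnth y i - tnth c i) ^+ al i) = 0.
Proof.
elim: s al a => [|s IH] al a ha hal.
  have z i : al i = 0%N.
    by apply/eqP; rewrite -leqn0; apply: leq_trans hal; rewrite (bigD1 i)//= leq_addr.
  have := ha [tuple 0%N | i < n].
  have -> : mabs [tuple 0%N | i < n] = 0%N by rewrite /mabs big1// => i _; rewrite tnth_mktuple.
  move=> /(_ isT).
  rewrite (_ : (fun y => a y * mono _ y) = (fun y => a y * \prod_i (tnth y i - tnth c i) ^+ al i))//.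
  apply/funext => y; rewrite /mono; congr (_ * _); apply: eq_bigr => i _.
  by rewrite tnth_mktuple z !expr0.
have [/existsP[i hi]|/existsPn h0] := boolP [exists i, (0 < al i)%N]; last first.
  apply: IH; last by rewrite big1// => i _; apply/eqP; rewrite -leqn0 leqNgt h0.
  by move=> be hbe; apply: ha; exact: leqW.
have hal' : (\sum_j (al j - (j == i)) <= s)%N.
  move: hal; rewrite (bigD1 i)//= [X in _ -> (X <= _)%N](bigD1 i)//= eqxx.
  rewrite [X in _ -> (_ + X <= _)%N](eq_bigr al); first by move: hi; lia.
  by move=> j /negbTE ->; rewrite subn0.
have := IH _ _ (rmz_mulX i (tnth c i) ha) hal'.
rewrite (_ : (fun y => a y * _ * _) = (fun y => a y * \prod_i (tnth y i - tnth c i) ^+ al i))//.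
apply/funext => y; rewrite -mulrA; congr (_ * _).
rewrite (bigD1 i)//= [in RHS](bigD1 i)//= eqxx mulrA -exprS subn1 prednK//.
by congr (_ * _); apply: eq_bigr => j /negbTE ->; rewrite subn0.
Qed.

End Moments.

Section SpecMore.
Variables (R : realType) (n N : nat) (cf : 'I_N -> R) (w : 'I_N -> R -> R) (rho : R).
Hypothesis rho0 : 0 < rho.
Hypothesis tw : forall t, tst rho (w t).
Local Notation X := (n.-tuple R).
Local Notation mu := (@lebn R n).
Local Notation leb := (@lebesgue_measure R).

(* A Taylor expansion of order s in the second variable, for a kernel of scale 1/c. *)
Definition ktaylor (s : nat) (C c : R) (K : X -> X -> R) := forall (l : R) (y0 : X),
  0 <= l -> c * l <= 1 -> exists co : {ffun 'I_n -> 'I_s.+1} -> X -> R,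
    (forall al, measurable_fun setT (co al)) /\
    forall x y, (forall i, `|tnth y i - tnth y0 i| <= l) ->
    `|K x y - \sum_(al : {ffun 'I_n -> 'I_s.+1} | (\sum_i al i <= s)%N) co al x * \prod_i (tnth y i - tnth y0 i) ^+ al i|
      <= C * c ^+ n * (c * l) ^+ s.+1.

Lemma Ksp_taylor s : exists2 C : R, 0 <= C & forall c, 0 < c -> ktaylor s C c (Ksp cf w c).
Proof.
have /choice[V hV] := fun t => tens_taylor n s (tw t).
have /choice[C hC] := hV.
exists (\sum_t `|cf t| * C t).
  by apply: sumr_ge0 => t _; have [C0 _ _] := hC t; rewrite mulr_ge0.
move=> c c0 l y0 l0 cl.
exists (fun (al : {ffun 'I_n -> 'I_s.+1}) x => \sum_t cf t * c ^+ n * \prod_i (V t (al i) (c * (tnth x i - tnth y0 i)) * (- c) ^+ al i)).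
split.
  move=> al; apply: measurable_sum => t; apply: measurable_funM => //; apply: measurable_prod => i _.
  apply: measurable_funM => //; apply: measurableT_comp; first by have [] := hC t.
  by apply: measurable_funM => //; apply: measurable_funB => //; exact: measurable_tnth.
move=> x y hy.
have cl0 : 0 <= c * l by rewrite mulr_ge0// ltW.
have -> : \sum_(al : {ffun 'I_n -> 'I_s.+1} | (\sum_i al i <= s)%N)
    (\sum_t cf t * c ^+ n * \prod_i (V t (al i) (c * (tnth x i - tnth y0 i)) * (- c) ^+ al i)) *
    \prod_i (tnth y i - tnth y0 i) ^+ al i =
  \sum_t cf t * c ^+ n * \sum_(al : {ffun 'I_n -> 'I_s.+1} | (\sum_i al i <= s)%N)
    (\prod_i V t (al i) (c * (tnth x i - tnth y0 i))) *
    \prod_i (- c * (tnth y i - tnth y0 i)) ^+ al i.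
  under eq_bigr => al _ do rewrite mulr_suml.
  rewrite exchange_big /=; apply: eq_bigr => t _; rewrite mulr_sumr; apply: eq_bigr => al _.
  rewrite -!mulrA; congr (_ * (_ * _)); rewrite big_split /= -mulrA; congr (_ * _).
  by rewrite -big_split /=; apply: eq_bigr => i _; rewrite exprMn.
rewrite /Ksp -sumrB !mulr_suml; apply: le_trans (ler_norm_sum _ _ _) _.
apply: ler_sum => t _; have [C0 _ H] := hC t.
rewrite Ksp_dil -[cf t * c ^+ n * _]mulrA -mulrBr -mulrBr !normrM -!mulrA.
apply: ler_wpM2l => //; rewrite (ger0_norm (x := c ^+ n)); last by rewrite exprn_ge0// ltW.
rewrite [leRHS]mulrCA; apply: ler_wpM2l; first by rewrite exprn_ge0// ltW.
have := H (c * l) (fun i => c * (tnth x i - tnth y0 i)) (fun i => - c * (tnth y i - tnth y0 i)) cl _ cl0.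
have -> : \prod_i w t (c * (tnth x i - tnth y0 i) + - c * (tnth y i - tnth y0 i)) =
    \prod_i w t (c * (tnth x i - tnth y i)).
  by apply: eq_bigr => i _; congr (w t _); ring.
apply=> i; rewrite normrM normrN (gtr0_norm c0); apply: ler_wpM2l; [exact: ltW|exact: hy].
Qed.

Variable s : nat.
Hypothesis mw : forall t, mr s (w t).

Lemma mr_int t : \int[leb]_x w t x = 1.
Proof.
have := mw t 0 (leq0n s); rewrite expr0 => <-; congr Rintegral; apply/funext => x.
by rewrite subr0 expr0 mulr1.
Qed.

(** Convolution with each profile reproduces the monomial, so only the sum of the coefficients
    remains: 0 for A, 1 for the approximate identity. *)
Lemma Ksp_moment c y (al : n.-tuple nat) : 0 < c -> (mabs al <= s)%N ->
  mu.-integrable setT (EFin \o (fun x => Ksp cf w c x y * mono al x)) /\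
  \int[mu]_x (Ksp cf w c x y * mono al x) = (\sum_t cf t) * mono al y.
Proof.
move=> c0 hal.
pose g t i x := dil c (w t) (x - tnth y i) * x ^+ tnth al i.
have ig t i : leb.-integrable setT (EFin \o g t i) by exact: integrable_mom (tst_dil c0 (tw t)).
have it t := integrable_tens (ig t).
have it' t : mu.-integrable setT (EFin \o (fun x => cf t * \prod_i g t i (tnth x i))).
  by have := integrableZl measurableT (cf t) (it t); apply: eq_integrable.
have E : (fun x => Ksp cf w c x y * mono al x) = (fun x => \sum_t cf t * \prod_i g t i (tnth x i)).
  apply/funext => x; rewrite /Ksp mulr_suml; apply: eq_bigr => t _; rewrite -mulrA.
  by congr (_ * _); rewrite /mono -big_split.
rewrite E; split; first exact: integrable_Rsum.
rewrite Rintegral_sum// mulr_suml; apply: eq_bigr => t _; rewrite RintegralZl//; last exact: it.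
congr (_ * _); rewrite Rintegral_tens//; apply: eq_bigr => i _.
rewrite (mr_dil c0 (tw t) (mw t))//; apply: leq_trans hal.
by rewrite /mabs (bigD1 i)//= leq_addr.
Qed.

End SpecMore.

Section Compose.
Variables (R : realType) (n N N' : nat) (cf : 'I_N -> R) (w : 'I_N -> R -> R)
  (cf' : 'I_N' -> R) (w' : 'I_N' -> R -> R) (r r' : R).
Hypotheses (tw : forall t, tst r (w t)) (tw' : forall t, tst r' (w' t)).
Local Notation X := (n.-tuple R).
Local Notation mu := (@lebn R n).
Local Notation leb := (@lebesgue_measure R).

Lemma Ksp_comp c (x z : X) : 0 < c ->
  \int[mu]_y (Ksp cf w c x y * Ksp cf' w' c y z) =
  \sum_t \sum_t' cf t * cf' t' * \prod_i dil c (cnv (w t) (w' t')) (tnth x i - tnth z i).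
Proof.
move=> c0.
pose g t t' i y := dil c (w t) (tnth x i - y) * dil c (w' t') (y - tnth z i).
have ig t t' i : leb.-integrable setT (EFin \o g t t' i).
  have [] := Rintegral_shift (tnth z i) (integrable_convx (tnth x i - tnth z i) (tst_dil c0 (tw t)) (tst_dil c0 (tw' t'))).
  move=> + _; apply: eq_integrable => // y _ /=; congr (_%:E); rewrite /g; congr (dil c _ _ * _); ring.
have it t t' := integrable_tens (ig t t').
have it' t t' : mu.-integrable setT (EFin \o (fun y => cf t * cf' t' * \prod_i g t t' i (tnth y i))).
  by have := integrableZl measurableT (cf t * cf' t') (it t t'); apply: eq_integrable.
have -> : (fun y => Ksp cf w c x y * Ksp cf' w' c y z) =
  (fun y => \sum_t \sum_t' cf t * cf' t' * \prod_i g t t' i (tnth y i)).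
  apply/funext => y; rewrite /Ksp mulr_suml; apply: eq_bigr => t _; rewrite mulr_sumr.
  by apply: eq_bigr => t' _; rewrite [X in _ = _ * X]big_split /=; ring.
rewrite Rintegral_sum; last by move=> t; apply: integrable_Rsum => t'.
apply: eq_bigr => t _; rewrite Rintegral_sum//; apply: eq_bigr => t' _.
rewrite RintegralZl//; last exact: it.
congr (_ * _); rewrite Rintegral_tens//; apply: eq_bigr => i _.
by rewrite (Rintegral_conv _ _ (tst_dil c0 (tw t)) (tst_dil c0 (tw' t'))) (conv_dil c0 (tw t) (tw' t')).
Qed.

End Compose.

(** * The telescoping family of kernels *)

Section KernelPackage.
Variables (R : realType) (n : nat).
Local Notation X := (n.-tuple R).
Local Notation mu := (@lebn R n).
Local Notation leb := (@lebesgue_measure R).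

(** The product structure is remembered because it makes [Op2] a combination of convolutions with
    test functions, hence smooth. *)
Definition skern (K : X -> X -> R) := exists (N : nat) (cf : 'I_N -> R) (u : 'I_N -> R -> R) (r : R),
  [/\ 0 < r, forall t, tst r (u t) & forall x y, K x y = \sum_t cf t * \prod_i u t (tnth x i - tnth y i)].

Lemma skern_Ksp N (cf : 'I_N -> R) w r c : 0 < r -> 0 < c -> (forall t, tst r (w t)) -> skern (Ksp cf w c).
Proof.
move=> r0 c0 tw; exists N, cf, (fun t => dil c (w t)), (r / c); split => //; first by rewrite divr_gt0.
by move=> t; exact: tst_dil.
Qed.

Lemma skern_tr K : skern K -> skern (fun x y => K y x).
Proof.
move=> [N [cf [u [r [r0 tu E]]]]]; exists N, cf, (fun t x => u t (- x)), r; split => //.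
  by move=> t; exact: tst_opp.
move=> x y; rewrite E; apply: eq_bigr => t _; congr (_ * _); apply: eq_bigr => i _.
by rewrite opprB.
Qed.

Lemma skern_kern K : skern K -> kern K.
Proof.
move=> [N [cf [u [r [r0 tu E]]]]].
have -> : K = Ksp cf u 1.
  apply/funext => x; apply/funext => y; rewrite E; apply: eq_bigr => t _; congr (_ * _).
  by apply: eq_bigr => i _; rewrite /dil !mul1r.
exact: (kern_Ksp n cf tu ltr01).
Qed.

Lemma famE1_le (I : Type) (K : I -> X -> X -> R) es C C' : C <= C' -> famE1 K es C -> famE1 K es C'.
Proof.
move=> CC [kK h]; split => // g bg; apply: le_trans (h g bg) _.
apply: ler_wpM2r => //; apply: sumr_ge0 => e _; apply: Rintegral_ge0 => x _; exact: sqr_ge0.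
Qed.

(** A synthesises and supplies the vanishing moments of the output, B analyses, and [kap] is the
    approximate identity h(X) at scale 2^e, whose consecutive differences are the products A B. The
    range 1/4 of A keeps A (1_Q g) inside the half neighbourhood of Q, hence inside its double; the
    ranges 1/2 and 1 enter in [interact] and in the supports of the telescoped terms. The Taylor
    bounds concern the second variable, where the moments of the argument act. *)
Record kpack (s : nat) (C : R) (A B kap : int -> X -> X -> R) : Prop := {
  kp_C0 : 0 < C;
  kp_A_s : forall e, skern (A e);
  kp_B_s : forall e, skern (B e);
  kp_k_s : forall e, skern (kap e);
  kp_A_supp : forall e x y, (exists i, 4^-1 * 2 ^ e < `|tnth x i - tnth y i|) -> A e x y = 0;
  kp_B_supp : forall e x y, (exists i, 2^-1 * 2 ^ e < `|tnth x i - tnth y i|) -> B e x y = 0;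
  kp_k_supp : forall e x y, (exists i, 2 ^ e < `|tnth x i - tnth y i|) -> kap e x y = 0;
  kp_A_m : forall e y (al : n.-tuple nat), (mabs al <= s)%N ->
    \int[mu]_x (A e x y * mono al x) = 0;
  kp_k_m : forall e y (al : n.-tuple nat), (mabs al <= s)%N ->
    \int[mu]_x (kap e x y * mono al x) = mono al y;
  kp_A_E1 : forall es, uniq es -> famE1 A es C;
  kp_B_E1 : forall es, uniq es -> famE1 (fun e x y => B e y x) es C;
  kp_B_T : forall e, ktaylor s C (2 ^ (- e)) (B e);
  kp_k_T : forall e, ktaylor s C (2 ^ (- e)) (kap e);
  kp_k_1 : forall e x, \int[mu]_y kap e x y = 1;
  kp_k_size : forall e x y, `|kap e x y| <= C * (2 ^ (- e)) ^+ n;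
  kp_comp : forall e x z, \int[mu]_y (A e x y * B e y z) = kap e x z - kap (e + 1) x z }.

Lemma ktaylor_le s D D' c (K : X -> X -> R) : 0 < c -> D <= D' -> ktaylor s D c K -> ktaylor s D' c K.
Proof.
move=> c0 DD h l y0 l0 cl; have [co [mc hc]] := h l y0 l0 cl; exists co; split => // x y hy.
apply: le_trans (hc x y hy) _; rewrite -!mulrA; apply: ler_wpM2r => //.
by apply: mulr_ge0; apply: exprn_ge0; [|apply: mulr_ge0 => //]; exact: ltW.
Qed.

Section Quadruple.
Variables (s : nat) (u : R -> R).
Hypotheses (tu : tst 8^-1 u) (mu_ : mr s u).

(** Halving the argument doubles the support: with u of radius 1/8, v has radius 1/4 and v convolved
    with itself radius 1/2. This is what makes the radii 1/4 and 1/2 of [tst_wA] and [tst_wB]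
    correct. *)
Let v := dil 2^-1 u.
Definition cA (t : 'I_2) : R := nth 0 [:: 1; -1] t.
Definition wA (t : 'I_2) := nth u [:: u; v] t.
Definition cB (t : 'I_5) : R := nth 0 [:: 3; 3; -2; -2; -2] t.
Definition wB (t : 'I_5) := nth u [:: u; v; cnv u u; cnv u v; cnv v v] t.
Definition ck (t : 'I_2) : R := nth 0 [:: 3; -2] t.
Definition wk (t : 'I_2) := nth u [:: cnv u u; cnv u (cnv u u)] t.

Let h2 : (0 : R) < 2^-1. Proof. by rewrite invr_gt0. Qed.
Let tv : tst 4^-1 v.
Proof. by have := tst_dil h2 tu; rewrite (_ : 8^-1 / 2^-1 = 4^-1 :> R)//; field. Qed.
Let mv : mr s v. Proof. exact: mr_dil h2 tu mu_. Qed.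
Let tuu := tst_conv tu tu.
Let tuv := tst_conv tu tv.
Let tvv := tst_conv tv tv.
Let tuuu := tst_conv tu tuu.
Let muu := mr_conv tu tu mu_ mu_.

Lemma tst_wA t : tst (4^-1) (wA t).
Proof. by case: t => [[|[|//]] i] /=; [apply: tst_weaken tu; lra|]. Qed.

Lemma tst_wB t : tst (2^-1) (wB t).
Proof.
case: t => [[|[|[|[|[|//]]]]] i] /=.
- by apply: tst_weaken tu; lra.
- by apply: tst_weaken tv; lra.
- by apply: tst_weaken tuu; lra.
- by apply: tst_weaken tuv; lra.
- by apply: tst_weaken tvv; lra.
Qed.

Lemma tst_wk t : tst 1 (wk t).
Proof.
case: t => [[|[|//]] i] /=; first by apply: tst_weaken tuu; lra.
by apply: tst_weaken tuuu; lra.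
Qed.

Lemma mr_wA t : mr s (wA t). Proof. by case: t => [[|[|//]] i]. Qed.

Lemma mr_wB t : mr s (wB t).
Proof.
case: t => [[|[|[|[|[|//]]]]] i] //=; first exact: (mr_conv tu tv mu_ mv).
exact: (mr_conv tv tv mv mv).
Qed.

Lemma mr_wk t : mr s (wk t).
Proof. by case: t => [[|[|//]] i] //=; exact: (mr_conv tu tuu mu_ muu). Qed.

Lemma sum_cA : \sum_t cA t = 0. Proof. by rewrite !big_ord_recl big_ord0 /cA /=; ring. Qed.
Lemma sum_cB : \sum_t cB t = 0. Proof. by rewrite !big_ord_recl big_ord0 /cB /=; ring. Qed.
Lemma sum_ck : \sum_t ck t = 1. Proof. by rewrite !big_ord_recl big_ord0 /ck /=; ring. Qed.

Lemma sum_AB (t : nat -> nat -> R) :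
  \sum_(i < 2) \sum_(j < 5) cA i * cB j * t i j =
  3 * t 0%N 0%N + 3 * t 0%N 1%N - 2 * t 0%N 2%N - 2 * t 0%N 3%N - 2 * t 0%N 4%N -
  (3 * t 1%N 0%N + 3 * t 1%N 1%N - 2 * t 1%N 2%N - 2 * t 1%N 3%N - 2 * t 1%N 4%N).
Proof. by rewrite !big_ord_recl !big_ord0 /cA /cB /=; ring. Qed.

Lemma sum_k (t : nat -> R) : \sum_(i < 2) ck i * t i = 3 * t 0%N - 2 * t 1%N.
Proof. by rewrite !big_ord_recl big_ord0 /ck /=; ring. Qed.

(* With X, Y the convolutions by u and v and h(x) = 3x^2 - 2x^3, this is the factorisation
   h(X) - h(Y) = (X - Y)(3(X + Y) - 2(X^2 + XY + Y^2)). *)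
Lemma sum_ABk (T : (R -> R) -> R) : \sum_t \sum_t' cA t * cB t' * T (cnv (wA t) (wB t')) =
  \sum_t ck t * T (wk t) - \sum_t ck t * T (dil 2^-1 (wk t)).
Proof.
have e1 : cnv v u = cnv u v by rewrite (cnvC tv tu).
have e2 : cnv v (cnv u u) = cnv u (cnv u v).
  by rewrite (cnvA tv tu tu) e1 -(cnvA tu tv tu) e1.
have e3 : cnv v (cnv u v) = cnv u (cnv v v) by rewrite (cnvA tv tu tv) e1 -(cnvA tu tv tv).
have evv : dil 2^-1 (cnv u u) = cnv v v by rewrite /v (conv_dil h2 tu tu).
have evvv : dil 2^-1 (cnv u (cnv u u)) = cnv v (cnv v v).
  by rewrite /v -(conv_dil h2 tu tuu) (conv_dil h2 tu tu).
rewrite (sum_AB (fun i j => T (cnv (nth u [:: u; v] i) (nth u [:: u; v; cnv u u; cnv u v; cnv v v] j)))).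
rewrite (sum_k (fun i => T (nth u [:: cnv u u; cnv u (cnv u u)] i))).
rewrite (sum_k (fun i => T (dil 2^-1 (nth u [:: cnv u u; cnv u (cnv u u)] i)))) /nth.
rewrite e1 e2 e3 evv evvv.
have id7 (a b c d e f g : R) : 3 * a + 3 * b - 2 * d - 2 * e - 2 * f - (3 * b + 3 * c - 2 * e - 2 * f - 2 * g) =
    3 * a - 2 * d - (3 * c - 2 * g) by ring.
exact: (id7 (T (cnv u u)) (T (cnv u v)) (T (cnv v v)) (T (cnv u (cnv u u))) (T (cnv u (cnv u v)))
  (T (cnv u (cnv v v))) (T (cnv v (cnv v v)))).
Qed.

Lemma Ksp_telescope (c : R) (x z : X) : 0 < c ->
  \int[mu]_y (Ksp cA wA c x y * Ksp cB wB c y z) = Ksp ck wk c x z - Ksp ck wk (c * 2^-1) x z.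
Proof.
move=> c0; rewrite (Ksp_comp cA cB tst_wA tst_wB x z c0).
rewrite (sum_ABk (fun w => \prod_i dil c w (tnth x i - tnth z i))); congr (_ - _).
apply: eq_bigr => t _; congr (_ * _); apply: eq_bigr => i _.
by rewrite /dil /= mulrA; congr (_ * wk t _); rewrite mulrA [2^-1 * c]mulrC.
Qed.

End Quadruple.

Lemma exists_kpack s : exists (C : R) (A B kap : int -> X -> X -> R), kpack s C A B kap.
Proof.
have [u tu mu_] := exists_mr_bump (rho := 8^-1 : R) s (ltac:(by rewrite invr_gt0)).
have h2 : (0 : R) < 2^-1 by rewrite invr_gt0.
have q4 : (0 : R) < 4^-1 by rewrite invr_gt0.
have p2 (e : int) : 0 < (2 : R) ^ e by rewrite exprz_gt0.
have tA := tst_wA tu; have tB := tst_wB tu; have tk := tst_wk tu.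
(* The almost orthogonality of B is needed for the transposed kernels, which are built from the
   reflected profiles. *)
have tB' t : tst (2^-1) (fun x => wB u t (- x)) by exact: tst_opp (tB t).
have iB' t : \int[leb]_x wB u t (- x) = 1.
  by have [_ ->] := Rintegral_opp (tst_integrable (tB t)); exact: (mr_int (mr_wB tu mu_)).
have [C1 C10 h1] := Ksp_E1 n q4 tA (mr_int (mr_wA tu mu_)) sum_cA.
have [C2 C20 h2'] := Ksp_E1 n h2 tB' iB' sum_cB.
have [C3 C30 h3] := Ksp_taylor n cB tB s.
have [C4 C40 h4] := Ksp_taylor n ck tk s.
have [C5 C50 h5] := Ksp_size n ck tk.
have [C [C0 c1 c2 [c3 c4 c5]]] : exists C, [/\ 0 < C, C1 <= C, C2 <= C & [/\ C3 <= C, C4 <= C & C5 <= C]].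
  by exists (C1 + C2 + C3 + C4 + C5); clear -C10 C20 C30 C40 C50; split; [lra|lra|lra|split; lra].
exists C, (fun e => Ksp cA (wA u) (2 ^ (- e))), (fun e => Ksp cB (wB u) (2 ^ (- e))),
  (fun e => Ksp ck (wk u) (2 ^ (- e))).
have supp N (cf : 'I_N -> R) w r e x y : (forall t, tst r (w t)) ->
    (exists i, r * 2 ^ e < `|tnth x i - tnth y i|) -> Ksp (n := n) cf w (2 ^ (- e)) x y = 0.
  move=> tw [i hi]; apply: (Ksp_supp cf tw); first exact: p2.
  by exists i; rewrite -invr_expz invrK.
split.
- exact: C0.
- by move=> e; exact: (skern_Ksp cA q4 (p2 _) tA).
- by move=> e; exact: (skern_Ksp cB h2 (p2 _) tB).
- by move=> e; exact: (skern_Ksp ck ltr01 (p2 _) tk).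
- by move=> e x y; exact: supp tA.
- by move=> e x y; exact: supp tB.
- by move=> e x y h; apply: (supp _ _ _ _ _ _ _ tk); rewrite mul1r.
- by move=> e y al hal; have [_ ->] := Ksp_moment cA tA (mr_wA tu mu_) y (p2 (- e)) hal; rewrite sum_cA mul0r.
- by move=> e y al hal; have [_ ->] := Ksp_moment ck tk (mr_wk tu mu_) y (p2 (- e)) hal; rewrite sum_ck mul1r.
- by move=> es ues; exact: famE1_le c1 (h1 es ues).
- move=> es ues; rewrite (_ : (fun e x y => _) = (fun e => Ksp cB (fun t x => wB u t (- x)) (2 ^ (- e)))).
    exact: famE1_le c2 (h2' es ues).
  apply/funext => e; apply/funext => x; apply/funext => y.
  apply: eq_bigr => t _; congr (_ * _); apply: eq_bigr => i _.
  by rewrite /dil -mulrN opprB.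
- by move=> e; exact: (ktaylor_le (p2 _) c3 (h3 _ (p2 _))).
- by move=> e; exact: (ktaylor_le (p2 _) c4 (h4 _ (p2 _))).
(* The integral is over the second variable, so it is again that of the reflected profiles. *)
- move=> e x; have tk' t : tst 1 (fun x => wk u t (- x)) by exact: tst_opp (tk t).
  have ik' t : \int[leb]_x wk u t (- x) = 1.
    by have [_ ->] := Rintegral_opp (tst_integrable (tk t)); exact: (mr_int (mr_wk tu mu_)).
  transitivity (\sum_t ck t); last exact: sum_ck.
  rewrite -(Rint_Ksp ck tk' ik' x (p2 (- e))); apply: Rint_eq => y.
  by apply: eq_bigr => t _; congr (_ * _); apply: eq_bigr => i _; rewrite /dil -mulrN opprB.
- move=> e x y; apply: le_trans (h5 _ x y (p2 (- e))) _; apply: ler_wpM2r; last exact: c5.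
  by apply: exprn_ge0; exact: ltW (p2 _).
- move=> e x z; rewrite (Ksp_telescope tu x z (p2 (- e))) opprD expfzDr//.
Qed.

End KernelPackage.

(** * Dyadic cubes and coverings *)

Section FiniteUnions.
Context (I : eqType) (T : Type).
Implicit Types (s : seq I) (F : I -> set T).

Definition bU s F : set T := [set x | exists2 i, i \in s & F i x].

Lemma bU_nil F : bU [::] F = set0.
Proof. by apply/seteqP; split => x; [case|]. Qed.

Lemma bU_cons i s F : bU (i :: s) F = F i `|` bU s F.
Proof.
apply/seteqP; split => x.
  by move=> [j]; rewrite inE => /orP[/eqP ->|js] Fx; [left|right; exists j].
by move=> [Fx|[j js Fx]]; [exists i => //; rewrite inE eqxx|exists j => //; rewrite inE js orbT].
Qed.

Lemma bU_sub s F (A : set T) : (forall i, i \in s -> F i `<=` A) -> bU s F `<=` A.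
Proof. by move=> h x [i si]; exact: h. Qed.

End FiniteUnions.

Section FiniteUnionsMeasure.
Context d (T : measurableType d) (R : realType) (mu : {measure set T -> \bar R}) (I : eqType).
Implicit Types (s : seq I) (F : I -> set T).
Local Open Scope ereal_scope.

Lemma measurable_bU s F : (forall i, measurable (F i)) -> measurable (bU s F).
Proof.
move=> mF; elim: s => [|i s IH]; first by rewrite bU_nil.
by rewrite bU_cons; exact: measurableU.
Qed.

Lemma mu_bU_le s F : (forall i, measurable (F i)) -> mu (bU s F) <= \sum_(i <- s) mu (F i).
Proof.
move=> mF; elim: s => [|i s IH]; first by rewrite bU_nil big_nil measure0.
rewrite bU_cons big_cons; apply: le_trans (measureU2 _ _ _) _ => //.
  exact: measurable_bU.
by rewrite leeD2l.
Qed.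

Lemma mu_bU_disj s F : (forall i, measurable (F i)) -> uniq s ->
  (forall i j, i \in s -> j \in s -> i != j -> F i `&` F j = set0) ->
  mu (bU s F) = \sum_(i <- s) mu (F i).
Proof.
move=> mF; elim: s => [|i s IH]; first by rewrite bU_nil big_nil measure0.
move=> /= /andP[is_ us] dj; rewrite bU_cons big_cons measureU//; last 2 first.
- exact: measurable_bU.
- apply/seteqP; split => // x [Fi [j js Fj]].
  rewrite -(dj i j) ?inE ?eqxx ?js ?orbT//.
  by apply: contra is_ => /eqP ->.
by congr (_ + _); apply: IH => // j k js ks; apply: dj; rewrite inE ?js ?ks orbT.
Qed.

Lemma sum_measure_le_mult s F (E : set T) (k : nat) : (forall i, measurable (F i)) -> measurable E ->
  (forall i, i \in s -> F i `<=` E) ->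
  (forall x, (count (fun i => `[< F i x >]) s <= k)%N) ->
  \sum_(i <- s) mu (F i) <= k%:R%:E * mu E.
Proof.
move=> mF mE FE ct.
have -> : \sum_(i <- s) mu (F i) = \sum_(i <- s) \int[mu]_x (\1_(F i) x)%:E.
  by apply: eq_bigr => i _; rewrite integral_indic// setIT.
rewrite -ge0_integral_sum//; last by move=> i; exact/measurable_EFinP.
apply: (@le_trans _ _ (\int[mu]_x (k%:R%:E * (\1_E x)%:E))).
  apply: ge0_le_integral => //.
  - by move=> x _; apply: sume_ge0 => i _; rewrite lee_fin.
  - by apply: emeasurable_sum => i; exact/measurable_EFinP.
  - by apply: measurable_funeM; exact/measurable_EFinP.
  move=> x _; rewrite sumEFin -EFinM lee_fin.
  have -> : (\sum_(i <- s) \1_(F i) x = (count (fun i => `[< F i x >]) s)%:R :> R)%R.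
    elim: (s) => [|i s' IH]; first by rewrite big_nil.
    by rewrite big_cons IH /= natrD indicE.
  have [xE|xE] := pselect (E x); first by rewrite indicE mem_set// mulr1 ler_nat.
  rewrite (_ : count _ _ = 0%N) ?mulr_ge0//; apply/eqP; rewrite -leqn0 leqNgt -has_count.
  by apply/hasPn => i si; apply/asboolPn => Fx; apply: xE; exact: FE Fx.
by rewrite ge0_integralZl_EFin ?integral_indic ?setIT//; exact/measurable_EFinP.
Qed.

End FiniteUnionsMeasure.

Section Dyadic.
Variables (R : realType) (n : nat).
Local Notation X := (n.-tuple R).
Local Notation mu := (@lebn R n).
Local Notation ds Q := (dside R Q).
Implicit Types (Q : dcube n).

Definition lo Q i : R := (tnth Q.2 i)%:~R * ds Q.

Lemma ds_gt0 k (Q : dcube k) : 0 < ds Q.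
Proof. by rewrite exprz_gt0. Qed.

Lemma cube_setP Q (x : X) : cube_set Q x <-> forall i, lo Q i <= tnth x i < lo Q i + ds Q.
Proof.
rewrite /cube_set /lo; split => h i; have := h i; rewrite mulrDl mul1r.
  by move=> [-> ->].
by move=> /andP[].
Qed.

Definition corner Q : X := [tuple lo Q i | i < n].

Lemma corner_in Q : cube_set Q (corner Q).
Proof.
by apply/cube_setP => i; rewrite tnth_mktuple lexx ltrDl ds_gt0.
Qed.

Lemma measurable_cube Q : measurable (cube_set Q : set X).
Proof.
rewrite (_ : cube_set Q = [set x : X | forall i, lo Q i <= tnth x i < lo Q i + ds Q]).
  exact: measurable_hbox.
by apply/seteqP; split => x /cube_setP.
Qed.

Lemma lebn_cube Q : mu (cube_set Q) = (ds Q ^+ n)%:E.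
Proof.
rewrite (_ : cube_set Q = [set x : X | forall i, lo Q i <= tnth x i < lo Q i + ds Q]).
  rewrite lebn_hbox; last by move=> i; rewrite lerDl ltW// ds_gt0.
  rewrite (eq_bigr (fun=> ds Q)); last by move=> i _; rewrite addrAC subrr add0r.
  by rewrite prodr_const card_ord.
by apply/seteqP; split => x /cube_setP.
Qed.

(* The k-th dyadic ancestor: exponents of dyadic cubes grow with the side length. *)
Definition up (k : nat) Q : dcube n := (Q.1 + k%:Z, [tuple (tnth Q.2 i %/ 2 ^+ k)%Z | i < n]).

Lemma ds_up k Q : ds (up k Q) = ds Q * 2 ^+ k.
Proof. by rewrite /dside /= expfzDr. Qed.

Lemma lo_up k Q i : lo (up k Q) i <= lo Q i /\ lo Q i + ds Q <= lo (up k Q) i + ds (up k Q).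
Proof.
rewrite /lo ds_up /= tnth_mktuple; set j := tnth Q.2 i.
have p2 : (0 < 2 ^+ k :> int)%R by rewrite exprn_gt0.
have E := divz_eq j (2 ^+ k); have h1 := modz_ge0 j (lt0r_neq0 p2); have h2 := ltz_pmod j p2.
set q := (j %/ _)%Z in E *; set r := (j %% _)%Z in E h1 h2.
have Er : j%:~R = q%:~R * 2 ^+ k + r%:~R :> R by rewrite E intrD intrM rmorphXn.
have r1 : 0 <= r%:~R :> R by rewrite ler0z.
have r2 : r%:~R + 1 <= 2 ^+ k :> R.
  have -> : 2 ^+ k = (2 ^+ k : int)%:~R :> R by rewrite rmorphXn.
  by rewrite -[1]/(1%:~R) -intrD ler_int; move: h2; lia.
rewrite Er; have d0 := ds_gt0 Q; split.
  rewrite mulrDl [ds Q * _]mulrC mulrA lerDl mulr_ge0// ltW//.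
rewrite (_ : _ + ds Q = (q%:~R * 2 ^+ k + (r%:~R + 1)) * ds Q); last by ring.
rewrite (_ : _ + ds Q * _ = (q%:~R * 2 ^+ k + 2 ^+ k) * ds Q); last by ring.
by rewrite ler_pM2r// lerD2l.
Qed.

Lemma cube_sub_up k Q : cube_set Q `<=` (cube_set (up k Q) : set X).
Proof.
move=> x /cube_setP h; apply/cube_setP => i; have [h1 h2] := lo_up k Q i.
by have /andP[h3 h4] := h i; rewrite (le_trans h1 h3) (lt_le_trans h4 h2).
Qed.

Definition cube_at (e : int) (x : X) : dcube n := (e, [tuple Num.floor (tnth x i / 2 ^ e) | i < n]).

Lemma cube_at_in e x : cube_set (cube_at e x) x.
Proof.
have d0 : (0 : R) < 2 ^ e by rewrite exprz_gt0.
apply/cube_setP => i; rewrite /lo /dside /= tnth_mktuple.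
have := floor_itv (tnth x i / 2 ^ e); rewrite ler_pdivlMr// ltr_pdivrMr// intrD mulrDl mul1r.
exact.
Qed.

Lemma cube_uniq Q Q' (x : X) : Q.1 = Q'.1 -> cube_set Q x -> cube_set Q' x -> Q = Q'.
Proof.
case: Q Q' => [e j] [e' j'] /= <- /cube_setP h /cube_setP h'; congr (_, _).
have d0 : (0 : R) < 2 ^ e by rewrite exprz_gt0.
apply: eq_from_tnth => i.
have F k : k%:~R * 2 ^ e <= tnth x i < k%:~R * 2 ^ e + 2 ^ e -> k = Num.floor (tnth x i / 2 ^ e).
  by move=> hk; symmetry; apply: floor_def; rewrite ler_pdivlMr// ltr_pdivrMr// intrD mulrDl mul1r.
by rewrite (F _ (h i)) (F _ (h' i)).
Qed.

(** A decidable form of inclusion on codes. It implies inclusion of the cubes ([below_sub]) and is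
    implied by it in positive dimension ([sub_below]). *)
Definition below Q Q' := (Q.1 <= Q'.1)%R && (up `|(Q'.1 - Q.1)%R|%N Q == Q').

Lemma belowP Q Q' : below Q Q' <-> exists k, Q' = up k Q.
Proof.
split; first by move=> /andP[_ /eqP <-]; eexists.
move=> [k ->]; rewrite /below /= lerDl /=.
by rewrite (_ : `|(Q.1 + k%:Z - Q.1)%R|%N = k) ?eqxx//; lia.
Qed.

Lemma below_sub Q Q' : below Q Q' -> cube_set Q `<=` (cube_set Q' : set X).
Proof. by move=> /belowP[k ->]; exact: cube_sub_up. Qed.

Lemma meet_below Q Q' (x : X) : (Q.1 <= Q'.1)%R -> cube_set Q x -> cube_set Q' x -> below Q Q'.
Proof.
move=> ee hx hx'; rewrite /below ee /=; apply/eqP; apply: cube_uniq (cube_sub_up _ hx) hx' => /=.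
by move: ee; lia.
Qed.

Lemma below_exp Q Q' : below Q Q' -> (Q.1 <= Q'.1)%R.
Proof. by case/andP. Qed.

Lemma below_refl Q : below Q Q.
Proof. by apply: (meet_below (lexx _) (corner_in Q)); exact: corner_in. Qed.

Lemma below_trans Q1 Q2 Q3 : below Q1 Q2 -> below Q2 Q3 -> below Q1 Q3.
Proof.
move=> h1 h2; apply: (meet_below _ (corner_in Q1)); last exact: (below_sub h2 (below_sub h1 (corner_in Q1))).
exact: le_trans (below_exp h1) (below_exp h2).
Qed.

Lemma below_up k Q : below Q (up k Q).
Proof. by apply/belowP; exists k. Qed.

Lemma below_eq Q Q' : below Q Q' -> Q.1 = Q'.1 -> Q = Q'.
Proof. by move=> h e; apply: (cube_uniq e (corner_in Q)); exact: (below_sub h (corner_in Q)). Qed.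

Lemma up_up j k Q : up j (up k Q) = up (k + j) Q.
Proof.
apply: (@cube_uniq _ _ (corner Q)) => /=; first by rewrite PoszD addrA.
  by do 2 apply: cube_sub_up; exact: corner_in.
by apply: cube_sub_up; exact: corner_in.
Qed.

Lemma up0 Q : up 0 Q = Q.
Proof.
apply: (@cube_uniq _ _ (corner Q)) => /=; first by rewrite addr0.
  by apply: cube_sub_up; exact: corner_in.
exact: corner_in.
Qed.

Lemma below_ds Q Q' : below Q Q' -> ds Q <= ds Q'.
Proof. by move=> /below_exp h; rewrite ler_weXz2l// ler1n. Qed.

Lemma below_lo Q Q' i : below Q Q' -> lo Q' i <= lo Q i /\ lo Q i + ds Q <= lo Q' i + ds Q'.
Proof. by move=> /belowP[k ->]; exact: lo_up. Qed.

Lemma sub_below Q Q' : (0 < n)%N -> cube_set Q `<=` (cube_set Q' : set X) -> below Q Q'.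
Proof.
move=> n0 h; have c := corner_in Q; have c' := h _ c.
have [ee|ee] := leP Q.1 Q'.1; first exact: meet_below c c'.
(* If Q were the larger cube the two sets would coincide, although their measures differ; this is
   where n > 0 is used. *)
have b := meet_below (ltW ee) c' c.
have E : cube_set Q = (cube_set Q' : set X) by apply/seteqP; split => //; exact: below_sub.
have : mu (cube_set Q) = mu (cube_set Q') by rewrite E.
rewrite !lebn_cube => -[] /eqP; rewrite eqrXn2 ?(ltW (ds_gt0 _))// => /eqP dd.
have : ds Q' < ds Q by rewrite ltr_eXz2l// ltr1n.
by rewrite dd ltxx.
Qed.

(** An open cube with the same centre and side 1 + 2 a times that of Q; open, because unions of such
    sets become the open sets of new atoms. *)
Definition nb (a : R) Q : set X := [set x | forall i, lo Q i - a * ds Q < tnth x i < lo Q i + ds Q + a * ds Q].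

Lemma measurable_nb a Q : measurable (nb a Q).
Proof.
rewrite (_ : nb a Q = \bigcap_(i in [set: 'I_n]) ((fun x => tnth x i) @^-1` `]lo Q i - a * ds Q, lo Q i + ds Q + a * ds Q[%classic)).
  apply: fin_bigcap_measurable => // i _; rewrite -[Z in measurable Z]setTI.
  by apply: measurable_tnth => //; exact: measurable_itv.
apply/seteqP; split => x /=; first by move=> hx i _ /=; rewrite in_itv /= hx.
by move=> hx i; have := hx i I; rewrite /= in_itv.
Qed.

Lemma lebn_nb a Q : 0 <= a -> (mu (nb a Q) <= (((1 + 2 * a) * ds Q) ^+ n)%:E)%E.
Proof.
move=> a0; have d0 := ds_gt0 Q.
apply: (@le_trans _ _ (mu [set x : X | forall i, lo Q i - a * ds Q <= tnth x i < lo Q i + ds Q + a * ds Q])).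
  apply: le_measure; rewrite ?inE; [exact: measurable_nb|exact: measurable_hbox|].
  by move=> x h i; have /andP[/ltW -> ->] := h i.
rewrite lebn_hbox; last first.
  move=> i; have : 0 <= a * ds Q by rewrite mulr_ge0// ltW.
  by lra.
rewrite (eq_bigr (fun=> (1 + 2 * a) * ds Q)); last by move=> i _; ring.
by rewrite prodr_const card_ord.
Qed.

Lemma sub_nb a Q : 0 < a -> cube_set Q `<=` nb a Q.
Proof.
move=> a0 x /cube_setP h i; have := h i; have : 0 < a * ds Q by rewrite mulr_gt0// ds_gt0.
by lra.
Qed.

Lemma below_nb a Q Q' : 0 <= a -> below Q Q' -> nb a Q `<=` nb a Q'.
Proof.
move=> a0 b x h i; have := h i; have [h1 h2] := below_lo i b.
have : a * ds Q <= a * ds Q' by rewrite ler_wpM2l// below_ds.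
by lra.
Qed.

Lemma dbl_cubeP Q (x : X) : dbl_cube_set Q x <->
  forall i, lo Q i - 2^-1 * ds Q <= tnth x i < lo Q i + ds Q + 2^-1 * ds Q.
Proof.
by rewrite /dbl_cube_set /lo; split => h i; have := h i; lra.
Qed.

Lemma below_dbl Q Q' : below Q Q' -> dbl_cube_set Q `<=` (dbl_cube_set Q' : set X).
Proof.
move=> b x /dbl_cubeP h; apply/dbl_cubeP => i; have := h i; have [h1 h2] := below_lo i b.
have := below_ds b; lra.
Qed.

Lemma exists_maximal (s : seq (dcube n)) Q : Q \in s -> exists2 Q', Q' \in s &
  below Q Q' /\ forall Q'', Q'' \in s -> below Q' Q'' -> Q'' = Q'.
Proof.
move=> sQ; pose t := [seq Q' <- s | below Q Q'].
have tQ : Q \in t by rewrite mem_filter below_refl sQ.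
have [Q' tQ' mx] : exists2 Q', Q' \in t & forall Q'', Q'' \in t -> (Q''.1 <= Q'.1)%R.
  move: t tQ => t; elim: t Q {sQ} => // Q1 u IH Q _; case: u IH => [_|Q2 u IH].
    by exists Q1; [rewrite mem_head|move=> Q'' /[1!inE] /eqP ->].
  have [Q' uQ' mx] := IH Q2 (mem_head _ _).
  have [h|h] := leP Q1.1 Q'.1.
    exists Q'; first by rewrite inE uQ' orbT.
    by move=> Q'' /[1!inE] /orP[/eqP ->//|]; exact: mx.
  exists Q1; first exact: mem_head.
  by move=> Q'' /[1!inE] /orP[/eqP ->//|/mx h']; exact: le_trans h' (ltW h).
move: tQ'; rewrite mem_filter => /andP[b s']; exists Q' => //; split => // Q'' s'' b'.
have b'' := below_trans b b'; have /mx h : Q'' \in t by rewrite mem_filter b'' s''.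
by symmetry; apply: (below_eq b'); apply/eqP; rewrite eq_le h (below_exp b').
Qed.

(** The maximal cubes of s are disjoint, each contains a fixed proportion of E, and their
    neighbourhoods contain those of all the others. The 7 is 1 + 2 * 3. *)
Lemma cover_nb (s : seq (dcube n)) (E : set X) (c : R) : 0 < c -> measurable E ->
  (forall Q, Q \in s -> ((c * ds Q ^+ n)%:E <= mu (cube_set Q `&` E))%E) ->
  (mu (bU s (nb 3)) <= (7 ^+ n / c)%:E * mu E)%E.
Proof.
move=> c0 mE hs.
pose mx := undup [seq Q <- s | all (fun Q' => below Q Q' ==> (Q' == Q)) s].
have mxP Q : Q \in s -> exists2 Q', Q' \in mx & below Q Q'.
  move=> /exists_maximal[Q' s' [b h]]; exists Q' => //; rewrite mem_undup mem_filter s' andbT.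
  by apply/allP => Q'' s''; apply/implyP => b'; apply/eqP; exact: h.
have dj Q Q' : Q \in mx -> Q' \in mx -> Q != Q' ->
    (cube_set Q `&` E) `&` (cube_set Q' `&` E) = set0.
  rewrite !mem_undup !mem_filter => /andP[/allP a sQ] /andP[/allP a' sQ'] QQ.
  apply/seteqP; split => // x [[hx _] [hx' _]].
  have [ee|/ltW ee] := leP Q.1 Q'.1.
    have b := meet_below ee hx hx'; have := a _ sQ'; rewrite b /= => /eqP e.
    by rewrite e eqxx in QQ.
  have b := meet_below ee hx' hx; have := a' _ sQ; rewrite b /= => /eqP e.
  by rewrite e eqxx in QQ.
have mCE Q : measurable (cube_set Q `&` E) by apply: measurableI => //; exact: measurable_cube.
apply: (@le_trans _ _ (mu (bU mx (nb 3)))).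
  apply: le_measure; rewrite ?inE; do 1? [by apply: measurable_bU => Q; exact: measurable_nb].
  move=> x [Q /mxP[Q' m' b] h]; exists Q' => //; exact: below_nb b _ h.
apply: le_trans (mu_bU_le _ _ _) _; first by move=> Q; exact: measurable_nb.
apply: (@le_trans _ _ (\sum_(Q <- mx) (7 ^+ n / c)%:E * mu (cube_set Q `&` E))%E).
  rewrite big_seq [leRHS]big_seq; apply: lee_sum => Q.
  rewrite mem_undup mem_filter => /andP[_ /hs h].
  apply: (@le_trans _ _ ((7 ^+ n / c)%:E * (c * ds Q ^+ n)%:E)%E).
    apply: le_trans (lebn_nb _ _) _ => //; rewrite -EFinM lee_fin.
    rewrite (_ : 1 + 2 * 3 = 7); last by ring.
    by rewrite exprMn mulrA divfK ?gt_eqF.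
  by rewrite lee_pmul// ?lee_fin ?mulr_ge0 ?exprn_ge0 ?invr_ge0 ?(ltW c0) ?(ltW (ds_gt0 _)).
rewrite -ge0_sume_distrr; last by move=> Q _.
rewrite lee_pmul ?lee_fin ?mulr_ge0 ?exprn_ge0 ?invr_ge0 ?(ltW c0)//.
  exact: sume_ge0.
rewrite -(mu_bU_disj mu (F := fun Q => cube_set Q `&` E))//; last exact: undup_uniq.
apply: le_measure; rewrite ?inE//; first exact: measurable_bU.
by apply: bU_sub => Q _ x [].
Qed.

End Dyadic.

Lemma absz_sub_inj (a b c : int) : (c <= a)%R -> (c <= b)%R ->
  `|(a - c)%R|%N = `|(b - c)%R|%N -> a = b.
Proof. by lia. Qed.

Lemma absz_sub_le (a c : int) (l : nat) : (c <= a)%R -> (l <= `|(a - c)%R|)%N -> (c + l%:Z <= a)%R.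
Proof. by lia. Qed.

Section ErealArithmetic.
Variable R : realType.
Local Open Scope ereal_scope.

Lemma ereal_quarter (a b : R) (v : \bar R) : (0 < a)%R -> 0 <= v ->
  (2^-1 * (a * b))%:E <= a%:E * v + (4^-1 * a)%:E * b%:E -> (4^-1 * b)%:E <= v.
Proof.
move=> a0; case: v => [v||]// v0; last by rewrite leey.
rewrite -!EFinM -EFinD !lee_fin => h; rewrite -(ler_pM2l a0).
by move: h; lra.
Qed.

Lemma ereal_half (a b c : \bar R) (D : R) : (0 < D)%R -> a < +oo -> b < +oo -> c < +oo ->
  0 <= a -> 0 <= b -> 0 <= c -> a = b + c -> c * D%:E <= (2^-1)%:E * (a * D%:E) -> a <= 2%:E * b.
Proof.
move=> D0; case: a => [a||]// _; case: b => [b||]// _; case: c => [c||]// _ a0 b0 c0.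
rewrite -EFinD => -[e]; rewrite -!EFinM !lee_fin mulrA ler_pM2r// => h.
by move: e h; lra.
Qed.

End ErealArithmetic.

(** * A covering estimate for rectangles by slices *)

Section ProductSections.
Variables (R : realType) (n m : nat).
Local Notation X := (n.-tuple R).
Local Notation Y := (m.-tuple R).
Local Notation mu := (@lebn R n).
Local Notation nu := (@lebn R m).
Local Notation P := (@leb2 R n m).
Local Notation ds Q := (dside R Q).
Local Open Scope ereal_scope.

Lemma leb2_X (A : set X) (B : set Y) : measurable A -> measurable B -> P (A `*` B) = mu A * nu B.
Proof. by move=> mA mB; rewrite -(product_measure1E mu nu mA mB). Qed.

Lemma leb2_x (E : set (pt R n m)) : P E = \int[mu]_x nu (xsection E x).
Proof. by []. Qed.

Lemma leb2_y (E : set (pt R n m)) : measurable E -> P E = \int[nu]_y mu (ysection E y).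
Proof.
move=> mE.
exact: (product_measure_unique (m' := (mu \x^ nu)%E) (fun A B mA mB => product_measure2E mu nu mA mB) mE).
Qed.

Lemma measurable_rect (Q : drect n m) : measurable (rect_set Q : set (pt R n m)).
Proof. by apply: measurableX; exact: measurable_cube. Qed.

Definition rvol (Q : drect n m) : R := (ds Q.1 ^+ n * ds Q.2 ^+ m)%R.

Lemma rvol_gt0 Q : (0 < rvol Q)%R.
Proof. by rewrite mulr_gt0// exprn_gt0// ds_gt0. Qed.

Lemma leb2_rect (Q : drect n m) : P (rect_set Q) = (rvol Q)%:E.
Proof. by rewrite leb2_X ?lebn_cube//; exact: measurable_cube. Qed.

Definition nb2 (a : R) (Q : drect n m) : set (pt R n m) := nb a Q.1 `*` nb a Q.2.

Lemma measurable_nb2 a Q : measurable (nb2 a Q).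
Proof. by apply: measurableX; exact: measurable_nb. Qed.

Let qn : (0 < (4^-1 : R))%R. Proof. by rewrite invr_gt0. Qed.

(** A substitute for the strong maximal theorem, by two uses of [cover_nb]. A(K) collects the y
    whose slice of E fills at least a quarter of K. Since half of S is filled, 1/2 |S| <= |I| |J
    meet A(I)| + 1/4 |I| |J|, so A(I) fills at least a quarter of J. Covering in x for fixed y
    bounds the intermediate set E' by E, covering in y for fixed x bounds the union by E'. *)
Lemma strong_cover (s : seq (drect n m)) (E : set (pt R n m)) : measurable E ->
  (forall S, S \in s -> (2^-1 * rvol S)%:E <= P (rect_set S `&` E)) ->
  P (bU s (nb2 3)) <= (7 ^+ n / 4^-1 * (7 ^+ m / 4^-1))%:E * P E.
Proof.
move=> mE hs.
have mKE K : measurable (E `&` (cube_set K `*` setT) : set (pt R n m)).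
  by apply: measurableI => //; apply: measurableX => //; exact: measurable_cube.
pose A K := [set y : Y | (4^-1 * ds K ^+ n)%:E <= mu (ysection (E `&` (cube_set K `*` setT)) y)].
have mA K : measurable (A K).
  rewrite -[Z in measurable Z]setTI.
  exact: (emeasurable_fun_c_infty measurableT (measurable_fun_ysection mu (mKE K))).
have ysE K y : ysection (E `&` (cube_set K `*` setT)) y = cube_set K `&` ysection E y.
  apply/seteqP; split => x.
    by move=> /ysectionP[Ex [/= Kx _]]; split => //; exact/ysectionP.
  by move=> [Kx /ysectionP Ex]; apply/ysectionP.
pose F (S : drect n m) : set (pt R n m) := nb 3 S.1 `*` A S.1.
pose E' := bU s F.
have mF S : measurable (F S) by apply: measurableX => //; exact: measurable_nb.
have mE' : measurable E' by exact: measurable_bU.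
have PE' : P E' <= (7 ^+ n / 4^-1)%:E * P E.
  rewrite !leb2_y// -ge0_integralZl_EFin//; last exact: (measurable_fun_ysection mu mE).
  apply: ge0_le_integral => //.
  - exact: (measurable_fun_ysection mu mE').
  - by apply: measurable_funeM; exact: (measurable_fun_ysection mu mE).
  move=> y _.
  pose t := [seq K <- [seq q.1 | q <- s] | `[< A K y >]].
  apply: (@le_trans _ _ (mu (bU t (nb 3)))).
    apply: le_measure; rewrite ?inE; [exact: measurable_ysection|by apply: measurable_bU => K; exact: measurable_nb|].
    move=> x /ysectionP[S sS [/= Nx Ay]]; exists S.1 => //; rewrite mem_filter map_f// andbT.
    exact/asboolP.
  apply: cover_nb => //; first exact: measurable_ysection.
  by move=> K; rewrite mem_filter => /andP[/asboolP + _]; rewrite /A /= ysE.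
have JA S : S \in s -> (4^-1 * ds S.2 ^+ m)%:E <= nu (cube_set S.2 `&` A S.1).
  move=> sS; have := hs S sS; have mS := measurable_rect S.
  have mC := @measurable_cube R m S.2; have mJ : measurable (cube_set S.2 `&` A S.1) by exact: measurableI.
  have k0 : (0 < ds S.1 ^+ n)%R by rewrite exprn_gt0// ds_gt0.
  have j0 : (0 < ds S.2 ^+ m)%R by rewrite exprn_gt0// ds_gt0.
  have le1 : P (rect_set S `&` E) <= (ds S.1 ^+ n)%:E * nu (cube_set S.2 `&` A S.1) +
      (4^-1 * ds S.1 ^+ n)%:E * nu (cube_set S.2).
    rewrite leb2_y; last exact: measurableI.
    apply: (@le_trans _ _ (\int[nu]_y ((ds S.1 ^+ n)%:E * (\1_(cube_set S.2 `&` A S.1) y)%:E +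
       (4^-1 * ds S.1 ^+ n)%:E * (\1_(cube_set S.2) y)%:E))).
      have c1 : (0 <= 4^-1 * ds S.1 ^+ n)%R by rewrite mulr_ge0// ltW.
      apply: ge0_le_integral => //.
      - by apply: (measurable_fun_ysection mu); exact: measurableI.
      - by apply: emeasurable_funD; apply: measurable_funeM; exact/measurable_EFinP.
      move=> y _; have [Jy|Jy] := pselect (cube_set S.2 y); last first.
        rewrite (_ : ysection _ y = set0) ?measure0; first by rewrite adde_ge0// mule_ge0// lee_fin// ltW.
        by apply/seteqP; split => // x /ysectionP[[_ /= ]].
      have [Ay|/negP Ay] := pselect (A S.1 y).
        rewrite !indicE !mem_set// mule1.
        apply: (@le_trans _ _ (ds S.1 ^+ n)%:E); last by rewrite mule1 leeDl// lee_fin.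
        rewrite -lebn_cube; apply: le_measure; rewrite ?inE.
        + by apply: measurable_ysection; exact: measurableI.
        + exact: measurable_cube.
        + by move=> x /ysectionP[[/= ]].
      rewrite !indicE [in X in _ + X]mem_set// memNset; last by move=> [_ /= hA]; rewrite hA in Ay.
      rewrite mule0 add0e mule1; apply: ltW; move: Ay; rewrite -ltNge; apply: le_lt_trans.
      apply: le_measure; rewrite ?inE.
      + by apply: measurable_ysection; exact: measurableI.
      + exact: measurable_ysection.
      + by move=> x /ysectionP[[/= Kx _] Ex]; apply/ysectionP.
    rewrite ge0_integralD//.
    - rewrite ge0_integralZl_EFin//; [|exact/measurable_EFinP|exact: ltW].
      rewrite ge0_integralZl_EFin//; [|exact/measurable_EFinP|by rewrite mulr_ge0// ltW].
      by rewrite !integral_indic// !setIT.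
    - by move=> y _; rewrite mule_ge0// lee_fin// ltW.
    - by apply: measurable_funeM; exact/measurable_EFinP.
    - by move=> y _; rewrite mule_ge0// lee_fin// mulr_ge0// ltW.
    - by apply: measurable_funeM; exact/measurable_EFinP.
  move=> /le_trans /(_ le1); rewrite lebn_cube.
  exact: ereal_quarter.
apply: (@le_trans _ _ ((7 ^+ m / 4^-1)%:E * P E')); last first.
  set a := (7 ^+ n / 4^-1)%R in PE' *; set b := (7 ^+ m / 4^-1)%R.
  have b0 : (0 <= b)%R by rewrite mulr_ge0// exprn_ge0.
  by rewrite [(a * b)%R]mulrC [(b * a)%:E]EFinM -muleA; apply: lee_pmul.
have mU : measurable (bU s (nb2 3)) by apply: measurable_bU => S; exact: measurable_nb2.
rewrite !leb2_x -ge0_integralZl_EFin//; last exact: (measurable_fun_xsection nu mE').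
apply: ge0_le_integral => //.
- exact: (measurable_fun_xsection nu mU).
- by apply: measurable_funeM; exact: (measurable_fun_xsection nu mE').
move=> x _; pose t := [seq q.2 | q <- s & `[< nb 3 q.1 x >]].
apply: (@le_trans _ _ (nu (bU t (nb 3)))).
  apply: le_measure; rewrite ?inE; [exact: measurable_xsection|by apply: measurable_bU => K; exact: measurable_nb|].
  move=> y /xsectionP[S sS [/= Nx Ny]]; exists S.2 => //; apply: map_f; rewrite mem_filter sS andbT.
  exact/asboolP.
apply: cover_nb => //; first exact: measurable_xsection.
move=> J /mapP[S]; rewrite mem_filter => /andP[/asboolP Nx sS] ->.
apply: le_trans (JA S sS) _; apply: le_measure; rewrite ?inE.
- by apply: measurableI => //; exact: measurable_cube.
- by apply: measurableI; [exact: measurable_cube|exact: measurable_xsection].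
- by move=> y [Jy Ay]; split => //; apply/xsectionP; exists S.
Qed.

End ProductSections.

(** * Journe's covering lemma *)

Section Journe.
Context d d' (Z : measurableType d) (X : measurableType d') (R : realType) (k : nat) (I : eqType).
Local Notation Y := (k.-tuple R).
Variables (P : {measure set Z -> \bar R}) (mu : {measure set X -> \bar R}).
Local Notation nu := (@lebn R k).
Variables (p1 : Z -> X) (p2 : Z -> Y).
Hypotheses (mp1 : measurable_fun setT p1) (mp2 : measurable_fun setT p2).
Hypothesis Pprod : forall A B, measurable A -> measurable B ->
  P (p1 @^-1` A `&` p2 @^-1` B) = (mu A * nu B)%E.
Variable F : I -> set X.
Hypotheses (mF : forall i, measurable (F i)) (fF : forall i, (mu (F i) < +oo)%E).
Local Open Scope ereal_scope.

Let rec (A : set X) (B : set Y) := p1 @^-1` A `&` p2 @^-1` B.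

Let mrec A B : measurable A -> measurable B -> measurable (rec A B).
Proof.
by move=> mA mB; apply: measurableI; rewrite -[Q in measurable Q]setTI; [exact: mp1|exact: mp2].
Qed.

(** From F q.1 remove the part [Zs] covered by members whose second cube contains the l-th ancestor
    of q.2. That part times the ancestor lies in E, so the last hypothesis makes it at most half of
    F q.1; this is the factor 2. What remains overlaps at most l times inside E. The projections p1
    and p2 are abstract so that both coordinate directions are instances. *)
Lemma journe (s : seq (I * dcube k)) (E : set Z) (l : nat) : uniq s -> measurable E ->
  (forall q q', q \in s -> q' \in s -> q.2 = q'.2 -> q.1 != q'.1 -> F q.1 `&` F q'.1 = set0) ->
  (forall q, q \in s -> rec (F q.1) (cube_set q.2) `<=` E) ->
  (forall q, q \in s -> P (rec (F q.1) (cube_set (up l q.2)) `&` E) <=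
     (2^-1)%:E * (mu (F q.1) * nu (cube_set (up l q.2)))) ->
  \sum_(q <- s) mu (F q.1) * nu (cube_set q.2) <= (2 * l%:R)%:E * P E.
Proof.
move=> us mE dj subE small.
pose Zs (J : dcube k) := bU [seq q <- s | below (up l J) q.2] (fun q => F q.1).
have mZ J : measurable (Zs J) by exact: measurable_bU.
pose G (q : I * dcube k) := F q.1 `\` Zs q.2.
have mG q : measurable (G q) by exact: measurableD.
have mC (J : dcube k) : measurable (cube_set J : set Y) by exact: measurable_cube.
have half q : q \in s -> mu (F q.1) <= 2%:E * mu (G q).
  move=> sq.
  have h : mu (F q.1 `&` Zs q.2) * nu (cube_set (up l q.2)) <=
      (2^-1)%:E * (mu (F q.1) * nu (cube_set (up l q.2))).
    apply: le_trans (small q sq); rewrite -Pprod//; last exact: measurableI.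
    apply: le_measure; rewrite ?inE.
    - by apply: mrec => //; exact: measurableI.
    - by apply: measurableI => //; exact: mrec.
    move=> z [[Fz [q' ]]]; rewrite mem_filter => /andP[b sq'] Fz' Cz; split; first by split.
    apply: (subE q' sq'); split => //; exact: below_sub b _ Cz.
  have := measureDI mu (mF q.1) (mZ q.2); rewrite -/(G q).
  have fG : (mu (G q) < +oo)%E.
    apply: le_lt_trans (fF q.1); apply: le_measure; rewrite ?inE//.
    by move=> x [].
  have fI : (mu (F q.1 `&` Zs q.2) < +oo)%E.
    apply: le_lt_trans (fF q.1); apply: le_measure; rewrite ?inE//; first exact: measurableI.
  move: h; rewrite lebn_cube => h E1.
  have d0 : (0 < dside R (up l q.2) ^+ k)%R by rewrite exprn_gt0// ds_gt0.
  exact: (ereal_half d0 (fF q.1) fG fI _ _ _ E1 h).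
apply: (@le_trans _ _ (\sum_(q <- s) 2%:E * P (rec (G q) (cube_set q.2)))).
  rewrite big_seq [leRHS]big_seq; apply: lee_sum => q sq; rewrite Pprod// muleA.
  by apply: lee_pmul => //; exact: half.
rewrite -ge0_sume_distrr; last by move=> q _.
rewrite EFinM -muleA; apply: lee_pmul => //; first by apply: sume_ge0 => q _.
apply: sum_measure_le_mult => //.
- by move=> q; exact: mrec.
- by move=> q sq z [[Fz _] Cz]; apply: (subE q sq).
move=> z; rewrite -size_filter; set t := [seq q <- s | _].
have ut : uniq t by rewrite filter_uniq.
have tP q : q \in t -> [/\ q \in s, F q.1 (p1 z), ~ Zs q.2 (p1 z) & cube_set q.2 (p2 z)].
  by rewrite mem_filter => /andP[/asboolP[[Fz nZ] Cz] sq].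
case Et : t => [//|q0 t0].
have [q1 tq1 mn] : exists2 q, q \in t & forall q', q' \in t -> (q.2.1 <= q'.2.1)%R.
  have : t != [::] by rewrite Et.
  elim: (t) => // q' t' IH _; case: t' IH => [_|q2 t' IH].
    by exists q'; [rewrite mem_head|move=> q'' /[1!inE] /eqP ->].
  have [q t'q mn] := IH isT; have [h|h] := leP q.2.1 q'.2.1.
    by exists q; [rewrite inE t'q orbT|move=> q'' /[1!inE] /orP[/eqP ->//|]; exact: mn].
  exists q'; first exact: mem_head.
  by move=> q'' /[1!inE] /orP[/eqP ->//|/mn]; apply: le_trans; exact: ltW.
(* The overlap at z is counted by exponents. Members of [t] with equal exponent have equal second
   cubes, hence the same first part by disjointness. Relative to the smallest exponent, that of
   [q1], all are below l: otherwise the cube of [q] would contain the l-th ancestor of q1.2 and p1 z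
   would lie in the removed set. *)
rewrite -Et -(size_iota 0 l) -(size_map (fun q : I * dcube k => `|(q.2.1 - q1.2.1)%R|%N)).
have [s1 F1 nZ1 C1] := tP _ tq1.
apply: uniq_leq_size.
  rewrite map_inj_in_uniq// => q q' tq tq' e.
  have [sq Fq _ Cq] := tP _ tq; have [sq' Fq' _ Cq'] := tP _ tq'.
  have e2 : q.2 = q'.2.
    by apply: cube_uniq Cq Cq'; exact: absz_sub_inj (mn _ tq) (mn _ tq') e.
  have [/eqP e1|ne] := boolP (q.1 == q'.1); first by case: (q) (q') e1 e2 => [? ?] [? ?] /= -> ->.
  by have := dj q q' sq sq' e2 ne; move=> /seteqP[/(_ (p1 z)) []].
move=> _ /mapP[q tq ->]; rewrite mem_iota /= add0n ltnNge; apply/negP => hl.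
have [sq Fq _ Cq] := tP _ tq; apply: nZ1; exists q => //; rewrite mem_filter sq andbT.
apply: meet_below (cube_sub_up _ C1) Cq; exact: absz_sub_le (mn _ tq) hl.
Qed.

End Journe.

(** * Maximal rectangles, open sets and the rectangles that cannot be enlarged *)

Section Rectangles.
Variables (R : realType) (n m : nat).
Hypotheses (n0 : (0 < n)%N) (m0 : (0 < m)%N).
Local Notation P := (@leb2 R n m).
Local Notation ds Q := (dside R Q).
Implicit Types Q S : drect n m.

Definition below2 Q Q' := below Q.1 Q'.1 && below Q.2 Q'.2.

Lemma below2_sub Q Q' : below2 Q Q' -> rect_set Q `<=` (rect_set Q' : set (pt R n m)).
Proof. by move=> /andP[b1 b2] x [h1 h2]; split; [exact: below_sub b1 _ h1|exact: below_sub b2 _ h2]. Qed.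

Lemma sub_below2 Q Q' : rect_set Q `<=` (rect_set Q' : set (pt R n m)) -> below2 Q Q'.
Proof.
move=> h; apply/andP; split.
  by apply: (@sub_below R) => // x hx; have [] := h (x, corner R Q.2) (conj hx (corner_in R Q.2)).
by apply: (@sub_below R) => // x hx; have [] := h (corner R Q.1, x) (conj (corner_in R Q.1) hx).
Qed.

Lemma below2_anti Q Q' : below2 Q Q' -> below2 Q' Q -> Q = Q'.
Proof.
move=> /andP[b1 b2] /andP[c1 c2].
have e1 : Q.1 = Q'.1 by apply: (@below_eq R _ _ _ b1); apply/eqP; rewrite eq_le !below_exp.
have e2 : Q.2 = Q'.2 by apply: (@below_eq R _ _ _ b2); apply/eqP; rewrite eq_le !below_exp.
by case: Q Q' e1 e2 {b1 b2 c1 c2} => [? ?] [? ?] /= -> ->.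
Qed.

Lemma rect_set_inj Q Q' : rect_set Q = rect_set Q' :> set (pt R n m) -> Q = Q'.
Proof. by move=> e; apply: below2_anti; apply: sub_below2; rewrite e. Qed.

Definition up2 i j Q : drect n m := (up i Q.1, up j Q.2).

Lemma below2_up i j Q : below2 Q (up2 i j Q).
Proof. by rewrite /below2 !below_up. Qed.

Lemma rvol_up i j Q : rvol R (up2 i j Q) = rvol R Q * (2 ^+ (i * n) * 2 ^+ (j * m)).
Proof. by rewrite /rvol /= !ds_up !exprMn -!exprM; ring. Qed.

(** Stretching Q by (i, j) generations multiplies its volume by 2^(i n + j m) >= i + j, which the
    finite measure of O bounds; a stretch inside O with the largest i + j is maximal. *)
Lemma exists_maxrect (O : set (pt R n m)) Q : measurable O -> (P O < +oo)%E ->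
  rect_set Q `<=` O -> exists2 Q', maxrect O Q' & below2 Q Q'.
Proof.
move=> mO fO QO.
have v0 := rvol_gt0 R Q.
pose p k := `[< exists i j, (i + j)%N = k /\ rect_set (up2 i j Q) `<=` O >].
have p0 : exists k, p k.
  by exists 0%N; apply/asboolP; exists 0%N, 0%N; rewrite /up2 !up0; case: (Q) QO.
have [B hB] : exists B : nat, fine (P O) / rvol R Q < B%:R.
  by eexists; exact: archi_boundP (divr_ge0 (fine_ge0 (measure_ge0 _ _)) (ltW v0)).
have pB k : p k -> (k <= B)%N.
  move=> /asboolP[i [j [<- h]]].
  have : (P (rect_set (up2 i j Q)) <= P O)%E.
    by apply: le_measure; rewrite ?inE//; exact: measurable_rect.
  rewrite leb2_rect -[P O]fineK ?ge0_fin_numE// lee_fin rvol_up mulrC -ler_pdivlMr// -exprD => h2.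
  rewrite -(ler_nat R); apply: ltW; apply: le_lt_trans hB; apply: le_trans h2.
  rewrite -natrX ler_nat; apply: (@leq_trans (i * n + j * m)); last exact/ltnW/ltn_expl.
  by rewrite leq_add// leq_pmulr.
case: (ex_maxnP p0 pB) => k /asboolP[i [j [ij h]]] mx.
exists (up2 i j Q); last exact: below2_up.
split => // Q' s1 s2.
have /andP[/belowP[i' e1] /belowP[j' e2]] := sub_below2 s1.
have E : Q' = up2 (i + i') (j + j') Q.
  by case: Q' e1 e2 {s1 s2} => [? ?] /= -> ->; rewrite !up_up.
have /mx : p (i + i' + (j + j'))%N by apply/asboolP; exists (i + i')%N, (j + j')%N; rewrite -E.
rewrite -ij => h3; have [i0 j0] : i' = 0%N /\ j' = 0%N by lia.
by rewrite E i0 j0 !addn0.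
Qed.

Lemma finite_min (I : finType) (f : I -> R) : (forall i, 0 < f i) ->
  exists2 d, 0 < d & forall i, d <= f i.
Proof.
move=> f0; pose S := 1 + \sum_i (f i)^-1.
have S0 i : (f i)^-1 <= S.
  rewrite /S (bigD1 i)//=; have : 0 <= \sum_(j | j != i) (f j)^-1.
    by apply: sumr_ge0 => j _; rewrite invr_ge0 ltW.
  lra.
have Sp : 0 < S by rewrite ltr_pwDl// sumr_ge0// => i _; rewrite invr_ge0 ltW.
exists S^-1; first by rewrite invr_gt0.
by move=> i; rewrite -[leRHS]invrK lef_pV2// posrE invr_gt0.
Qed.

Lemma nb_open k (a : R) (Q : dcube k) x : nb a Q x -> exists2 d : R, 0 < d &
  forall y : k.-tuple R, (forall i, `|tnth y i - tnth x i| < d) -> nb a Q y.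
Proof.
move=> h.
have [|d d0 hd] := @finite_min 'I_k (fun i => Num.min (tnth x i - (lo R Q i - a * ds Q))
    (lo R Q i + ds Q + a * ds Q - tnth x i)).
  by move=> i; have /andP[h1 h2] := h i; rewrite lt_min !subr_gt0 h1 h2.
exists d => // y hy i; have := hy i; have := hd i; rewrite le_min ltr_norml => /andP[h1 h2] h3.
by move: h1 h2 h3; lra.
Qed.

Lemma open_nb2 a Q : open_set (nb2 a Q : set (pt R n m)).
Proof.
move=> x [/nb_open[d1 d10 h1] /nb_open[d2 d20 h2]].
exists (Num.min d1 d2); first by rewrite lt_min d10.
move=> y hy1 hy2; split; [apply: h1 => i|apply: h2 => i].
  by have := hy1 i; rewrite lt_min => /andP[].
by have := hy2 i; rewrite lt_min => /andP[].
Qed.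

Lemma open_bU (I : eqType) (s : seq I) (F : I -> set (pt R n m)) :
  (forall i, open_set (F i)) -> open_set (bU s F).
Proof.
move=> oF x [i si Fx]; have [d d0 h] := oF i x Fx; exists d => // y h1 h2.
by exists i => //; exact: h.
Qed.

Lemma open_rect (O : set (pt R n m)) x : open_set O -> O x ->
  exists2 Q : drect n m, rect_set Q x & (rect_set Q : set (pt R n m)) `<=` O.
Proof.
move=> oO /oO[d d0 h].
have [N hN] : exists N : nat, d^-1 < N%:R.
  by eexists; apply: archi_boundP; rewrite invr_ge0 ltW.
have dN : (2 : R) ^ (- N%:Z) < d.
  rewrite -invr_expz -[ltRHS]invrK ltf_pV2 ?posrE ?invr_gt0 ?exprz_gt0//.
  by apply: lt_trans hN _; rewrite -exprnP -natrX ltr_nat ltn_expl.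
have [h1 h2] : rect_set (cube_at (- N%:Z) x.1, cube_at (- N%:Z) x.2) x by split; exact: cube_at_in.
exists (cube_at (- N%:Z) x.1, cube_at (- N%:Z) x.2) => //.
have dist k (z y : k.-tuple R) (Q : dcube k) i : Q.1 = - N%:Z -> cube_set Q z -> cube_set Q y -> `|tnth y i - tnth z i| < d.
  move=> e /cube_setP hz /cube_setP hy; apply: lt_trans dN; rewrite -e.
  have := hz i; have := hy i; rewrite /dside ltr_norml; lra.
by move=> y [/= g1 g2]; apply: h => i; [exact: dist h1 g1|exact: dist h2 g2].
Qed.

Lemma open_measurable2 (O : set (pt R n m)) : open_set O -> measurable O.
Proof.
move=> oO; have -> : O = \bigcup_(Q : drect n m) (if `[< rect_set Q `<=` O >] then rect_set Q else set0).
  apply/seteqP; split => x; last first.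
    by move=> [Q _]; case: asboolP => // h /h.
  by move=> /(open_rect oO)[Q Qx QO]; exists Q => //; rewrite (asboolT QO).
apply: countable_bigcupT_measurable => [|Q]; first exact: countableP.
by case: asboolP => _ //; exact: measurable_rect.
Qed.

Definition Cst : R := 7 ^+ n / 4^-1 * (7 ^+ m / 4^-1).

Lemma Cst_ge1 : 1 <= Cst.
Proof.
have h k : (1 : R) <= 7 ^+ k / 4^-1.
  rewrite invrK; have : (1 : R) <= 7 ^+ k by rewrite exprn_ege1// ler1n.
  lra.
by rewrite -[1]mul1r ler_pM.
Qed.

Section BadRectangles.
Variables (Om : set (pt R n m)) (s : seq (drect n m)) (K : nat).
Hypotheses (mOm : measurable Om) (fOm : (P Om < +oo)%E) (us : uniq s).
Hypothesis smax : forall Q, Q \in s -> maxrect Om Q.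

Definition hdense (E : set (pt R n m)) S := `[< ((2^-1 * rvol R S)%:E < P (rect_set S `&` E))%E >].
(* Journe's two enlargement steps: Om2 is the union of the rectangles of Dl, which extend those of
   s in the first factor and are at least half filled by Om. *)
Definition Dl := [seq S <- [seq (up k q.1, q.2) | q <- s, k <- iota 0 K] | hdense Om S].
Definition Om2 : set (pt R n m) := bU Dl (@rect_set R n m).

Lemma measurable_Om2 : measurable Om2.
Proof. by apply: measurable_bU => Q; exact: measurable_rect. Qed.

Lemma Om2_le : (P Om2 <= Cst%:E * P Om)%E.
Proof.
apply: le_trans (strong_cover (s := Dl) mOm _).
  apply: le_measure; rewrite ?inE; [exact: measurable_Om2|by apply: measurable_bU => S; exact: measurable_nb2|].
  move=> x [S sS [h1 h2]]; exists S => //; split; exact: sub_nb.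
by move=> S; rewrite mem_filter => /andP[/asboolP /ltW].
Qed.

Lemma fOm2 : (P Om2 < +oo)%E.
Proof.
apply: le_lt_trans Om2_le _; rewrite -[P Om]fineK ?ge0_fin_numE// -EFinM.
by rewrite ltry.
Qed.

Lemma max_disjoint1 Q Q' : Q \in s -> Q' \in s -> Q.1 = Q'.1 -> Q.2 != Q'.2 ->
  cube_set Q.2 `&` cube_set Q'.2 = set0 :> set (m.-tuple R).
Proof.
wlog ee : Q Q' / (Q.2.1 <= Q'.2.1)%R => [H sQ sQ' e ne|sQ sQ' e ne].
  have [h|/ltW h] := leP Q.2.1 Q'.2.1; first exact: H.
  by rewrite setIC; apply: H => //; rewrite eq_sym.
apply/seteqP; split => // x [h h']; have b := meet_below ee h h'.
have [QO mx] := smax sQ; have [QO' _] := smax sQ'.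
have b2 : below2 Q Q' by rewrite /below2 b e (@below_refl R).
have := mx Q' (below2_sub b2) QO' => /rect_set_inj E.
by rewrite E eqxx in ne.
Qed.

Lemma max_disjoint2 Q Q' : Q \in s -> Q' \in s -> Q.2 = Q'.2 -> Q.1 != Q'.1 ->
  cube_set Q.1 `&` cube_set Q'.1 = set0 :> set (n.-tuple R).
Proof.
wlog ee : Q Q' / (Q.1.1 <= Q'.1.1)%R => [H sQ sQ' e ne|sQ sQ' e ne].
  have [h|/ltW h] := leP Q.1.1 Q'.1.1; first exact: H.
  by rewrite setIC; apply: H => //; rewrite eq_sym.
apply/seteqP; split => // x [h h']; have b := meet_below ee h h'.
have [QO mx] := smax sQ; have [QO' _] := smax sQ'.
have b2 : below2 Q Q' by rewrite /below2 b e (@below_refl R).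
have := mx Q' (below2_sub b2) QO' => /rect_set_inj E.
by rewrite E eqxx in ne.
Qed.

(** Journe's lemma with the factors exchanged: the second cubes play the sets F and the first cubes
    are stretched. Disjointness for equal first cubes is maximality in Om. *)
Lemma bad_sum1 t i : uniq t -> {subset t <= s} ->
  (forall Q, Q \in t -> ~~ hdense Om (up i Q.1, Q.2)) ->
  \sum_(Q <- t) rvol R Q <= 2 * i%:R * fine (P Om).
Proof.
move=> ut ts bad.
have inj : injective (fun Q : drect n m => (Q.2, Q.1)) by move=> [? ?] [? ?] [-> ->].
have Pp (A : set (m.-tuple R)) (B : set (n.-tuple R)) : measurable A -> measurable B ->
    P (snd @^-1` A `&` fst @^-1` B) = (lebn A * lebn B)%E.
  by move=> mA mB; rewrite muleC -leb2_X// setIC.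
have fF (J : dcube m) : (lebn (cube_set J : set (m.-tuple R)) < +oo)%E by rewrite lebn_cube ltry.
have mF (J : dcube m) : measurable (cube_set J : set (m.-tuple R)) by exact: measurable_cube.
have := journe (P := P) (mu := @lebn R m) (p1 := snd) (p2 := fst) measurable_snd measurable_fst Pp
  (F := @cube_set R m) mF fF (s := [seq (q.2, q.1) | q <- t]) (E := Om) (l := i).
rewrite map_inj_uniq// => /(_ ut mOm) H.
have : (\sum_(Q <- t) (rvol R Q)%:E <= (2 * i%:R)%:E * P Om)%E.
  apply: le_trans (H _ _ _).
  - rewrite big_map; apply: lee_sum => Q _ /=; rewrite !lebn_cube -EFinM lee_fin /rvol.
    by rewrite mulrC.
  - move=> _ _ /mapP[Q tQ ->] /mapP[Q' tQ' ->] /= e ne; exact: (max_disjoint1 (ts _ tQ) (ts _ tQ') e ne).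
  - move=> _ /mapP[Q tQ ->] /= x [h1 h2]; have [QO _] := smax (ts _ tQ); by apply: QO; split.
  - move=> _ /mapP[Q tQ ->] /=; have := bad Q tQ; rewrite /hdense => /asboolPn/negP.
    rewrite -leNgt /= !lebn_cube -!EFinM [ds Q.2 ^+ m * _]mulrC.
    by rewrite [snd @^-1` _ `&` _]setIC => h; exact: h.
by rewrite sumEFin -[P Om]fineK ?ge0_fin_numE// -EFinM lee_fin.
Qed.

(** Several rectangles of [t] may have the same or comparable first stretches, so Journe's lemma is
    applied to [w], the stretched rectangles that are maximal in the first factor for their second
    cube. The rectangles of [t] below one member of [w] share its second cube and are disjoint by
    maximality in Om, so their volumes add up to at most its own. *)
Lemma bad_sum2 t i j : uniq t -> {subset t <= s} -> (i < K)%N ->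
  (forall Q, Q \in t -> hdense Om (up i Q.1, Q.2)) ->
  (forall Q, Q \in t -> ~~ hdense Om2 (up2 i j Q)) ->
  \sum_(Q <- t) rvol R Q <= 2 * j%:R * fine (P Om2).
Proof.
move=> ut ts iK den bad.
pose u := undup [seq (up i q.1, q.2) | q <- t].
pose w := [seq q <- u | all (fun q' => (q'.2 == q.2) && below q.1 q'.1 ==> (q'.1 == q.1)) u].
have wu q : q \in w -> exists2 Q, Q \in t & q = (up i Q.1, Q.2).
  by rewrite mem_filter mem_undup => /andP[_ /mapP[Q tQ ->]]; exists Q.
have uw : uniq w by rewrite filter_uniq// undup_uniq.
have wmax q : q \in u -> exists2 q', q' \in w & q'.2 = q.2 /\ below q.1 q'.1.
  move=> uq.
  have q1 : q.1 \in [seq q'.1 | q' <- u & q'.2 == q.2] by apply: map_f; rewrite mem_filter eqxx.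
  have [K' + []] := exists_maximal R q1.
  move=> /mapP[q']; rewrite mem_filter => /andP[/eqP e uq'] -> b mx.
  exists q' => //; rewrite mem_filter uq' andbT; apply/allP => q'' uq''; apply/implyP => /andP[/eqP e' b'].
  by apply/eqP; apply: mx => //; apply: map_f; rewrite mem_filter uq'' e' e eqxx.
have Pp (A : set (n.-tuple R)) (B : set (m.-tuple R)) : measurable A -> measurable B ->
    P (fst @^-1` A `&` snd @^-1` B) = (lebn A * lebn B)%E by move=> mA mB; rewrite -leb2_X.
have fF (J : dcube n) : (lebn (cube_set J : set (n.-tuple R)) < +oo)%E by rewrite lebn_cube ltry.
have mF (J : dcube n) : measurable (cube_set J : set (n.-tuple R)) by exact: measurable_cube.
have H := journe (P := P) (mu := @lebn R n) (p1 := fst) (p2 := snd) measurable_fst measurable_snd Pp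
  (F := @cube_set R n) mF fF (s := w) (E := Om2) (l := j) uw measurable_Om2.
have : (\sum_(q <- w) (rvol R q)%:E <= (2 * j%:R)%:E * P Om2)%E.
  apply: le_trans (H _ _ _).
  - by apply: lee_sum => Q _ /=; rewrite !lebn_cube -EFinM lee_fin /rvol.
  - move=> q q'; rewrite !mem_filter => /andP[/allP a uq] /andP[/allP a' uq'] e ne.
    apply/seteqP; split => // x [hx hx'].
    have [ee|/ltW ee] := leP q.1.1 q'.1.1.
      have b := meet_below ee hx hx'; have := a _ uq'; rewrite e eqxx b /= => /eqP e1.
      by rewrite e1 eqxx in ne.
    have b := meet_below ee hx' hx; have := a' _ uq; rewrite e eqxx b /= => /eqP e1.
    by rewrite e1 eqxx in ne.
  - move=> q /wu[Q tQ ->] /= x [h1 h2]; exists (up i Q.1, Q.2); last by split.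
    rewrite mem_filter den//=; apply/allpairsP; exists (Q, i); split => //; first exact: ts.
    by rewrite mem_iota.
  - move=> q /wu[Q tQ ->] /=; have := bad Q tQ; rewrite /hdense => /asboolPn/negP.
    by rewrite -leNgt /= !lebn_cube -!EFinM => h; apply: le_trans h.
rewrite sumEFin -[P Om2]fineK ?ge0_fin_numE ?fOm2// -EFinM lee_fin.
apply: le_trans.
apply: (@le_trans _ _ (\sum_(Q <- t) \sum_(q <- w | (q.2 == Q.2) && below Q.1 q.1) rvol R Q)).
  rewrite big_seq [leRHS]big_seq; apply: ler_sum => Q tQ.
  have [q' wq' [e b]] : exists2 q', q' \in w & q'.2 = Q.2 /\ below Q.1 q'.1.
    have [q' wq' [e b]] := wmax (up i Q.1, Q.2) (ltac:(by rewrite mem_undup; apply: map_f)).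
    by exists q' => //; split => //; exact: (@below_trans R _ _ _ _ (below_up _ _) b).
  rewrite (big_rem q')//= e eqxx b /= lerDl sumr_ge0// => q _; exact: ltW (rvol_gt0 _ _).
under eq_bigr => Q _ do rewrite big_mkcond.
rewrite exchange_big /=; apply: ler_sum => q _; rewrite -big_mkcond -big_filter.
set t' := [seq Q <- t | _].
have ut' : uniq t' by rewrite filter_uniq.
rewrite -lee_fin -sumEFin -leb2_rect.
have -> : (\sum_(Q <- t') (rvol R Q)%:E = \sum_(Q <- t') P (rect_set Q))%E.
  by apply: eq_bigr => Q _; rewrite leb2_rect.
rewrite -(mu_bU_disj P (F := @rect_set R n m))//.
- apply: le_measure; rewrite ?inE; [by apply: measurable_bU => Q; exact: measurable_rect|exact: measurable_rect|].
  apply: bU_sub => Q; rewrite mem_filter => /andP[/andP[/eqP e b] _]; apply: below2_sub.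
  by rewrite /below2 b e (@below_refl R).
- by move=> Q; exact: measurable_rect.
move=> Q Q'; rewrite !mem_filter => /andP[/andP[/eqP e b] tQ] /andP[/andP[/eqP e' b'] tQ'] ne.
apply/seteqP; split => // x [[h1 h2] [h1' h2']].
have ne1 : Q.1 != Q'.1.
  by apply: contra ne => /eqP e1; case: (Q) (Q') e1 e e' => [? ?] [? ?] /= -> <- <-.
by have /seteqP[/(_ x.1) []] := max_disjoint2 (ts _ tQ) (ts _ tQ') (etrans (esym e) e') ne1.
Qed.

(** If the first stretch is not half filled by Om, [bad_sum1] applies; if it is, the stretched
    rectangle belongs to Om2 and the failure of the second stretch is measured against Om2 in
    [bad_sum2]. The growth in i and j is only linear. *)
Lemma bad_sum t i j : uniq t -> {subset t <= s} -> (i < K)%N ->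
  (forall Q, Q \in t -> ~~ hdense Om2 (up2 i j Q)) ->
  \sum_(Q <- t) rvol R Q <= 2 * Cst * (1 + i%:R + j%:R) * fine (P Om).
Proof.
move=> ut ts iK bad; rewrite (bigID (fun Q => hdense Om (up i Q.1, Q.2))) /= -big_filter -[X in _ + X <= _]big_filter.
have h1 := @bad_sum2 [seq Q <- t | hdense Om (up i Q.1, Q.2)] i j.
have h2 := @bad_sum1 [seq Q <- t | ~~ hdense Om (up i Q.1, Q.2)] i.
have {}h1 : \sum_(Q <- [seq Q <- t | hdense Om (up i Q.1, Q.2)]) rvol R Q <= 2 * j%:R * fine (P Om2).
  apply: h1 => //; first by rewrite filter_uniq.
  - by move=> Q; rewrite mem_filter => /andP[_ /ts].
  - by move=> Q; rewrite mem_filter => /andP[].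
  - by move=> Q; rewrite mem_filter => /andP[_ /bad].
have {}h2 : \sum_(Q <- [seq Q <- t | ~~ hdense Om (up i Q.1, Q.2)]) rvol R Q <= 2 * i%:R * fine (P Om).
  apply: h2; first by rewrite filter_uniq.
  - by move=> Q; rewrite mem_filter => /andP[_ /ts].
  - by move=> Q; rewrite mem_filter => /andP[].
have h3 : fine (P Om2) <= Cst * fine (P Om).
  by rewrite -lee_fin EFinM !fineK ?ge0_fin_numE ?fOm2//; exact: Om2_le.
have p0 : 0 <= fine (P Om) by exact: fine_ge0.
have := Cst_ge1; move: h1 h2 h3; set a := fine (P Om) in p0 *; set b := fine (P Om2).
move=> h1 h2 h3 C1.
have i0 : (0 : R) <= i%:R by []; have j0 : (0 : R) <= j%:R by [].
have h4 : j%:R * b <= j%:R * (Cst * a) by exact: ler_wpM2l.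
have h5 : i%:R * a <= i%:R * (Cst * a) by apply: ler_wpM2l => //; rewrite ler_peMl.
have h6 : 0 <= Cst * a by rewrite mulr_ge0//; lra.
by move: h1 h2 h4 h5 h6; lra.
Qed.

End BadRectangles.
End Rectangles.

(** * Smoothness *)

Section Coordinates.
Variables (R : realType) (n m : nat).
Local Notation pt := (pt R n m).
Local Notation coord := Defs.coord.
Local Notation shift := Defs.shift.
Local Notation P := (@leb2 R n m).
Local Notation hp := (boxes_pt R n m).
Implicit Types (c d : coord n m).

Definition xc (x : pt) c : R := match c with inl i => tnth x.1 i | inr j => tnth x.2 j end.

Lemma xc_shift (x : pt) c t d : xc (shift x c t) d = xc x d + (if d == c then t else 0).
Proof.
case: c d => [i|i] [j|j] /=; rewrite ?tnth_mktuple ?addr0//=.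
Qed.

Lemma measurable_xc c : measurable_fun setT (fun x : pt => xc x c).
Proof.
case: c => i /=.
  by apply: (measurableT_comp (f := fun x : n.-tuple R => tnth x i)) => //; exact: measurable_tnth.
by apply: (measurableT_comp (f := fun x : m.-tuple R => tnth x i)) => //; exact: measurable_tnth.
Qed.

Lemma bbox2P r (x : pt) : bbox2 r x <-> forall c, `|xc x c| <= r.
Proof.
split; first by move=> [h1 h2] [i|i]; [exact: h1|exact: h2].
by move=> h; split => i; [exact: (h (inl i))|exact: (h (inr i))].
Qed.

Lemma prod_diff_seq (I : Type) (s : seq I) (a b : I -> R) (M : R) : 1 <= M ->
  (forall i, `|a i| <= M) -> (forall i, `|b i| <= M) ->
  `|\prod_(i <- s) a i - \prod_(i <- s) b i| <= M ^+ size s * \sum_(i <- s) `|a i - b i|.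
Proof.
move=> M1 ha hb; have M0 : 0 <= M by lra.
elim: s => [|i s IH]; first by rewrite !big_nil subrr normr0 mulr0.
rewrite !big_cons.
have -> : a i * \prod_(j <- s) a j - b i * \prod_(j <- s) b j =
   (a i - b i) * \prod_(j <- s) a j + b i * (\prod_(j <- s) a j - \prod_(j <- s) b j) by ring.
apply: le_trans (ler_normD _ _) _; rewrite [leRHS]mulrDr.
apply: lerD; rewrite normrM /= exprS.
  rewrite mulrC; apply: ler_wpM2r => //; rewrite normr_prod.
  apply: (@le_trans _ _ (\prod_(j <- s) M)); first by apply: ler_prod => j _; rewrite normr_ge0 ha.
  by rewrite big_const_seq count_predT iter_mulr_1 ler_peMl// exprn_ge0.
by rewrite -mulrA; apply: ler_pM.
Qed.

Definition tconv (u : coord n m -> R -> R) (g : pt -> R) (x : pt) : R :=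
  \int[P]_y ((\prod_c u c (xc x c - xc y c)) * g y).

Lemma common_bound r (u : coord n m -> R -> R) : (forall c, tst r (u c)) ->
  exists2 M : R, 1 <= M & forall c x, `|u c x| <= M.
Proof.
move=> tu.
have /choice[M hM] : forall c, exists M : R, 0 <= M /\ forall x, `|u c x| <= M.
  by move=> c; have [M M0 hM] := tst_bounded (tu c); exists M.
exists (1 + \sum_c M c); first by rewrite lerDl sumr_ge0// => c _; case: (hM c).
move=> c x; have [M0 h] := hM c; apply: le_trans (h x) _.
have : M c <= \sum_c M c by rewrite (bigD1 c)//= lerDl sumr_ge0// => t' _; case: (hM t').
by lra.
Qed.

Lemma common_lip r (u : coord n m -> R -> R) : (forall c, tst r (u c)) ->
  exists2 M : R, 0 <= M & forall c x y, `|u c x - u c y| <= M * `|x - y|.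
Proof.
move=> tu.
have /choice[M hM] : forall c, exists M : R, 0 <= M /\ forall x y, `|u c x - u c y| <= M * `|x - y|.
  by move=> c; have [M M0 hM] := tst_lipschitz (tu c); exists M.
exists (\sum_c M c); first by apply: sumr_ge0 => c _; case: (hM c).
move=> c x y; have [M0 h] := hM c; apply: le_trans (h x y) _; apply: ler_wpM2r => //.
by rewrite (bigD1 c)//= lerDl sumr_ge0// => t' _; case: (hM t').
Qed.

Lemma measurable_tprod r (u : coord n m -> R -> R) (x : pt) (p : pred (coord n m)) : (forall c, tst r (u c)) ->
  measurable_fun setT (fun y : pt => \prod_(c | p c) u c (xc x c - xc y c)).
Proof.
move=> tu; under eq_fun do rewrite big_mkcond /=.
apply: measurable_prod => c _; case: (p c) => //.
apply: measurableT_comp; first exact: tst_measurable (tu c).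
by apply: measurable_funB => //; exact: measurable_xc.
Qed.

Lemma tprod_bound r (u : coord n m -> R -> R) (p : pred (coord n m)) : (forall c, tst r (u c)) ->
  exists2 M : R, 0 <= M & forall x y : pt, `|\prod_(c | p c) u c (xc x c - xc y c)| <= M.
Proof.
move=> tu; have [M M1 hM] := common_bound tu.
exists (\prod_(c | p c) M); first by apply: prodr_ge0 => c _; lra.
by move=> x y; rewrite normr_prod; apply: ler_prod => c _; rewrite normr_ge0 hM.
Qed.

Lemma bx2_tprod r u g x : (forall c, tst r (u c)) -> bx2 g ->
  bx2 (fun y => (\prod_c u c (xc x c - xc y c)) * g y).
Proof.
move=> tu bg; apply: bxdM => //; first exact: (measurable_tprod _ _ tu).
by have [M _ hM] := tprod_bound xpredT tu; exists M.
Qed.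

Lemma tconv_derive r u g c : (forall c, tst r (u c)) -> bx2 g ->
  exists2 u', forall c, tst r (u' c) &
    forall x, is_derive (0 : R) (1 : R) (fun t => tconv u g (shift x c t)) (tconv u' g x).
Proof.
move=> tu [rg bg]; have [mB fB _] := hp.
have [w' tw' dw] := tst_deriv (tu c).
pose u' d := if d == c then w' else u d.
have tu' d : tst r (u' d) by rewrite /u'; case: ifP.
exists u' => // x.
have [Mq Mq0 hq] := tst_quad (tu c) dw.
have [Mb Mb0 hb] := tprod_bound (fun d => d != c) tu.
have [M1 M10 h1] := tst_bounded (tu c).
have [M2 M20 h2] := tst_bounded tw'.
pose rest y := \prod_(d | d != c) u d (xc x d - xc y d).
pose F t y := u c (xc x c + t - xc y c) * rest y.
pose F' t y := w' (xc x c + t - xc y c) * rest y.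
have mrest : measurable_fun setT rest by exact: (measurable_tprod _ _ tu).
have mm w t : tst r w -> measurable_fun setT (fun y : pt => w (xc x c + t - xc y c) * rest y).
  move=> tw; apply: measurable_funM => //; apply: measurableT_comp; first exact: tst_measurable tw.
  by apply: measurable_funB => //; exact: measurable_xc.
have := @is_derive_integral _ _ R P (bbox2 rg) g F F' 0 (Mq * Mb) (mB rg) (fB rg) bg.
have -> : (fun t => \int[P]_y (F t y * g y)) = (fun t => tconv u g (shift x c t)).
  apply/funext => t; apply: eq_Rintegral => y _; congr (_ * _).
  rewrite [RHS](bigD1 c)//= xc_shift eqxx; congr (_ * _).
  by apply: eq_bigr => d /negbTE dc; rewrite xc_shift dc addr0.
have -> : \int[P]_y (F' 0 y * g y) = tconv u' g x.
  apply: eq_Rintegral => y _; congr (_ * _).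
  rewrite [RHS](bigD1 c)//= /u' eqxx /F' addr0; congr (_ * _).
  by apply: eq_bigr => d /negbTE dc; rewrite dc.
apply.
- by move=> t; exact: mm (tu c).
- by move=> t; exact: mm tw'.
- by move=> t; exists (M1 * Mb) => y; rewrite normrM ler_pM//; exact: hb.
- by move=> t; exists (M2 * Mb) => y; rewrite normrM ler_pM//; exact: hb.
move=> h y; rewrite /F /F' !add0r !addr0.
rewrite (_ : _ - _ = (u c (xc x c - xc y c + h) - u c (xc x c - xc y c) - h * w' (xc x c - xc y c)) * rest y); last first.
  by rewrite (_ : xc x c + h - xc y c = xc x c - xc y c + h); ring.
by rewrite normrM mulrAC; apply: ler_pM => //; exact: hb.
Qed.

Lemma tconv_continuous r u g : (forall c, tst r (u c)) -> bx2 g -> pt_continuous (tconv u g).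
Proof.
move=> tu bg x e e0.
have [M M1 hM] := common_bound tu; have [L L0 hL] := common_lip tu.
have bgn := bxd_norm bg.
set N := size (index_enum (coord n m)).
set I := \int[P]_y `|g y|.
have I0 : 0 <= I by apply: Rintegral_ge0 => y _.
pose C := M ^+ N * (L * N%:R) * I + 1.
have C0 : 0 < C by rewrite ltr_wpDl// !mulr_ge0// exprn_ge0//; lra.
exists (e / C); first by rewrite divr_gt0.
move=> y hy1 hy2.
have hy c : `|xc y c - xc x c| <= e / C.
  by case: c => i; apply: ltW; [exact: hy1|exact: hy2].
have b1 := bx2_tprod y tu bg; have b2 := bx2_tprod x tu bg.
rewrite /tconv -(RintB hp)//.
apply: (@le_lt_trans _ _ (M ^+ N * (L * N%:R * (e / C)) * I)).
  apply: le_trans (Rint_le_norm hp (bxdB hp b1 b2)) _.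
  rewrite -(RintZ hp)//; apply: (le_Rint hp).
  - exact: bxd_norm (bxdB hp b1 b2).
  - exact: bxdZ.
  move=> z; rewrite -mulrBl normrM; apply: ler_wpM2r => //.
  apply: le_trans (prod_diff_seq _ M1 _ _) _ => //; rewrite -/N.
  apply: ler_wpM2l; first by rewrite exprn_ge0//; lra.
  apply: (@le_trans _ _ (\sum_(c : coord n m) L * (e / C))).
    apply: ler_sum => c _; apply: le_trans (hL _ _ _) _; apply: ler_wpM2l => //.
    by rewrite (_ : _ - _ = xc y c - xc x c) ?hy//; ring.
  by move: (e / C) => q; rewrite -[leRHS]mulrAC mulr_natr /N big_const_seq count_predT iter_addr_0.
rewrite (_ : _ * _ * I = e * ((C - 1) / C)); last by rewrite /C; field; rewrite gt_eqF.
rewrite gtr_pMr// ltr_pdivrMr// mul1r; lra.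
Qed.

Lemma tconv_bx2 r u g : (forall c, tst r (u c)) -> bx2 g -> bx2 (tconv u g).
Proof.
move=> tu bg; have [rg [mg [Mg hMg] g0]] := bg; have [Mb Mb0 hb] := tprod_bound xpredT tu.
apply: (bxd_inner1 (mu := P) (nu := P) (F := fun z : pt * pt => (\prod_c u c (xc z.1 c - xc z.2 c)) * g z.2) hp hp).
exists (rg + `|r|); split.
- apply: measurable_funM; last by apply: measurableT_comp.
  apply: measurable_prod => c _; apply: measurableT_comp; first exact: tst_measurable (tu c).
  apply: measurable_funB; apply: (measurableT_comp (f := fun x : pt => xc x c)) => //; exact: measurable_xc.
- by exists (Mb * Mg) => z; rewrite normrM ler_pM.
- move=> [x y] /= h; have [hy|hy] := pselect (bbox2 rg y); last by rewrite g0 ?mulr0.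
  have [c hc] : exists c, rg + `|r| < `|xc x c|.
    apply: contrapT => hn; apply: h; split => /=.
      by apply/bbox2P => c; rewrite leNgt; apply/negP => hc; apply: hn; exists c.
    by apply/bbox2P => c; move/bbox2P: hy => /(_ c) /le_trans; apply; rewrite lerDl.
  rewrite (bigD1 c)//= (tst_supp (tu c)) ?mul0r//.
  have h2 := ler_normD (xc x c - xc y c) (xc y c); rewrite subrK in h2.
  by move/bbox2P: hy => /(_ c); have := ler_norm r; lra.
Qed.

(** A partial derivative of such a combination only changes the test functions ([tconv_derive]), so
    membership yields derivatives of every order at once. *)
Inductive ntc : (pt -> R) -> Prop :=
| ntc_0 : ntc (fun=> 0)
| ntc_D u h r g : (forall c, tst r (u c)) -> bx2 h -> ntc g -> forall k : R,
    ntc (fun x => k * tconv u h x + g x).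

Lemma ntc_ext f g : (forall x, f x = g x) -> ntc f -> ntc g.
Proof. by move=> /funext ->. Qed.

Lemma ntc_add f g : ntc f -> ntc g -> ntc (fun x => f x + g x).
Proof.
move=> nf ng; elim: nf => [|u h r f' tu bh _ IH k].
  by apply: ntc_ext ng => x; rewrite add0r.
by apply: ntc_ext (ntc_D tu bh IH k) => x; rewrite addrA.
Qed.

Lemma ntc_scale k g : ntc g -> ntc (fun x => k * g x).
Proof.
elim=> [|u h r f' tu bh _ IH k']; first by apply: ntc_ext ntc_0 => x; rewrite mulr0.
by apply: ntc_ext (ntc_D tu bh IH (k * k')) => x; rewrite mulrDr mulrA.
Qed.

Lemma ntc_sum (I : Type) (s : seq I) (F : I -> pt -> R) : (forall i, ntc (F i)) ->
  ntc (fun x => \sum_(i <- s) F i x).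
Proof.
move=> nF; elim: s => [|i s IH]; first by apply: ntc_ext ntc_0 => x; rewrite big_nil.
by apply: ntc_ext (ntc_add (nF i) IH) => x; rewrite big_cons.
Qed.

Lemma ntc_bx2 g : ntc g -> bx2 g.
Proof.
elim=> [|u h r f' tu bh _ IH k]; first exact: bxd0.
by apply: (bxdD hp) => //; apply: bxdZ; exact: tconv_bx2 tu bh.
Qed.

Lemma pt_continuous_lin (a b : R) f g : pt_continuous f -> pt_continuous g ->
  pt_continuous (fun x : pt => a * f x + b * g x).
Proof.
move=> cf cg x e e0.
pose A := `|a| + `|b| + 1; have A0 : 0 < A by rewrite ltr_wpDl// addr_ge0.
have eA : 0 < e / A by rewrite divr_gt0.
have [d1 d10 h1] := cf x _ eA; have [d2 d20 h2] := cg x _ eA.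
exists (Num.min d1 d2); first by rewrite lt_min d10.
move=> y hy1 hy2.
have {}h1 : `|f y - f x| < e / A.
  by apply: h1 => i; [have := hy1 i|have := hy2 i]; rewrite lt_min => /andP[].
have {}h2 : `|g y - g x| < e / A.
  by apply: h2 => i; [have := hy1 i|have := hy2 i]; rewrite lt_min => /andP[].
rewrite (_ : _ - _ = a * (f y - f x) + b * (g y - g x)); last by ring.
apply: le_lt_trans (ler_normD _ _) _; rewrite !normrM.
apply: (@le_lt_trans _ _ (`|a| * (e / A) + `|b| * (e / A))).
  by apply: lerD; apply: ler_wpM2l => //; exact: ltW.
rewrite -mulrDl mulrA ltr_pdivrMr// mulrC ltr_pM2l// /A; lra.
Qed.

Lemma pt_continuous_ext f g : (forall x, f x = g x) -> pt_continuous f -> pt_continuous (g : pt -> R).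
Proof. by move=> /funext ->. Qed.

Lemma ntc_continuous g : ntc g -> pt_continuous g.
Proof.
elim=> [|u h r f' tu bh _ IH k].
  by move=> x e e0; exists 1 => // y _ _; rewrite subrr normr0.
apply: (@pt_continuous_ext (fun x => k * tconv u h x + 1 * f' x)); first by move=> x; rewrite mul1r.
by apply: pt_continuous_lin => //; exact: tconv_continuous tu bh.
Qed.

Lemma is_derive_lin (a b : R) (f g : R -> R) x df dg : is_derive x (1 : R) f df -> is_derive x (1 : R) g dg ->
  is_derive x (1 : R) (fun t => a * f t + b * g t) (a * df + b * dg).
Proof. by move=> hf hg; have := is_deriveD (is_deriveZ a hf) (is_deriveZ b hg). Qed.

Lemma ntc_deriv g c : ntc g -> exists2 g', ntc g' &
  forall x, is_derive (0 : R) (1 : R) (fun t => g (shift x c t)) (g' x).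
Proof.
elim=> [|u h r f' tu bh _ [g' ng' dg'] k].
  by exists (fun=> 0); [exact: ntc_0|move=> x; exact: is_derive_cst].
have [u' tu' du] := tconv_derive c tu bh.
exists (fun x => k * tconv u' h x + g' x); first exact: ntc_D tu' bh ng' k.
move=> x; have := is_derive_lin k 1 (du x) (dg' x); rewrite mul1r.
by under eq_fun do rewrite mul1r.
Qed.

Lemma ntc_iter g s : ntc g -> ntc (iter_pd s g).
Proof.
move=> ng; elim: s => [//|c s IH] /=.
have [g' ng' dg] := ntc_deriv c IH; apply: ntc_ext ng' => x.
by rewrite /pderiv derive1E; have [_ ->] := dg x.
Qed.

Lemma ntc_smooth g : ntc g -> smooth g.
Proof.
move=> ng s; have ns := ntc_iter s ng; split; first exact: ntc_continuous.
by move=> c x; have [g' _ dg] := ntc_deriv c ns; case: (dg x).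
Qed.

Lemma iter_pd_lin (a b : R) f g s : smooth f -> smooth g ->
  forall x : pt, iter_pd s (fun x => a * f x + b * g x) x = a * iter_pd s f x + b * iter_pd s g x.
Proof.
move=> sf sg; elim: s => [//|c s IH] x /=.
have [_ /(_ c x) /derivableP df] := sf s; have [_ /(_ c x) /derivableP dg] := sg s.
rewrite /pderiv.
have -> : iter_pd s (fun x => a * f x + b * g x) = (fun x => a * iter_pd s f x + b * iter_pd s g x).
  by apply/funext => z; exact: IH.
by rewrite !derive1E; have [_ ->] := is_derive_lin a b df dg.
Qed.

Lemma smooth_lin (a b : R) f g : smooth f -> smooth g -> smooth (fun x : pt => a * f x + b * g x).
Proof.
move=> sf sg s.
have -> : iter_pd s (fun x => a * f x + b * g x) = (fun x => a * iter_pd s f x + b * iter_pd s g x).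
  by apply/funext => x; exact: iter_pd_lin.
have [cf df] := sf s; have [cg dg] := sg s; split; first exact: pt_continuous_lin.
move=> c x; have /derivableP hf := df c x; have /derivableP hg := dg c x.
by have [] := is_derive_lin a b hf hg.
Qed.

Lemma ntc_Op2 K1 K2 g : skern K1 -> skern K2 -> bx2 g -> ntc (Op2 K1 K2 g).
Proof.
move=> [N [cf [u [r [r0 tu E]]]]] [N' [cf' [u' [r' [r0' tu' E']]]]] bg.
pose U t t' (c : coord n m) := match c with inl _ => u t | inr _ => u' t' end.
have tU t t' c : tst (Num.max r r') (U t t' c).
  by case: c => i; [apply: tst_weaken (tu t)|apply: tst_weaken (tu' t')]; rewrite le_max lexx ?orbT.
apply: (@ntc_ext (fun x => \sum_t \sum_t' (cf t * cf' t') * tconv (U t t') g x)).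
  move=> x; rewrite /Op2; transitivity (\int[P]_y \sum_t \sum_t' (cf t * cf' t') *
      ((\prod_c U t t' c (xc x c - xc y c)) * g y)).
    rewrite (Rint_sum hp); last first.
      by move=> t; apply: (bxd_sum hp) => t'; apply: bxdZ; exact: bx2_tprod (tU t t') bg.
    apply: eq_bigr => t _; rewrite (Rint_sum hp); last by move=> t'; apply: bxdZ; exact: bx2_tprod (tU t t') bg.
    by apply: eq_bigr => t' _; rewrite (RintZ hp)//; exact: bx2_tprod (tU t t') bg.
  apply: eq_Rintegral => y _; rewrite E E' big_distrlr /= mulr_suml; apply: eq_bigr => t _.
  rewrite mulr_suml; apply: eq_bigr => t' _; rewrite big_sumType /=; ring.
apply: ntc_sum => t; apply: ntc_sum => t'; apply: ntc_scale.
by apply: ntc_ext (ntc_D (tU t t') bg ntc_0 1) => x; rewrite mul1r addr0.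
Qed.

Lemma continuous_measurable2 (g : pt -> R) : pt_continuous g -> measurable_fun setT g.
Proof.
move=> cg; apply: (measurability _ (RGenOInfty.measurableE R)) => _ [_ [a ->] <-].
rewrite setTI; apply: open_measurable2 => x /=; rewrite in_itv /= andbT => ax.
have [|d d0 h] := cg x (g x - a); first by rewrite subr_gt0.
exists d => // y h1 h2; have := h y h1 h2; rewrite /= in_itv /= andbT ltr_norml; lra.
Qed.

End Coordinates.

(** * Compactness: boundedness and uniform continuity *)

Section Compactness.
Variables (R : realType) (n m : nat).
Local Notation pt := (pt R n m).
Local Notation coord := (Defs.coord n m).

(** Points are carried to row vectors only because compactness of closed boxes is taken from
    there. *)
Definition pt_of (v : 'rV[R]_(n + m)) : pt :=
  ([tuple v ord0 (lshift m i) | i < n], [tuple v ord0 (rshift n j) | j < m]).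
Definition rv_of (x : pt) : 'rV[R]_(n + m) :=
  \row_k match fintype.split k with inl i => tnth x.1 i | inr j => tnth x.2 j end.

Lemma rv_ofK x : pt_of (rv_of x) = x.
Proof.
case: x => x1 x2; congr (_, _); apply: eq_from_tnth => i; rewrite tnth_mktuple mxE.
  by case: splitP => j /= e; [congr tnth; exact: val_inj|move: (ltn_ord i); rewrite e; lia].
case: splitP => j /= e; first by move: (ltn_ord j); rewrite -e; lia.
by congr tnth; apply: val_inj => /=; lia.
Qed.

Lemma pt_near (v : 'rV[R]_(n + m)) (d : R) : 0 < d ->
  \forall w \near v, forall c, `|xc (pt_of w) c - xc (pt_of v) c| < d.
Proof.
move=> d0; apply/nbhs_ballP; exists d => // w hw c.
by case: c => i /=; rewrite !tnth_mktuple distrC; have [_ /(_ ord0)] := hw; exact.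
Qed.

Lemma seg_box_compact r : compact [set v : 'rV[R]_(n + m) | forall i, `[- r, r]%classic (v ord0 i)].
Proof. by apply: (rV_compact (fun=> @segment_compact R (- r) r)). Qed.

Lemma rv_of_box r x : bbox2 r x -> forall i, `[- r, r]%classic ((rv_of x) ord0 i).
Proof.
move=> /bbox2P h i /=; rewrite in_itv /= mxE -ler_norml.
by case: splitP => j _; [exact: (h (inl j))|exact: (h (inr j))].
Qed.

Lemma ptcP (g : pt -> R) : pt_continuous g -> forall x e, 0 < e -> exists2 d : R, 0 < d &
  forall y, (forall c, `|xc y c - xc x c| < d) -> `|g y - g x| < e.
Proof.
move=> cg x e e0; have [d d0 h] := cg x e e0; exists d => // y hy.
by apply: h => i; [exact: (hy (inl i))|exact: (hy (inr i))].
Qed.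

Lemma continuous_bounded (g : pt -> R) r : pt_continuous g ->
  exists M : R, forall x, bbox2 r x -> `|g x| <= M.
Proof.
move=> cg; have /compact_near_coveringP nc := @seg_box_compact r.
have [|M [_ hM]] := nc R (pinfty_nbhs R) (fun M v => `|g (pt_of v)| <= M) _.
  move=> v _; have [d d0 h] := ptcP cg (pt_of v) ltr01.
  exists ([set w | forall c, `|xc (pt_of w) c - xc (pt_of v) c| < d], [set M | `|g (pt_of v)| + 1 < M]).
    split => /=; first exact: pt_near.
    by exists (`|g (pt_of v)| + 1); split => //; exact: num_real.
  move=> [w M] [/= /h hw hM]; have := ler_normD (g (pt_of w) - g (pt_of v)) (g (pt_of v)).
  by rewrite subrK; move: hw hM; lra.
exists (M + 1) => x hx; have := hM (M + 1) (ltac:(by rewrite ltrDl)) (rv_of x) (rv_of_box hx).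
by rewrite rv_ofK.
Qed.

Lemma continuous_uniform (g : pt -> R) r e : pt_continuous g -> (forall x, ~ bbox2 r x -> g x = 0) -> 0 < e ->
  exists2 d : R, 0 < d & forall x y, (forall c, `|xc y c - xc x c| < d) -> `|g y - g x| < e.
Proof.
move=> cg g0 e0; have /compact_near_coveringP nc := @seg_box_compact (r + 1).
have [|d /= d0 hd] := nc R (0 : R)^'+ (fun d v => forall y, (forall c, `|xc y c - xc (pt_of v) c| < d) ->
   `|g y - g (pt_of v)| < e) _.
  move=> v _; have e2 : 0 < e / 2 by rewrite divr_gt0.
  have [d d0 h] := ptcP cg (pt_of v) e2; have d2 : 0 < d / 2 by rewrite divr_gt0.
  exists ([set w | forall c, `|xc (pt_of w) c - xc (pt_of v) c| < d / 2], [set t | t < d / 2]).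
    split => /=; first exact: pt_near.
    exact: nbhs_right_lt.
  move=> [w t] [/= hw ht] y hy.
  have h1 : `|g (pt_of w) - g (pt_of v)| < e / 2 by apply: h => c; have := hw c; lra.
  have h2 : `|g y - g (pt_of v)| < e / 2.
    apply: h => c; have := ler_distD (xc (pt_of w) c) (xc y c) (xc (pt_of v) c).
    by have := hw c; have := hy c; lra.
  have := ler_distD (g (pt_of v)) (g y) (g (pt_of w)); rewrite [`|g (pt_of v) - _|]distrC.
  by move: h1 h2; lra.
pose dd := Num.min (d / 2) 1; have dd0 : 0 < dd by rewrite lt_min ltr01 divr_gt0.
exists dd => // x y hxy.
have ddd : dd < d by rewrite /dd gt_min (_ : d / 2 < d)//; lra.
have [hx|hx] := pselect (bbox2 (r + 1) x).
  have := hd dd _ dd0 (rv_of x) (rv_of_box hx) y; rewrite rv_ofK; apply => //.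
  by rewrite /ball_ /= sub0r normrN gtr0_norm.
have hx' : ~ bbox2 r x.
  by move=> /bbox2P h; apply: hx; apply/bbox2P => c; have := h c; lra.
have hy' : ~ bbox2 r y.
  move=> /bbox2P h; apply: hx; apply/bbox2P => c; have := h c; have := hxy c.
  have := ler_distD (xc y c) (xc x c) 0; rewrite !subr0 [`|xc x c - _|]distrC.
  have : dd <= 1 by rewrite /dd ge_min lexx orbT.
  lra.
by rewrite !g0// subrr normr0.
Qed.

Lemma continuous_bx2 (g : pt -> R) r : pt_continuous g -> (forall x, ~ bbox2 r x -> g x = 0) -> bx2 g.
Proof.
move=> cg g0; have [M hM] := continuous_bounded r cg; exists r; split => //.
  exact: continuous_measurable2.
exists `|M| => x; have [/hM h|/g0 ->] := pselect (bbox2 r x); last by rewrite normr0.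
exact: le_trans h (ler_norm _).
Qed.

End Compactness.

(** * Real test functions with vanishing moments *)

Section RealTests.
Variables (R : realType) (n m s1 s2 : nat).
Local Notation pt := (pt R n m).
Local Notation P := (@leb2 R n m).
Local Notation hp := (boxes_pt R n m).

Lemma bx1_mono k (g : k.-tuple R -> R) (al : k.-tuple nat) : bx1 g -> bx1 (fun x => g x * mono al x).
Proof.
move=> [r [mg [M hM] g0]]; exists r; split.
- by apply: measurable_funM => //; exact: measurable_mono.
- exists (M * \prod_(i < k) (`|r|) ^+ tnth al i) => x.
  have M0 : 0 <= M by exact: le_trans (hM x).
  have [hx|hx] := pselect (bbox r x); last first.
    by rewrite g0// mul0r normr0 mulr_ge0// prodr_ge0// => i _; rewrite exprn_ge0.
  rewrite normrM ler_pM// normr_prod; apply: ler_prod => i _.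
  rewrite normr_ge0 normrX lerXn2r ?nnegrE//; exact: le_trans (hx i) (ler_norm _).
- by move=> x /g0 ->; rewrite mul0r.
Qed.

Definition mom1 (g : pt -> R) := forall x2 (al : n.-tuple nat), (mabs al <= s1)%N ->
  \int[@lebn R n]_x1 (g (x1, x2) * mono al x1) = 0.
Definition mom2 (g : pt -> R) := forall x1 (al : m.-tuple nat), (mabs al <= s2)%N ->
  \int[@lebn R m]_x2 (g (x1, x2) * mono al x2) = 0.
Definition rD (g : pt -> R) := [/\ smooth g, bx2 g, mom1 g & mom2 g].

Lemma rD_ext f g : (forall x, f x = g x) -> rD f -> rD g.
Proof. by move=> /funext ->. Qed.

Lemma rD_lin (a b : R) f g : rD f -> rD g -> rD (fun x => a * f x + b * g x).
Proof.
move=> [sf bf f1 f2] [sg bg g1 g2]; split.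
- exact: smooth_lin.
- by apply: (bxdD hp); exact: bxdZ.
- move=> x2 al hal.
  have b1 := bx1_mono al (bxd_section2 bf x2); have b2 := bx1_mono al (bxd_section2 bg x2).
  rewrite (Rint_eq _ (g := fun x1 => a * (f (x1, x2) * mono al x1) + b * (g (x1, x2) * mono al x1))); last first.
    by move=> x; ring.
  have hn := boxes_n R n.
  rewrite (RintD hn (bxdZ _ b1) (bxdZ _ b2)) (RintZ hn _ b1) (RintZ hn _ b2) f1// g1//.
  by rewrite !mulr0 addr0.
- move=> x1 al hal.
  have b1 := bx1_mono al (bxd_section1 bf x1); have b2 := bx1_mono al (bxd_section1 bg x1).
  rewrite (Rint_eq _ (g := fun x2 => a * (f (x1, x2) * mono al x2) + b * (g (x1, x2) * mono al x2))); last first.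
    by move=> x; ring.
  have hn := boxes_n R m.
  rewrite (RintD hn (bxdZ _ b1) (bxdZ _ b2)) (RintZ hn _ b1) (RintZ hn _ b2) f2// g2//.
  by rewrite !mulr0 addr0.
Qed.

Lemma rD0 : rD (fun=> 0).
Proof.
split; first exact/ntc_smooth/ntc_0; first exact: bxd0.
  by move=> x2 al _; under eq_Rintegral do rewrite mul0r; rewrite Rintegral_cst// mul0r.
by move=> x2 al _; under eq_Rintegral do rewrite mul0r; rewrite Rintegral_cst// mul0r.
Qed.

Lemma rD_scale a f : rD f -> rD (fun x => a * f x).
Proof. by move=> rf; apply: rD_ext (rD_lin a 0 rf rf) => x; rewrite mul0r addr0. Qed.

Lemma rD_add f g : rD f -> rD g -> rD (fun x => f x + g x).
Proof. by move=> rf rg; apply: rD_ext (rD_lin 1 1 rf rg) => x; rewrite !mul1r. Qed.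

Lemma rD_sub f g : rD f -> rD g -> rD (fun x => f x - g x).
Proof. by move=> rf rg; apply: rD_ext (rD_lin 1 (-1) rf rg) => x; rewrite mul1r mulN1r. Qed.

Lemma rD_sum (I : eqType) (s : seq I) (F : I -> pt -> R) : (forall i, i \in s -> rD (F i)) ->
  rD (fun x => \sum_(i <- s) F i x).
Proof.
elim: s => [|i s IH] h; first by apply: rD_ext rD0 => x; rewrite big_nil.
have r1 : rD (F i) by apply: h; rewrite mem_head.
have r2 : rD (fun x => \sum_(i <- s) F i x) by apply: IH => j js; apply: h; rewrite inE js orbT.
by apply: rD_ext (rD_add r1 r2) => x; rewrite big_cons.
Qed.

End RealTests.

Section OpMoments.
Variable R : realType.

Lemma bxd_loc d (T : measurableType d) (B : R -> set T) (g h : T -> R) : bxd B g ->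
  measurable_fun setT h -> (forall r, exists M : R, forall x, B r x -> `|h x| <= M) ->
  bxd B (fun x => g x * h x).
Proof.
move=> [r [mg [M hM] g0]] mh lh; have [N hN] := lh r; exists r; split.
- exact: measurable_funM.
- exists (M * `|N|) => x; have M0 : 0 <= M by exact: le_trans (hM x).
  have [hx|hx] := pselect (B r x); last by rewrite g0// mul0r normr0 mulr_ge0.
  rewrite normrM; apply: ler_pM => //; exact: le_trans (hN x hx) (ler_norm _).
- by move=> x /g0 ->; rewrite mul0r.
Qed.

Lemma mono_loc k (al : k.-tuple nat) r : exists M : R, forall x : k.-tuple R, bbox r x -> `|mono al x| <= M.
Proof.
exists (\prod_(i < k) (`|r|) ^+ tnth al i) => x hx; rewrite normr_prod; apply: ler_prod => i _.
by rewrite normr_ge0 normrX lerXn2r ?nnegrE//; exact: le_trans (hx i) (ler_norm _).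
Qed.

Lemma Op2_swap n m K1 K2 (g : pt R n m -> R) x : kern K1 -> kern K2 -> bx2 g ->
  Op2 K1 K2 g x = Op2 K2 K1 (fun z => g (z.2, z.1)) (x.2, x.1).
Proof.
move=> k1 k2 bg.
have b : bx2 (fun y : pt R n m => K1 x.1 y.1 * K2 x.2 y.2 * g y).
  by apply: bxd_ext (bx_K1 x.1 k1 (bx2_K2 x.2 k2 bg)) => y; rewrite mulrA.
have b' := bx2_swap b.
rewrite /Op2 (Rint_pt b) (Rint_eq _ (g := fun z => (fun z : pt R m n => K1 x.1 z.2 * K2 x.2 z.1 * g (z.2, z.1)) z)); last first.
  by move=> z /=; ring.
by rewrite (Rint_pt_swap b').
Qed.

(** By Fubini the kernel K1 turns a moment of the output into c1 times a moment of g. The case c1 =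
    0 is that of the kernels A; with c1 = 1 the approximate identity hands on the moments of g. *)
Lemma Op2_mom n m s1 K1 K2 (g : pt R n m -> R) (c1 : R) : kern K1 -> kern K2 -> bx2 g ->
  (forall y (al : n.-tuple nat), (mabs al <= s1)%N -> \int[@lebn R n]_x (K1 x y * mono al x) = c1 * mono al y) ->
  c1 = 0 \/ mom1 s1 g -> mom1 s1 (Op2 K1 K2 g).
Proof.
move=> k1 k2 bg h1 z1 x2 al hal.
have hn := boxes_n R n; have hm := boxes_n R m.
have b2 := kern_op_r k2 bg.
pose G (z : pt R n m) := \int[@lebn R m]_y (K2 z.2 y * g (z.1, y)).
have bG : bx1 (fun y1 => G (y1, x2)) := bxd_section2 b2 x2.
have bGm : bx1 (fun y1 => mono al y1 * G (y1, x2)).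
  by apply: bxd_ext (bx1_mono al bG) => y; rewrite mulrC.
have mfst k : measurable_fun setT (fun z : n.-tuple R * k.-tuple R => mono al z.1).
  by apply: (measurableT_comp (f := mono al)) => //; exact: measurable_mono.
have lfst k r : exists M : R, forall x : n.-tuple R * k.-tuple R, bbox2 r x -> `|mono al x.1| <= M.
  by have [M hM] := mono_loc al r; exists M => x [/hM].
have bF : bx2 (fun z : n.-tuple R * n.-tuple R => K1 z.1 z.2 * mono al z.1 * G (z.2, x2)).
  by apply: bxd_ext (bxd_loc (kern_bx2 k1 bG) (mfst n) (lfst n)) => z; rewrite mulrAC.
have -> : \int[@lebn R n]_x1 (Op2 K1 K2 g (x1, x2) * mono al x1) =
   \int[@lebn R n]_x1 \int[@lebn R n]_y1 (K1 x1 y1 * mono al x1 * G (y1, x2)).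
  apply: Rint_eq => x1; rewrite (Op2_iter k1 k2 (x1, x2) bg) /= -(RintZr hn).
    by apply: Rint_eq => y1; rewrite mulrAC.
  exact: bxd_mul (kern_bx x1 k1) bG.
rewrite (Rint_swap (mu := @lebn R n) (nu := @lebn R n) hn hn bF).
have -> : \int[@lebn R n]_y1 \int[@lebn R n]_x1 (K1 x1 y1 * mono al x1 * G (y1, x2)) =
    \int[@lebn R n]_y1 (c1 * (mono al y1 * G (y1, x2))).
  apply: Rint_eq => y1; rewrite (RintZr hn); last exact: bx1_mono (kern_bx y1 (kern_tr k1)).
  by rewrite h1// mulrA.
rewrite (RintZ hn _ bGm); case: z1 => [->|m1]; first by rewrite mul0r.
have bH : bx2 (fun z : pt R n m => K2 x2 z.2 * (mono al z.1 * g z)).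
  by apply: (bx2_K2 _ k2); apply: bxd_ext (bxd_loc bg (mfst m) (lfst m)) => z; rewrite mulrC.
have -> : \int[@lebn R n]_y1 (mono al y1 * G (y1, x2)) = \int[@leb2 R n m]_z (K2 x2 z.2 * (mono al z.1 * g z)).
  rewrite (Rint_pt bH); apply: Rint_eq => y1 /=; rewrite -(RintZ hm); last first.
    exact: bxd_mul (kern_bx x2 k2) (bxd_section1 bg y1).
  by apply: Rint_eq => y2; ring.
rewrite (Rint_pt_swap bH) (Rint_eq _ (g := fun=> 0)); first by rewrite Rintegral_cst// mul0r mulr0.
move=> y2 /=; rewrite (RintZ hn); last first.
  by apply: bxd_ext (bx1_mono al (bxd_section2 bg y2)) => y; rewrite mulrC.
by rewrite (Rint_eq _ (g := fun x => g (x, y2) * mono al x)) ?m1 ?mulr0// => x; rewrite mulrC.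
Qed.

Lemma rD_Op2 n m s1 s2 K1 K2 (g : pt R n m -> R) (c1 c2 : R) : skern K1 -> skern K2 -> bx2 g ->
  (forall y (al : n.-tuple nat), (mabs al <= s1)%N -> \int[@lebn R n]_x (K1 x y * mono al x) = c1 * mono al y) ->
  (forall y (al : m.-tuple nat), (mabs al <= s2)%N -> \int[@lebn R m]_x (K2 x y * mono al x) = c2 * mono al y) ->
  c1 = 0 \/ mom1 s1 g -> c2 = 0 \/ mom2 s2 g -> rD s1 s2 (Op2 K1 K2 g).
Proof.
move=> sk1 sk2 bg h1 h2 z1 z2.
have k1 := skern_kern sk1; have k2 := skern_kern sk2.
split.
- exact: ntc_smooth (ntc_Op2 sk1 sk2 bg).
- exact: bx2_Op2.
- exact: Op2_mom z1.
- move=> x1 al hal.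
  have H : mom1 s2 (Op2 K2 K1 (fun z => g (z.2, z.1))).
    by apply: (Op2_mom k2 k1 (bx2_swap bg) h2); case: z2 => [->|mg2]; [left|right].
  by rewrite -[RHS](H x1 al hal); apply: Rint_eq => x2; rewrite (Op2_swap (x1, x2) k1 k2 bg).
Qed.

End OpMoments.

(** * Building smooth atoms *)

Section AtomBuilder.
Variables (R : realType) (n m : nat).
Hypotheses (n0 : (0 < n)%N) (m0 : (0 < m)%N).
Variables (p : R) (s1 s2 : nat).
Hypothesis p0 : 0 < p.
Local Notation pt := (pt R n m).
Local Notation P := (@leb2 R n m).
Local Notation hp := (boxes_pt R n m).

Definition rC (g : pt -> R) : pt -> R[i] := fun x => Complex (g x) 0.

Lemma cmod_rC g x : cmod (rC g x) ^+ 2 = g x ^+ 2.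
Proof.
by rewrite /cmod /cre /cim /= expr0n addr0 sqrtr_sqr real_normK ?num_real.
Qed.

Lemma L2sq_rC g : bx2 g -> L2sq (rC g) = (\int[P]_x g x ^+ 2)%:E.
Proof.
move=> bg; rewrite /L2sq; under eq_integral do rewrite cmod_rC.
rewrite /Rintegral fineK//; apply: (integrable_fin_num measurableT).
exact: (bxd_integrable hp (bxd_sqr bg)).
Qed.

Lemma cmeasurable_rC g : measurable_fun setT g -> cmeasurable (rC g).
Proof. by move=> mg; split => //=; exact: measurable_cst. Qed.

Lemma ereal_int0 k (D : set (k.-tuple R)) (f : k.-tuple R -> R) : bx1 f ->
  (forall x, ~ D x -> f x = 0) -> \int[@lebn R k]_x f x = 0 -> (\int[@lebn R k]_(x in D) (f x)%:E = 0)%E.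
Proof.
move=> bf f0 h; rewrite integral_mkcond.
have -> : (fun x => (f x)%:E) \_ D = (fun x => (f x)%:E).
  apply/funext => x; rewrite patchE; case: ifP => // /negP hD; rewrite f0//.
  by apply: contra_not hD; rewrite inE.
rewrite -[LHS]fineK; first by rewrite -/(Rintegral _ _ _) h.
by apply: (integrable_fin_num measurableT); exact: (bxd_integrable (boxes_n R k) bf).
Qed.

Lemma int0E d (T : measurableType d) (mu : {measure set T -> \bar R}) (D : set T) (h : T -> R) :
  (\int[mu]_(x in D) (0 * h x)%:E = 0)%E.
Proof. by under eq_integral do rewrite mul0r; exact: integral0. Qed.

Lemma smooth0 : smooth (fun _ : pt => 0 : R).
Proof. exact/ntc_smooth/ntc_0. Qed.

Lemma rD_Dss g : rD s1 s2 g -> Dss s1 s2 (rC g).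
Proof.
move=> [sg bg g1 g2]; split; [split; [exact: sg|split]|split].
- exact: smooth0.
- have [r [_ _ h]] := bg; exists r => x hx; rewrite /rC h// => -[h1 h2].
  by case: hx => [[j]|[j]]; rewrite ltNge ?h1 ?h2.
- move=> x2 al hal; split; last exact: int0E.
  apply: (ereal_int0 (D := setT) (f := fun x1 => g (x1, x2) * mono al x1)); [|by move=> x /(_ I)|exact: g1].
  exact: (bx1_mono al (bxd_section2 bg x2)).
- move=> x1 al hal; split; last exact: int0E.
  apply: (ereal_int0 (D := setT) (f := fun x2 => g (x1, x2) * mono al x2)); [|by move=> x /(_ I)|exact: g2].
  exact: (bx1_mono al (bxd_section1 bg x1)).
Qed.

Lemma esqrt_le (x : \bar R) (c : R) : 0 <= c -> (x <= (c ^+ 2)%:E)%E -> (esqrt x <= c%:E)%E.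
Proof.
move=> c0; case: x => [x||] //=; rewrite lee_fin => h.
by rewrite lee_fin -[leRHS]ger0_norm// -sqrtr_sqr; exact: ler_wsqrtr.
Qed.

Lemma esum_seq_le (I : choiceType) (S : set I) (L : seq I) (h : I -> R) (c : R) :
  uniq L -> (forall i, 0 <= h i) -> (forall i, i \notin L -> h i = 0) -> \sum_(i <- L) h i <= c ->
  (\esum_(i in S) (h i)%:E <= c%:E)%E.
Proof.
move=> uL h0 hL hc; apply: ub_ereal_sup => _ [A [fA AS] <-].
rewrite fsbig_finite//= sumEFin lee_fin; apply: le_trans hc.
rewrite (bigID (fun i => i \in L)) /= [X in _ + X]big1; last by move=> i /hL.
rewrite addr0 -big_filter; apply: sum_sub_uniq => //; first by rewrite filter_uniq.
by move=> i; rewrite mem_filter => /andP[].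
Qed.

Definition atom_scale (O : set pt) (b : R) : R := (b * fine (P O) `^ (p^-1 - 2^-1))^-1.

(** Maximal rectangles outside [L] get the component 0. So (AI) holds exactly as soon as the partial
    sum contains [L], and the sum over all maximal rectangles in (AII) is a sum over [L]. *)
Lemma build_atom (O : set pt) (L : seq (drect n m)) (g : drect n m -> pt -> R) (b : R) :
  open_set O -> (P O < +oo)%E -> 0 < fine (P O) -> uniq L -> (forall Q, Q \in L -> maxrect O Q) ->
  (forall Q, Q \in L -> rD s1 s2 (g Q)) ->
  (forall Q, Q \in L -> forall x, ~ dbl_rect_set Q x -> g Q x = 0) ->
  (forall x, ~ O x -> \sum_(Q <- L) g Q x = 0) -> 0 < b ->
  \int[P]_x (\sum_(Q <- L) g Q x) ^+ 2 <= b ^+ 2 ->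
  \sum_(Q <- L) \int[P]_x (g Q x) ^+ 2 <= b ^+ 2 ->
  atom p s1 s2 (rC (fun x => atom_scale O b * \sum_(Q <- L) g Q x)).
Proof.
move=> oO fO V0 uL Lmax gD gsupp gO b0 hb1 hb2.
set V := fine (P O) in V0 *; set k := atom_scale O b.
have W0 : 0 < V `^ (p^-1 - 2^-1) by exact: powR_gt0.
have k0 : 0 < k by rewrite invr_gt0 mulr_gt0.
have kb : k * b = V `^ (2^-1 - p^-1).
  rewrite /k /atom_scale -/V -opprB powRN invfM mulrAC mulVf ?mul1r ?invrK ?gt_eqF//.
pose h Q x := if Q \in L then k * g Q x else 0.
have bh Q : bx2 (h Q).
  rewrite /h; have [QL|QL] := boolP (Q \in L); last exact: bxd0.
  by have [_ bg _ _] := gD Q QL; exact: bxdZ.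
have rh Q : rD s1 s2 (h Q).
  rewrite /h; have [QL|QL] := boolP (Q \in L); last exact: rD0.
  exact: rD_scale (gD Q QL).
have rS : rD s1 s2 (fun x => \sum_(Q <- L) g Q x) by exact: rD_sum.
have [_ bS _ _] := rS.
exists O, (fun Q => rC (h Q)); rewrite -/V; split => //.
- by apply: cmeasurable_rC; apply: measurable_funM => //; exact: (bxd_measurable bS).
- by move=> x /gO; rewrite /rC => ->; rewrite mulr0.
split.
- move=> Q QO; have hs x : ~ dbl_rect_set Q x -> h Q x = 0.
    by move=> hx; rewrite /h; case: ifP => // QL; rewrite gsupp ?mulr0.
  have [_ _ h1 h2] := rh Q; split.
  + by apply: cmeasurable_rC; exact: (bxd_measurable (bh Q)).
  + by move=> x /hs e; rewrite /rC e.
  + move=> x2 al _ hal; split; last exact: int0E.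
    apply: (ereal_int0 (f := fun x1 => h Q (x1, x2) * mono al x1)); [exact: (bx1_mono al (bxd_section2 (bh Q) x2))| |exact: h1].
    by move=> x1 hx1; rewrite hs ?mul0r// => -[].
  + move=> x1 al _ hal; split; last exact: int0E.
    apply: (ereal_int0 (f := fun x2 => h Q (x1, x2) * mono al x2)); [exact: (bx1_mono al (bxd_section1 (bh Q) x1))| |exact: h2].
    by move=> x2 hx2; rewrite hs ?mul0r// => -[].
- move=> e e0; exists L; split => // s us Ls smax.
  have E x : rC (fun x => k * \sum_(Q <- L) g Q x) x - \sum_(Q <- s) rC (h Q) x = 0.
    have -> : \sum_(Q <- s) rC (h Q) x = rC (fun x => \sum_(Q <- s) h Q x) x.
      elim: (s) => [|Q s' IH]; first by rewrite /rC !big_nil.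
      by rewrite big_cons IH /rC big_cons /=; apply/eqP; rewrite eq_complex /= addr0 !eqxx.
    rewrite (_ : rC (fun x => \sum_(Q <- s) h Q x) x = rC (fun x => k * \sum_(Q <- L) g Q x) x) ?subrr//.
    rewrite /rC; congr (Complex _ _); rewrite mulr_sumr.
    have pe : perm_eq L [seq Q <- s | Q \in L].
      apply: uniq_perm => //; first by rewrite filter_uniq.
      by move=> Q; rewrite mem_filter; case: (boolP (Q \in L)) => //= /Ls ->.
    by rewrite (perm_big _ pe) /= big_filter [RHS]big_mkcond.
  rewrite /L2norm /L2sq (_ : (fun x => _) = cst 0%E).
    by rewrite integral_cst// mul0e /= sqrtr0 lee_fin ltW.
  apply/funext => x /=; rewrite E /cmod /cre /cim /= expr0n addr0 sqrtr0 expr0n//.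
- apply: esqrt_le; first exact: powR_ge0.
  rewrite L2sq_rC; last exact: bxdZ.
  rewrite lee_fin -kb exprMn.
  under eq_Rintegral do rewrite exprMn.
  rewrite (RintZ hp _ (bxd_sqr bS)); apply: ler_wpM2l => //; exact: sqr_ge0.
- apply: esqrt_le; first exact: powR_ge0.
  have -> : (fun Q => L2sq (rC (h Q))) = (fun Q => (\int[P]_x h Q x ^+ 2)%:E).
    by apply/funext => Q; rewrite L2sq_rC.
  apply: (@esum_seq_le (drect n m) _ L (fun Q => \int[P]_x h Q x ^+ 2) _ uL).
  + by move=> Q; apply: Rintegral_ge0 => x _; exact: sqr_ge0.
  + move=> Q /negbTE QL; rewrite /h QL; under eq_Rintegral do rewrite expr0n.
    by rewrite Rintegral_cst// mul0r.
  rewrite -kb exprMn; apply: (@le_trans _ _ (k ^+ 2 * \sum_(Q <- L) \int[P]_x (g Q x) ^+ 2)); last first.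
    by apply: ler_wpM2l => //; exact: sqr_ge0.
  rewrite mulr_sumr big_seq [leRHS]big_seq; apply: ler_sum => Q QL.
  rewrite /h QL; under eq_Rintegral do rewrite exprMn.
  by have [_ bg _ _] := gD Q QL; rewrite (RintZ hp _ (bxd_sqr bg)).
Qed.

(** These are the structural properties of a functional that the estimates use. Two instances occur:
    g |-> ||T g|| in [pnu_nuT] and the L^2 norm in [pnu_nrm2]. *)
Record pnu (nu : (pt -> R) -> R) : Prop := {
  pnu_ge0 : forall g, rD s1 s2 g -> 0 <= nu g;
  pnu_Z : forall c g, rD s1 s2 g -> nu (fun x => c * g x) <= `|c| * nu g;
  pnu_D : forall f g, rD s1 s2 f -> rD s1 s2 g ->
    nu (fun x => f x + g x) `^ p <= nu f `^ p + nu g `^ p }.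

(* Bound on the finite smooth atoms, restricted to sets O that contain a rectangle of F: this lower
   bound on the measure of O is what makes the hypothesis true for the L^2 norm. *)
Definition abd (nu : (pt -> R) -> R) (M : R) (F : seq (drect n m)) :=
  forall (O : set pt) (L : seq (drect n m)) (g : drect n m -> pt -> R) (b : R),
  open_set O -> (P O < +oo)%E -> (exists2 Q, Q \in F & (rect_set Q : set pt) `<=` O) ->
  uniq L -> (forall Q, Q \in L -> maxrect O Q) ->
  (forall Q, Q \in L -> rD s1 s2 (g Q)) ->
  (forall Q, Q \in L -> forall x, ~ dbl_rect_set Q x -> g Q x = 0) ->
  (forall x, ~ O x -> \sum_(Q <- L) g Q x = 0) -> 0 < b ->
  \int[P]_x (\sum_(Q <- L) g Q x) ^+ 2 <= b ^+ 2 ->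
  \sum_(Q <- L) \int[P]_x (g Q x) ^+ 2 <= b ^+ 2 ->
  nu (fun x => \sum_(Q <- L) g Q x) <= M * b * fine (P O) `^ (p^-1 - 2^-1).

Lemma fine_leb2_ge (O : set pt) Q : measurable O -> (P O < +oo)%E -> rect_set Q `<=` O -> rvol R Q <= fine (P O).
Proof.
move=> mO fO h; rewrite -lee_fin fineK ?ge0_fin_numE// -leb2_rect.
by apply: le_measure; rewrite ?inE//; exact: measurable_rect.
Qed.

Lemma abd_of_atoms nu M F : pnu nu ->
  (forall g, rD s1 s2 g -> atom p s1 s2 (rC g) -> nu g <= M) -> abd nu M F.
Proof.
move=> hnu hM O L g b oO fO [Q _ QO] uL Lmax gD gsupp gO b0 hb1 hb2.
have V0 : 0 < fine (P O).
  apply: lt_le_trans (fine_leb2_ge (open_measurable2 oO) fO QO); exact: rvol_gt0.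
have at_ := build_atom oO fO V0 uL Lmax gD gsupp gO b0 hb1 hb2.
have rS : rD s1 s2 (fun x => \sum_(Q <- L) g Q x) by exact: rD_sum.
have W0 : 0 < fine (P O) `^ (p^-1 - 2^-1) by exact: powR_gt0.
have c0 : 0 < b * fine (P O) `^ (p^-1 - 2^-1) by rewrite mulr_gt0.
have h1 := hM _ (rD_scale (atom_scale O b) rS) at_.
have := pnu_Z hnu (b * fine (P O) `^ (p^-1 - 2^-1)) (rD_scale (atom_scale O b) rS).
have -> : (fun x => b * fine (P O) `^ (p^-1 - 2^-1) * (atom_scale O b * \sum_(Q <- L) g Q x)) =
   (fun x => \sum_(Q <- L) g Q x).
  by apply/funext => x; rewrite mulrA mulfV ?mul1r ?gt_eqF.
move=> h2; apply: le_trans h2 _; rewrite gtr0_norm// mulrC -[leRHS]mulrA.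
by apply: ler_wpM2r => //; exact: ltW.
Qed.

Lemma leb2_nb2_half Q : (P (nb2 2^-1 Q) <= (2 ^+ n * 2 ^+ m * rvol R Q)%:E)%E.
Proof.
have h2 : (0 : R) <= 2^-1 by rewrite invr_ge0.
rewrite leb2_X; [|exact: measurable_nb|exact: measurable_nb].
apply: (@le_trans _ _ ((((1 + 2 * 2^-1) * dside R Q.1) ^+ n)%:E * (((1 + 2 * 2^-1) * dside R Q.2) ^+ m)%:E)%E).
  by apply: lee_pmul => //; exact: lebn_nb.
by rewrite -EFinM lee_fin mulfV// (_ : 1 + 1 = 2)// /rvol !exprMn le_eqVlt; apply/orP; left; apply/eqP; ring.
Qed.

(** The open set is the half neighbourhood of Q, and g itself is the only component, placed on a
    maximal rectangle Q' that contains Q: the double of Q' contains the whole open set because the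
    double of Q does. *)
Lemma rect_bound_pos nu M F (Q Q0 : drect n m) (g : pt -> R) (b : R) : abd nu M F ->
  Q0 \in F -> (rect_set Q0 : set pt) `<=` nb2 2^-1 Q -> rD s1 s2 g -> (forall x, ~ nb2 2^-1 Q x -> g x = 0) ->
  0 < b -> \int[P]_x g x ^+ 2 <= b ^+ 2 ->
  0 <= M -> 2^-1 <= p^-1 ->
  nu g <= M * b * (2 ^+ n * 2 ^+ m * rvol R Q) `^ (p^-1 - 2^-1).
Proof.
move=> hA Q0F Q0Q gD gs b0 hb M0 p2.
have oO := @open_nb2 R n m 2^-1 Q; have mO := open_measurable2 oO.
have hO := leb2_nb2_half Q.
have fO : (P (nb2 2^-1 Q) < +oo)%E by apply: le_lt_trans hO _; rewrite ltry.
have h2' : (0 : R) < 2^-1 by rewrite invr_gt0.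
have QO : (rect_set Q : set pt) `<=` nb2 2^-1 Q.
  by move=> x [x1 x2]; split; exact: sub_nb.
have [Q' mx b2] := exists_maxrect n0 m0 mO fO QO.
have := hA (nb2 2^-1 Q) [:: Q'] (fun=> g) b oO fO.
have E : (fun x => \sum_(Q <- [:: Q']) g x) = g by apply/funext => x; rewrite big_seq1.
rewrite E => H.
have {}H : nu g <= M * b * fine (P (nb2 2^-1 Q)) `^ (p^-1 - 2^-1).
  apply: H => //.
  - by exists Q0.
  - by move=> Q1; rewrite inE => /eqP ->.
  - move=> Q1; rewrite inE => /eqP -> x hx; apply: gs => -[x1 x2]; apply: hx.
    move/andP: b2 => [b1 b2]; split.
      by apply: (below_dbl b1); apply/dbl_cubeP => i; have /andP[/ltW -> ->] := x1 i.
    by apply: (below_dbl b2); apply/dbl_cubeP => i; have /andP[/ltW -> ->] := x2 i.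
  - by move=> x /gs; rewrite big_seq1.
  - by under eq_Rintegral do rewrite big_seq1.
  - by rewrite big_seq1.
apply: le_trans H _; apply: ler_wpM2l; first by rewrite mulr_ge0// ltW.
apply: ge0_ler_powR; rewrite ?subr_ge0// ?nnegrE ?fine_ge0//.
  by apply: mulr_ge0; [rewrite mulr_ge0// exprn_ge0|exact: ltW (rvol_gt0 _ _)].
by rewrite -lee_fin fineK// ge0_fin_numE.
Qed.

(** The size b in [abd] is strictly positive, so the L^2 norm is approached from above; the
    denominator K keeps the excess below e. *)
Lemma rect_bound nu M F (Q Q0 : drect n m) (g : pt -> R) : abd nu M F ->
  Q0 \in F -> (rect_set Q0 : set pt) `<=` nb2 2^-1 Q -> rD s1 s2 g ->
  (forall x, ~ nb2 2^-1 Q x -> g x = 0) -> 0 <= M -> 2^-1 <= p^-1 ->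
  nu g <= M * Num.sqrt (\int[P]_x g x ^+ 2) * (2 ^+ n * 2 ^+ m * rvol R Q) `^ (p^-1 - 2^-1).
Proof.
move=> hA Q0F Q0Q gD gs M0 p2; set W := _ `^ _.
have W0 : 0 <= W by exact: powR_ge0.
have I0 : 0 <= \int[P]_x g x ^+ 2 by apply: Rintegral_ge0 => x _; exact: sqr_ge0.
apply/ler_addgt0Pr => e e0.
pose K := M * W + 1; have K0 : 0 < K by rewrite ltr_wpDl// mulr_ge0.
pose b := Num.sqrt (\int[P]_x g x ^+ 2) + e / K.
have b0 : 0 < b by rewrite ltr_wpDl// ?sqrtr_ge0 ?divr_gt0.
apply: le_trans (rect_bound_pos hA Q0F Q0Q gD gs b0 _ M0 p2) _.
  rewrite -[leLHS]sqr_sqrtr// lerXn2r ?nnegrE ?sqrtr_ge0// ?(ltW b0)// lerDl divr_ge0// ltW//.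
rewrite -/W /b mulrDr mulrDl lerD2l.
rewrite (_ : M * (e / K) * W = e * (M * W / K)); last by ring.
by rewrite ger_pMr// ler_pdivrMr// mul1r lerDl.
Qed.

End AtomBuilder.

Lemma sum_regroup (R : realType) (I J : eqType) (s : seq I) (t : seq J) (k : I -> J) (X : I -> R) :
  uniq t -> (forall i, i \in s -> k i \in t) ->
  \sum_(j <- t) \sum_(i <- s | k i == j) X i = \sum_(i <- s) X i.
Proof.
move=> ut kt; under eq_bigr => j _ do rewrite big_mkcond.
rewrite exchange_big /= big_seq [RHS]big_seq; apply: eq_bigr => i is_.
rewrite (bigD1_seq (k i)) ?kt//= eqxx big1 ?addr0// => j; rewrite eq_sym => /negbTE ->//.
Qed.

Lemma sum_regroup2 (R : realType) (I J J' : eqType) (s : seq I) (t : seq J) (t' : seq J') (k : I -> J)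
    (k' : I -> J') (X : I -> R) : uniq t -> uniq t' ->
  (forall i, i \in s -> k i \in t) -> (forall i, i \in s -> k' i \in t') ->
  \sum_(j <- t) \sum_(j' <- t') \sum_(i <- s | (k i == j) && (k' i == j')) X i = \sum_(i <- s) X i.
Proof.
move=> ut ut' kt kt'; rewrite -(sum_regroup X ut kt); apply: eq_bigr => j _.
rewrite -[RHS]big_filter -(sum_regroup X ut' (k := k')); last by move=> i; rewrite mem_filter => /andP[_ /kt'].
by apply: eq_bigr => j' _; rewrite big_filter_cond.
Qed.

(** * Square functions of a piece of an atom *)

Section Sqsum.
Variables (R : realType) (n m : nat).
Local Notation pt := (pt R n m).
Local Notation P := (@leb2 R n m).
Local Notation hp := (boxes_pt R n m).

Lemma bx2_cube k (Q : dcube k) : bx1 (\1_(cube_set Q) : k.-tuple R -> R).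
Proof.
exists (\sum_i `|lo R Q i| + dside R Q); split => //.
- by apply: measurable_indic; exact: measurable_cube.
- by exists 1 => x; rewrite indicE; case: (_ \in _); rewrite ?normr1 ?normr0.
- move=> x hx; rewrite indicE memNset// => /cube_setP h; apply: hx => i.
  have : `|lo R Q i| <= \sum_i `|lo R Q i| by rewrite (bigD1 i)//= lerDl sumr_ge0.
  have a1 := ler_norm (lo R Q i); have a2 := ler_norm (- lo R Q i); rewrite normrN in a2.
  have := h i; have := ds_gt0 R Q; rewrite [`|tnth x i| <= _]ler_norml; move: a1 a2; lra.
Qed.

Lemma bx2_rect (Q : drect n m) : bx2 (\1_(rect_set Q) : pt -> R).
Proof.
apply: bxd_ext (bxd_prod (boxes_n R n) (boxes_n R m) (bx2_cube Q.1) (bx2_cube Q.2)) => x.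
rewrite !indicE; have [h1|h1] := pselect (cube_set Q.1 x.1); last first.
  by rewrite (memNset h1) mul0r memNset// => -[].
have [h2|h2] := pselect (cube_set Q.2 x.2); last first.
  by rewrite (memNset h2) mulr0 memNset// => -[].
by rewrite !mem_set ?mulr1//; split.
Qed.

Lemma sqr_sum_disj (I : eqType) (s : seq I) (h : I -> R) : uniq s ->
  (forall i j, i \in s -> j \in s -> i != j -> h i * h j = 0) ->
  (\sum_(i <- s) h i) ^+ 2 = \sum_(i <- s) h i ^+ 2.
Proof.
move=> us dj; rewrite expr2 mulr_suml big_seq [RHS]big_seq; apply: eq_bigr => i is_.
rewrite mulr_sumr (bigD1_seq i)//= big_seq_cond big1 ?addr0 ?expr2// => j /andP[js ji].
by apply: dj => //; rewrite eq_sym.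
Qed.

Lemma indic_disj (F : seq (drect n m)) (e f : int) (Q Q' : drect n m) (x : pt) :
  Q \in [seq Q <- F | (Q.1.1 == e) && (Q.2.1 == f)] ->
  Q' \in [seq Q <- F | (Q.1.1 == e) && (Q.2.1 == f)] -> Q != Q' ->
  (\1_(rect_set Q) x : R) * \1_(rect_set Q') x = 0.
Proof.
rewrite !mem_filter => /andP[/andP[/eqP e1 /eqP e2] _] /andP[/andP[/eqP e1' /eqP e2'] _] ne.
rewrite !indicE; have [[h1 h2]|h] := pselect (rect_set Q x); last by rewrite (memNset h) mul0r.
have [[h1' h2']|h'] := pselect (rect_set Q' x); last by rewrite (memNset h') mulr0.
have E1 := cube_uniq (etrans e1 (esym e1')) h1 h1'; have E2 := cube_uniq (etrans e2 (esym e2')) h2 h2'.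
by move: ne; rewrite (surjective_pairing Q) (surjective_pairing Q') E1 E2 eqxx.
Qed.

Variables (A1 : int -> n.-tuple R -> n.-tuple R -> R) (A2 : int -> m.-tuple R -> m.-tuple R -> R).
Variables (C1 C2 : R).
Hypotheses (C10 : 0 < C1) (C20 : 0 < C2).

(** Rectangles with the same pair of scales are disjoint. Summing those first turns the sum over F
    into a sum over scales, to which [Op2_E1] applies, and by disjointness the square of each
    partial sum is the sum of the squares. *)
Lemma synthesis (F : seq (drect n m)) (h : drect n m -> pt -> R) : uniq F ->
  (forall es, uniq es -> famE1 A1 es C1) -> (forall es, uniq es -> famE1 A2 es C2) ->
  (forall Q, bx2 (h Q)) ->
  \int[P]_x (\sum_(Q <- F) Op2 (A1 Q.1.1) (A2 Q.2.1) (fun y => \1_(rect_set Q) y * h Q y) x) ^+ 2 <=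
  C1 * C2 * \sum_(Q <- F) \int[P]_x (\1_(rect_set Q) x * h Q x) ^+ 2.
Proof.
move=> uF hA1 hA2 bh.
pose es := undup [seq q.1.1 | q <- F]; pose fs := undup [seq q.2.1 | q <- F].
have ues : uniq es by exact: undup_uniq.
have ufs : uniq fs by exact: undup_uniq.
have inE1 Q : Q \in F -> Q.1.1 \in es by move=> QF; rewrite mem_undup; exact: (map_f (fun q : drect n m => q.1.1) QF).
have inE2 Q : Q \in F -> Q.2.1 \in fs by move=> QF; rewrite mem_undup; exact: (map_f (fun q : drect n m => q.2.1) QF).
have bH Q : bx2 (fun y => \1_(rect_set Q) y * h Q y) by exact: bxd_mul (bx2_rect Q) (bh Q).
have [k1 _] := hA1 es ues; have [k2 _] := hA2 fs ufs.
pose g e f (y : pt) := \sum_(Q <- F | (Q.1.1 == e) && (Q.2.1 == f)) \1_(rect_set Q) y * h Q y.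
have bg e f : bx2 (g e f).
  by rewrite /g; under eq_fun do rewrite -big_filter; exact: (bxd_sum hp).
have := Op2_E1 (hA1 es ues) (hA2 fs ufs) (ltW C10) (ltW C20) bg.
have -> : (fun x => (\sum_(e <- es) \sum_(f <- fs) Op2 (A1 e) (A2 f) (g e f) x) ^+ 2) =
  (fun x => (\sum_(Q <- F) Op2 (A1 Q.1.1) (A2 Q.2.1) (fun y => \1_(rect_set Q) y * h Q y) x) ^+ 2).
  apply/funext => x; congr (_ ^+ 2); rewrite -(sum_regroup2 _ ues ufs inE1 inE2).
  apply: eq_bigr => e _; apply: eq_bigr => f _; rewrite /Op2 -[RHS]big_filter.
  rewrite (Rint_eq _ (g := fun y => \sum_(Q <- [seq Q <- F | (Q.1.1 == e) && (Q.2.1 == f)])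
     (A1 e x.1 y.1 * A2 f x.2 y.2 * (\1_(rect_set Q) y * h Q y)))); last first.
    by move=> y; rewrite /g -big_filter mulr_sumr.
  rewrite (Rint_sum hp); last by move=> Q; exact: bxd_mul (bx2_KK (k1 e) (k2 f) x) (bH Q).
  rewrite [LHS]big_seq [RHS]big_seq; apply: eq_bigr => Q.
  by rewrite mem_filter => /andP[/andP[/eqP -> /eqP ->] _].
move=> H; apply: le_trans H _; apply: ler_wpM2l; first by rewrite mulr_ge0// ltW.
rewrite -(sum_regroup2 _ ues ufs inE1 inE2) le_eqVlt; apply/orP; left; apply/eqP.
apply: eq_bigr => e _; apply: eq_bigr => f _; rewrite -big_filter.
rewrite -(Rint_sum hp); last by move=> Q; exact: bxd_sqr (bH Q).
apply: Rint_eq => y; rewrite /g -big_filter; apply: sqr_sum_disj; first exact: filter_uniq.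
by move=> Q Q' h1 h2 ne; rewrite mulrACA (indic_disj _ h1 h2 ne) mul0r.
Qed.

(** Dual to [synthesis]. The hypotheses concern only the scales that occur in F, so that the kernels
    may later be replaced by Taylor remainders on a restricted set of scales. *)
Lemma analysis (F : seq (drect n m)) (a : pt -> R) : uniq F -> L2f P a ->
  famE1 (fun e x y => A1 e y x) (undup [seq q.1.1 | q <- F]) C1 ->
  famE1 (fun e x y => A2 e y x) (undup [seq q.2.1 | q <- F]) C2 ->
  \sum_(Q <- F) \int[P]_x (\1_(rect_set Q) x * Op2 (A1 Q.1.1) (A2 Q.2.1) a x) ^+ 2 <=
  C1 * C2 * \int[P]_x (a x) ^+ 2.
Proof.
move=> uF La hA1 hA2.
set es := undup [seq q.1.1 | q <- F] in hA1; set fs := undup [seq q.2.1 | q <- F] in hA2.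
have ues : uniq es by exact: undup_uniq.
have ufs : uniq fs by exact: undup_uniq.
have inE1 Q : Q \in F -> Q.1.1 \in es by move=> QF; rewrite mem_undup; exact: (map_f (fun q : drect n m => q.1.1) QF).
have inE2 Q : Q \in F -> Q.2.1 \in fs by move=> QF; rewrite mem_undup; exact: (map_f (fun q : drect n m => q.2.1) QF).
pose D e f : set pt := bU [seq Q <- F | (Q.1.1 == e) && (Q.2.1 == f)] (@rect_set R n m).
have DE e f x : (\1_(D e f) x : R) = \sum_(Q <- [seq Q <- F | (Q.1.1 == e) && (Q.2.1 == f)]) \1_(rect_set Q) x.
  have [hx|hx] := pselect (D e f x); last first.
    rewrite indicE (memNset hx) big_seq big1// => Q hQ; rewrite indicE memNset// => h.
    by apply: hx; exists Q.
  have [Q hQ Qx] := hx; rewrite (bigD1_seq Q)/= ?filter_uniq// !indicE !mem_set// big_seq_cond big1 ?addr0//.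
  move=> Q' /andP[hQ' ne]; have := indic_disj x hQ' hQ ne.
  by rewrite [X in _ * X]indicE mem_set// mulr1.
have bD e f : bx2 (\1_(D e f) : pt -> R).
  by apply: (bxd_ext (f := fun x => \sum_(Q <- [seq Q <- F | (Q.1.1 == e) && (Q.2.1 == f)]) \1_(rect_set Q) x));
     [move=> x; rewrite DE|apply: (bxd_sum hp) => Q; exact: bx2_rect].
have := Op2_E2 hA1 hA2 C10 C20 bD La; apply: le_trans.
have [k1t _] := hA1; have [k2t _] := hA2.
have k1 e : kern (A1 e) := kern_tr (k1t e); have k2 e : kern (A2 e) := kern_tr (k2t e).
rewrite -(sum_regroup2 _ ues ufs inE1 inE2) le_eqVlt; apply/orP; left; apply/eqP.
apply: eq_bigr => e _; apply: eq_bigr => f _; rewrite -big_filter.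
have bQ Q : bx2 (fun x => \1_(rect_set Q) x * Op2 (A1 e) (A2 f) a x) by exact: Op2_bounded (bx2_rect Q).
rewrite big_seq (eq_bigr (fun Q => \int[P]_x (\1_(rect_set Q) x * Op2 (A1 e) (A2 f) a x) ^+ 2)); last first.
  by move=> Q; rewrite mem_filter => /andP[/andP[/eqP -> /eqP ->] _].
rewrite -big_seq -(Rint_sum hp); last by move=> Q; exact: bxd_sqr (bQ Q).
apply: Rint_eq => x; rewrite DE mulr_suml; symmetry; apply: sqr_sum_disj; first exact: filter_uniq.
by move=> Q Q' h1 h2 ne; rewrite mulrACA (indic_disj _ h1 h2 ne) mul0r.
Qed.

End Sqsum.

(** * Taylor remainders of the analysing kernels by size class *)

Section ClassKernels.
Variables (R : realType) (n s : nat) (C : R) (A B kap : int -> n.-tuple R -> n.-tuple R -> R).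
Hypothesis kp : kpack s C A B kap.
Local Notation X := (n.-tuple R).
Local Notation mu := (@lebn R n).
Local Notation ds Q := (dside R Q).
Implicit Types Q I : dcube n.

(* Number of generations from I up to the scale e, and 0 if I is already larger. *)
Definition ecls (e : int) I : nat := if (I.1 <= e)%R then `|(e - I.1)%R|%N else 0%N.
Definition cls Q I := ecls Q.1 I.

Lemma cls_exp Q I : (Q.1 <= (up (cls Q I) I).1)%R.
Proof. by rewrite /cls /ecls /=; case: ifP => h; lia. Qed.

(** The 2 adds up in sides of the enlarged cube: 1/2 for the doubling, 1/2 for the range of B and 1
    for the side of Q. *)
Lemma interact Q I (x y : X) : cube_set Q x -> dbl_cube_set I y ->
  (forall i, `|tnth x i - tnth y i| <= 2^-1 * 2 ^ Q.1) -> cube_set Q `<=` (nb 2 (up (cls Q I) I) : set X).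
Proof.
move=> /cube_setP hx hy hxy z /cube_setP hz i.
have /dbl_cubeP/(_ i) := below_dbl (below_up (cls Q I) I) hy.
have : ds Q <= ds (up (cls Q I) I) by rewrite /dside ler_weXz2l ?ler1n// cls_exp.
have := hxy i; have := hx i; have := hz i; rewrite -/(dside R Q) [`|_| <= _]ler_norml.
have := ds_gt0 R Q; lra.
Qed.

Definition dcenter I : X := [tuple lo R I i + 2^-1 * ds I | i < n].

Lemma dbl_cbox I : dbl_cube_set I `<=` cbox (dcenter I) (ds I).
Proof.
move=> x /dbl_cubeP h i; rewrite tnth_mktuple ler_norml; have := h i; have := ds_gt0 R I; lra.
Qed.

Lemma cbox_bbox (c : X) r : cbox c r `<=` bbox (\sum_i `|tnth c i| + r).
Proof.
move=> x h i; have := h i; have := ler_normD (tnth x i - tnth c i) (tnth c i); rewrite subrK.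
have : `|tnth c i| <= \sum_i `|tnth c i| by rewrite (bigD1 i)//= lerDl sumr_ge0.
lra.
Qed.

Lemma nb_bbox a Q : exists r, nb a Q `<=` (bbox r : set X).
Proof.
exists (\sum_i `|tnth [tuple lo R Q i | i < n] i| + (1 + `|a|) * ds Q) => x h; apply: cbox_bbox => i.
rewrite tnth_mktuple ler_norml; have := h i; have := ds_gt0 R Q.
have : a * ds Q <= `|a| * ds Q by rewrite ler_wpM2r ?ler_norm// ltW// ds_gt0.
have : 0 <= `|a| * ds Q by rewrite mulr_ge0// ltW// ds_gt0.
lra.
Qed.

Lemma bx1_indic (D : set X) r : measurable D -> D `<=` bbox r -> bx1 (\1_D : X -> R).
Proof.
move=> mD h; exists r; split; first exact: measurable_indic.
- by exists 1 => x; rewrite indicE; case: (_ \in _); rewrite ?normr1 ?normr0.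
- by move=> x hx; rewrite indicE memNset// => /h.
Qed.

Lemma Rint_indic_le (D : set X) V : measurable D -> (mu D <= V%:E)%E -> \int[mu]_x \1_D x <= V.
Proof.
move=> mD h; rewrite /Rintegral integral_indic// setIT -lee_fin fineK// ge0_fin_numE//.
by apply: le_lt_trans h _; rewrite ltry.
Qed.

(** The squared operator norm of a remainder of class i, up to constants: the remainder of relative
    size 2^(-i(s+1)) enters squared, and 2^(-i n) is the ratio of the volume of I to that of a cube
    of the coarser scale. *)
Definition delta (i : nat) : R := (2^-1) ^+ (i * (n + 2 * s.+1)).
(** C serves class 0. In the other classes 20 = 5 * 4, where 5 comes from the side of [nb 2] and 4
    from the measure bound for [cbox]. *)
Definition Ccls : R := C + C ^+ 2 * 20 ^+ n.

Lemma Ccls_gt0 : 0 < Ccls.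
Proof.
have C0 := kp_C0 kp; rewrite ltr_wpDr// mulr_ge0// ?sqr_ge0// exprn_ge0//.
Qed.

Definition polyrep (co : {ffun 'I_n -> 'I_s.+1} -> R) (c y : X) : R :=
  \sum_(al : {ffun 'I_n -> 'I_s.+1} | (\sum_i al i <= s)%N) co al * \prod_i (tnth y i - tnth c i) ^+ al i.

(** [KK] is the Taylor remainder cut off in both variables. The cut makes it small everywhere and of
    finite range, while on the uncut part it differs from K by a polynomial in y. *)
Lemma taylor_kernel (K : X -> X -> R) (D c l : R) (y0 : X) (N : set X) : kern K -> ktaylor s D c K ->
  0 <= D -> 0 <= c -> 0 <= l -> c * l <= 1 -> measurable N -> (exists r, N `<=` bbox r) ->
  exists KK : X -> X -> R, [/\ kern KK, forall x y, `|KK x y| <= D * c ^+ n * (c * l) ^+ s.+1,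
    forall x y, ~ N x -> KK x y = 0, forall x y, ~ cbox y0 l y -> KK x y = 0 &
    forall x, N x -> exists co, forall y, cbox y0 l y -> K x y - KK x y = polyrep co y0 y].
Proof.
move=> kK tK D0 c0 l0 cl1 mN [r1 hN].
have [co [mco hco]] := tK l y0 l0 cl1.
set k := D * c ^+ n * (c * l) ^+ s.+1 in hco *.
have k0 : 0 <= k by rewrite !mulr_ge0 ?exprn_ge0 ?mulr_ge0.
pose E : set X := cbox y0 l; have mE : measurable E by exact: measurable_cbox.
have hE := @cbox_bbox y0 l; set r2 := \sum_i `|tnth y0 i| + l in hE.
pose KK (x y : X) := \1_N x * \1_E y * (K x y - polyrep (fun al => co al x) y0 y).
have K1 x y : ~ N x -> KK x y = 0 by move=> h; rewrite /KK indicE memNset// !mul0r.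
have K2 x y : ~ E y -> KK x y = 0 by move=> h; rewrite /KK [\1_E y]indicE memNset// mulr0 mul0r.
have Kk x y : `|KK x y| <= k.
  have [hx|/K1 ->] := pselect (N x); last by rewrite normr0.
  have [hy|/K2 ->] := pselect (E y); last by rewrite normr0.
  by rewrite /KK !indicE !mem_set// !mul1r; exact: hco.
exists KK; split => //.
  split.
  - apply: measurable_funM.
      by apply: measurable_funM; apply: measurableT_comp => //; exact: measurable_indic.
    apply: measurable_funB; first by have [] := kK.
    rewrite /polyrep; under eq_fun do rewrite -big_filter /=.
    apply: (@measurable_sum _ _ _ _ _ _ (fun (al : {ffun 'I_n -> 'I_s.+1}) (z : X * X) =>
      co al z.1 * \prod_i0 (tnth z.2 i0 - tnth y0 i0) ^+ al i0)).
    move=> al; apply: measurable_funM.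
      by apply: (measurableT_comp (f := co al)) => //; exact: mco.
    apply: measurable_prod => i0 _; apply: measurable_funX; apply: measurable_funB => //.
    by apply: (measurableT_comp (f := fun x : X => tnth x i0)) => //; exact: measurable_tnth.
  - by exists k.
  - exists (`|r1| + `|r2|) => x y [i0 hi].
    have [hx|/K1 ->//] := pselect (N x); have [hy|/K2 ->//] := pselect (E y).
    have := hN x hx i0; have := hE y hy i0; have := ler_normB (tnth x i0) (tnth y i0).
    by have := ler_norm r1; have := ler_norm r2; move: hi; lra.
move=> x hx; exists (fun al => co al x) => y hy.
by rewrite /KK !indicE !mem_set// !mul1r opprB addrC subrK.
Qed.

(** In class 0 the scales are at most that of I; nothing is gained there, and B is kept with its
    almost orthogonality. A class i > 0 contains the single scale I.1 + i, so no orthogonality is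
    required and the remainder at the centre of I is estimated by size and support. *)
Lemma class_kernel I i (es : seq int) : uniq es -> (forall e, e \in es -> ecls e I = i) ->
  exists2 KK : int -> X -> X -> R, famE1 (fun e x y => KK e y x) es (Ccls * delta i) &
    forall e x, e \in es -> nb 2 (up i I) x -> exists co, forall y, dbl_cube_set I y ->
      B e x y - KK e x y = polyrep co (dcenter I) y.
Proof.
move=> ues hes; have C0 := kp_C0 kp.
case: i hes => [|i] hes.
  exists B.
    rewrite /delta mul0n expr0 mulr1; apply: famE1_le (kp_B_E1 kp ues).
    by rewrite lerDl mulr_ge0 ?sqr_ge0// exprn_ge0.
  move=> e x _ _; exists (fun=> 0) => y _; rewrite subrr /polyrep big1// => al _; exact: mul0r.
set j := i.+1 in hes *.
case: es ues hes => [|e0 es] ues hes.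
  exists B => //; have [kB _] := kp_B_E1 kp ues; split => // g bg.
  rewrite big_nil mulr0; under eq_Rintegral do rewrite big_nil expr0n.
  by rewrite Rintegral_cst// mul0r.
have he e : e \in e0 :: es -> e = I.1 + j%:Z.
  by move=> /hes; rewrite /ecls; case: ifP => //; lia.
have ee0 := he e0 (mem_head _ _).
have es0 : es = [::].
  case: es ues he {hes} => // e1 es /= /andP[h _] he.
  have e1E := he e1 (ltac:(by rewrite !inE eqxx orbT)).
  by rewrite inE e1E ee0 eqxx in h.
rewrite {ues hes he}es0.
set l := ds I; have l0 : 0 < l by exact: ds_gt0.
have p2 (e : int) : 0 < (2 : R) ^ e by rewrite exprz_gt0.
have cl : 2 ^ (- e0) * l = (2^-1) ^+ j.
  rewrite /l /dside ee0 -expfzDr// opprD addrAC addNr add0r -exprnN exprVn//.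
have cl1 : 2 ^ (- e0) * l <= 1 by rewrite cl exprn_ile1 ?invr_ge0// invf_le1// ler1n.
set k := C * (2 ^ (- e0)) ^+ n * (2 ^ (- e0) * l) ^+ s.+1.
have k0 : 0 <= k.
  by rewrite /k cl !mulr_ge0// ?(ltW C0) ?exprn_ge0 ?invr_ge0//; exact: ltW (p2 _).
pose N : set X := nb 2 (up j I); pose D : set X := cbox (dcenter I) l.
have mN : measurable N by exact: measurable_nb.
have mD : measurable D by exact: measurable_cbox.
have [r1 hN] := nb_bbox 2 (up j I); have hD := @cbox_bbox (dcenter I) l.
have tB : ktaylor s C (2 ^ (- e0)) (B e0) by exact: (kp_B_T kp).
have [K [kK Kk K1 K2 hK]] := taylor_kernel (dcenter I) (skern_kern (kp_B_s kp e0)) tB (ltW C0) (ltW (p2 _))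
  (ltW l0) cl1 mN (ex_intro _ r1 hN).
exists (fun=> K).
  have vN := @lebn_nb R n 2 (up j I) (ler0n _ 2); have vD := lebn_cbox (dcenter I) l0.
  have dN : ds (up j I) = 2 ^ e0 by rewrite /dside /= ee0.
  have := @famE1_single R n int e0 (fun x y => K y x) N D (((1 + 2 * 2) * 2 ^ e0) ^+ n) ((4 * l) ^+ n) k
    (kern_tr kK) (bx1_indic mN hN) (bx1_indic mD hD).
  rewrite dN in vN.
  have q1 : 0 < ((1 + 2 * 2) * 2 ^ e0 : R) ^+ n by rewrite exprn_gt0// mulr_gt0//; lra.
  have q2 : 0 <= (4 * l) ^+ n by rewrite exprn_ge0// mulr_ge0// ltW.
  move=> /(_ q1 q2 k0 (Rint_indic_le mN vN) (Rint_indic_le mD vD) (fun x y => Kk y x)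
     (fun x y => @K1 y x) (fun x y => @K2 y x)).
  apply: famE1_le.
  have -> : k ^+ 2 * ((1 + 2 * 2) * 2 ^ e0) ^+ n * (4 * l) ^+ n = C ^+ 2 * 20 ^+ n * delta j.
    rewrite /k cl /delta.
    have -> : (2^-1 : R) ^+ (j * (n + 2 * s.+1)) = ((2^-1) ^+ j) ^+ n * (((2^-1) ^+ j) ^+ s.+1) ^+ 2.
      by rewrite mulnDr exprD exprM; congr (_ * _); rewrite -!exprM; congr (_ ^+ _); lia.
    have -> : ((2^-1 : R) ^+ j) ^+ n = (2 ^ (- e0)) ^+ n * l ^+ n by rewrite -cl exprMn.
    have e1 : (2 ^ (- e0)) ^+ n * (2 ^ e0) ^+ n = 1 :> R.
      by rewrite -exprMn -expfzDr// addNr expr0z expr1n.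
    have e2 : (20 : R) ^+ n = (1 + 2 * 2) ^+ n * 4 ^+ n by rewrite -exprMn; congr (_ ^+ _); ring.
    rewrite e2 !exprMn.
    transitivity (C ^+ 2 * ((1 + 2 * 2) ^+ n * 4 ^+ n) * ((2 ^ (- e0)) ^+ n * l ^+ n * (((2^-1) ^+ j) ^+ s.+1) ^+ 2)
       * ((2 ^ (- e0)) ^+ n * (2 ^ e0) ^+ n)); first by ring.
    by rewrite e1 mulr1.
  apply: ler_wpM2r; first by rewrite /delta exprn_ge0 ?invr_ge0.
  by rewrite /Ccls lerDr ltW.
move=> e x; rewrite inE => /eqP -> hx; have [co hco] := hK x hx; exists co => y /dbl_cbox; exact: hco.
Qed.

End ClassKernels.

Section Replace.
Variables (R : realType) (n m : nat).
Local Notation pt := (pt R n m).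
Local Notation P := (@leb2 R n m).
Local Notation hp := (boxes_pt R n m).

Lemma slice0_1 (f : pt -> R) : P.-integrable setT (EFin \o f) ->
  (forall y2, (\int[@lebn R n]_y1 (f (y1, y2))%:E = 0)%E) -> \int[P]_y f y = 0.
Proof.
move=> iF h; rewrite /Rintegral.
have -> : (\int[P]_y (f y)%:E = \int[@lebn R m]_y2 fubini_G (@lebn R n) (EFin \o f) y2)%E.
  by rewrite (integral21_prod_meas1 (m1 := @lebn R n) (m2 := @lebn R m)).
rewrite (eq_integral (cst 0%E)) ?integral0// => y2 _; exact: h.
Qed.

Lemma slice0_2 (f : pt -> R) : P.-integrable setT (EFin \o f) ->
  (forall y1, (\int[@lebn R m]_y2 (f (y1, y2))%:E = 0)%E) -> \int[P]_y f y = 0.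
Proof.
move=> iF h; rewrite /Rintegral.
have -> : (\int[P]_y (f y)%:E = \int[@lebn R n]_y1 fubini_F (@lebn R m) (EFin \o f) y1)%E.
  by rewrite (integral12_prod_meas1 (m1 := @lebn R n) (m2 := @lebn R m)).
rewrite (eq_integral (cst 0%E)) ?integral0// => y1 _; exact: h.
Qed.

Lemma poly_loc k (al : 'I_k -> nat) (c : k.-tuple R) r : exists M : R, forall y : k.-tuple R, bbox r y ->
  `|\prod_i (tnth y i - tnth c i) ^+ al i| <= M.
Proof.
exists (\prod_i (`|r| + `|tnth c i|) ^+ al i) => y h; rewrite normr_prod; apply: ler_prod => i _.
rewrite normr_ge0 normrX lerXn2r ?nnegrE ?addr_ge0//; apply: le_trans (ler_normB _ _) _.
by rewrite lerD2r; exact: le_trans (h i) (ler_norm _).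
Qed.

Lemma measurable_poly k (al : 'I_k -> nat) (c : k.-tuple R) :
  measurable_fun setT (fun y : k.-tuple R => \prod_i (tnth y i - tnth c i) ^+ al i).
Proof.
by apply: measurable_prod => i _; apply: measurable_funX; apply: measurable_funB => //; exact: measurable_tnth.
Qed.

Lemma dbl_bbox k (I : dcube k) : exists r, dbl_cube_set I `<=` (bbox r : set (k.-tuple R)).
Proof.
eexists; apply: subset_trans (@dbl_cbox R k I) _; exact: cbox_bbox.
Qed.

Lemma measurable_dbl k (I : dcube k) : measurable (dbl_cube_set I : set (k.-tuple R)).
Proof.
rewrite (_ : dbl_cube_set I = [set x : k.-tuple R | forall i,
   lo R I i - 2^-1 * dside R I <= tnth x i < lo R I i + dside R I + 2^-1 * dside R I]).
  exact: measurable_hbox.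
by apply/seteqP; split => x /dbl_cubeP.
Qed.

Lemma int_mul0 k (a h : k.-tuple R -> R) (c : R) :
  (@lebn R k).-integrable setT (EFin \o (fun y => a y * h y)) -> \int[@lebn R k]_y (a y * h y) = 0 ->
  (\int[@lebn R k]_y (c * (a y * h y))%:E = 0)%E.
Proof.
move=> i0 e; under eq_integral do rewrite EFinM.
rewrite integralZl// (_ : (\int[_]_x _ = 0)%E) ?mule0//.
rewrite -[LHS]fineK; last exact: (integrable_fin_num measurableT i0).
by rewrite -/(Rintegral _ _ _) e.
Qed.

Variables (a : pt -> R) (Q : drect n m).
Hypotheses (La : L2f P a) (a0 : forall x, ~ dbl_rect_set Q x -> a x = 0).

Let bdbl : bx2 (\1_(dbl_rect_set Q) : pt -> R).
Proof.
have [r1 h1] := dbl_bbox Q.1; have [r2 h2] := dbl_bbox Q.2.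
have b1 := bx1_indic (measurable_dbl Q.1) h1; have b2 := bx1_indic (measurable_dbl Q.2) h2.
apply: bxd_ext (bxd_prod (boxes_n R n) (boxes_n R m) b1 b2) => x.
rewrite !indicE; have [g1|g1] := pselect (dbl_cube_set Q.1 x.1); last first.
  by rewrite (memNset g1) mul0r memNset// => -[].
have [g2|g2] := pselect (dbl_cube_set Q.2 x.2); last first.
  by rewrite (memNset g2) mulr0 memNset// => -[].
by rewrite !mem_set ?mulr1//; split.
Qed.

Let a1 x : \1_(dbl_rect_set Q) x * a x = a x.
Proof.
have [h|h] := pselect (dbl_rect_set Q x); first by rewrite indicE mem_set// mul1r.
by rewrite a0// mulr0.
Qed.

(** On the support of [a] the two kernels differ by a polynomial of degree at most s in the first
    variable, which the moments of [a] annihilate for each fixed second variable. *)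
Lemma Op2_replace1 s (K KK : n.-tuple R -> n.-tuple R -> R) (K2 : m.-tuple R -> m.-tuple R -> R) x c co :
  kern K -> kern KK -> kern K2 -> (forall x2, rmz s (fun x1 => a (x1, x2))) ->
  (forall y, dbl_cube_set Q.1 y -> K x.1 y - KK x.1 y = polyrep (s := s) co c y) ->
  Op2 K K2 a x = Op2 KK K2 a x.
Proof.
move=> kK kKK k2 mz hpoly; apply/eqP; rewrite -subr_eq0; apply/eqP.
have i1 := bxd_L2_integrable hp (bx2_KK kK k2 x) La.
have i2 := bxd_L2_integrable hp (bx2_KK kKK k2 x) La.
rewrite /Op2 -RintegralB//.
have bp (al : {ffun 'I_n -> 'I_s.+1}) : bx2 (fun y : pt => \1_(dbl_rect_set Q) y *
    (K2 x.2 y.2 * \prod_i (tnth y.1 i - tnth c i) ^+ al i)).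
  have [mK2 [N hN] _] := k2.
  apply: (bxd_loc bdbl).
    apply: measurable_funM.
      apply: (measurableT_comp (f := K2 x.2)) => //; exact: (bxd_measurable (kern_bx x.2 k2)).
    by apply: (measurableT_comp (f := fun y : n.-tuple R => \prod_i (tnth y i - tnth c i) ^+ al i)) => //; exact: measurable_poly.
  move=> r; have [M hM] := poly_loc (fun i => al i : nat) c r; exists (N * M) => y [h1 _].
  by rewrite normrM; apply: ler_pM => //; exact: hM.
have ip al : P.-integrable setT (EFin \o (fun y : pt => co al * (K2 x.2 y.2 * (a y * \prod_i (tnth y.1 i - tnth c i) ^+ al i)))).
  have := integrableZl measurableT (co al) (bxd_L2_integrable hp (bp al) La).
  apply: eq_integrable => // y _ /=; congr (_%:E); congr (_ * _).
  by rewrite -[in RHS]a1; ring.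
rewrite (Rint_eq _ (g := fun y => \sum_(al <- [seq al : {ffun _ -> 'I_s.+1} <- index_enum _ | (\sum_i al i <= s)%N])
    co al * (K2 x.2 y.2 * (a y * \prod_i (tnth y.1 i - tnth c i) ^+ al i)))); last first.
  move=> y; rewrite -mulrBl -mulrBl big_filter.
  have [[h1 h2]|h] := pselect (dbl_rect_set Q y); last first.
    by rewrite a0// mulr0 big1// => al _; rewrite mul0r !mulr0.
  rewrite hpoly// /polyrep mulr_suml mulr_suml; apply: eq_bigr => al _; ring.
rewrite Rintegral_sum// big_seq big1// => al; rewrite mem_filter => /andP[hal _].
apply: (slice0_1 (ip al)) => y2 /=.
have [j1 j2] := rmz_prod c (mz y2) hal.
by rewrite -[RHS](int_mul0 (co al * K2 x.2 y2) j1 j2); apply: eq_integral => y1 _; rewrite mulrA.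
Qed.

Lemma Op2_replace2 s (K1 : n.-tuple R -> n.-tuple R -> R) (K KK : m.-tuple R -> m.-tuple R -> R) x c co :
  kern K -> kern KK -> kern K1 -> (forall x1, rmz s (fun x2 => a (x1, x2))) ->
  (forall y, dbl_cube_set Q.2 y -> K x.2 y - KK x.2 y = polyrep (s := s) co c y) ->
  Op2 K1 K a x = Op2 K1 KK a x.
Proof.
move=> kK kKK k1 mz hpoly; apply/eqP; rewrite -subr_eq0; apply/eqP.
have i1 := bxd_L2_integrable hp (bx2_KK k1 kK x) La.
have i2 := bxd_L2_integrable hp (bx2_KK k1 kKK x) La.
rewrite /Op2 -RintegralB//.
have bp (al : {ffun 'I_m -> 'I_s.+1}) : bx2 (fun y : pt => \1_(dbl_rect_set Q) y *
    (K1 x.1 y.1 * \prod_i (tnth y.2 i - tnth c i) ^+ al i)).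
  have [mK1 [N hN] _] := k1.
  apply: (bxd_loc bdbl).
    apply: measurable_funM.
      apply: (measurableT_comp (f := K1 x.1)) => //; exact: (bxd_measurable (kern_bx x.1 k1)).
    by apply: (measurableT_comp (f := fun y : m.-tuple R => \prod_i (tnth y i - tnth c i) ^+ al i)) => //; exact: measurable_poly.
  move=> r; have [M hM] := poly_loc (fun i => al i : nat) c r; exists (N * M) => y [_ h1].
  by rewrite normrM; apply: ler_pM => //; exact: hM.
have ip al : P.-integrable setT (EFin \o (fun y : pt => co al * (K1 x.1 y.1 * (a y * \prod_i (tnth y.2 i - tnth c i) ^+ al i)))).
  have := integrableZl measurableT (co al) (bxd_L2_integrable hp (bp al) La).
  apply: eq_integrable => // y _ /=; congr (_%:E); congr (_ * _).
  by rewrite -[in RHS]a1; ring.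
rewrite (Rint_eq _ (g := fun y => \sum_(al <- [seq al : {ffun _ -> 'I_s.+1} <- index_enum _ | (\sum_i al i <= s)%N])
    co al * (K1 x.1 y.1 * (a y * \prod_i (tnth y.2 i - tnth c i) ^+ al i)))); last first.
  move=> y; rewrite -mulrBl -mulrBr big_filter.
  have [[h1 h2]|h] := pselect (dbl_rect_set Q y); last first.
    by rewrite a0// mulr0 big1// => al _; rewrite mul0r !mulr0.
  rewrite hpoly// /polyrep mulr_sumr mulr_suml; apply: eq_bigr => al _; ring.
rewrite Rintegral_sum// big_seq big1// => al; rewrite mem_filter => /andP[hal _].
apply: (slice0_2 (ip al)) => y1 /=.
have [j1 j2] := rmz_prod c (mz y1) hal.
by rewrite -[RHS](int_mul0 (co al * K1 x.1 y1) j1 j2); apply: eq_integral => y2 _; rewrite mulrA.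
Qed.

End Replace.

Section L2Functions.
Context d (T : measurableType d) (R : realType) (mu : {measure set T -> \bar R}).

Lemma L2f_lin (c e : R) (a b : T -> R) : L2f mu a -> L2f mu b -> L2f mu (fun x => c * a x + e * b x).
Proof.
move=> [ma ia] [mb ib].
have mab : measurable_fun setT (fun x => c * a x + e * b x).
  by apply: measurable_funD; apply: measurable_funM.
split => //.
have i2 : mu.-integrable setT (EFin \o (fun x => 2 * c ^+ 2 * a x ^+ 2 + 2 * e ^+ 2 * b x ^+ 2)).
  have := integrableD measurableT (integrableZl measurableT (2 * c ^+ 2) ia) (integrableZl measurableT (2 * e ^+ 2) ib).
  by apply: eq_integrable.
apply: le_integrable i2 => //; first by apply/measurable_EFinP; exact: measurable_funX.
move=> x _ /=; rewrite lee_fin ger0_norm ?sqr_ge0// (le_trans _ (ler_norm _))//.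
have := sqr_ge0 (c * a x - e * b x); rewrite sqrrB sqrrD !exprMn; lra.
Qed.

Lemma L2f_sum (I : eqType) (s : seq I) (F : I -> T -> R) : (forall i, i \in s -> L2f mu (F i)) ->
  L2f mu (fun x => \sum_(i <- s) F i x).
Proof.
elim: s => [|i s IH] h.
  rewrite (_ : (fun x => _) = cst 0); last by apply/funext => x; rewrite big_nil.
  split => //; rewrite (_ : _ \o _ = cst 0%E); first exact: integrable0.
  by apply/funext => x /=; rewrite expr0n.
have r1 : L2f mu (F i) by apply: h; rewrite mem_head.
have r2 : L2f mu (fun x => \sum_(i <- s) F i x) by apply: IH => j js; apply: h; rewrite inE js orbT.
rewrite (_ : (fun x => _) = fun x => 1 * F i x + 1 * \sum_(j <- s) F j x); first exact: L2f_lin.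
by apply/funext => x; rewrite big_cons !mul1r.
Qed.

End L2Functions.

(** * The discretised reproducing operators *)

Section Pieces.
Variables (R : realType) (n m : nat).
Local Notation pt := (pt R n m).
Local Notation P := (@leb2 R n m).
Local Notation hp := (boxes_pt R n m).
Implicit Types (Q S : drect n m) (F G : seq (drect n m)) (a b : pt -> R).

Lemma Op2_lin K1 K2 (c d : R) a b x : kern K1 -> kern K2 -> L2f P a -> L2f P b ->
  Op2 K1 K2 (fun y => c * a y + d * b y) x = c * Op2 K1 K2 a x + d * Op2 K1 K2 b x.
Proof.
move=> k1 k2 La Lb; rewrite /Op2.
have i1 := bxd_L2_integrable hp (bx2_KK k1 k2 x) La.
have i2 := bxd_L2_integrable hp (bx2_KK k1 k2 x) Lb.
rewrite -(RintegralZl c measurableT i1) -(RintegralZl d measurableT i2) -RintegralD//.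
- by apply: Rint_eq => y; ring.
- by have := integrableZl measurableT c i1; apply: eq_integrable.
- by have := integrableZl measurableT d i2; apply: eq_integrable.
Qed.

Variables (s1 s2 : nat) (C1 C2 : R).
Variables (A1 B1 k1 : int -> n.-tuple R -> n.-tuple R -> R) (A2 B2 k2 : int -> m.-tuple R -> m.-tuple R -> R).
Hypotheses (kp1 : kpack s1 C1 A1 B1 k1) (kp2 : kpack s2 C2 A2 B2 k2).

(** [coefQ], [piece] and [PF] are the 1_Q B_Q g, A_Q (1_Q B_Q g) and P_F g of the overview. *)
Definition coefQ Q a (y : pt) : R := \1_(rect_set Q) y * Op2 (B1 Q.1.1) (B2 Q.2.1) a y.
Definition piece Q a : pt -> R := Op2 (A1 Q.1.1) (A2 Q.2.1) (coefQ Q a).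
Definition PF F a (x : pt) : R := \sum_(Q <- F) piece Q a x.

Let kA1 e : kern (A1 e). Proof. exact: skern_kern (kp_A_s kp1 e). Qed.
Let kA2 e : kern (A2 e). Proof. exact: skern_kern (kp_A_s kp2 e). Qed.
Let kB1 e : kern (B1 e). Proof. exact: skern_kern (kp_B_s kp1 e). Qed.
Let kB2 e : kern (B2 e). Proof. exact: skern_kern (kp_B_s kp2 e). Qed.

Lemma bx2_coefQ Q a : L2f P a -> bx2 (coefQ Q a).
Proof. by move=> La; apply: Op2_bounded => //; exact: bx2_rect. Qed.

Lemma coefQ_lin (c d : R) Q a b y : L2f P a -> L2f P b ->
  coefQ Q (fun y => c * a y + d * b y) y = c * coefQ Q a y + d * coefQ Q b y.
Proof. by move=> La Lb; rewrite /coefQ Op2_lin//; ring. Qed.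

Lemma piece_lin (c d : R) Q a b x : L2f P a -> L2f P b ->
  piece Q (fun y => c * a y + d * b y) x = c * piece Q a x + d * piece Q b x.
Proof.
move=> La Lb; rewrite -[RHS]Op2_lin//; [|exact: (bxd_L2 hp (bx2_coefQ Q La))|exact: (bxd_L2 hp (bx2_coefQ Q Lb))].
by congr Op2; apply/funext => y; rewrite coefQ_lin.
Qed.

Lemma PF_lin (c d : R) F a b x : L2f P a -> L2f P b ->
  PF F (fun y => c * a y + d * b y) x = c * PF F a x + d * PF F b x.
Proof.
by move=> La Lb; rewrite /PF !mulr_sumr -big_split; apply: eq_bigr => Q _; rewrite piece_lin.
Qed.

Lemma coefQ0 Q a y : (forall z, a z = 0) -> coefQ Q a y = 0.
Proof.
move=> a0; rewrite /coefQ /Op2 (Rint_eq _ (g := fun=> 0)); last by move=> z; rewrite a0 mulr0.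
by rewrite Rintegral_cst// mul0r mulr0.
Qed.

Lemma piece0 Q a x : (forall y, coefQ Q a y = 0) -> piece Q a x = 0.
Proof.
move=> h; rewrite /piece /Op2 (Rint_eq _ (g := fun=> 0)); last by move=> z; rewrite h mulr0.
by rewrite Rintegral_cst// mul0r.
Qed.

Lemma PF0 F a x : (forall z, a z = 0) -> PF F a x = 0.
Proof. by move=> a0; rewrite /PF big1// => Q _; apply: piece0 => y; exact: coefQ0. Qed.

Lemma PF_sum (I : eqType) (s : seq I) F (g : I -> pt -> R) x : (forall i, i \in s -> L2f P (g i)) ->
  PF F (fun y => \sum_(i <- s) g i y) x = \sum_(i <- s) PF F (g i) x.
Proof.
elim: s => [|i s IH] h; first by rewrite big_nil PF0// => y; rewrite big_nil.
have r1 : L2f P (g i) by apply: h; rewrite mem_head.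
have hs j : j \in s -> L2f P (g j) by move=> js; apply: h; rewrite inE js orbT.
have r2 := L2f_sum hs.
rewrite big_cons -IH//; transitivity (PF F (fun y => 1 * g i y + 1 * \sum_(j <- s) g j y) x).
  by congr (PF F _ x); apply/funext => y; rewrite big_cons !mul1r.
by rewrite PF_lin// !mul1r.
Qed.

Lemma rD_piece Q a : L2f P a -> rD s1 s2 (piece Q a).
Proof.
move=> La; apply: (@rD_Op2 _ n m s1 s2 _ _ _ 0 0).
- exact: kp_A_s kp1 _.
- exact: kp_A_s kp2 _.
- exact: bx2_coefQ.
- by move=> y al hal; rewrite mul0r (kp_A_m kp1).
- by move=> y al hal; rewrite mul0r (kp_A_m kp2).
- by left.
- by left.
Qed.

Lemma rD_PF F a : L2f P a -> rD s1 s2 (PF F a).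
Proof. by move=> La; apply: rD_sum => Q _; exact: rD_piece. Qed.

Lemma near_nb k (Q : dcube k) (x y : k.-tuple R) (A : int -> k.-tuple R -> k.-tuple R -> R) :
  (forall e x y, (exists i, 4^-1 * 2 ^ e < `|tnth x i - tnth y i|) -> A e x y = 0) ->
  cube_set Q y -> ~ nb 2^-1 Q x -> A Q.1 x y = 0.
Proof.
move=> h /cube_setP hy hx; apply: h; apply: contrapT => hn; apply: hx => i.
have : `|tnth x i - tnth y i| <= 4^-1 * dside R Q.
  by rewrite leNgt; apply/negP => hi; apply: hn; exists i.
rewrite ler_norml; have := hy i; have := ds_gt0 R Q; lra.
Qed.

Lemma piece_supp Q a x : ~ nb2 2^-1 Q x -> piece Q a x = 0.
Proof.
move=> hx; rewrite /piece /Op2 (Rint_eq _ (g := fun=> 0)); last first.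
  move=> y; have [[h1 h2]|h] := pselect (rect_set Q y); last first.
    by rewrite /coefQ indicE memNset// mul0r mulr0.
  have [g1|g1] := pselect (nb 2^-1 Q.1 x.1); last by rewrite (near_nb (kp_A_supp kp1) h1 g1) !mul0r.
  have [g2|g2] := pselect (nb 2^-1 Q.2 x.2); last by rewrite (near_nb (kp_A_supp kp2) h2 g2) mulr0 mul0r.
  by case: hx; split.
by rewrite Rintegral_cst// mul0r.
Qed.

Lemma PF_synthesis G a : uniq G -> L2f P a ->
  \int[P]_x (PF G a x) ^+ 2 <= C1 * C2 * \sum_(Q <- G) \int[P]_x (coefQ Q a x) ^+ 2.
Proof.
move=> uG La.
have E Q x : \1_(rect_set Q) x * coefQ Q a x = coefQ Q a x.
  by rewrite /coefQ mulrA; congr (_ * _); rewrite indicE -natrM; case: (_ \in _).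
have := synthesis (kp_C0 kp1) (kp_C0 kp2) uG (kp_A_E1 kp1) (kp_A_E1 kp2) (fun Q => bx2_coefQ Q La).
rewrite (Rint_eq _ (g := fun x => (PF G a x) ^+ 2)); last first.
  move=> x; congr (_ ^+ 2); apply: eq_bigr => Q _; rewrite /piece; congr Op2.
  by apply/funext => y; exact: E.
move=> h; apply: le_trans h _; rewrite le_eqVlt; apply/orP; left; apply/eqP; congr (_ * _).
by apply: eq_bigr => Q _; apply: Rint_eq => y; rewrite E.
Qed.

Lemma PF_analysis G a : uniq G -> L2f P a ->
  \sum_(Q <- G) \int[P]_x (coefQ Q a x) ^+ 2 <= C1 * C2 * \int[P]_x (a x) ^+ 2.
Proof.
move=> uG La; apply: (analysis (kp_C0 kp1) (kp_C0 kp2) uG La).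
  exact: kp_B_E1 kp1 _ (undup_uniq _).
exact: kp_B_E1 kp2 _ (undup_uniq _).
Qed.

Lemma PF_energy G a : uniq G -> L2f P a ->
  \int[P]_x (PF G a x) ^+ 2 <= (C1 * C2) ^+ 2 * \int[P]_x (a x) ^+ 2.
Proof.
move=> uG La; apply: le_trans (PF_synthesis uG La) _; rewrite expr2 -[leRHS]mulrA.
by apply: ler_wpM2l; [rewrite mulr_ge0// ltW// ?(kp_C0 kp1) ?(kp_C0 kp2)|exact: PF_analysis].
Qed.

Lemma PF_filter (q : pred (drect n m)) F a x :
  PF F a x = PF [seq Q <- F | q Q] a x + PF [seq Q <- F | ~~ q Q] a x.
Proof. by rewrite /PF !big_filter (bigID q). Qed.

Lemma nb_mono k (Q S : dcube k) (x : k.-tuple R) : (Q.1 <= S.1)%R -> cube_set Q `<=` (nb 2 S : set (k.-tuple R)) ->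
  nb 2^-1 Q x -> nb 3 S x.
Proof.
move=> e h hx i.
have /h/(_ i) := corner_in R Q; rewrite tnth_mktuple.
have hds : dside R Q <= dside R S by rewrite /dside ler_weXz2l ?ler1n.
pose z : k.-tuple R := [tuple Num.max (lo R Q i) (tnth x i - dside R Q / 2) | i < k].
have ds0 := ds_gt0 R Q.
have /h/(_ i) : cube_set Q z.
  apply/cube_setP => j; rewrite tnth_mktuple; have /andP[u1 u2] := hx j.
  by rewrite le_max lexx gt_max /=; apply/andP; split; lra.
have : tnth x i - dside R Q / 2 <= tnth z i by rewrite tnth_mktuple le_max lexx orbT.
have /andP[u1 u2] := hx i; move=> h1 /andP[h2 h3] /andP[h4 h5]; apply/andP; split; lra.
Qed.

Lemma nb2_mono Q S (x : pt) : (Q.1.1 <= S.1.1)%R -> (Q.2.1 <= S.2.1)%R ->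
  rect_set Q `<=` (nb2 2 S : set pt) -> nb2 2^-1 Q x -> nb2 3 S x.
Proof.
move=> e1 e2 h [h1 h2]; split; [apply: nb_mono e1 _ h1|apply: nb_mono e2 _ h2].
  by move=> y hy; have [] := h (y, corner R Q.2) (conj hy (corner_in R Q.2)).
by move=> y hy; have [] := h (corner R Q.1, y) (conj (corner_in R Q.1) hy).
Qed.

(** Three generations are what it takes: half the side of the third ancestor is 4 sides of S, which
    exceeds 3. *)
Lemma nb_up3 k (S : dcube k) (x : k.-tuple R) : nb 3 S x -> nb 2^-1 (up 3 S) x.
Proof.
move=> h i; have := h i; have [] := lo_up R 3 S i; rewrite ds_up.
by have := ds_gt0 R S; rewrite !exprS expr0; lra.
Qed.

End Pieces.

(** * Real powers and decay ratios *)

Section RealPowers.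
Variable R : realType.
Implicit Types (x y p t V : R).

Lemma powRX x t k : 0 <= x -> (x ^+ k) `^ t = (x `^ t) ^+ k.
Proof.
move=> x0; elim: k => [|k IH]; first by rewrite !expr0 powR1.
by rewrite !exprS powRM ?exprn_ge0// IH.
Qed.

Lemma powR_young x y t : 0 <= x -> 0 <= y -> 0 <= t <= 1 -> x `^ t * y `^ (1 - t) <= x + y.
Proof.
move=> x0 y0 /andP[t0 t1]; pose z := Num.max x y.
have xz : x <= z by rewrite le_max lexx.
have yz : y <= z by rewrite le_max lexx orbT.
have z0 := le_trans x0 xz.
apply: (@le_trans _ _ (z `^ t * z `^ (1 - t))).
  by apply: ler_pM; rewrite ?powR_ge0//; apply: ge0_ler_powR; rewrite ?nnegrE ?subr_ge0.
rewrite -powRD; last by rewrite addrC subrK oner_eq0.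
by rewrite addrC subrK powRr1// /z ge_max lerDl lerDr x0 y0.
Qed.

(** The two normalisations are those of an atom and their powers of V cancel. The product of energy
    and volume of a component is thereby split into two terms that are summed separately, the
    energies by (AII) and the volumes by Journe's lemma. *)
Lemma powR_young_V V x y p : 0 < V -> 0 <= x -> 0 <= y -> 0 < p <= 1 ->
  x `^ (2^-1 * p) * y `^ (1 - 2^-1 * p) <= x / (V `^ (2^-1 - p^-1)) ^+ 2 + y / V.
Proof.
move=> V0 x0 y0 /andP[p0 p1]; set b := _ `^ _ ^+ 2.
have b0 : 0 < b by rewrite exprn_gt0// powR_gt0.
have bE : b = V `^ ((2^-1 - p^-1) * 2) by rewrite powRrM powR_mulrn// powR_ge0.
apply: le_trans (@powR_young (x / b) (y / V) (2^-1 * p) _ _ _).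
- rewrite !powRM ?invr_ge0 ?(ltW b0) ?(ltW V0)// mulrACA -[leLHS]mulr1.
  rewrite le_eqVlt; apply/orP; left; apply/eqP; congr (_ * _).
  rewrite bE -powRN -[V^-1]powR_inv1 ?(ltW V0)// -!powRrM -powRD; last by rewrite (gt_eqF V0) implybT.
  by rewrite (_ : _ + _ = 0) ?powRr0//; field; rewrite gt_eqF.
- by rewrite divr_ge0// ltW.
- by rewrite divr_ge0// ltW.
- by apply/andP; split; [rewrite mulr_ge0 ?invr_ge0// ltW|lra].
Qed.

(* The decay ratio per generation in the sum over far rectangles; rho < 1 is the place where the
   condition s >= floor(k (1/p - 1)) enters. *)
Definition rho (k s : nat) p : R := ((2^-1) ^+ (k + 2 * s.+1)) `^ (2^-1 * p) * (2 ^+ k) `^ (1 - 2^-1 * p).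

(** As a power of 2, rho has exponent -(k + 2(s+1)) p/2 + k (1 - p/2) = k (1 - p) - (s+1) p. *)
Lemma rho_lt1 k s p : 0 < p -> k%:R * (p^-1 - 1) < s.+1%:R -> rho k s p < 1.
Proof.
move=> p0 h; rewrite /rho exprVn -!powR_mulrn// -powRN -!powRrM -powRD; last by rewrite pnatr_eq0 implybT.
rewrite /powR pnatr_eq0 /= expR_lt1 pmulr_llt0 ?ln_gt0 ?ltr1n//.
have : k%:R * (p^-1 - 1) * p < s.+1%:R * p by rewrite ltr_pM2r.
rewrite (_ : k%:R * (p^-1 - 1) * p = k%:R * (1 - p)); last by field; rewrite gt_eqF.
rewrite natrD natrM; lra.
Qed.

Lemma rho_ge0 k s p : 0 <= rho k s p.
Proof. by rewrite mulr_ge0 ?powR_ge0. Qed.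

Lemma sum_lin_geo (r : R) K : 0 <= r < 1 -> \sum_(i < K) (1 + i%:R) * r ^+ i <= ((1 - r) ^+ 2)^-1.
Proof.
move=> /andP[r0 r1]; have q0 : 0 < (1 - r) ^+ 2 by rewrite exprn_gt0// subr_gt0.
rewrite -[leRHS]mul1r ler_pdivlMr//.
have -> : (\sum_(i < K) (1 + i%:R) * r ^+ i) * (1 - r) ^+ 2 = 1 - (1 + K%:R) * r ^+ K + K%:R * r ^+ K.+1.
  elim: K => [|K IH]; first by rewrite big_ord0 expr0 !mul0r; ring.
  by rewrite big_ord_recr /= mulrDl IH -[K.+1%:R]natr1 !exprS; ring.
have : K%:R * r ^+ K.+1 <= K%:R * r ^+ K.
  by apply: ler_wpM2l => //; rewrite exprS; apply: ler_piMl; [exact: exprn_ge0|exact: ltW].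
have : 0 <= r ^+ K by exact: exprn_ge0.
by rewrite mulrDl mul1r; lra.
Qed.

(** Separates the decay in the class (i, j) from the energy X and the volume Y of the component. *)
Lemma far_power (n m s1 s2 i j : nat) p (M D E X Y : R) : 0 < p <= 1 -> 0 <= M -> 0 <= D -> 0 <= E -> 0 <= X -> 0 <= Y ->
  (M * Num.sqrt (D * (delta R n s1 i * delta R m s2 j) * X) *
     (E * (Y * (2 ^+ (i * n) * 2 ^+ (j * m)))) `^ (p^-1 - 2^-1)) `^ p =
  M `^ p * (D `^ (2^-1 * p) * E `^ (1 - 2^-1 * p)) * (rho n s1 p ^+ i * rho m s2 p ^+ j) *
    (X `^ (2^-1 * p) * Y `^ (1 - 2^-1 * p)).
Proof.
move=> /andP[p0 p1] M0 D0 E0 X0 Y0.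
have d0 k s l : 0 <= delta R k s l by rewrite exprn_ge0 ?invr_ge0.
have Z0 : 0 <= D * (delta R n s1 i * delta R m s2 j) * X by rewrite !mulr_ge0.
rewrite -powR12_sqrt//.
rewrite powRM ?powR_ge0 ?mulr_ge0 ?powR_ge0//.
rewrite [(M * _) `^ p]powRM ?powR_ge0// -!powRrM.
have -> : (p^-1 - 2^-1) * p = 1 - 2^-1 * p by field; rewrite gt_eqF.
set t := 2^-1 * p.
rewrite (powRM t) ?mulr_ge0// (powRM t) ?mulr_ge0// (powRM t)//.
rewrite (powRM (1 - t)) ?mulr_ge0 ?exprn_ge0//.
rewrite (powRM (1 - t)) ?mulr_ge0 ?exprn_ge0//.
rewrite (powRM (1 - t)) ?mulr_ge0 ?exprn_ge0//.
have e1 k s l : delta R k s l `^ t = (((2^-1) ^+ (k + 2 * s.+1)) `^ t) ^+ l.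
  by rewrite /delta mulnC exprM powRX// exprn_ge0 ?invr_ge0.
have e2 l k : ((2 : R) ^+ (l * k)) `^ (1 - t) = ((2 ^+ k) `^ (1 - t)) ^+ l.
  by rewrite mulnC exprM powRX// exprn_ge0.
rewrite !e1 !e2 /rho -/t !exprMn; ring.
Qed.

End RealPowers.

Section PNu.
Variables (R : realType) (n m : nat) (p : R) (s1 s2 : nat).
Hypotheses (p0 : 0 < p).
Local Notation pt := (pt R n m).
Variable nu : (pt -> R) -> R.
Hypothesis hnu : pnu p s1 s2 nu.

Lemma pnu0 g : (forall x, g x = 0) -> nu g `^ p = 0.
Proof.
move=> g0; have -> : g = (fun x : pt => 0 * 0) by apply/funext => x; rewrite g0 mulr0.
have r0 : rD s1 s2 (fun _ : pt => 0 : R) by exact: rD0.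
have r1 : rD s1 s2 (fun _ : pt => 0 * 0 : R) by exact: rD_scale.
have := pnu_Z hnu 0 r0; rewrite normr0 [X in _ <= X]mul0r => h.
have -> : nu (fun _ : pt => 0 * 0 : R) = 0 by apply/eqP; rewrite eq_le h (pnu_ge0 hnu r1).
by rewrite powR0 ?gt_eqF.
Qed.

Lemma pnu_sum (I : eqType) (s : seq I) (g : I -> pt -> R) : (forall i, i \in s -> rD s1 s2 (g i)) ->
  nu (fun x => \sum_(i <- s) g i x) `^ p <= \sum_(i <- s) nu (g i) `^ p.
Proof.
elim: s => [|i s IH] h; first by rewrite big_nil pnu0// => x; rewrite big_nil.
have r1 : rD s1 s2 (g i) by apply: h; rewrite mem_head.
have hs j : j \in s -> rD s1 s2 (g j) by move=> js; apply: h; rewrite inE js orbT.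
rewrite big_cons (_ : (fun x => _) = (fun x => g i x + \sum_(j <- s) g j x)); last first.
  by apply/funext => x; rewrite big_cons.
by apply: le_trans (pnu_D hnu r1 (rD_sum hs)) _; rewrite lerD2l IH.
Qed.

Lemma pnu_le g c : rD s1 s2 g -> nu g <= c -> nu g `^ p <= c `^ p.
Proof.
move=> rg h; have g0 := pnu_ge0 hnu rg.
by apply: ge0_ler_powR; rewrite ?nnegrE ?(ltW p0)//; exact: le_trans h.
Qed.

End PNu.

(** * Near, error and far contributions of an atom *)

Section Parts.
Variables (R : realType) (n m : nat) (p : R) (s1 s2 : nat) (C1 C2 : R).
Hypotheses (n0 : (0 < n)%N) (m0 : (0 < m)%N) (p0 : 0 < p) (p1 : p <= 1).
Variables (A1 B1 k1 : int -> n.-tuple R -> n.-tuple R -> R) (A2 B2 k2 : int -> m.-tuple R -> m.-tuple R -> R).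
Hypotheses (kp1 : kpack s1 C1 A1 B1 k1) (kp2 : kpack s2 C2 A2 B2 k2).
Local Notation pt := (pt R n m).
Local Notation P := (@leb2 R n m).
Local Notation PF := (PF A1 B1 A2 B2).
Local Notation piece := (piece A1 B1 A2 B2).
Local Notation coefQ := (coefQ B1 B2).
Local Notation Cst := (Cst R n m).
Implicit Types (Q S : drect n m) (F G : seq (drect n m)) (a : pt -> R).
Variables (nu : (pt -> R) -> R) (M : R) (F : seq (drect n m)).
Hypotheses (hnu : pnu p s1 s2 nu) (M0 : 0 <= M) (hab : abd p s1 s2 nu M F).

Let C0 : 0 < C1 * C2. Proof. by rewrite mulr_gt0 ?(kp_C0 kp1) ?(kp_C0 kp2). Qed.
Let p2 : 2^-1 <= p^-1. Proof. by rewrite lef_pV2 ?posrE//; apply: le_trans p1 _; rewrite ler1n. Qed.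

(** The pieces live in O, the union of the neighbourhoods of the good rectangles. The covering
    estimate, used once for Om2 and once for O, gives |O| <= Cst^2 |Om|. Assigning every Q to a
    maximal rectangle of O that contains it makes PF G a one multiple of an atom on O, whose
    energies are controlled by the L^2 norm of a. *)
Lemma near_part Om (s : seq (drect n m)) K G (good : seq (drect n m)) a :
  measurable Om -> (P Om < +oo)%E -> 0 < fine (P Om) -> uniq G -> {subset G <= F} ->
  (forall S, S \in good -> hdense (Om2 Om s K) S) ->
  (forall Q, Q \in G -> exists2 S, S \in good &
     [/\ (Q.1.1 <= S.1.1)%R, (Q.2.1 <= S.2.1)%R & rect_set Q `<=` (nb2 2 S : set pt)]) ->
  L2f P a -> \int[P]_x a x ^+ 2 <= (fine (P Om) `^ (2^-1 - p^-1)) ^+ 2 ->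
  nu (PF G a) `^ p <= M `^ p * (C1 * C2 * (Cst * Cst) `^ (p^-1 - 2^-1)) `^ p.
Proof.
move=> mOm fOm V0 uG GF hgood hG La ha; set V := fine (P Om) in V0 ha *.
have Cst0 : 0 <= Cst by exact: le_trans ler01 (Cst_ge1 R n m).
(* A member Q0 of G provides the rectangle of F inside O that [abd] asks for; an empty G contributes
   0. *)
case: G uG GF hG => [|Q0 G'] uG GF hG.
  rewrite (pnu0 p0 hnu); first by rewrite mulr_ge0// powR_ge0.
  by move=> x; rewrite /PF big_nil.
move: uG GF hG; have Q0G : Q0 \in Q0 :: G' by exact: mem_head.
set G := Q0 :: G' in Q0G * => uG GF hG.
pose O : set pt := bU good (nb2 3).
have oO : open_set O by apply: open_bU => S; exact: open_nb2.
have mO := open_measurable2 oO.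
have PO : (P O <= (Cst * Cst * V)%:E)%E.
  apply: (@le_trans _ _ (Cst%:E * P (Om2 Om s K))%E).
    apply: strong_cover; first exact: measurable_Om2.
    by move=> S /hgood /asboolP /ltW.
  rewrite -[(Cst * Cst * V)%R]mulrA [(Cst * (Cst * V))%:E]EFinM; apply: lee_pmul => //.
  by rewrite [(Cst * V)%:E]EFinM fineK ?ge0_fin_numE//; exact: Om2_le.
have fO : (P O < +oo)%E by apply: le_lt_trans PO _; rewrite ltry.
have QO Q : Q \in G -> nb2 2^-1 Q `<=` O.
  move=> /hG[S Sg [e1 e2 h]] x hx; exists S => //; exact: nb2_mono e1 e2 h hx.
have h2 : (0 : R) < 2^-1 by rewrite invr_gt0.
have rQO Q : Q \in G -> rect_set Q `<=` O.
  by move=> QG x [x1 x2]; apply: (QO Q QG); split; exact: sub_nb.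
have [mx hmx] : exists mx : drect n m -> drect n m, forall Q, Q \in G -> maxrect O (mx Q) /\ below2 Q (mx Q).
  have /choice[mx h] : forall Q, exists Q', Q \in G -> maxrect O Q' /\ below2 Q Q'.
    move=> Q; have [QG|] := boolP (Q \in G); last by exists Q.
    by have [Q' h1 h2'] := exists_maxrect n0 m0 mO fO (rQO Q QG); exists Q'.
  by exists mx.
pose L := undup [seq mx q | q <- G].
have kt Q : Q \in G -> mx Q \in L by move=> QG; rewrite mem_undup; exact: map_f.
pose g S := PF [seq q <- G | mx q == S] a.
have ug S : uniq [seq q <- G | mx q == S] by exact: filter_uniq.
have gE x : \sum_(S <- L) g S x = PF G a x.
  rewrite /PF -(sum_regroup _ (undup_uniq _) kt); apply: eq_bigr => S _.
  by rewrite /g /PF big_filter.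
have b0 : 0 < C1 * C2 * V `^ (2^-1 - p^-1) by rewrite mulr_gt0 ?powR_gt0.
have hb : (C1 * C2) ^+ 2 * \int[P]_x a x ^+ 2 <= (C1 * C2 * V `^ (2^-1 - p^-1)) ^+ 2.
  by rewrite [leRHS]exprMn; apply: ler_wpM2l => //; exact: sqr_ge0.
have H : nu (fun x => \sum_(S <- L) g S x) <= M * (C1 * C2 * V `^ (2^-1 - p^-1)) * fine (P O) `^ (p^-1 - 2^-1).
  apply: hab => //.
  - by exists Q0; [exact: GF|exact: rQO].
  - exact: undup_uniq.
  - by move=> S; rewrite mem_undup => /mapP[Q QG ->]; have [] := hmx Q QG.
  - by move=> S _; exact: (rD_PF kp1 kp2 _ La).
  - move=> S _ x hx; rewrite /g /PF big_seq big1// => Q; rewrite mem_filter => /andP[/eqP e QG].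
    apply: (piece_supp kp1 kp2) => -[x1 x2]; apply: hx.
    have [_ /andP[b1 b2]] := hmx Q QG; rewrite -e; split.
      by apply: (below_dbl b1); apply/dbl_cubeP => i; have /andP[/ltW -> ->] := x1 i.
    by apply: (below_dbl b2); apply/dbl_cubeP => i; have /andP[/ltW -> ->] := x2 i.
  - move=> x hx; rewrite gE /PF big_seq big1// => Q QG.
    by apply: (piece_supp kp1 kp2) => h; apply: hx; exact: QO h.
  - by under eq_Rintegral do rewrite gE; apply: le_trans (PF_energy kp1 kp2 uG La) hb.
  - apply: le_trans hb; rewrite expr2 -[leRHS]mulrA.
    apply: (@le_trans _ _ (C1 * C2 * \sum_(Q <- G) \int[P]_x coefQ Q a x ^+ 2)); last first.
      by apply: ler_wpM2l; [exact: ltW|exact: PF_analysis kp1 kp2 _ _ uG La].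
    rewrite -(sum_regroup _ (undup_uniq _) kt) mulr_sumr; apply: ler_sum => S _.
    by apply: le_trans (PF_synthesis kp1 kp2 (ug S) La) _; rewrite big_filter.
have -> : PF G a = (fun x => \sum_(S <- L) g S x) by apply/funext => x; rewrite gE.
have rS : rD s1 s2 (fun x => \sum_(S <- L) g S x).
  by apply: rD_sum => S _; exact: (rD_PF kp1 kp2 _ La).
rewrite -powRM//; last by rewrite mulr_ge0 ?powR_ge0// ltW.
apply: (pnu_le p0 hnu rS); apply: le_trans H _; rewrite -mulrA; apply: ler_wpM2l => //.
rewrite -mulrA; apply: ler_wpM2l; first exact: ltW.
have CV : 0 <= Cst * Cst * V by rewrite mulr_ge0 ?mulr_ge0// ltW.
have hV : fine (P O) <= Cst * Cst * V by rewrite -lee_fin fineK ?ge0_fin_numE.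
apply: (@le_trans _ _ (V `^ (2^-1 - p^-1) * (Cst * Cst * V) `^ (p^-1 - 2^-1))).
  apply: ler_wpM2l; first exact: powR_ge0.
  by apply: ge0_ler_powR; rewrite ?subr_ge0 ?nnegrE ?fine_ge0.
rewrite powRM ?mulr_ge0 ?(ltW V0)// mulrCA -powRD; last by rewrite (gt_eqF V0) implybT.
have -> : 2^-1 - p^-1 + (p^-1 - 2^-1) = 0 by ring.
by rewrite powRr0 mulr1.
Qed.

(** The constant of a crude estimate, one piece at a time. It depends on G, so it is applied only to
    functions whose L^2 norm can be made small after F is fixed. *)
Definition errc G : R := \sum_(Q <- G) ((2 ^+ n * 2 ^+ m * rvol R Q) `^ (p^-1 - 2^-1)) `^ p.

Lemma err_part G a : {subset G <= F} -> L2f P a ->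
  nu (PF G a) `^ p <= M `^ p * (C1 * C2 * Num.sqrt (\int[P]_x a x ^+ 2)) `^ p * errc G.
Proof.
move=> GF La; apply: (le_trans (pnu_sum p0 hnu (fun Q _ => rD_piece kp1 kp2 Q La))).
rewrite /errc mulr_sumr big_seq [leRHS]big_seq; apply: ler_sum => Q QG.
have e0 : 0 <= C1 * C2 * Num.sqrt (\int[P]_x a x ^+ 2) by rewrite mulr_ge0 ?sqrtr_ge0// ltW.
rewrite -(powRM p M0 e0) -(powRM p (mulr_ge0 M0 e0) (powR_ge0 _ _)).
have rQ := rD_piece kp1 kp2 Q La; apply: (pnu_le p0 hnu rQ).
have h2 : (0 : R) < 2^-1 by rewrite invr_gt0.
apply: le_trans (rect_bound n0 m0 hab (GF _ QG) (Q := Q) _ rQ (fun x => piece_supp kp1 kp2 a (x := x)) M0 p2) _.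
  by move=> x [x1 x2]; split; exact: sub_nb.
apply: ler_wpM2r; first exact: powR_ge0.
apply: ler_wpM2l => //.
have -> : C1 * C2 = Num.sqrt ((C1 * C2) ^+ 2) by rewrite sqrtr_sqr gtr0_norm.
rewrite -sqrtrM ?sqr_ge0//; apply: ler_wsqrtr.
have /(_ isT) := PF_energy kp1 kp2 (G := [:: Q]) _ La.
by rewrite (Rint_eq _ (g := fun x => piece Q a x ^+ 2))// => x; rewrite /PF big_seq1.
Qed.

(** If some coefficient were nonzero, the range of B would let Q reach the double of S, and
    [interact] would put Q into that neighbourhood. *)
Lemma far_zero Q S a x : (forall y, ~ dbl_rect_set S y -> a y = 0) ->
  ~ rect_set Q `<=` (nb2 2 (up2 (cls Q.1 S.1) (cls Q.2 S.2) S) : set pt) -> piece Q a x = 0.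
Proof.
move=> a0 hQ; apply: piece0 => y; rewrite /coefQ.
have [[y1 y2]|hy] := pselect (rect_set Q y); last by rewrite indicE memNset// mul0r.
rewrite /Op2 (Rint_eq _ (g := fun=> 0)); first by rewrite Rintegral_cst// mul0r mulr0.
move=> z; have [[z1 z2]|hz] := pselect (dbl_rect_set S z); last by rewrite a0// mulr0.
have [c1|c1] := pselect (exists i, 2^-1 * 2 ^ Q.1.1 < `|tnth y.1 i - tnth z.1 i|).
  by rewrite (kp_B_supp kp1 c1) !mul0r.
have [c2|c2] := pselect (exists i, 2^-1 * 2 ^ Q.2.1 < `|tnth y.2 i - tnth z.2 i|).
  by rewrite (kp_B_supp kp2 c2) mulr0 mul0r.
case: hQ => w [w1 w2]; split.
  by apply: (interact y1 z1) => // i; rewrite leNgt; apply/negP => h; apply: c1; exists i.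
by apply: (interact y2 z2) => // i; rewrite leNgt; apply/negP => h; apply: c2; exists i.
Qed.

Section FarPiece.
Variables (S : drect n m) (a : pt -> R).
Hypotheses (La : L2f P a) (a0 : forall x, ~ dbl_rect_set S x -> a x = 0).
Hypotheses (am1 : forall x2, rmz s1 (fun x1 => a (x1, x2))) (am2 : forall x1, rmz s2 (fun x2 => a (x1, x2))).

(** Within one class both kernels B may be replaced by remainders, one variable after the other,
    since the component has vanishing moments in each; [analysis] for the remainders carries the
    gain. *)
Lemma far_energy G i j : uniq G ->
  (forall Q, Q \in G -> [/\ cls Q.1 S.1 = i, cls Q.2 S.2 = j & rect_set Q `<=` (nb2 2 (up2 i j S) : set pt)]) ->
  \int[P]_x (PF G a x) ^+ 2 <= C1 * C2 * ((Ccls n C1 * delta R n s1 i) * (Ccls m C2 * delta R m s2 j)) * \int[P]_x a x ^+ 2.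
Proof.
move=> uG hG; apply: le_trans (PF_synthesis kp1 kp2 uG La) _; rewrite -[leRHS]mulrA.
apply: ler_wpM2l; first exact: ltW.
have c1 e : e \in undup [seq q.1.1 | q <- G] -> ecls e S.1 = i.
  by rewrite mem_undup => /mapP[Q QG ->]; have [] := hG Q QG.
have c2 e : e \in undup [seq q.2.1 | q <- G] -> ecls e S.2 = j.
  by rewrite mem_undup => /mapP[Q QG ->]; have [] := hG Q QG.
have [K1 f1 r1] := class_kernel kp1 (undup_uniq _) c1.
have [K2 f2 r2] := class_kernel kp2 (undup_uniq _) c2.
have dl k s l : 0 < delta R k s l by rewrite exprn_gt0 ?invr_gt0.
have := analysis (mulr_gt0 (Ccls_gt0 kp1) (dl _ _ i)) (mulr_gt0 (Ccls_gt0 kp2) (dl _ _ j)) uG La f1 f2.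
apply: le_trans; rewrite le_eqVlt; apply/orP; left; apply/eqP.
rewrite big_seq [RHS]big_seq; apply: eq_bigr => Q QG; apply: Rint_eq => y; congr (_ ^+ 2); rewrite /coefQ.
have [yQ|yQ] := pselect (rect_set Q y); last by rewrite indicE memNset// !mul0r.
have [_ _ /(_ y yQ)[y1 y2]] := hG Q QG; congr (_ * _).
have i1 : Q.1.1 \in undup [seq q.1.1 | q <- G] by rewrite mem_undup; exact: (map_f (fun q : drect n m => q.1.1) QG).
have i2 : Q.2.1 \in undup [seq q.2.1 | q <- G] by rewrite mem_undup; exact: (map_f (fun q : drect n m => q.2.1) QG).
have [co1 h1] := r1 _ _ i1 y1; have [co2 h2] := r2 _ _ i2 y2.
have kB1 := skern_kern (kp_B_s kp1 Q.1.1); have kB2 := skern_kern (kp_B_s kp2 Q.2.1).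
have kK1 := kern_tr (f1.1 Q.1.1); have kK2 := kern_tr (f2.1 Q.2.1).
by rewrite (Op2_replace1 La a0 kB1 kK1 kB2 am1 h1) (Op2_replace2 La a0 kB2 kK2 kK1 am2 h2).
Qed.

(** The factors 2^(3n) and 2^(3m) are the cost of third ancestors in [nb_up3]; 2^n 2^m is that of
    the half neighbourhood. *)
Definition Cfar : R := (C1 * C2 * (Ccls n C1 * Ccls m C2)) `^ (2^-1 * p) *
  (2 ^+ n * 2 ^+ m * (2 ^+ (3 * n) * 2 ^+ (3 * m))) `^ (1 - 2^-1 * p).

Lemma far_bound G i j : uniq G -> {subset G <= F} ->
  (forall Q, Q \in G -> [/\ cls Q.1 S.1 = i, cls Q.2 S.2 = j & rect_set Q `<=` (nb2 2 (up2 i j S) : set pt)]) ->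
  nu (PF G a) `^ p <= M `^ p * Cfar * (rho n s1 p ^+ i * rho m s2 p ^+ j) *
    ((\int[P]_x a x ^+ 2) `^ (2^-1 * p) * rvol R S `^ (1 - 2^-1 * p)).
Proof.
case: G => [|Q0 G'] uG GF hG.
  rewrite (pnu0 p0 hnu); last by move=> x; rewrite /PF big_nil.
  by rewrite !mulr_ge0 ?powR_ge0 ?exprn_ge0 ?rho_ge0.
move: uG GF hG; have Q0G : Q0 \in Q0 :: G' by exact: mem_head.
set G := Q0 :: G' in Q0G * => uG GF hG.
have X0 : 0 <= \int[P]_x a x ^+ 2 by apply: Rintegral_ge0 => x _; exact: sqr_ge0.
have cc1 := Ccls_gt0 kp1; have cc2 := Ccls_gt0 kp2.
have rG := rD_PF kp1 kp2 G La.
have D0 : 0 <= C1 * C2 * (Ccls n C1 * Ccls m C2) by apply: ltW; rewrite mulr_gt0// mulr_gt0.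
have E0 : (0 : R) <= 2 ^+ n * 2 ^+ m * (2 ^+ (3 * n) * 2 ^+ (3 * m)) by rewrite !mulr_ge0 ?exprn_ge0.
rewrite /Cfar -(far_power n m s1 s2 i j (introT andP (conj p0 p1)) M0 D0 E0 X0 (ltW (rvol_gt0 R S))).
apply: (pnu_le p0 hnu rG).
pose W := up2 3 3 (up2 i j S).
have QW Q : Q \in G -> (nb2 2^-1 Q : set pt) `<=` nb2 2^-1 W.
  move=> QG x hx; have [e1 e2 h] := hG Q QG.
  have [|| g1 g2] := nb2_mono (S := up2 i j S) _ _ h hx.
  - by rewrite -e1; exact: cls_exp.
  - by rewrite -e2; exact: cls_exp.
  by split; exact: nb_up3.
have h2 : (0 : R) < 2^-1 by rewrite invr_gt0.
have Q0W : (rect_set Q0 : set pt) `<=` nb2 2^-1 W.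
  by move=> x [x1 x2]; apply: (QW Q0 Q0G); split; exact: sub_nb.
have sW x : ~ nb2 2^-1 W x -> PF G a x = 0.
  move=> hx; rewrite /PF big_seq big1// => Q QG; apply: (piece_supp kp1 kp2) => h; apply: hx; exact: QW h.
apply: le_trans (rect_bound n0 m0 hab (GF _ Q0G) Q0W rG sW M0 p2) _.
have -> : 2 ^+ n * 2 ^+ m * rvol R W = 2 ^+ n * 2 ^+ m * (2 ^+ (3 * n) * 2 ^+ (3 * m)) *
    (rvol R S * (2 ^+ (i * n) * 2 ^+ (j * m))) by rewrite /W !rvol_up; ring.
apply: ler_wpM2r; first exact: powR_ge0.
apply: ler_wpM2l => //; apply: ler_wsqrtr; apply: le_trans (far_energy uG hG) _.
by rewrite le_eqVlt; apply/orP; left; apply/eqP; ring.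
Qed.

End FarPiece.
End Parts.

(** * Uniform bound on atoms *)

Section MainEstimate.
Variables (R : realType) (n m : nat) (p : R) (s1 s2 : nat) (C1 C2 : R).
Hypotheses (n0 : (0 < n)%N) (m0 : (0 < m)%N) (p0 : 0 < p) (p1 : p <= 1).
Hypotheses (hs1 : n%:R * (p^-1 - 1) < s1.+1%:R) (hs2 : m%:R * (p^-1 - 1) < s2.+1%:R).
Variables (A1 B1 k1 : int -> n.-tuple R -> n.-tuple R -> R) (A2 B2 k2 : int -> m.-tuple R -> m.-tuple R -> R).
Hypotheses (kp1 : kpack s1 C1 A1 B1 k1) (kp2 : kpack s2 C2 A2 B2 k2).
Local Notation pt := (pt R n m).
Local Notation P := (@leb2 R n m).
Local Notation PF := (PF A1 B1 A2 B2).
Local Notation piece := (piece A1 B1 A2 B2).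
Local Notation Cst := (Cst R n m).
Implicit Types (Q S : drect n m) (F G : seq (drect n m)) (a : pt -> R).

(* The properties of the real or imaginary part of an atom that the estimate uses. *)
Record ratom (Om : set pt) (a : pt -> R) (aR : drect n m -> pt -> R) : Prop := {
  ra_open : open_set Om;
  ra_fin : (P Om < +oo)%E;
  ra_V : 0 < fine (P Om);
  ra_L2 : L2f P a;
  ra_RL2 : forall Q, maxrect Om Q -> L2f P (aR Q);
  ra_supp : forall Q, maxrect Om Q -> forall x, ~ dbl_rect_set Q x -> aR Q x = 0;
  ra_m1 : forall Q, maxrect Om Q -> forall x2, rmz s1 (fun x1 => aR Q (x1, x2));
  ra_m2 : forall Q, maxrect Om Q -> forall x1, rmz s2 (fun x2 => aR Q (x1, x2));
  ra_AI : forall e : R, 0 < e -> exists s : seq (drect n m),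
    [/\ uniq s, forall Q, Q \in s -> maxrect Om Q & \int[P]_x (a x - \sum_(Q <- s) aR Q x) ^+ 2 <= e];
  ra_b : \int[P]_x a x ^+ 2 <= (fine (P Om) `^ (2^-1 - p^-1)) ^+ 2;
  ra_bR : forall s : seq (drect n m), uniq s -> (forall Q, Q \in s -> maxrect Om Q) ->
    \sum_(Q <- s) \int[P]_x aR Q x ^+ 2 <= (fine (P Om) `^ (2^-1 - p^-1)) ^+ 2 }.

Lemma leq_sum_mem (I : eqType) (s : seq I) (f : I -> nat) i : i \in s -> (f i <= \sum_(j <- s) f j)%N.
Proof. by move=> h; rewrite (big_rem i h) /= leq_addr. Qed.

Lemma bad_total_aux (c i j : R) : 0 <= c * (i * j) -> 1 <= c * (1 + i + j) ->
  1 + 2 * c * (1 + i + j) <= 3 * c * (1 + i + j + i * j).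
Proof. by move: c i j => c i j; lra. Qed.

Let r1 := rho n s1 p.
Let r2 := rho m s2 p.
Local Notation Cf := (Cfar n m p C1 C2).
Let Cst1 : 1 <= Cst. Proof. exact: Cst_ge1. Qed.

Section OneAtom.
Variables (nu : (pt -> R) -> R) (M : R) (F : seq (drect n m)).
Hypotheses (hnu : pnu p s1 s2 nu) (M0 : 0 <= M) (hab : abd p s1 s2 nu M F) (uF : uniq F).
Variables (Om : set pt) (a : pt -> R) (aR : drect n m -> pt -> R) (s : seq (drect n m)) (K : nat).
Hypotheses (ra : ratom Om a aR) (us : uniq s) (smax : forall Q, Q \in s -> maxrect Om Q).
Hypotheses (K1 : forall Q S, Q \in F -> S \in s -> (cls Q.1 S.1 < K)%N).
Hypotheses (K2 : forall Q S, Q \in F -> S \in s -> (cls Q.2 S.2 < K)%N).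
Local Notation V := (fine (P Om)).
Local Notation b2 := ((fine (P Om) `^ (2^-1 - p^-1)) ^+ 2).

Definition goodS S := hdense (Om2 Om s K) S.
(* Q is near if it lies in the neighbourhood of a good ancestor, of side at least that of Q, of some
   rectangle of s; Fij S i j collects the far rectangles of class (i, j) relative to S. *)
Definition nearQ Q := has (fun S => goodS (up2 (cls Q.1 S.1) (cls Q.2 S.2) S) &&
  `[< rect_set Q `<=` (nb2 2 (up2 (cls Q.1 S.1) (cls Q.2 S.2) S) : set pt) >]) s.
Definition Ff := [seq Q <- F | ~~ nearQ Q].
Definition Fij S i j := [seq Q <- Ff | (cls Q.1 S.1 == i) && (cls Q.2 S.2 == j)].

Let mOm : measurable Om. Proof. exact: open_measurable2 (ra_open ra). Qed.

Lemma near_est : nu (PF [seq Q <- F | nearQ Q] a) `^ p <=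
  M `^ p * (C1 * C2 * (Cst * Cst) `^ (p^-1 - 2^-1)) `^ p.
Proof.
pose good := [seq q <- [seq up2 (cls Q.1 q.1) (cls Q.2 q.2) q | Q <- F, q <- s] | goodS q].
apply: (@near_part R n m p s1 s2 C1 C2 n0 m0 p0 p1 A1 B1 k1 A2 B2 k2 kp1 kp2 nu M F hnu M0 hab Om s K _ good) => //.
- exact: ra_fin ra.
- exact: ra_V ra.
- exact: filter_uniq.
- by move=> Q; rewrite mem_filter => /andP[].
- by move=> S; rewrite mem_filter => /andP[].
- move=> Q; rewrite mem_filter => /andP[/hasP[S Ss /andP[g /asboolP h]] QF].
  exists (up2 (cls Q.1 S.1) (cls Q.2 S.2) S).
    by rewrite mem_filter g; apply/allpairsP; exists (Q, S).
  by split => //; exact: cls_exp.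
- exact: ra_L2 ra.
- exact: ra_b ra.
Qed.

Lemma far_est_bad S i j : S \in s -> ~~ goodS (up2 i j S) ->
  nu (PF (Fij S i j) (aR S)) `^ p <=
  M `^ p * Cf * (r1 ^+ i * r2 ^+ j) * (\int[P]_x aR S x ^+ 2 / b2 + rvol R S / V).
Proof.
move=> Ss gS; have Sm := smax Ss.
pose G := [seq Q <- Fij S i j | `[< rect_set Q `<=` (nb2 2 (up2 i j S) : set pt) >]].
have -> : PF (Fij S i j) (aR S) = PF G (aR S).
  apply/funext => x; rewrite (PF_filter _ _ _ _ (fun Q => `[< rect_set Q `<=` (nb2 2 (up2 i j S) : set pt) >])) -/G.
  rewrite [X in _ + X](_ : _ = 0) ?addr0// /PF big_seq big1// => Q.
  rewrite mem_filter => /andP[/asboolPn h]; rewrite mem_filter => /andP[/andP[/eqP e1 /eqP e2] _].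
  by apply: (far_zero kp1 kp2 (S := S)); [exact: ra_supp ra _ Sm|rewrite e1 e2].
have uG : uniq G by do 3 (apply: filter_uniq).
have GF : {subset G <= F}.
  by move=> Q; rewrite !mem_filter => /andP[_ /andP[_ /andP[]]].
have hG Q : Q \in G -> [/\ cls Q.1 S.1 = i, cls Q.2 S.2 = j & rect_set Q `<=` (nb2 2 (up2 i j S) : set pt)].
  by rewrite !mem_filter => /andP[/asboolP h /andP[/andP[/eqP e1 /eqP e2] _]].
apply: le_trans (far_bound n0 m0 p0 p1 kp1 kp2 hnu M0 hab (ra_RL2 ra Sm) (ra_supp ra Sm)
  (ra_m1 ra Sm) (ra_m2 ra Sm) uG GF hG) _.
apply: ler_wpM2l; first by rewrite !mulr_ge0 ?powR_ge0 ?exprn_ge0 ?rho_ge0.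
apply: powR_young_V; rewrite ?p0//; first exact: ra_V ra.
  by apply: Rintegral_ge0 => x _; exact: sqr_ge0.
exact: ltW (rvol_gt0 _ _).
Qed.

(** If the enlarged S is good, a rectangle of this class inside its neighbourhood would be near. So
    the far rectangles of the class are out of reach of aR S. *)
Lemma far_est_good S i j : S \in s -> goodS (up2 i j S) -> nu (PF (Fij S i j) (aR S)) `^ p = 0.
Proof.
move=> Ss gS; have Sm := smax Ss; apply: (pnu0 p0 hnu) => x; rewrite /PF big_seq big1// => Q.
rewrite mem_filter => /andP[/andP[/eqP e1 /eqP e2]]; rewrite mem_filter => /andP[nQ QF].
apply: (far_zero kp1 kp2 (S := S)); first exact: ra_supp ra _ Sm.
move=> h; move/negP: nQ; apply; apply/hasP; exists S => //.
by apply/andP; split; [rewrite e1 e2|apply/asboolP].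
Qed.

Lemma far_est_S S : S \in s -> nu (PF Ff (aR S)) `^ p <=
  \sum_(i <- index_iota 0 K) \sum_(j <- index_iota 0 K) nu (PF (Fij S i j) (aR S)) `^ p.
Proof.
move=> Ss; have LS := ra_RL2 ra (smax Ss).
have -> : PF Ff (aR S) = (fun x => \sum_(i <- index_iota 0 K) \sum_(j <- index_iota 0 K) PF (Fij S i j) (aR S) x).
  apply/funext => x.
  rewrite {1}/PF -(@sum_regroup2 _ _ _ _ Ff (index_iota 0 K) (index_iota 0 K) (fun Q => cls Q.1 S.1) (fun Q => cls Q.2 S.2)) ?iota_uniq//.
  - by apply: eq_bigr => i _; apply: eq_bigr => j _; rewrite /PF /Fij big_filter.
  - by move=> Q; rewrite mem_filter mem_index_iota => /andP[_ QF]; exact: K1.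
  - by move=> Q; rewrite mem_filter mem_index_iota => /andP[_ QF]; exact: K2.
have rG i j : rD s1 s2 (PF (Fij S i j) (aR S)) by exact: (rD_PF kp1 kp2 _ LS).
apply: le_trans (pnu_sum p0 hnu (g := fun i x => \sum_(j <- index_iota 0 K) PF (Fij S i j) (aR S) x) _) _.
  by move=> i _; exact: rD_sum.
by apply: ler_sum => i _; apply: (pnu_sum p0 hnu).
Qed.

(** After normalisation the energies add up to at most 1 by (AII); the volumes are bounded by
    [bad_sum]. *)
Lemma bad_total i j : (i < K)%N ->
  \sum_(S <- s | ~~ goodS (up2 i j S)) (\int[P]_x aR S x ^+ 2 / b2 + rvol R S / V) <=
  3 * Cst * ((1 + i%:R) * (1 + j%:R)).
Proof.
move=> iK; have V0 := ra_V ra; have b20 : 0 < b2 by rewrite exprn_gt0// powR_gt0.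
rewrite -big_filter; set t := [seq S <- s | _].
have ut : uniq t by exact: filter_uniq.
have ts : {subset t <= s} by move=> S; rewrite mem_filter => /andP[].
have tm S : S \in t -> maxrect Om S by move=> /ts /smax.
rewrite big_split /= -!mulr_suml.
have h1 : (\sum_(S <- t) \int[P]_x aR S x ^+ 2) / b2 <= 1.
  by rewrite ler_pdivrMr// mul1r; have := ra_bR ra ut tm.
have h2 : (\sum_(S <- t) rvol R S) / V <= 2 * Cst * (1 + i%:R + j%:R).
  rewrite ler_pdivrMr//; apply: (bad_sum n0 m0 mOm (ra_fin ra) smax ut ts iK).
  by move=> S; rewrite mem_filter => /andP[].
apply: le_trans (lerD h1 h2) _.
have i0 : (0 : R) <= i%:R by []. have j0 : (0 : R) <= j%:R by [].
have q0 : (0 : R) <= i%:R * j%:R by rewrite mulr_ge0.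
have -> : (1 + i%:R) * (1 + j%:R) = 1 + i%:R + j%:R + i%:R * j%:R :> R by ring.
have g0 : 0 <= 1 + i%:R + j%:R :> R by rewrite !addr_ge0.
have : 1 <= Cst * (1 + i%:R + j%:R).
  by rewrite -[leLHS]mulr1; apply: ler_pM => //; rewrite -addrA lerDl addr_ge0.
have : 0 <= Cst * (i%:R * j%:R) by rewrite mulr_ge0// (le_trans ler01).
exact: bad_total_aux.
Qed.

(** The class is summed last: for fixed (i, j) the sum over the bad S grows at most like (1 + i)(1 +
    j), which the powers of r1 and r2, both less than 1, absorb. *)
Lemma far_est : \sum_(S <- s) nu (PF Ff (aR S)) `^ p <=
  M `^ p * Cf * (3 * Cst) * (((1 - r1) ^+ 2)^-1 * ((1 - r2) ^+ 2)^-1).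
Proof.
have c0 i j : 0 <= M `^ p * Cf * (r1 ^+ i * r2 ^+ j) by rewrite !mulr_ge0 ?powR_ge0 ?exprn_ge0 ?rho_ge0.
apply: (@le_trans _ _ (\sum_(i <- index_iota 0 K) \sum_(j <- index_iota 0 K)
   M `^ p * Cf * (r1 ^+ i * r2 ^+ j) * (3 * Cst * ((1 + i%:R) * (1 + j%:R))))).
  apply: (@le_trans _ _ (\sum_(S <- s) \sum_(i <- index_iota 0 K) \sum_(j <- index_iota 0 K)
    nu (PF (Fij S i j) (aR S)) `^ p)).
    by rewrite big_seq [leRHS]big_seq; apply: ler_sum => S Ss; exact: far_est_S.
  rewrite exchange_big /= big_seq [leRHS]big_seq; apply: ler_sum => i; rewrite mem_index_iota => /andP[_ iK].
  rewrite exchange_big /=; apply: ler_sum => j _.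
  apply: le_trans (ler_wpM2l (c0 i j) (bad_total j iK)).
  rewrite (bigID (fun S => goodS (up2 i j S))) /= [X in X + _]big1_seq ?add0r; last first.
    by move=> S /andP[gS Ss]; exact: far_est_good.
  rewrite mulr_sumr big_seq_cond [leRHS]big_seq_cond; apply: ler_sum => S /andP[Ss gS].
  exact: far_est_bad.
have -> : \sum_(i <- index_iota 0 K) \sum_(j <- index_iota 0 K)
   M `^ p * Cf * (r1 ^+ i * r2 ^+ j) * (3 * Cst * ((1 + i%:R) * (1 + j%:R))) =
  M `^ p * Cf * (3 * Cst) * ((\sum_(i < K) (1 + i%:R) * r1 ^+ i) * (\sum_(j < K) (1 + j%:R) * r2 ^+ j)).
  rewrite mulr_suml mulr_sumr -[RHS](big_mkord xpredT (fun i => M `^ p * Cf * (3 * Cst) *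
    ((1 + i%:R) * r1 ^+ i * \sum_(j < K) (1 + j%:R) * r2 ^+ j))); apply: eq_bigr => i _.
  rewrite mulr_sumr mulr_sumr -[RHS](big_mkord xpredT (fun j => M `^ p * Cf * (3 * Cst) *
    ((1 + i%:R) * r1 ^+ i * ((1 + j%:R) * r2 ^+ j)))); apply: eq_bigr => j _; ring.
apply: ler_wpM2l; first by rewrite !mulr_ge0 ?powR_ge0// (le_trans ler01).
apply: ler_pM; try by apply: sumr_ge0 => i _; rewrite mulr_ge0 ?addr_ge0 ?exprn_ge0 ?rho_ge0.
  by apply: sum_lin_geo; rewrite rho_ge0 rho_lt1.
by apply: sum_lin_geo; rewrite rho_ge0 rho_lt1.
Qed.

Lemma atom_split x : PF F a x = PF [seq Q <- F | nearQ Q] a x +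
  (PF Ff (fun y => a y - \sum_(S <- s) aR S y) x + \sum_(S <- s) PF Ff (aR S) x).
Proof.
have Ls S : S \in s -> L2f P (aR S) by move=> /smax; exact: ra_RL2 ra _.
have La := ra_L2 ra; have LS := L2f_sum Ls.
have Le : L2f P (fun y => a y - \sum_(S <- s) aR S y).
  rewrite (_ : (fun y => _) = (fun y => 1 * a y + (-1) * \sum_(S <- s) aR S y)); first exact: L2f_lin.
  by apply/funext => y; rewrite mul1r mulN1r.
rewrite (PF_filter _ _ _ _ nearQ) -/Ff; congr (_ + _).
rewrite -(PF_sum kp1 kp2 _ _ Ls).
transitivity (PF Ff (fun y => 1 * (a y - \sum_(S <- s) aR S y) + 1 * \sum_(S <- s) aR S y) x).
  by congr (PF Ff _ x); apply/funext => y; rewrite !mul1r subrK.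
by rewrite (PF_lin kp1 kp2)// !mul1r.
Qed.

End OneAtom.

(** The summands belong, in this order, to the near rectangles, to the L^2 error of a finite partial
    sum and to the far rectangles. *)
Definition Cme : R := (C1 * C2 * (Cst * Cst) `^ (p^-1 - 2^-1)) `^ p + 1 +
  Cf * (3 * Cst) * (((1 - r1) ^+ 2)^-1 * ((1 - r2) ^+ 2)^-1).

Theorem main_estimate nu M F Om a aR : pnu p s1 s2 nu -> 0 <= M -> abd p s1 s2 nu M F -> uniq F ->
  ratom Om a aR -> nu (PF F a) `^ p <= M `^ p * Cme.
Proof.
move=> hnu M0 hab uF ra.
have C0 : 0 < C1 * C2 by rewrite mulr_gt0 ?(kp_C0 kp1) ?(kp_C0 kp2).
have er0 G : 0 <= errc p G :> R by apply: sumr_ge0 => Q _; exact: powR_ge0.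
(* e is the accuracy to which the atom is replaced by a finite sum of components. With d^p = 1 /
   (errc + 1) the error contributes at most M^p, the middle summand of [Cme]. *)
pose d := (errc p F + 1) `^ (- p^-1); pose e := (d / (C1 * C2)) ^+ 2.
have D1 : 0 < errc p F + 1 by rewrite ltr_wpDl.
have d0 : 0 < d by exact: powR_gt0.
have e0 : 0 < e by rewrite exprn_gt0// divr_gt0.
have [s [us smax hs]] := ra_AI ra e0.
pose K := (\sum_(Q <- F) \sum_(S <- s) (cls Q.1 S.1 + cls Q.2 S.2)).+1.
have KK Q S : Q \in F -> S \in s -> (cls Q.1 S.1 + cls Q.2 S.2 < K)%N.
  move=> QF Ss; rewrite ltnS.
  apply: leq_trans (leq_sum_mem (fun Q => \sum_(S <- s) (cls Q.1 S.1 + cls Q.2 S.2))%N QF).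
  exact: (leq_sum_mem (fun S => cls Q.1 S.1 + cls Q.2 S.2)%N Ss).
have K1 Q S : Q \in F -> S \in s -> (cls Q.1 S.1 < K)%N.
  by move=> QF Ss; apply: leq_ltn_trans (KK Q S QF Ss); exact: leq_addr.
have K2 Q S : Q \in F -> S \in s -> (cls Q.2 S.2 < K)%N.
  by move=> QF Ss; apply: leq_ltn_trans (KK Q S QF Ss); exact: leq_addl.
have Ls S : S \in s -> L2f P (aR S) by move=> /smax; exact: ra_RL2 ra _.
have La := ra_L2 ra; have LS := L2f_sum Ls.
pose er y := a y - \sum_(S <- s) aR S y.
have Le : L2f P er.
  rewrite (_ : er = (fun y => 1 * a y + (-1) * \sum_(S <- s) aR S y)); first exact: L2f_lin.
  by apply/funext => y; rewrite mul1r mulN1r.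
pose Ff' := Ff F Om s K.
have -> : PF F a = (fun x => PF [seq Q <- F | nearQ Om s K Q] a x +
   (PF Ff' er x + \sum_(S <- s) PF Ff' (aR S) x)) by apply/funext => x; apply: atom_split.
have rn := rD_PF kp1 kp2 [seq Q <- F | nearQ Om s K Q] La.
have re := rD_PF kp1 kp2 Ff' Le.
have rs S : S \in s -> rD s1 s2 (PF Ff' (aR S)) by move=> /Ls LS'; exact: (rD_PF kp1 kp2 Ff' LS').
apply: le_trans (pnu_D hnu rn (rD_add re (rD_sum rs))) _.
rewrite /Cme -addrA mulrDr; apply: lerD; first by apply: near_est => //; exact: ra.
apply: le_trans (pnu_D hnu re (rD_sum rs)) _.
rewrite mulrDr; apply: lerD.
  have FfF : {subset Ff' <= F} by move=> Q; rewrite mem_filter => /andP[].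
  apply: le_trans (err_part n0 m0 p0 p1 kp1 kp2 hnu M0 hab FfF Le) _.
  rewrite -mulrA; apply: ler_wpM2l; first exact: powR_ge0.
  apply: (@le_trans _ _ (d `^ p * errc p F)).
    apply: ler_pM; rewrite ?powR_ge0//.
      apply: ge0_ler_powR; rewrite ?nnegrE ?(ltW p0) ?(ltW d0)//.
        by rewrite mulr_ge0 ?sqrtr_ge0// ltW.
      rewrite -ler_pdivlMl// mulrC -[leRHS]gtr0_norm ?divr_gt0// -sqrtr_sqr.
      exact: ler_wsqrtr.
    by apply: sum_sub_uniq => //; [exact: filter_uniq|move=> Q; exact: powR_ge0].
  rewrite /d -powRrM mulNr mulVf ?gt_eqF// powR_inv1 ?(ltW D1)// mulrC ler_pdivrMr// mul1r lerDl//.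
apply: le_trans (pnu_sum p0 hnu rs) _; apply: le_trans (far_est hnu M0 hab uF ra us smax K1 K2) _.
by rewrite -!mulrA.
Qed.

End MainEstimate.

Lemma powR_subadd (R : realType) (u v t : R) : 0 <= u -> 0 <= v -> 0 < t <= 1 ->
  (u + v) `^ t <= u `^ t + v `^ t.
Proof.
move=> u0 v0 /andP[t0 t1].
have [->|u1] := eqVneq u 0; first by rewrite powR0 ?gt_eqF// !add0r.
have [->|v1] := eqVneq v 0; first by rewrite [0 `^ t]powR0 ?gt_eqF// !addr0.
have {u0 u1}u0 : 0 < u by rewrite lt_def u1.
have {v0 v1}v0 : 0 < v by rewrite lt_def v1.
have s0 : 0 < u + v by rewrite addr_gt0.
have key w : 0 < w -> w <= u + v -> w / (u + v) * (u + v) `^ t <= w `^ t.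
  move=> w0 wl; have w1 : 0 < w / (u + v) <= 1 by rewrite divr_gt0//= ler_pdivrMr// mul1r.
  apply: le_trans (ler_wpM2r (powR_ge0 _ _) (ger1_powR w1 t1)) _.
  rewrite -powRM ?(ltW s0) ?divr_ge0 ?(ltW w0) ?(ltW s0)// divfK ?gt_eqF//.
have uv : u <= u + v by rewrite lerDl ltW.
have vu : v <= u + v by rewrite lerDr ltW.
apply: le_trans (lerD (key u u0 uv) (key v v0 vu)).
by rewrite -mulrDl -mulrDl mulfV ?gt_eqF// mul1r.
Qed.

(** * Passage from atoms to atomic series *)

Section AtomParts.
Variables (R : realType) (n m : nat) (p : R) (s1 s2 : nat).
Local Notation pt := (pt R n m).
Local Notation P := (@leb2 R n m).
Local Notation hp := (boxes_pt R n m).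
Local Notation C := R[i].

Lemma cmod_sqr (z : C) : cmod z ^+ 2 = cre z ^+ 2 + cim z ^+ 2.
Proof. by rewrite sqr_sqrtr// addr_ge0// sqr_ge0. Qed.

Lemma L2sq_le (g : pt -> C) c : 0 <= c -> (L2norm g <= c%:E)%E -> (L2sq g <= (c ^+ 2)%:E)%E.
Proof.
move=> c0; rewrite /L2norm; have : (0 <= L2sq g)%E by apply: integral_ge0 => x _; rewrite lee_fin sqr_ge0.
case: (L2sq g) => [r||] //=; rewrite !lee_fin => r0 h.
by rewrite -[leLHS]sqr_sqrtr// lerXn2r ?nnegrE ?sqrtr_ge0.
Qed.

(** Lets the real and the imaginary part be treated by one argument. *)
Record cpart (h : C -> R) : Prop := {
  cp_or : h = @cre R \/ h = @cim R;
  cp_B : forall z w, h (z - w) = h z - h w;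
  cp_le : forall z, h z ^+ 2 <= cmod z ^+ 2;
  cp_meas : forall g : pt -> C, cmeasurable g -> measurable_fun setT (fun x => h (g x)) }.

Lemma cpart_re : cpart (@cre R).
Proof.
split; [by left|by move=> [a b] [c d]|by move=> z; rewrite cmod_sqr lerDl sqr_ge0|by move=> g []].
Qed.

Lemma cpart_im : cpart (@cim R).
Proof.
split; [by right|by move=> [a b] [c d]|by move=> z; rewrite cmod_sqr lerDr sqr_ge0|by move=> g []].
Qed.

Variable h : C -> R.
Hypothesis hh : cpart h.

Lemma cp0 : h 0 = 0. Proof. by rewrite -(subrr 0) (cp_B hh) subrr. Qed.

Lemma cp_sum (I : Type) (s : seq I) (z : I -> C) : h (\sum_(i <- s) z i) = \sum_(i <- s) h (z i).
Proof.
elim: s => [|i s IH]; first by rewrite !big_nil cp0.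
by rewrite !big_cons -IH -[\sum_(j <- s) z j in LHS]opprK -[- \sum_(j <- s) z j]sub0r !(cp_B hh) cp0; ring.
Qed.

Lemma cmeasurable_sub (f g : pt -> C) : cmeasurable f -> cmeasurable g -> cmeasurable (fun x => f x - g x).
Proof.
move=> [f1 f2] [g1 g2]; split.
  rewrite (_ : (fun x => _) = (fun x => cre (f x) - cre (g x))); first exact: measurable_funB.
  by apply/funext => x; case: (f x) (g x) => [a b] [c d].
rewrite (_ : (fun x => _) = (fun x => cim (f x) - cim (g x))); first exact: measurable_funB.
by apply/funext => x; case: (f x) (g x) => [a b] [c d].
Qed.

Lemma cmeasurable_sum (I : eqType) (s : seq I) (g : I -> pt -> C) : (forall i, i \in s -> cmeasurable (g i)) ->
  cmeasurable (fun x => \sum_(i <- s) g i x).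
Proof.
elim: s => [|i s IH] hs.
  rewrite (_ : (fun x => _) = (fun=> 0)); last by apply/funext => x; rewrite big_nil.
  by split; exact: measurable_cst.
have [a1 a2] := hs i (mem_head _ _).
have [b1 b2] := IH (fun j js => hs j (ltac:(by rewrite inE js orbT))).
split.
  rewrite (_ : (fun x => _) = (fun x => cre (g i x) + cre (\sum_(j <- s) g j x))); first exact: measurable_funD.
  by apply/funext => x; rewrite big_cons; case: (g i x) (\sum_(j <- s) g j x) => [a b] [c d].
rewrite (_ : (fun x => _) = (fun x => cim (g i x) + cim (\sum_(j <- s) g j x))); first exact: measurable_funD.
by apply/funext => x; rewrite big_cons; case: (g i x) (\sum_(j <- s) g j x) => [a b] [c d].
Qed.

Lemma L2f_part (g : pt -> C) : cmeasurable g -> (L2sq g < +oo)%E ->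
  L2f P (fun x => h (g x)) /\ ((\int[P]_x h (g x) ^+ 2)%:E <= L2sq g)%E.
Proof.
move=> mg fg; have mh := cp_meas hh mg; have [g1 g2] := mg.
have mc : measurable_fun setT (fun x => (cmod (g x) ^+ 2)%:E).
  rewrite (_ : (fun x => _) = EFin \o (fun x => cre (g x) ^+ 2 + cim (g x) ^+ 2)).
    by apply/measurable_EFinP; apply: measurable_funD; apply: measurable_funX.
  by apply/funext => x /=; rewrite cmod_sqr.
have mh2 : measurable_fun setT (fun x => (h (g x) ^+ 2)%:E).
  by apply/measurable_EFinP; exact: measurable_funX.
have le : (\int[P]_x (h (g x) ^+ 2)%:E <= L2sq g)%E.
  apply: ge0_le_integral => //; try by move=> x _; rewrite lee_fin sqr_ge0.
  by move=> x _; rewrite lee_fin; exact: cp_le hh _.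
have fin : (\int[P]_x (h (g x) ^+ 2)%:E < +oo)%E by exact: le_lt_trans le fg.
split; last first.
  rewrite /Rintegral fineK// ge0_fin_numE//.
  by apply: integral_ge0 => x _; rewrite lee_fin sqr_ge0.
split => //; apply/integrableP; split => //.
rewrite (eq_integral (fun x => (h (g x) ^+ 2)%:E))// => x _ /=.
by rewrite ger0_norm// sqr_ge0.
Qed.

Lemma rmz_part k s (D : set (k.-tuple R)) (g : k.-tuple R -> R) : measurable_fun setT g ->
  (forall x, ~ D x -> g x = 0) ->
  (forall al : k.-tuple nat, (mabs al <= s)%N -> (\int[@lebn R k]_(x in D) (g x * mono al x)%:E = 0)%E) -> rmz s g.
Proof.
move=> mg g0 hg; apply: rmz_ereal => // al hal; rewrite -(hg al hal) [RHS]integral_mkcond.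
apply: eq_integral => x _; rewrite patchE; case: ifPn => // /negP xD.
by rewrite g0 ?mul0r//; apply: contra_not xD; rewrite inE.
Qed.

Lemma rmz0 k s : rmz s (fun _ : k.-tuple R => 0).
Proof.
apply: rmz_ereal => // al _.
by under eq_integral do rewrite mul0r; rewrite integral0.
Qed.

(** An atom whose open set is empty vanishes; it is a separate case because [ratom] asks for
    positive measure, by which the estimates divide. *)
Definition ratp (g : pt -> R) := (forall x, g x = 0) \/ exists Om aR, ratom p s1 s2 Om g aR.

Lemma atom_rat (a : pt -> C) : atom p s1 s2 a -> ratp (fun x => h (a x)).
Proof.
case=> O; case=> aR H; move: H => /= [oO fO ma aO [hQ hAI hb hbR]].
have [[x0 Ox0]|Oe] := pselect (exists x, O x); last first.
  by left => x; rewrite aO ?cp0// => Ox; apply: Oe; exists x.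
right; exists O, (fun Q x => h (aR Q x)).
have mO := open_measurable2 oO.
have V0 : 0 < fine (P O).
  have [Q _ QO] := open_rect oO Ox0.
  by apply: lt_le_trans (fine_leb2_ge mO fO QO); exact: rvol_gt0.
set b := fine (P O) `^ (2^-1 - p^-1) in hb hbR *.
have b0 : 0 <= b by exact: powR_ge0.
have La : (L2sq a <= (b ^+ 2)%:E)%E by exact: L2sq_le.
have hS : (\esum_(Q in maxrect O) L2sq (aR Q) <= (b ^+ 2)%:E)%E.
  move: hbR; have : (0 <= \esum_(Q in maxrect O) L2sq (aR Q))%E.
    by apply: esum_ge0 => Q _; apply: integral_ge0 => x _; rewrite lee_fin sqr_ge0.
  case: (\esum_(Q in _) _) => [r||] //=; rewrite !lee_fin => r0 hr.
  by rewrite -[leLHS]sqr_sqrtr// lerXn2r ?nnegrE ?sqrtr_ge0.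
have hseq s : uniq s -> (forall Q, Q \in s -> maxrect O Q) -> (\sum_(Q <- s) L2sq (aR Q) <= (b ^+ 2)%:E)%E.
  move=> us ms; apply: le_trans hS; apply: esum_ge; exists [set` s].
    by split; [exact: finite_seq|move=> Q /= /ms].
  by rewrite -fsbig_seq.
have LQ Q : maxrect O Q -> (L2sq (aR Q) < +oo)%E.
  move=> mQ; have /(_ isT) := @hseq [:: Q].
  rewrite big_seq1 => hh'; apply: (@le_lt_trans _ _ (b ^+ 2)%:E); last by rewrite ltry.
  by apply: hh' => Q'; rewrite inE => /eqP ->.
have faO : (L2sq a < +oo)%E by apply: le_lt_trans La _; rewrite ltry.
split => //.
- by have [] := L2f_part ma faO.
- by move=> Q mQ; have [mm _ _ _] := hQ Q mQ; have [] := L2f_part mm (LQ Q mQ).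
- by move=> Q mQ x hx; have [_ -> // _ _] := hQ Q mQ; exact: cp0.
- move=> Q mQ x2; have [mm sup m1 _] := hQ Q mQ; have mh := cp_meas hh mm.
  have [hx2|hx2] := pselect (dbl_cube_set Q.2 x2); last first.
    rewrite (_ : (fun x1 => _) = (fun=> 0)); first exact: rmz0.
    by apply/funext => x1; rewrite sup ?cp0// => -[].
  apply: (rmz_part (D := dbl_cube_set Q.1)).
  + by apply: (measurableT_comp mh); exact: measurable_pair2.
  + by move=> x1 hx1; rewrite sup ?cp0// => -[].
  + by move=> al hal; have [g1 g2] := m1 x2 al hx2 hal; case: (cp_or hh) => ->.
- move=> Q mQ x1; have [mm sup _ m2] := hQ Q mQ; have mh := cp_meas hh mm.
  have [hx1|hx1] := pselect (dbl_cube_set Q.1 x1); last first.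
    rewrite (_ : (fun x2 => _) = (fun=> 0)); first exact: rmz0.
    by apply/funext => x2; rewrite sup ?cp0// => -[].
  apply: (rmz_part (D := dbl_cube_set Q.2)).
  + by apply: (measurableT_comp mh); exact: measurable_pair1.
  + by move=> x2 hx2; rewrite sup ?cp0// => -[].
  + by move=> al hal; have [g1 g2] := m2 x1 al hx1 hal; case: (cp_or hh) => ->.
- move=> e e0; have [s0 [ms0 hs0]] := hAI (Num.sqrt e) (ltac:(by rewrite sqrtr_gt0)).
  have ms : forall Q, Q \in undup s0 -> maxrect O Q by move=> Q; rewrite mem_undup => /ms0.
  exists (undup s0); split => //; first exact: undup_uniq.
  have := hs0 (undup s0) (undup_uniq _) (ltac:(by move=> Q; rewrite mem_undup)) ms.
  move=> /(L2sq_le (sqrtr_ge0 e)); rewrite sqr_sqrtr ?(ltW e0)// => hL.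
  have mg : cmeasurable (fun x => a x - \sum_(Q <- undup s0) aR Q x).
    by apply: cmeasurable_sub => //; apply: cmeasurable_sum => Q /ms mQ; have [] := hQ Q mQ.
  have [|_ hi] := L2f_part mg; first by apply: le_lt_trans hL _; rewrite ltry.
  rewrite -lee_fin; apply: le_trans hL; apply: le_trans hi.
  rewrite lee_fin le_eqVlt; apply/orP; left; apply/eqP; apply: Rint_eq => x.
  by rewrite (cp_B hh) cp_sum.
- by rewrite -lee_fin; apply: le_trans La; have [] := L2f_part ma faO.
- move=> s us ms; rewrite -lee_fin; apply: le_trans (hseq s us ms).
  rewrite -sumEFin big_seq [leRHS]big_seq; apply: lee_sum => Q /ms mQ.
  by have [mm _ _ _] := hQ Q mQ; have [] := L2f_part mm (LQ Q mQ).
Qed.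

End AtomParts.

(** * The L^2 norm as a functional, and Fatou's lemma *)

Section L2Norm.
Variables (R : realType) (n m : nat) (p : R) (s1 s2 : nat).
Hypotheses (p0 : 0 < p) (p1 : p <= 1).
Local Notation pt := (pt R n m).
Local Notation P := (@leb2 R n m).
Local Notation hp := (boxes_pt R n m).

Definition nrm2 (g : pt -> R) : R := Num.sqrt (\int[P]_x g x ^+ 2).

Lemma int_sqr_ge0 (g : pt -> R) : 0 <= \int[P]_x g x ^+ 2.
Proof. by apply: Rintegral_ge0 => x _; exact: sqr_ge0. Qed.

(** Minkowski from (f + g)^2 <= (1 + Y/X) f^2 + (1 + X/Y) g^2, where X and Y are the two norms,
    increased by e / 2 so that they are positive. *)
Lemma nrm2D f g : bx2 f -> bx2 g -> nrm2 (fun x => f x + g x) <= nrm2 f + nrm2 g.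
Proof.
move=> bf bg; apply/ler_addgt0Pr => e e0.
pose X := nrm2 f + e / 2; pose Y := nrm2 g + e / 2.
have X0 : 0 < X by rewrite ltr_wpDl ?sqrtr_ge0// divr_gt0.
have Y0 : 0 < Y by rewrite ltr_wpDl ?sqrtr_ge0// divr_gt0.
have -> : nrm2 f + nrm2 g + e = X + Y by rewrite /X /Y; field.
have XY : 0 < X + Y by rewrite addr_gt0.
rewrite -[leRHS](gtr0_norm XY) -sqrtr_sqr; apply: ler_wsqrtr.
apply: (@le_trans _ _ ((1 + Y / X) * \int[P]_x f x ^+ 2 + (1 + X / Y) * \int[P]_x g x ^+ 2)).
  rewrite -(RintZ hp _ (bxd_sqr bf)) -(RintZ hp _ (bxd_sqr bg)) -(RintD hp); last 2 first.
  - exact: bxdZ (bxd_sqr bf).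
  - exact: bxdZ (bxd_sqr bg).
  apply: (le_Rint hp).
  - exact: bxd_sqr (bxdD hp bf bg).
  - by apply: (bxdD hp); apply: bxdZ; apply: bxd_sqr.
  move=> x; rewrite -subr_ge0.
  have -> : (1 + Y / X) * f x ^+ 2 + (1 + X / Y) * g x ^+ 2 - (f x + g x) ^+ 2 =
     (X * Y)^-1 * (Y * f x - X * g x) ^+ 2 by field; rewrite !gt_eqF.
  by rewrite mulr_ge0 ?sqr_ge0// invr_ge0 mulr_ge0 ?ltW.
have -> : (X + Y) ^+ 2 = (1 + Y / X) * X ^+ 2 + (1 + X / Y) * Y ^+ 2 by field; rewrite !gt_eqF.
have h (g' : pt -> R) : \int[P]_x g' x ^+ 2 <= (nrm2 g' + e / 2) ^+ 2.
  rewrite -[leLHS]sqr_sqrtr ?int_sqr_ge0// lerXn2r ?nnegrE ?sqrtr_ge0// ?lerDl ?addr_ge0 ?sqrtr_ge0// divr_ge0// ltW//.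
by apply: lerD; apply: ler_wpM2l; rewrite ?h// addr_ge0// divr_ge0 ?ltW.
Qed.

Lemma pnu_nrm2 : pnu p s1 s2 nrm2.
Proof.
split.
- by move=> g _; exact: sqrtr_ge0.
- move=> c g [_ bg _ _]; rewrite /nrm2 (Rint_eq _ (g := fun x => c ^+ 2 * g x ^+ 2)); last first.
    by move=> x; rewrite exprMn.
  by rewrite (RintZ hp _ (bxd_sqr bg)) sqrtrM ?sqr_ge0// sqrtr_sqr.
- move=> f g [_ bf _ _] [_ bg _ _].
  apply: le_trans (powR_subadd _ _ _); rewrite ?sqrtr_ge0 ?p0//.
  apply: ge0_ler_powR; rewrite ?nnegrE ?addr_ge0 ?sqrtr_ge0 ?(ltW p0)//.
  exact: nrm2D.
Qed.

(** Here the restriction on O in [abd] acts: |O| >= |Q| bounds |O|^(1/p - 1/2) below by |Q|^(1/p -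
    1/2), so b itself is at most the right side. *)
Lemma abd_nrm2 Q : 2^-1 <= p^-1 -> abd p s1 s2 nrm2 (rvol R Q `^ (2^-1 - p^-1)) [:: Q].
Proof.
move=> p2 O L g b oO fO [Q']; rewrite inE => /eqP -> QO _ _ _ _ _ b0 hb _.
apply: (@le_trans _ _ b).
  by rewrite /nrm2 -[leRHS]gtr0_norm// -sqrtr_sqr; exact: ler_wsqrtr.
have rv := fine_leb2_ge (open_measurable2 oO) fO QO; have r0 := rvol_gt0 R Q.
rewrite mulrAC -[leLHS]mul1r; apply: ler_wpM2r; first exact: ltW.
apply: (@le_trans _ _ (rvol R Q `^ (2^-1 - p^-1) * rvol R Q `^ (p^-1 - 2^-1))).
  rewrite -powRD; last by rewrite (gt_eqF r0) implybT.
  have -> : 2^-1 - p^-1 + (p^-1 - 2^-1) = 0 by ring.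
  by rewrite powRr0.
apply: ler_wpM2l; first exact: powR_ge0.
by apply: ge0_ler_powR; rewrite ?subr_ge0 ?nnegrE ?fine_ge0 ?(ltW r0).
Qed.

End L2Norm.

Section FatouSquares.
Variables (R : realType) (n m : nat).
Local Notation pt := (pt R n m).
Local Notation P := (@leb2 R n m).
Local Notation hp := (boxes_pt R n m).

Lemma fatou_sqr (u : nat -> pt -> R) (v : pt -> R) (b : R) : (forall j, bx2 (u j)) -> bx2 v ->
  (forall x, (fun j => u j x) @ \oo --> v x) -> (forall j, \int[P]_x u j x ^+ 2 <= b) ->
  \int[P]_x v x ^+ 2 <= b.
Proof.
move=> bu bv cv hb.
have fin (g : pt -> R) : bx2 g -> (\int[P]_x g x ^+ 2)%:E = (\int[P]_x (g x ^+ 2)%:E)%E.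
  move=> bg; rewrite /Rintegral fineK//; apply: (integrable_fin_num measurableT).
  exact: (bxd_integrable hp (bxd_sqr bg)).
rewrite -lee_fin fin//.
have mu_ j : measurable_fun setT (fun x => (u j x ^+ 2)%:E).
  by apply/measurable_EFinP; apply: measurable_funX; exact: bxd_measurable (bu j).
have nu_ j x : setT x -> (0 <= (u j x ^+ 2)%:E)%E by rewrite lee_fin sqr_ge0.
have E x : limn_einf (fun j => (u j x ^+ 2)%:E) = (v x ^+ 2)%:E.
  have c : (fun j => (u j x ^+ 2)%:E) @ \oo --> (v x ^+ 2)%:E.
    apply: cvg_EFin; first by apply: nearW.
    by rewrite !expr2; apply: cvgM; exact: cv.
  by have [-> _] := cvg_limn_einf_sup c.
have := fatou P measurableT mu_ nu_.
under eq_integral do rewrite E.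
move=> H; apply: le_trans H _.
rewrite limn_einf_lim; apply: lime_le; first exact: is_cvg_einfs.
apply: nearW => j; apply: (@le_trans _ _ (\int[P]_x (u j x ^+ 2)%:E)%E).
  by apply: ereal_inf_lbound; exists j => /=.
by rewrite -fin// lee_fin.
Qed.

End FatouSquares.

(** * The finite operators as pairings with test functions *)

Section SchwartzKernels.
Variables (R : realType) (n m : nat).
Local Notation pt := (pt R n m).
Local Notation P := (@leb2 R n m).
Local Notation hp := (boxes_pt R n m).

Lemma ntc_rapid g s (b1 : n.-tuple nat) (b2 : m.-tuple nat) : ntc g -> exists2 N : R, 0 <= N &
  forall x : pt, `|mono b1 x.1 * mono b2 x.2 * iter_pd s g x| <= N.
Proof.
move=> /(ntc_iter s)/ntc_bx2 bg.
have b1' : bx2 (fun x : pt => iter_pd s g x * mono b1 x.1).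
  apply: (bxd_loc bg); first by apply: (measurableT_comp (f := mono b1)) => //; exact: measurable_mono.
  by move=> r; have [N hN] := mono_loc b1 r; exists N => x [/hN].
have b2' : bx2 (fun x : pt => iter_pd s g x * mono b1 x.1 * mono b2 x.2).
  apply: (bxd_loc b1'); first by apply: (measurableT_comp (f := mono b2)) => //; exact: measurable_mono.
  by move=> r; have [N hN] := mono_loc b2 r; exists N => x [_ /hN].
have [r [_ [N hN] _]] := b2'; exists `|N| => // x.
apply: le_trans (ler_norm N); apply: le_trans (hN x); rewrite le_eqVlt; apply/orP; left; apply/eqP.
by congr (`|_|); ring.
Qed.

Lemma schwartz_ntc (g : pt -> R) : ntc g -> schwartz (rC g).
Proof.
move=> ng; split; first exact: ntc_smooth.
split; first exact: smooth0.
move=> s b1 b2; have [N1 N10 h1] := ntc_rapid s b1 b2 ng.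
have [N2 N20 h2] := ntc_rapid s b1 b2 (@ntc_0 R n m).
exists (N1 + N2) => x; split.
  by apply: le_trans (h1 x) _; rewrite lerDl.
by apply: le_trans (h2 x) _; rewrite lerDr.
Qed.

Lemma pairing_rC (g : pt -> R[i]) k : pairing g (rC k) =
  Complex (\int[P]_x (cre (g x) * k x)) (\int[P]_x (cim (g x) * k x)).
Proof.
rewrite /pairing /cintegral /Rintegral; congr (Complex (fine _) (fine _)); apply: eq_integral => x _; congr (_%:E);
  rewrite /rC; case: (g x) => [a b]; rewrite /cre /cim /=.
  by rewrite mulr0 subr0.
by rewrite mulr0 add0r.
Qed.

Variables (s1 s2 : nat) (C1 C2 : R).
Variables (A1 B1 k1 : int -> n.-tuple R -> n.-tuple R -> R) (A2 B2 k2 : int -> m.-tuple R -> m.-tuple R -> R).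
Hypotheses (kp1 : kpack s1 C1 A1 B1 k1) (kp2 : kpack s2 C2 A2 B2 k2).
Local Notation PF := (PF A1 B1 A2 B2).

(** The kernel of [piece Q] as a function of the second point: the transposed B applied to z |->
    A(x, z) 1_Q(z). Smoothness in the second point comes from B alone, so the sharp cut along Q does
    no harm. *)
Definition KQ (Q : drect n m) (x : pt) : pt -> R :=
  Op2 (fun u v => B1 Q.1.1 v u) (fun u v => B2 Q.2.1 v u)
    (fun z => A1 Q.1.1 x.1 z.1 * A2 Q.2.1 x.2 z.2 * \1_(rect_set Q) z).
Definition KP (F : seq (drect n m)) (x y : pt) : R := \sum_(Q <- F) KQ Q x y.

Lemma bx2_AAQ (Q : drect n m) (x : pt) :
  bx2 (fun z : pt => A1 Q.1.1 x.1 z.1 * A2 Q.2.1 x.2 z.2 * \1_(rect_set Q) z).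
Proof.
have h1 := bx2_KK (skern_kern (kp_A_s kp1 Q.1.1)) (skern_kern (kp_A_s kp2 Q.2.1)) x.
have h2 : bx2 (\1_(rect_set Q) : pt -> R) by exact: bx2_rect.
by have h3 := bxd_mul h1 h2; exact: h3.
Qed.

Lemma ntc_KQ Q x : ntc (KQ Q x).
Proof.
apply: ntc_Op2; [exact: skern_tr (kp_B_s kp1 _)|exact: skern_tr (kp_B_s kp2 _)|exact: bx2_AAQ].
Qed.

Lemma ntc_KP F x : ntc (KP F x).
Proof. by apply: ntc_sum => Q; exact: ntc_KQ. Qed.

Lemma PF_KP F a x : L2f P a -> PF F a x = \int[P]_y (a y * KP F x y).
Proof.
move=> La; rewrite (Rint_eq _ (g := fun y => \sum_(Q <- F) a y * KQ Q x y)); last by move=> y; rewrite mulr_sumr.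
rewrite Rintegral_sum; last first.
  move=> Q; have := bxd_L2_integrable hp (ntc_bx2 (ntc_KQ Q x)) La.
  by apply: eq_integrable => // y _ /=; rewrite mulrC.
apply: eq_bigr => Q _; rewrite /piece /KQ -(Op2_dual _ _ La (bx2_AAQ Q x)).
- by apply: Rint_eq => y; rewrite /coefQ mulrA.
- exact: skern_kern (kp_B_s kp1 _).
- exact: skern_kern (kp_B_s kp2 _).
Qed.

End SchwartzKernels.

(** * Atomic series under the finite operators *)

Section Limit.
Variables (R : realType) (n m : nat) (p : R) (s1 s2 : nat) (C1 C2 : R).
Hypotheses (n0 : (0 < n)%N) (m0 : (0 < m)%N) (p0 : 0 < p) (p1 : p <= 1).
Hypotheses (hs1 : n%:R * (p^-1 - 1) < s1.+1%:R) (hs2 : m%:R * (p^-1 - 1) < s2.+1%:R).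
Variables (A1 B1 k1 : int -> n.-tuple R -> n.-tuple R -> R) (A2 B2 k2 : int -> m.-tuple R -> m.-tuple R -> R).
Hypotheses (kp1 : kpack s1 C1 A1 B1 k1) (kp2 : kpack s2 C2 A2 B2 k2).
Local Notation pt := (pt R n m).
Local Notation P := (@leb2 R n m).
Local Notation hp := (boxes_pt R n m).
Local Notation PF := (PF A1 B1 A2 B2).
Local Notation Cm := (Cme n m p s1 s2 C1 C2).

Let p2 : 2^-1 <= p^-1. Proof. by rewrite lef_pV2 ?posrE//; apply: le_trans p1 _; rewrite ler1n. Qed.

Lemma Cme_ge0 : 0 <= Cm.
Proof.
have c : (0 : R) <= Cst R n m by exact: le_trans ler01 (Cst_ge1 R n m).
by rewrite /Cme !addr_ge0 ?powR_ge0// !mulr_ge0 ?powR_ge0 ?invr_ge0 ?sqr_ge0.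
Qed.

Lemma rat_L2f g : ratp p s1 s2 g -> L2f P g.
Proof.
case=> [g0|[Om [aR ra]]]; last exact: ra_L2 ra.
have b0 : bx2 (fun _ : pt => 0 : R) by exact: bxd0.
rewrite (_ : g = fun=> 0); first exact: (bxd_L2 hp b0).
by apply/funext => x.
Qed.

Lemma rat_est nu M F g : pnu p s1 s2 nu -> 0 <= M -> abd p s1 s2 nu M F -> uniq F -> ratp p s1 s2 g ->
  nu (PF F g) `^ p <= M `^ p * Cm.
Proof.
move=> hnu M0 hab uF [g0|[Om [aR ra]]]; last exact: (main_estimate n0 m0 p0 p1 hs1 hs2 kp1 kp2 hnu M0 hab uF ra).
by rewrite (pnu0 p0 hnu) ?mulr_ge0 ?powR_ge0 ?Cme_ge0// => x; exact: PF0.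
Qed.

Variables (c d l : nat -> R) (g h : nat -> pt -> R) (f : pt -> R) (S : R).
Hypotheses (rg : forall k, ratp p s1 s2 (g k)) (rh : forall k, ratp p s1 s2 (h k)).
Hypotheses (cl : forall k, `|c k| <= l k) (dl : forall k, `|d k| <= l k).
Hypotheses (lS : forall N, \sum_(0 <= k < N) l k `^ p <= S).
Hypotheses (Sl : forall e, 0 < e -> exists N, S - e <= \sum_(0 <= k < N) l k `^ p).
Hypothesis Lf : L2f P f.
Hypothesis cf : forall F x,
  (fun N => \sum_(0 <= k < N) (c k * PF F (g k) x + d k * PF F (h k) x)) @ \oo --> PF F f x.

Let b k (x : pt) := c k * g k x + d k * h k x.
Let Lb k : L2f P (b k). Proof. by apply: L2f_lin; exact: rat_L2f. Qed.

(** [b k] is one real component of lambda_k a_k. For the real part c, d are Re lambda_k and minus Im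
    lambda_k; for the imaginary part they are Re lambda_k and Im lambda_k with the roles of g and h
    exchanged. The two terms give the factor 2. *)
Lemma term_est nu M F k : pnu p s1 s2 nu -> 0 <= M -> abd p s1 s2 nu M F -> uniq F ->
  nu (PF F (b k)) `^ p <= 2 * (M `^ p * Cm) * l k `^ p.
Proof.
move=> hnu M0 hab uF; have Lg := rat_L2f (rg k); have Lh := rat_L2f (rh k).
have -> : PF F (b k) = (fun x => c k * PF F (g k) x + d k * PF F (h k) x).
  by apply/funext => x; rewrite -(PF_lin kp1 kp2).
have r1 := rD_PF kp1 kp2 F Lg; have r2 := rD_PF kp1 kp2 F Lh.
apply: le_trans (pnu_D hnu (rD_scale (c k) r1) (rD_scale (d k) r2)) _.
have key (e : R) w : `|e| <= l k -> ratp p s1 s2 w -> nu (fun x => e * PF F w x) `^ p <= M `^ p * Cm * l k `^ p.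
  move=> el rw; have Lw := rat_L2f rw; have r := rD_PF kp1 kp2 F Lw.
  apply: le_trans (pnu_le p0 hnu (rD_scale e r) (pnu_Z hnu e r)) _.
  rewrite powRM ?normr_ge0 ?(pnu_ge0 hnu)// mulrC; apply: ler_pM; rewrite ?powR_ge0//; first exact: rat_est.
  by apply: ge0_ler_powR; rewrite ?nnegrE ?(ltW p0)//; exact: le_trans el.
apply: le_trans (lerD (key _ _ (cl k) (rg k)) (key _ _ (dl k) (rh k))) _.
by rewrite le_eqVlt; apply/orP; left; apply/eqP; ring.
Qed.

Let T Q N (x : pt) := PF [:: Q] f x - \sum_(0 <= k < N) PF [:: Q] (b k) x.

Let cb F x : (fun N => \sum_(0 <= k < N) PF F (b k) x) @ \oo --> PF F f x.
Proof.
rewrite (_ : (fun N => _) = (fun N => \sum_(0 <= k < N) (c k * PF F (g k) x + d k * PF F (h k) x))); first exact: cf.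
apply/funext => N; apply: eq_bigr => k _; rewrite -(PF_lin kp1 kp2)//; exact: rat_L2f.
Qed.

Let rT Q N : rD s1 s2 (T Q N).
Proof.
apply: rD_sub; first exact: (rD_PF kp1 kp2 _ Lf).
by apply: rD_sum => k _; exact: (rD_PF kp1 kp2 _ (Lb k)).
Qed.

(** For one rectangle and the L^2 norm, the partial sums after N are bounded by the tail of the sum
    of the l k^p. Their convergence is known only pointwise, and Fatou's lemma passes to the
    limit. *)
Lemma tail_est Q N e : S - e <= \sum_(0 <= k < N) l k `^ p ->
  nrm2 (T Q N) `^ p <= 2 * ((rvol R Q `^ (2^-1 - p^-1)) `^ p * Cm) * e.
Proof.
move=> hN; set D := 2 * _; have D0 : 0 <= D by rewrite !mulr_ge0 ?powR_ge0 ?Cme_ge0.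
pose u j (x : pt) := \sum_(N <= k < N + j) PF [:: Q] (b k) x.
have rP k : rD s1 s2 (PF [:: Q] (b k)) by exact: rD_PF kp1 kp2 _ _ (Lb k).
have ru j : rD s1 s2 (u j) by exact: rD_sum.
have e0 : 0 <= e by have := le_trans hN (lS N); lra.
have hn := pnu_nrm2 n m s1 s2 p0 p1.
have ub j : nrm2 (u j) <= (D * e) `^ p^-1.
  have : nrm2 (u j) `^ p <= D * e.
    apply: le_trans (pnu_sum p0 hn (fun k _ => rP k)) _.
    apply: (@le_trans _ _ (\sum_(N <= k < N + j) D * l k `^ p)).
      apply: ler_sum => k _; apply: term_est => //; [exact: powR_ge0|exact: abd_nrm2].
    rewrite -mulr_sumr; apply: ler_wpM2l => //.
    have := lS (N + j); rewrite (big_cat_nat (leq0n N) (leq_addr j N)) /=; move: hN; lra.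
  move=> hj; have -> : nrm2 (u j) = (nrm2 (u j) `^ p) `^ p^-1 by rewrite -powRrM mulfV ?gt_eqF// powRr1 ?sqrtr_ge0.
  have i0 : 0 <= p^-1 by rewrite invr_ge0 ltW.
  have De : 0 <= D * e by exact: mulr_ge0.
  by apply: (ge0_ler_powR i0); rewrite ?nnegrE ?powR_ge0.
have H : \int[P]_x T Q N x ^+ 2 <= ((D * e) `^ p^-1) ^+ 2.
  apply: (fatou_sqr (u := u)).
  - by move=> j; have [] := ru j.
  - by have [] := rT Q N.
  - move=> x; have := @cb [:: Q] x; rewrite -(cvg_shiftn N) => cN.
    rewrite (_ : (fun j => u j x) = (fun j => \sum_(0 <= k < j + N) PF [:: Q] (b k) x -
        \sum_(0 <= k < N) PF [:: Q] (b k) x)); first by apply: cvgB; [exact: cN|exact: cvg_cst].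
    by apply/funext => j; rewrite (big_cat_nat (leq0n N) (leq_addl j N)) /= addrAC subrr add0r /u addnC.
  - move=> j; rewrite -[leLHS]sqr_sqrtr ?int_sqr_ge0//.
    by rewrite lerXn2r ?nnegrE ?sqrtr_ge0 ?powR_ge0//; exact: ub.
have : nrm2 (T Q N) <= (D * e) `^ p^-1.
  by rewrite -[leRHS]ger0_norm ?powR_ge0// -sqrtr_sqr; exact: ler_wsqrtr.
move=> hT; have := ge0_ler_powR (ltW p0) _ _ hT; rewrite !nnegrE sqrtr_ge0 powR_ge0 => /(_ isT isT) h'.
by apply: le_trans h' _; rewrite -powRrM mulVf ?gt_eqF// powRr1// mulr_ge0.
Qed.

Theorem limit_est nu M F : pnu p s1 s2 nu -> 0 <= M -> abd p s1 s2 nu M F -> uniq F ->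
  nu (PF F f) `^ p <= 2 * (M `^ p * Cm) * S.
Proof.
move=> hnu M0 hab uF; set D := 2 * _; have D0 : 0 <= D by rewrite !mulr_ge0 ?powR_ge0 ?Cme_ge0.
have rP k : rD s1 s2 (PF F (b k)) by exact: rD_PF kp1 kp2 _ _ (Lb k).
(* [T Q N] lives near Q, so by [rect_bound] nu of it is controlled by its L^2 norm; W Q collects the
   constants. Their sum K is finite because F is, and N is chosen after it. *)
pose W (Q : drect n m) := (M * (2 ^+ n * 2 ^+ m * rvol R Q) `^ (p^-1 - 2^-1)) `^ p * (2 * ((rvol R Q `^ (2^-1 - p^-1)) `^ p * Cm)).
have W0 Q : 0 <= W Q by rewrite !mulr_ge0 ?powR_ge0 ?Cme_ge0.
pose K := \sum_(Q <- F) W Q; have K0 : 0 <= K by exact: sumr_ge0.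
apply/ler_addgt0Pr => e e0.
have K1 : 0 < K + 1 by rewrite ltr_wpDl.
have eK : 0 < e / (K + 1) by rewrite divr_gt0.
have [N hN] := Sl eK.
have tS x : PF F f x = \sum_(0 <= k < N) PF F (b k) x + \sum_(Q <- F) T Q N x.
  have E a : \sum_(Q <- F) PF [:: Q] a x = PF F a x by apply: eq_bigr => Q _; rewrite /PF big_seq1.
  have E2 : \sum_(Q <- F) \sum_(0 <= k < N) PF [:: Q] (b k) x = \sum_(0 <= k < N) PF F (b k) x.
    by rewrite exchange_big /=; apply: eq_bigr => k _; rewrite E.
  have -> : \sum_(Q <- F) T Q N x = PF F f x - \sum_(0 <= k < N) PF F (b k) x.
    by rewrite big_split /= sumrN E E2.
  by rewrite addrCA subrr addr0.
have -> : PF F f = (fun x => \sum_(0 <= k < N) PF F (b k) x + \sum_(Q <- F) T Q N x) by apply/funext => x; exact: tS.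
have rS1 : rD s1 s2 (fun x => \sum_(0 <= k < N) PF F (b k) x) by exact: rD_sum.
have rS2 : rD s1 s2 (fun x => \sum_(Q <- F) T Q N x) by exact: rD_sum.
apply: le_trans (pnu_D hnu rS1 rS2) _; apply: lerD.
  apply: le_trans (pnu_sum p0 hnu (fun k _ => rP k)) _.
  apply: (@le_trans _ _ (\sum_(0 <= k < N) D * l k `^ p)).
    by apply: ler_sum => k _; exact: term_est.
  by rewrite -mulr_sumr; apply: ler_wpM2l.
apply: le_trans (pnu_sum p0 hnu (fun Q _ => rT Q N)) _.
apply: (@le_trans _ _ (\sum_(Q <- F) W Q * (e / (K + 1)))); last first.
  by rewrite -mulr_suml -/K mulrCA ger_pMr// ler_pdivrMr// mul1r lerDl.
rewrite big_seq [leRHS]big_seq; apply: ler_sum => Q QF.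
have sT x : ~ nb2 2^-1 Q x -> T Q N x = 0.
  move=> hx; have z a : PF [:: Q] a x = 0 by rewrite /PF big_seq1 (piece_supp kp1 kp2).
  by rewrite /T z big1 ?subr0// => k _; exact: z.
have h2 : (0 : R) < 2^-1 by rewrite invr_gt0.
have QQ : (rect_set Q : set pt) `<=` nb2 2^-1 Q by move=> x [x1 x2]; split; exact: sub_nb.
apply: le_trans (pnu_le p0 hnu (rT Q N) (rect_bound n0 m0 hab QF QQ (rT Q N) sT M0 p2)) _.
rewrite mulrAC (powRM _ (mulr_ge0 M0 (powR_ge0 _ _)) (sqrtr_ge0 _)) /W -[leRHS]mulrA.
by apply: ler_wpM2l; [exact: powR_ge0|exact: tail_est].
Qed.

End Limit.

(** * The reproducing formula *)

Section FiniteFamily.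
Variables (R : realType) (n m : nat).
Local Notation pt := (pt R n m).

Definition es (J : nat) : seq int := [seq i%:Z - J%:Z | i <- index_iota 0 (J + J)].
Definition tups k L : seq (k.-tuple int) :=
  [seq [tuple (nat_of_ord (v i))%:Z - L%:Z | i < k] | v : {ffun 'I_k -> 'I_(L + L).+1} <- enum {: {ffun 'I_k -> 'I_(L + L).+1}}].
Definition cubes k J L : seq (dcube k) := [seq (e, t) | e <- es J, t <- tups k L].
Definition Fam J L : seq (drect n m) := undup [seq (q1, q2) | q1 <- cubes n J L, q2 <- cubes m J L].

Lemma uniq_es J : uniq (es J).
Proof. by rewrite map_inj_uniq ?iota_uniq// => i j /= h; apply/eqP; rewrite -eqz_nat; apply/eqP; lia. Qed.

Lemma mem_es J e : e \in es J -> (- J%:Z <= e)%R /\ (e < J%:Z)%R.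
Proof. by rewrite /es => /mapP[j jJ ->]; move: jJ; rewrite mem_index_iota => /andP[_ h]; split; lia. Qed.

Lemma mem_tups k L (t : k.-tuple int) : (forall i, - L%:Z <= tnth t i /\ tnth t i <= L%:Z) -> t \in tups k L.
Proof.
move=> h; apply/mapP; exists [ffun i => inord `|(tnth t i + L%:Z)%R|%N]; first by rewrite mem_enum.
apply: eq_from_tnth => i; rewrite tnth_mktuple ffunE; move: (h i); move: (tnth t i) => z [h1 h2].
by rewrite inordK; lia.
Qed.

Lemma mem_Fam J L (Q : drect n m) : Q.1.1 \in es J -> Q.2.1 \in es J ->
  (forall i, - L%:Z <= tnth Q.1.2 i /\ tnth Q.1.2 i <= L%:Z) ->
  (forall i, - L%:Z <= tnth Q.2.2 i /\ tnth Q.2.2 i <= L%:Z) -> Q \in Fam J L.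
Proof.
case: Q => [[e1 t1] [e2 t2]] /= h1 h2 /mem_tups g1 /mem_tups g2; rewrite mem_undup.
apply/allpairsP; exists ((e1, t1), (e2, t2)); split => //=.
  by apply/allpairsP; exists (e1, t1).
by apply/allpairsP; exists (e2, t2).
Qed.

Lemma Fam_exp J L (Q : drect n m) : Q \in Fam J L -> Q.1.1 \in es J /\ Q.2.1 \in es J.
Proof.
rewrite mem_undup => /allpairsP[[q1 q2] /= [/allpairsP[[e1 t1] /= [h1 _ ->]] /allpairsP[[e2 t2] /= [h2 _ ->]] ->]].
by [].
Qed.

Lemma floor_bound (t : R) L : `|t| + 1 <= L%:R -> - L%:Z <= Num.floor t /\ Num.floor t <= L%:Z.
Proof.
move=> h; have h1 : -t <= `|t| by rewrite -normrN ler_norm.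
have h2 := ler_norm t; have f1 := floor_le_tmp t; have f2 := floorD1_gt t.
split; rewrite -(ler_int R) ?rmorphN /=.
  by move: f2; rewrite rmorphD /=; lra.
by lra.
Qed.

(** L is so large that, for every pair of scales of the family, the rectangle through y belongs to
    it; the finest cubes, of side 2^(-J), give the factor 2^J. *)
Lemma sum_indic J L e e' (y : pt) (a : R) : e \in es J -> e' \in es J ->
  bbox a y.1 -> bbox a y.2 -> a * 2 ^+ J + 1 <= L%:R ->
  \sum_(Q <- Fam J L | (Q.1.1 == e) && (Q.2.1 == e')) \1_(rect_set Q) y = 1 :> R.
Proof.
move=> he he' h1 h2 hL; set Q0 : drect n m := (cube_at e y.1, cube_at e' y.2).
have fb k (z : k.-tuple R) i c : bbox a z -> c \in es J -> `|tnth z i / 2 ^ c| + 1 <= L%:R.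
  move=> hz /mem_es[c1 _]; apply: le_trans hL; rewrite lerD2r normrM [`|(2 ^ c)^-1|]gtr0_norm ?invr_gt0 ?exprz_gt0//.
  apply: ler_pM => //; first by rewrite invr_ge0 exprz_ge0.
  by rewrite invr_expz exprnP ler_weXz2l ?ler1n//; lia.
have Q0F : Q0 \in Fam J L.
  by apply: mem_Fam => //= i; rewrite tnth_mktuple; apply: floor_bound; apply: fb.
have yQ0 : rect_set Q0 y by split; exact: cube_at_in.
rewrite -big_filter (bigD1_seq Q0) /=; last 2 first.
- by rewrite mem_filter /= !eqxx Q0F.
- by apply: filter_uniq; exact: undup_uniq.
rewrite indicE mem_set// big_seq_cond big1 ?addr0// => Q /andP[]; rewrite mem_filter => /andP[/andP[/eqP e1 /eqP e2] _] ne.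
rewrite indicE memNset// => -[g1 g2]; move/negP: ne; apply; apply/eqP.
by rewrite (surjective_pairing Q) (cube_uniq (Q' := Q0.1) e1 g1 (cube_at_in _ _)) (cube_uniq (Q' := Q0.2) e2 g2 (cube_at_in _ _)).
Qed.

End FiniteFamily.

Section Reproducing.
Variables (R : realType) (n m : nat).
Local Notation pt := (pt R n m).
Local Notation P := (@leb2 R n m).
Local Notation hp := (boxes_pt R n m).
Local Notation X := (n.-tuple R).
Local Notation Y := (m.-tuple R).

Lemma Rint_tensor (u : X -> R) (v : Y -> R) : bx1 u -> bx1 v ->
  \int[P]_y (u y.1 * v y.2) = \int[@lebn R n]_y u y * \int[@lebn R m]_y v y.
Proof.
move=> bu bv; rewrite Rint_pt /=; last exact: (bxd_prod (boxes_n R n) (boxes_n R m) bu bv).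
rewrite -(RintZr (boxes_n R n) _ bu); apply: Rint_eq => x.
by rewrite (RintZ (boxes_n R m) _ bv).
Qed.

Lemma Op2_supp (K1 : X -> X -> R) (K2 : Y -> Y -> R) (c1 c2 r : R) (f : pt -> R) x :
  (forall x y, (exists i, c1 < `|tnth x i - tnth y i|) -> K1 x y = 0) ->
  (forall x y, (exists i, c2 < `|tnth x i - tnth y i|) -> K2 x y = 0) ->
  (forall y, ~ bbox2 r y -> f y = 0) -> ~ (bbox (r + c1) x.1 /\ bbox (r + c2) x.2) -> Op2 K1 K2 f x = 0.
Proof.
move=> h1 h2 f0 hx; rewrite /Op2 (Rint_eq _ (g := fun=> 0)); first by rewrite Rintegral_cst// mul0r.
move=> y; have [[y1 y2]|/f0 ->] := pselect (bbox2 r y); last by rewrite mulr0.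
have [g1|g1] := pselect (exists i, c1 < `|tnth x.1 i - tnth y.1 i|); first by rewrite h1// !mul0r.
have [g2|g2] := pselect (exists i, c2 < `|tnth x.2 i - tnth y.2 i|); first by rewrite h2// mulr0 mul0r.
case: hx; have key k (a b : k.-tuple R) c : bbox r b -> ~ (exists i, c < `|tnth a i - tnth b i|) -> bbox (r + c) a.
  move=> hb hn i; have := hb i; have : `|tnth a i - tnth b i| <= c by rewrite leNgt; apply/negP => h; apply: hn; exists i.
  have := ler_normD (tnth a i - tnth b i) (tnth b i); rewrite subrK; lra.
by split; [exact: key y1 g1|exact: key y2 g2].
Qed.

Lemma Op2_comp (A B : X -> X -> R) (A' B' : Y -> Y -> R) (f : pt -> R) x : kern A -> kern B -> kern A' -> kern B' ->
  bx2 f -> Op2 A A' (Op2 B B' f) x =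
  \int[P]_z (f z * ((\int[@lebn R n]_y (A x.1 y * B y z.1)) * (\int[@lebn R m]_y (A' x.2 y * B' y z.2)))).
Proof.
move=> kA kB kA' kB' bf; have Lf := bxd_L2 hp bf.
rewrite /Op2 -/(Op2 B B' f) (Op2_dual kB kB' Lf (bx2_KK kA kA' x)); apply: Rint_eq => z; congr (_ * _).
have b1 := bxd_mul (kern_bx x.1 kA) (kern_bx z.1 (kern_tr kB)).
have b2 := bxd_mul (kern_bx x.2 kA') (kern_bx z.2 (kern_tr kB')).
by rewrite -(Rint_tensor b1 b2); apply: Rint_eq => y; ring.
Qed.

Variables (s1 s2 : nat) (C1 C2 : R).
Variables (A1 B1 k1 : int -> X -> X -> R) (A2 B2 k2 : int -> Y -> Y -> R).
Hypotheses (kp1 : kpack s1 C1 A1 B1 k1) (kp2 : kpack s2 C2 A2 B2 k2).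
Local Notation PF := (PF A1 B1 A2 B2).
Local Notation Fam := (Fam n m).

Let kA1 e : kern (A1 e). Proof. exact: skern_kern (kp_A_s kp1 e). Qed.
Let kA2 e : kern (A2 e). Proof. exact: skern_kern (kp_A_s kp2 e). Qed.
Let kB1 e : kern (B1 e). Proof. exact: skern_kern (kp_B_s kp1 e). Qed.
Let kB2 e : kern (B2 e). Proof. exact: skern_kern (kp_B_s kp2 e). Qed.
Let kk1 e : kern (k1 e). Proof. exact: skern_kern (kp_k_s kp1 e). Qed.
Let kk2 e : kern (k2 e). Proof. exact: skern_kern (kp_k_s kp2 e). Qed.

Variables (f : pt -> R) (r : R) (J L : nat).
Hypotheses (bf : bx2 f) (f0 : forall y, ~ bbox2 r y -> f y = 0) (hL : (r + 2 ^+ J) * 2 ^+ J + 1 <= L%:R).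

Lemma PF_Fam x : PF (Fam J L) f x =
  \sum_(e <- es J) \sum_(e' <- es J) Op2 (A1 e) (A2 e') (Op2 (B1 e) (B2 e') f) x.
Proof.
rewrite /PF -(@sum_regroup2 _ _ _ _ (Fam J L) (es J) (es J) (fun Q => Q.1.1) (fun Q => Q.2.1)) ?uniq_es//; last 2 first.
- by move=> Q /Fam_exp[].
- by move=> Q /Fam_exp[].
rewrite big_seq [RHS]big_seq; apply: eq_bigr => e he; rewrite big_seq [RHS]big_seq; apply: eq_bigr => e' he'.
pose h := Op2 (B1 e) (B2 e') f; have bh : bx2 h by exact: bx2_Op2.
transitivity (\sum_(Q <- [seq Q <- Fam J L | (Q.1.1 == e) && (Q.2.1 == e')])
   \int[P]_y (A1 e x.1 y.1 * A2 e' x.2 y.2 * (\1_(rect_set Q) y * h y))).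
  rewrite -big_filter big_seq [RHS]big_seq; apply: eq_bigr => Q; rewrite mem_filter => /andP[/andP[/eqP e1 /eqP e2] _].
  by rewrite /piece /Op2 e1 e2; apply: Rint_eq => y; rewrite /coefQ e1 e2.
rewrite -(Rint_sum hp); last first.
  move=> Q; have h1 := bx2_KK (kA1 e) (kA2 e') x.
  have h2 : bx2 (\1_(rect_set Q) : pt -> R) by exact: bx2_rect.
  by have h4 := bxd_mul h1 (bxd_mul h2 bh); exact: h4.
transitivity (\int[P]_y (A1 e x.1 y.1 * A2 e' x.2 y.2 * h y)); last by [].
apply: Rint_eq => y.
rewrite -mulr_sumr -mulr_suml big_filter.
have [hy|hy] := pselect (bbox (r + 2 ^+ J) y.1 /\ bbox (r + 2 ^+ J) y.2).
  by have [y1 y2] := hy; rewrite (sum_indic he he' y1 y2 hL) mul1r.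
suff -> : h y = 0 by rewrite !mulr0.
have le c : c \in es J -> 2^-1 * 2 ^ c <= 2 ^+ J :> R.
  move=> /mem_es[_ cJ]; have : (2 : R) ^ c <= 2 ^+ J by rewrite exprnP ler_weXz2l ?ler1n// ltW.
  by have : 0 <= (2 : R) ^+ J by []; lra.
apply: (Op2_supp (kp_B_supp kp1 (e := e)) (kp_B_supp kp2 (e := e')) f0) => -[g1 g2]; apply: hy; split => i.
  by apply: le_trans (g1 i) _; rewrite lerD2l le.
by apply: le_trans (g2 i) _; rewrite lerD2l le.
Qed.

Lemma telescope_es (k : int -> R) : \sum_(e <- es J) (k e - k (e + 1)) = k (- J%:Z) - k J%:Z.
Proof.
rewrite big_map -[RHS]opprB -(_ : \sum_(0 <= i < J + J) (k (i.+1%:Z - J%:Z) - k (i%:Z - J%:Z)) = k J%:Z - k (- J%:Z)).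
  rewrite -sumrN; apply: eq_bigr => i _; rewrite opprB; congr (_ - k _); lia.
rewrite (telescope_sumr (fun i => k (i%:Z - J%:Z)))//; congr (k _ - k _); lia.
Qed.

(** For fixed scales the rectangles of the family tile the box that carries B f, so the cuts
    disappear; the sum then telescopes in each variable, and a product of two differences has four
    terms. *)
Lemma PF_repro x : PF (Fam J L) f x =
  Op2 (k1 (- J%:Z)) (k2 (- J%:Z)) f x - Op2 (k1 J%:Z) (k2 (- J%:Z)) f x
  - Op2 (k1 (- J%:Z)) (k2 J%:Z) f x + Op2 (k1 J%:Z) (k2 J%:Z) f x.
Proof.
rewrite PF_Fam.
have bkk e e' : bx2 (fun z => k1 e x.1 z.1 * k2 e' x.2 z.2 * f z) by exact: bxd_mul (bx2_KK (kk1 e) (kk2 e') x) bf.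
rewrite [in RHS]/Op2 -(RintB hp (bkk _ _) (bkk _ _)) -(RintB hp (bxdB hp (bkk _ _) (bkk _ _)) (bkk _ _)).
rewrite -(RintD hp (bxdB hp (bxdB hp (bkk _ _) (bkk _ _)) (bkk _ _)) (bkk _ _)).
transitivity (\sum_(e <- es J) \sum_(e' <- es J) \int[P]_z (f z *
    ((k1 e x.1 z.1 - k1 (e + 1) x.1 z.1) * (k2 e' x.2 z.2 - k2 (e' + 1) x.2 z.2)))).
  apply: eq_bigr => e _; apply: eq_bigr => e' _.
  rewrite (Op2_comp x (kA1 e) (kB1 e) (kA2 e') (kB2 e') bf).
  by apply: Rint_eq => z; rewrite (kp_comp kp1) (kp_comp kp2).
have bt e e' : bx2 (fun z : pt => f z * ((k1 e x.1 z.1 - k1 (e + 1) x.1 z.1) * (k2 e' x.2 z.2 - k2 (e' + 1) x.2 z.2))).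
  have u1 : bx1 (fun z : X => k1 e x.1 z - k1 (e + 1) x.1 z) by apply: (bxdB (boxes_n R n)); exact: kern_bx.
  have u2 : bx1 (fun z : Y => k2 e' x.2 z - k2 (e' + 1) x.2 z) by apply: (bxdB (boxes_n R m)); exact: kern_bx.
  by have h := bxd_mul bf (bxd_prod (boxes_n R n) (boxes_n R m) u1 u2); exact: h.
rewrite (eq_bigr (fun e => \int[P]_z (\sum_(e' <- es J) (f z *
    ((k1 e x.1 z.1 - k1 (e + 1) x.1 z.1) * (k2 e' x.2 z.2 - k2 (e' + 1) x.2 z.2)))))); last first.
  by move=> e _; rewrite (Rint_sum hp) // => e'; exact: bt.
rewrite -(Rint_sum hp); last by move=> e; apply: (bxd_sum hp) => e'; exact: bt.
apply: Rint_eq => z.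
rewrite (_ : \sum_(e <- es J) _ = f z * ((\sum_(e <- es J) (k1 e x.1 z.1 - k1 (e + 1) x.1 z.1)) *
   (\sum_(e' <- es J) (k2 e' x.2 z.2 - k2 (e' + 1) x.2 z.2)))); last first.
  rewrite mulr_suml mulr_sumr; apply: eq_bigr => e _; rewrite mulr_sumr mulr_sumr; by apply: eq_bigr.
rewrite (telescope_es (fun e => k1 e x.1 z.1)) (telescope_es (fun e => k2 e x.2 z.2)); ring.
Qed.

End Reproducing.

(** * Kernels at extreme scales and sup bounds *)

Section KernelSize.
Variables (R : realType) (n : nat).
Local Notation X := (n.-tuple R).
Local Notation mu := (@lebn R n).
Implicit Types (K : X -> X -> R) (D : set X).

Definition kabs K D (t : R) := forall x, \int[mu]_y (`|K x y| * \1_D y) <= t.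

Lemma bx1_kabs K D x : kern K -> measurable D -> bx1 (fun y => `|K x y| * \1_D y).
Proof.
move=> kK mD; have h : bx1 (fun y => \1_D y * `|K x y|).
  apply: bxdM (bxd_norm (kern_bx x kK)); first exact: measurable_indic.
  by exists 1 => y; rewrite indicE; case: (_ \in _); rewrite ?normr1 ?normr0.
by apply: bxd_ext h => y; rewrite mulrC.
Qed.

Lemma kabs_ge0 K D x : 0 <= \int[mu]_y (`|K x y| * \1_D y).
Proof. by apply: Rintegral_ge0 => y _; rewrite mulr_ge0// indicE. Qed.

Lemma kabs_le K D b y x : `|K x y| <= b -> `| `|K x y| * \1_D y| <= b.
Proof.
move=> h; rewrite normrM normr_id indicE; case: (_ \in _); rewrite ?normr1 ?mulr1// normr0 mulr0.
exact: le_trans h.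
Qed.

Lemma kabs_size K D b c : kern K -> measurable D -> (forall x y, `|K x y| <= b) -> 0 < c ->
  (forall x y, (exists i, c < `|tnth x i - tnth y i|) -> K x y = 0) -> kabs K D (b * (4 * c) ^+ n).
Proof.
move=> kK mD hb c0 hc x.
have mC := measurable_cbox x c; have vC := lebn_cbox x c0.
have fC : (mu (cbox x c) < +oo)%E by apply: le_lt_trans vC _; rewrite ltry.
have [r [mK _ _]] := bx1_kabs x kK mD.
have bf : bfun (cbox x c) (fun y => `|K x y| * \1_D y).
  split => //; first by exists b => y; exact: kabs_le.
  move=> y /existsNP[i0 /negP]; rewrite -ltNge distrC => hi.
  by rewrite hc ?normr0 ?mul0r//; exists i0.
have := Rintegral_le_bound mC fC bf (fun y => kabs_le D (hb x y)).
rewrite ger0_norm ?kabs_ge0// => h; apply: le_trans h _.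
by apply: ler_wpM2l; [exact: le_trans (hb x x)|exact: lebn_cbox_fin].
Qed.

Lemma measurable_bbox r : measurable (bbox r : set X).
Proof. by have [] := boxes_n R n. Qed.

Lemma kabs_flat K b r : kern K -> (forall x y, `|K x y| <= b) -> 0 < r -> kabs K (bbox r) (b * (4 * r) ^+ n).
Proof.
move=> kK hb r0 x; have mD := measurable_bbox r.
have fC : (mu (bbox r) < +oo)%E by have [_ h _] := boxes_n R n; exact: h.
have [r' [mK _ _]] := bx1_kabs x kK mD.
have bf : bfun (bbox r) (fun y => `|K x y| * \1_(bbox r) y).
  split => //; first by exists b => y; exact: kabs_le.
  by move=> y hy; rewrite indicE memNset// mulr0.
have := Rintegral_le_bound mD fC bf (fun y => kabs_le (bbox r) (hb x y)).
rewrite ger0_norm ?kabs_ge0// => h; apply: le_trans h _.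
apply: ler_wpM2l; first exact: le_trans (hb x x).
by rewrite bbox_cbox; exact: lebn_cbox_fin.
Qed.

(** The dyadic cube with lower corner at 0. In positive dimension no dyadic cube contains a
    neighbourhood of 0, but the half neighbourhood of this one contains the box of radius r as soon
    as 2 r < 2^e. *)
Definition oc (e : int) : dcube n := (e, [tuple 0%Z | i < n]).

Lemma bbox_oc e r : 2 * r < 2 ^ e -> bbox r `<=` (nb 2^-1 (oc e) : set X).
Proof.
move=> h x hx i; rewrite /lo tnth_mktuple mul0r /dside /=.
have := hx i; rewrite ler_norml => /andP[h1 h2]; apply/andP; split; lra.
Qed.

Lemma nb_dbl (Q : dcube n) : (nb 2^-1 Q : set X) `<=` dbl_cube_set Q.
Proof. by move=> x h; apply/dbl_cubeP => i; have /andP[/ltW -> ->] := h i. Qed.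

Variables (s : nat) (C : R) (A B kap : int -> X -> X -> R).
Hypothesis kp : kpack s C A B kap.

(** At scales not below that of I the approximate identity may be replaced, on functions with
    vanishing moments carried by the double of I, by its Taylor remainder. N contains all points
    within reach, so off N both kernels vanish on that double and the polynomial is 0. *)
Lemma kap_far (I : dcube n) (J : int) : (I.1 <= J)%R -> exists KK : X -> X -> R,
  [/\ kern KK, forall x y, `|KK x y| <= C * (2 ^ (- J)) ^+ n * (2 ^ (- J) * dside R I) ^+ s.+1 &
   forall x, exists co, forall y, dbl_cube_set I y -> kap J x y - KK x y = polyrep (s := s) co (dcenter R I) y].
Proof.
move=> IJ; have C0 := kp_C0 kp.
have p2 (e : int) : 0 < (2 : R) ^ e by rewrite exprz_gt0.
have l0 := ds_gt0 R I; set l := dside R I in l0 *.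
have cl : 2 ^ (- J) * l <= 1.
  by rewrite /l /dside -expfzDr// -[leRHS](expr0z (2 : R)) ler_weXz2l ?ler1n//; lia.
pose N : set X := cbox (dcenter R I) (l + 2 ^ J).
have hN : exists r, N `<=` bbox r by eexists; exact: cbox_bbox.
have [KK [kK Kb K1 K2 hK]] := @taylor_kernel R n s (kap J) C (2 ^ (- J)) l (dcenter R I) N
  (skern_kern (kp_k_s kp J)) (@kp_k_T _ _ _ _ _ _ _ kp J) (ltW C0) (ltW (p2 _)) (ltW l0) cl
  (measurable_cbox _ _) hN.
exists KK; split => // x; have [Nx|Nx] := pselect (N x).
  by have [co hco] := hK x Nx; exists co => y /dbl_cbox; exact: hco.
exists (fun=> 0) => y /dbl_cbox hy; rewrite K1// subr0.
have -> : polyrep (s := s) (fun=> 0) (dcenter R I) y = 0 by rewrite /polyrep big1// => al _; rewrite mul0r.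
apply: (kp_k_supp kp); move/existsNP: Nx => [i0 /negP]; rewrite -ltNge => hi; exists i0.
have := hy i0; have := ler_normD (tnth x i0 - tnth y i0) (tnth y i0 - tnth (dcenter R I) i0).
by rewrite addrA subrK -/l; move: hi; lra.
Qed.

End KernelSize.

Section SupBounds.
Variables (R : realType) (n m : nat).
Local Notation pt := (pt R n m).
Local Notation P := (@leb2 R n m).
Local Notation hp := (boxes_pt R n m).
Local Notation X := (n.-tuple R).
Local Notation Y := (m.-tuple R).

Lemma Op2_sup (K1 : X -> X -> R) (K2 : Y -> Y -> R) (f : pt -> R) r N t1 t2 x : kern K1 -> kern K2 -> bx2 f ->
  (forall y, ~ bbox2 r y -> f y = 0) -> (forall y, `|f y| <= N) ->
  kabs K1 (bbox r) t1 -> kabs K2 (bbox r) t2 -> `|Op2 K1 K2 f x| <= N * (t1 * t2).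
Proof.
move=> k1 k2 bf f0 fN h1 h2; have N0 : 0 <= N by exact: le_trans (fN x).
have b1 := bx1_kabs x.1 k1 (measurable_bbox r); have b2 := bx1_kabs x.2 k2 (measurable_bbox r).
have bp := bxd_mul (bx2_KK k1 k2 x) bf.
have bq := bxdZ N (bxd_prod (boxes_n R n) (boxes_n R m) b1 b2).
apply: le_trans (Rint_le_norm hp bp) _.
apply: (@le_trans _ _ (\int[P]_y (N * (`|K1 x.1 y.1| * \1_(bbox r) y.1 * (`|K2 x.2 y.2| * \1_(bbox r) y.2))))).
  apply: (le_Rint hp (bxd_norm bp) bq) => y; have [[y1 y2]|hy] := pselect (bbox2 r y); last first.
    by rewrite f0// mulr0 normr0 !mulr_ge0.
  rewrite !indicE !mem_set// !mulr1 !normrM mulrC; apply: ler_wpM2r; rewrite ?mulr_ge0//.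
rewrite (RintZ hp _ (bxd_prod (boxes_n R n) (boxes_n R m) b1 b2)) (Rint_tensor b1 b2).
by apply: ler_wpM2l => //; apply: ler_pM => //; exact: kabs_ge0.
Qed.

Lemma approx_identity (K1 : X -> X -> R) (K2 : Y -> Y -> R) (f : pt -> R) (d w t1 t2 : R) x :
  kern K1 -> kern K2 -> bx2 f -> (forall x, \int[@lebn R n]_y K1 x y = 1) -> (forall x, \int[@lebn R m]_y K2 x y = 1) ->
  (forall x y, (exists i, d < `|tnth x i - tnth y i|) -> K1 x y = 0) ->
  (forall x y, (exists i, d < `|tnth x i - tnth y i|) -> K2 x y = 0) ->
  0 <= w -> (forall x y, (forall c, `|xc y c - xc x c| <= d) -> `|f y - f x| <= w) ->
  kabs K1 setT t1 -> kabs K2 setT t2 -> `|f x - Op2 K1 K2 f x| <= w * (t1 * t2).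
Proof.
move=> k1 k2 bf i1 i2 s1 s2 w0 hw h1 h2.
have b1 := bx1_kabs x.1 k1 measurableT; have b2 := bx1_kabs x.2 k2 measurableT.
have bKK := bx2_KK k1 k2 x; have bp := bxd_mul bKK bf.
have bc : bx2 (fun y : pt => K1 x.1 y.1 * K2 x.2 y.2 * f x).
  by apply: bxd_ext (bxdZ (f x) bKK) => y; rewrite mulrC.
have -> : f x - Op2 K1 K2 f x = \int[P]_y (K1 x.1 y.1 * K2 x.2 y.2 * f x - K1 x.1 y.1 * K2 x.2 y.2 * f y).
  rewrite (RintB hp bc bp) (RintZr hp _ bKK) (Rint_tensor (kern_bx x.1 k1) (kern_bx x.2 k2)) i1 i2.
  by rewrite mulr1 mul1r.
have bd := bxdB hp bc bp.
have bq := bxdZ w (bxd_prod (boxes_n R n) (boxes_n R m) b1 b2).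
apply: le_trans (Rint_le_norm hp bd) _.
apply: (@le_trans _ _ (\int[P]_y (w * (`|K1 x.1 y.1| * \1_setT y.1 * (`|K2 x.2 y.2| * \1_setT y.2))))).
  apply: (le_Rint hp (bxd_norm bd) bq) => y; rewrite !indicE !mem_set// !mulr1 -mulrBr !normrM mulrC.
  have [g1|g1] := pselect (exists i, d < `|tnth x.1 i - tnth y.1 i|).
    by rewrite s1// normr0 !mul0r !mulr0.
  have [g2|g2] := pselect (exists i, d < `|tnth x.2 i - tnth y.2 i|).
    by rewrite s2// normr0 !mulr0.
  apply: ler_wpM2r; first by rewrite mulr_ge0.
  rewrite distrC; apply: hw => -[i0|i0] /=; rewrite distrC leNgt; apply/negP => h.
    by apply: g1; exists i0.
  by apply: g2; exists i0.
rewrite (RintZ hp _ (bxd_prod (boxes_n R n) (boxes_n R m) b1 b2)) (Rint_tensor b1 b2).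
by apply: ler_wpM2l => //; apply: ler_pM => //; exact: kabs_ge0.
Qed.

Lemma rmz_mom1 s (f : pt -> R) : bx2 f -> mom1 s f -> forall x2, rmz s (fun x1 => f (x1, x2)).
Proof.
move=> bf h x2 al hal; split; last exact: h.
exact: (bxd_integrable (boxes_n R n) (bx1_mono al (bxd_section2 bf x2))).
Qed.

Lemma rmz_mom2 s (f : pt -> R) : bx2 f -> mom2 s f -> forall x1, rmz s (fun x2 => f (x1, x2)).
Proof.
move=> bf h x1 al hal; split; last exact: h.
exact: (bxd_integrable (boxes_n R m) (bx1_mono al (bxd_section1 bf x1))).
Qed.

Variables (p : R) (s1 s2 : nat).
Hypotheses (n0 : (0 < n)%N) (m0 : (0 < m)%N) (p0 : 0 < p) (p1 : p <= 1).
Variables (nu : (pt -> R) -> R) (M : R).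
Hypotheses (M0 : 0 <= M) (hab : forall F, abd p s1 s2 nu M F).

Let p2 : 2^-1 <= p^-1. Proof. by rewrite lef_pV2 ?posrE//; apply: le_trans p1 _; rewrite ler1n. Qed.

(** A sup bound is turned into an L^2 bound on a set of measure at most U, which costs U^(1/2) and
    raises the exponent 1/p - 1/2 to 1/p. *)
Lemma sup_bound (W : drect n m) (g : pt -> R) (t : R) : rD s1 s2 g -> (forall x, ~ nb2 2^-1 W x -> g x = 0) ->
  (forall x, `|g x| <= t) -> nu g <= M * t * (2 ^+ n * 2 ^+ m * rvol R W) `^ p^-1.
Proof.
move=> rg sg gt; have h2 : (0 : R) < 2^-1 by rewrite invr_gt0.
have t0 : 0 <= t by exact: le_trans (gt ([tuple 0 | i < n], [tuple 0 | i < m])).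
have WW : (rect_set W : set pt) `<=` nb2 2^-1 W by move=> x [x1 x2]; split; exact: sub_nb.
have WF : W \in [:: W] by rewrite inE.
apply: le_trans (rect_bound n0 m0 (@hab [:: W]) WF WW rg sg M0 p2) _.
set U := 2 ^+ n * 2 ^+ m * rvol R W.
have U0 : 0 < U by rewrite mulr_gt0 ?rvol_gt0// mulr_gt0 ?exprn_gt0.
have mD := @measurable_nb2 R n m 2^-1 W; have vD := leb2_nb2_half R W.
have fD : (P (nb2 2^-1 W) < +oo)%E by apply: le_lt_trans vD _; rewrite ltry.
have [_ [r [mg _ _]] _ _] := rg.
have g2 x : `|g x ^+ 2| <= t ^+ 2 by rewrite normrX lerXn2r ?nnegrE.
have bf : bfun (nb2 2^-1 W) (fun x => g x ^+ 2).
  by split; [exact: measurable_funX|exists (t ^+ 2)|move=> x /sg ->; rewrite expr0n].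
have hI : \int[P]_x g x ^+ 2 <= t ^+ 2 * U.
  apply: le_trans (ler_norm _) _; apply: le_trans (Rintegral_le_bound mD fD bf g2) _.
  by apply: ler_wpM2l; rewrite ?sqr_ge0// -lee_fin fineK ?ge0_fin_numE.
have hs : Num.sqrt (\int[P]_x g x ^+ 2) <= t * U `^ 2^-1.
  rewrite powR12_sqrt ?(ltW U0)// -[t in leRHS]ger0_norm// -sqrtr_sqr -sqrtrM ?sqr_ge0//; exact: ler_wsqrtr.
apply: (@le_trans _ _ (M * (t * U `^ 2^-1) * U `^ (p^-1 - 2^-1))).
  by apply: ler_wpM2r; [exact: powR_ge0|apply: ler_wpM2l].
rewrite -!mulrA -powRD; last by rewrite (gt_eqF U0) implybT.
by rewrite addrC subrK.
Qed.

End SupBounds.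

Lemma sum5_le (a b c d e : nat) : let s := (a + b + c + d + e)%N in
  [/\ (a <= s)%N, (b <= s)%N, (c <= s)%N, (d <= s)%N & (e <= s)%N].
Proof. by split; lia. Qed.

Section Decay.
Variable R : realType.

Lemma geo_small (k c e : R) : 0 <= k < 1 -> 0 < e -> exists J0, forall J, (J0 <= J)%N -> c * k ^+ J <= e.
Proof.
move=> /andP[k0 k1] e0; have c1 : 0 < `|c| + 1 by rewrite ltr_wpDl.
have k1' : `|k| < 1 by rewrite ger0_norm.
have /cvgrPdist_le/(_ (e / (`|c| + 1)) (divr_gt0 e0 c1))[J0 _ hJ] := cvg_expr k1'.
exists J0 => J J0J; have := hJ J J0J; rewrite /= sub0r normrN ger0_norm ?exprn_ge0// => h.
apply: le_trans (ler_wpM2r (exprn_ge0 J k0) (ler_norm c)) _.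
apply: le_trans (ler_wpM2l (normr_ge0 c) h) _.
by rewrite mulrCA ger_pMr// ler_pdivrMr// mul1r lerDl.
Qed.

(** At scale 2^J the remainder kernel has size of order 2^(-J(k+s+1)), and the output lives on a set
    of volume of order 2^(J k), which enters with the power 1/p. The product is decay^J, and decay <
    1 under the same condition as for [rho]. *)
Definition decay (k s : nat) (p : R) : R := (2^-1) ^+ (k + s.+1) * (2 ^+ k) `^ p^-1.

Lemma decay_ge0 k s p : 0 <= decay k s p.
Proof. by rewrite mulr_ge0 ?powR_ge0 ?exprn_ge0 ?invr_ge0. Qed.

Lemma decay_lt1 k s p : 0 < p -> k%:R * (p^-1 - 1) < s.+1%:R -> decay k s p < 1.
Proof.
move=> p0 h; rewrite /decay exprVn -!powR_mulrn// -powRN -!powRrM -powRD; last by rewrite pnatr_eq0 implybT.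
rewrite /powR pnatr_eq0 /= expR_lt1 pmulr_llt0 ?ln_gt0 ?ltr1n//.
by rewrite natrD; move: h; rewrite mulrBr mulr1; lra.
Qed.

Lemma expN2 (J : nat) : (2 : R) ^ (- J%:Z) = (2^-1) ^+ J.
Proof. by rewrite -exprnN exprVn. Qed.

Lemma oc_ds n (e : nat) : dside R (oc n e%:Z) = 2 ^+ e.
Proof. by rewrite /dside /= -exprnP. Qed.

End Decay.

Section KapSizes.
Variables (R : realType) (n s : nat) (C : R) (A B kap : int -> n.-tuple R -> n.-tuple R -> R).
Hypothesis kp : kpack s C A B kap.

Lemma kap_kabs J (D : set (n.-tuple R)) : measurable D -> kabs (kap J) D (C * 4 ^+ n).
Proof.
move=> mD; have kK := skern_kern (kp_k_s kp J).
have c0 : 0 < (2 : R) ^ J by rewrite exprz_gt0.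
have -> : C * 4 ^+ n = C * (2 ^ (- J)) ^+ n * (4 * 2 ^ J) ^+ n.
  have e1 : ((2 : R) ^ (- J)) ^+ n * (2 ^ J) ^+ n = 1 by rewrite -exprMn -expfzDr// addNr expr0z expr1n.
  by rewrite exprMn; transitivity (C * 4 ^+ n * ((2 ^ (- J)) ^+ n * (2 ^ J) ^+ n)); [rewrite e1 mulr1|ring].
exact: (kabs_size kK mD (kp_k_size kp J) c0 (@kp_k_supp _ _ _ _ _ _ _ kp J)).
Qed.

Lemma kap_far_kabs (k0 J : nat) r : (k0 <= J)%N -> 0 < r -> exists KK : n.-tuple R -> n.-tuple R -> R,
  [/\ kern KK, kabs KK (bbox r) (C * (2 ^+ k0) ^+ s.+1 * (4 * r) ^+ n * ((2^-1) ^+ (n + s.+1)) ^+ J) &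
   forall x, exists co, forall y, dbl_cube_set (oc n k0%:Z) y ->
     kap J%:Z x y - KK x y = polyrep (s := s) co (dcenter R (oc n k0%:Z)) y].
Proof.
move=> kJ r0; have [|KK [kK hK hp]] := @kap_far R n s C A B kap kp (oc n k0%:Z) J%:Z; first by rewrite /=; lia.
exists KK; split => //.
have -> : C * (2 ^+ k0) ^+ s.+1 * (4 * r) ^+ n * ((2^-1) ^+ (n + s.+1)) ^+ J =
   C * (2 ^ (- J%:Z)) ^+ n * (2 ^ (- J%:Z) * dside R (oc n k0%:Z)) ^+ s.+1 * (4 * r) ^+ n.
  rewrite expN2 oc_ds -[(_ ^+ (n + _)) ^+ J]exprM mulnC exprM exprD [in RHS]exprMn; ring.
exact: kabs_flat.
Qed.

End KapSizes.

(** * Convergence of the finite operators on test functions *)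

Section Approximation.
Variables (R : realType) (n m : nat) (p : R) (s1 s2 : nat) (C1 C2 : R).
Hypotheses (n0 : (0 < n)%N) (m0 : (0 < m)%N) (p0 : 0 < p) (p1 : p <= 1).
Hypotheses (hs1 : n%:R * (p^-1 - 1) < s1.+1%:R) (hs2 : m%:R * (p^-1 - 1) < s2.+1%:R).
Variables (A1 B1 k1 : int -> n.-tuple R -> n.-tuple R -> R) (A2 B2 k2 : int -> m.-tuple R -> m.-tuple R -> R).
Hypotheses (kp1 : kpack s1 C1 A1 B1 k1) (kp2 : kpack s2 C2 A2 B2 k2).
Local Notation pt := (pt R n m).
Local Notation P := (@leb2 R n m).
Local Notation hp := (boxes_pt R n m).
Local Notation PF := (PF A1 B1 A2 B2).
Variables (nu : (pt -> R) -> R) (M : R).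
Hypotheses (hnu : pnu p s1 s2 nu) (M0 : 0 <= M) (hab : forall F, abd p s1 s2 nu M F).

Let kk1 e : kern (k1 e). Proof. exact: skern_kern (kp_k_s kp1 e). Qed.
Let kk2 e : kern (k2 e). Proof. exact: skern_kern (kp_k_s kp2 e). Qed.

Section OneScale.
Variables (f : pt -> R) (r N : R) (k0 J : nat).
Hypotheses (rf : rD s1 s2 f) (f0 : forall y, ~ bbox2 r y -> f y = 0) (fN : forall y, `|f y| <= N).
Hypotheses (r0 : 0 < r) (hk : 2 * (r + 1) < 2 ^+ k0) (kJ : (k0 <= J)%N).

Let bf : bx2 f. Proof. by have [] := rf. Qed.
Let Lf : L2f P f. Proof. exact: (bxd_L2 hp bf). Qed.

Definition U0 : R := 2 ^+ n * 2 ^+ m * ((2 ^+ k0) ^+ n * (2 ^+ k0) ^+ m).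
Let U0_ge0 : 0 <= U0. Proof. by rewrite !mulr_ge0 ?exprn_ge0. Qed.

Let f_dbl x : ~ dbl_rect_set (oc n k0%:Z, oc m k0%:Z) x -> f x = 0.
Proof.
move=> h; apply: f0 => -[h1 h2]; apply: h; have hr : 2 * r < (2 : R) ^ k0%:Z by rewrite -exprnP; move: hk; lra.
by split; apply: nb_dbl; apply: (bbox_oc hr).
Qed.

Lemma rD_kk e e' : rD s1 s2 (Op2 (k1 e) (k2 e') f).
Proof.
have [_ _ f1 f2] := rf; apply: (@rD_Op2 _ n m s1 s2 _ _ _ 1 1).
- exact: kp_k_s kp1 _.
- exact: kp_k_s kp2 _.
- exact: bf.
- by move=> y al hal; rewrite mul1r (kp_k_m kp1).
- by move=> y al hal; rewrite mul1r (kp_k_m kp2).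
- by right.
- by right.
Qed.

Let p2J : 1 <= (2 : R) ^+ J. Proof. by rewrite exprn_ege1// ler1n. Qed.
Let smallE : (2 : R) ^ (- J%:Z) <= 1.
Proof. by rewrite expN2 exprn_ile1 ?invr_ge0// invf_le1// ler1n. Qed.

Let boxZ k : bbox (r + 2 ^ J%:Z) `<=` (nb 2^-1 (oc k (J + k0)%N%:Z) : set (k.-tuple R)).
Proof.
apply: bbox_oc; rewrite -!exprnP exprD.
apply: (@le_lt_trans _ _ (2 ^+ J * (2 * (r + 1)))); last by rewrite ltr_pM2l// (lt_le_trans ltr01).
have : r * 1 <= r * 2 ^+ J by rewrite ler_pM2l.
by lra.
Qed.

Let boxE k : bbox (r + 2 ^ (- J%:Z)) `<=` (nb 2^-1 (oc k k0%:Z) : set (k.-tuple R)).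
Proof. by apply: bbox_oc; rewrite -exprnP; move: hk smallE; lra. Qed.

Lemma rvol_oc (e e' : nat) : rvol R (oc n e%:Z, oc m e'%:Z) = (2 ^+ e) ^+ n * (2 ^+ e') ^+ m.
Proof. by rewrite /rvol /= !oc_ds. Qed.

Let z1 : R := C1 * (2 ^+ k0) ^+ s1.+1 * (4 * r) ^+ n.
Let z2 : R := C2 * (2 ^+ k0) ^+ s2.+1 * (4 * r) ^+ m.

Let upJ k : (2 : R) ^+ (J + k0) ^+ k = (2 ^+ k0) ^+ k * (2 ^+ k) ^+ J.
Proof. by rewrite exprD exprMn -[(2 ^+ J) ^+ k]exprM -[(2 ^+ k) ^+ J]exprM mulnC mulrC. Qed.

(** In the first variable, at the coarse scale 2^J, the moments of f give the decay; in the second,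
    at scale 2^(-J), the kernel is only bounded. *)
Lemma T1_le : nu (Op2 (k1 J%:Z) (k2 (- J%:Z)) f) <=
  M * (N * (z1 * (C2 * 4 ^+ m))) * U0 `^ p^-1 * decay n s1 p ^+ J.
Proof.
have [KK [kK aK hK]] := kap_far_kabs kp1 kJ r0.
have [_ _ f1 _] := rf; have mz := rmz_mom1 bf f1.
have E x : Op2 (k1 J%:Z) (k2 (- J%:Z)) f x = Op2 KK (k2 (- J%:Z)) f x.
  have [co hco] := hK x.1; exact: (Op2_replace1 (Q := (oc n k0%:Z, oc m k0%:Z)) Lf f_dbl (kk1 _) kK (kk2 _) mz hco).
have sup x : `|Op2 (k1 J%:Z) (k2 (- J%:Z)) f x| <= N * (z1 * ((2^-1) ^+ (n + s1.+1)) ^+ J * (C2 * 4 ^+ m)).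
  rewrite E; apply: (Op2_sup x kK (kk2 _) bf f0 fN aK); apply: (kap_kabs kp2); exact: measurable_bbox.
have sp x : ~ nb2 2^-1 (oc n (J + k0)%N%:Z, oc m k0%:Z) x -> Op2 (k1 J%:Z) (k2 (- J%:Z)) f x = 0.
  move=> hx; apply: (Op2_supp (@kp_k_supp _ _ _ _ _ _ _ kp1 _) (@kp_k_supp _ _ _ _ _ _ _ kp2 _) f0) => -[g1 g2].
  by apply: hx; split; [exact: boxZ|exact: boxE].
apply: le_trans (sup_bound n0 m0 p0 p1 M0 hab (rD_kk _ _) sp sup) _.
rewrite rvol_oc upJ.
have -> : 2 ^+ n * 2 ^+ m * ((2 ^+ k0) ^+ n * (2 ^+ n) ^+ J * (2 ^+ k0) ^+ m) = U0 * (2 ^+ n) ^+ J by rewrite /U0; ring.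
rewrite powRM ?exprn_ge0// powRX ?exprn_ge0// /decay [in leRHS]exprMn.
by rewrite le_eqVlt; apply/orP; left; apply/eqP; ring.
Qed.

Lemma T2_le : nu (Op2 (k1 (- J%:Z)) (k2 J%:Z) f) <=
  M * (N * (C1 * 4 ^+ n * z2)) * U0 `^ p^-1 * decay m s2 p ^+ J.
Proof.
have [KK [kK aK hK]] := kap_far_kabs kp2 kJ r0.
have [_ _ _ f2] := rf; have mz := rmz_mom2 bf f2.
have E x : Op2 (k1 (- J%:Z)) (k2 J%:Z) f x = Op2 (k1 (- J%:Z)) KK f x.
  have [co hco] := hK x.2; exact: (Op2_replace2 (Q := (oc n k0%:Z, oc m k0%:Z)) Lf f_dbl (kk2 _) kK (kk1 _) mz hco).
have sup x : `|Op2 (k1 (- J%:Z)) (k2 J%:Z) f x| <= N * (C1 * 4 ^+ n * (z2 * ((2^-1) ^+ (m + s2.+1)) ^+ J)).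
  rewrite E; apply: (Op2_sup x (kk1 _) kK bf f0 fN _ aK); apply: (kap_kabs kp1); exact: measurable_bbox.
have sp x : ~ nb2 2^-1 (oc n k0%:Z, oc m (J + k0)%N%:Z) x -> Op2 (k1 (- J%:Z)) (k2 J%:Z) f x = 0.
  move=> hx; apply: (Op2_supp (@kp_k_supp _ _ _ _ _ _ _ kp1 _) (@kp_k_supp _ _ _ _ _ _ _ kp2 _) f0) => -[g1 g2].
  by apply: hx; split; [exact: boxE|exact: boxZ].
apply: le_trans (sup_bound n0 m0 p0 p1 M0 hab (rD_kk _ _) sp sup) _.
rewrite rvol_oc upJ.
have -> : 2 ^+ n * 2 ^+ m * ((2 ^+ k0) ^+ n * ((2 ^+ k0) ^+ m * (2 ^+ m) ^+ J)) = U0 * (2 ^+ m) ^+ J by rewrite /U0; ring.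
rewrite powRM ?exprn_ge0// powRX ?exprn_ge0// /decay [in leRHS]exprMn.
by rewrite le_eqVlt; apply/orP; left; apply/eqP; ring.
Qed.

Lemma T3_le : nu (Op2 (k1 J%:Z) (k2 J%:Z) f) <=
  M * (N * (z1 * z2)) * U0 `^ p^-1 * (decay n s1 p * decay m s2 p) ^+ J.
Proof.
have [KK [kK aK hK]] := kap_far_kabs kp1 kJ r0; have [LL [kL aL hL]] := kap_far_kabs kp2 kJ r0.
have [_ _ f1 f2] := rf; have mz1 := rmz_mom1 bf f1; have mz2 := rmz_mom2 bf f2.
have E x : Op2 (k1 J%:Z) (k2 J%:Z) f x = Op2 KK LL f x.
  have [co hco] := hK x.1; have [co' hco'] := hL x.2.
  rewrite (Op2_replace1 (Q := (oc n k0%:Z, oc m k0%:Z)) Lf f_dbl (kk1 _) kK (kk2 _) mz1 hco).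
  exact: (Op2_replace2 (Q := (oc n k0%:Z, oc m k0%:Z)) Lf f_dbl (kk2 _) kL kK mz2 hco').
have sup x : `|Op2 (k1 J%:Z) (k2 J%:Z) f x| <=
    N * (z1 * ((2^-1) ^+ (n + s1.+1)) ^+ J * (z2 * ((2^-1) ^+ (m + s2.+1)) ^+ J)).
  by rewrite E; apply: (Op2_sup x kK kL bf f0 fN aK aL).
have sp x : ~ nb2 2^-1 (oc n (J + k0)%N%:Z, oc m (J + k0)%N%:Z) x -> Op2 (k1 J%:Z) (k2 J%:Z) f x = 0.
  move=> hx; apply: (Op2_supp (@kp_k_supp _ _ _ _ _ _ _ kp1 _) (@kp_k_supp _ _ _ _ _ _ _ kp2 _) f0) => -[g1 g2].
  by apply: hx; split; exact: boxZ.
apply: le_trans (sup_bound n0 m0 p0 p1 M0 hab (rD_kk _ _) sp sup) _.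
rewrite rvol_oc !upJ.
have -> : 2 ^+ n * 2 ^+ m * ((2 ^+ k0) ^+ n * (2 ^+ n) ^+ J * ((2 ^+ k0) ^+ m * (2 ^+ m) ^+ J)) =
   U0 * ((2 ^+ n) ^+ J * (2 ^+ m) ^+ J) by rewrite /U0; ring.
rewrite powRM ?mulr_ge0 ?exprn_ge0// [(_ * (2 ^+ m) ^+ J) `^ _]powRM ?exprn_ge0//.
rewrite (powRX p^-1 J (exprn_ge0 n (ler0n R 2))) (powRX p^-1 J (exprn_ge0 m (ler0n R 2))).
rewrite /decay [in leRHS]exprMn ![in leRHS]exprMn.
by rewrite le_eqVlt; apply/orP; left; apply/eqP; ring.
Qed.

Lemma T0_le w : 0 <= w -> (forall x y, (forall c, `|xc y c - xc x c| <= 2 ^ (- J%:Z)) -> `|f y - f x| <= w) ->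
  nu (fun x => f x - Op2 (k1 (- J%:Z)) (k2 (- J%:Z)) f x) <=
  M * (C1 * 4 ^+ n * (C2 * 4 ^+ m)) * U0 `^ p^-1 * w.
Proof.
move=> w0 hw.
have sup x : `|f x - Op2 (k1 (- J%:Z)) (k2 (- J%:Z)) f x| <= w * (C1 * 4 ^+ n * (C2 * 4 ^+ m)).
  apply: (approx_identity x (kk1 _) (kk2 _) bf (kp_k_1 kp1 _) (kp_k_1 kp2 _)
    (@kp_k_supp _ _ _ _ _ _ _ kp1 _) (@kp_k_supp _ _ _ _ _ _ _ kp2 _) w0 hw).
    exact: (kap_kabs kp1).
  exact: (kap_kabs kp2).
have sp x : ~ nb2 2^-1 (oc n k0%:Z, oc m k0%:Z) x -> f x - Op2 (k1 (- J%:Z)) (k2 (- J%:Z)) f x = 0.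
  move=> hx; rewrite f0; last first.
    have e0 : 0 <= (2 : R) ^ (- J%:Z) by rewrite exprz_ge0.
    by move=> [g1 g2]; apply: hx; split; apply: boxE => i; [apply: le_trans (g1 i) _|apply: le_trans (g2 i) _]; rewrite lerDl.
  rewrite sub0r; apply/eqP; rewrite oppr_eq0; apply/eqP.
  apply: (Op2_supp (@kp_k_supp _ _ _ _ _ _ _ kp1 _) (@kp_k_supp _ _ _ _ _ _ _ kp2 _) f0) => -[g1 g2].
  by apply: hx; split; exact: boxE.
apply: le_trans (sup_bound n0 m0 p0 p1 M0 hab (rD_sub rf (rD_kk _ _)) sp sup) _.
rewrite rvol_oc -/U0.
by rewrite le_eqVlt; apply/orP; left; apply/eqP; ring.
Qed.

End OneScale.

(** By [PF_repro] the remainder is T0 + T1 + T2 - T3. T0 is small because f is uniformly continuous,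
    the other terms decay geometrically in J, and each of the four lives on the neighbourhood of one
    rectangle, where [sup_bound] applies. *)
Theorem reproducing (f : pt -> R) (e : R) : rD s1 s2 f -> 0 < e ->
  exists2 F, uniq F & nu (fun x => f x - PF F f x) `^ p <= e.
Proof.
move=> rf e0; have [sf bf _ _] := rf.
have [r' [_ [N fN] fz]] := bf.
pose r := `|r'| + 1; have r0 : 0 < r by rewrite ltr_wpDl.
have f0 y : ~ bbox2 r y -> f y = 0.
  move=> h; apply: fz => -[h1 h2]; apply: h; have rr : r' <= r by rewrite /r (le_trans (ler_norm r'))// lerDl.
  by split => i; [apply: le_trans (h1 i) _|apply: le_trans (h2 i) _].
have [k0 hk] : exists k0 : nat, 2 * (r + 1) < 2 ^+ k0.
  have [k hk] : exists k : nat, 2 * (r + 1) < k%:R.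
    by eexists; apply: archi_boundP; rewrite mulr_ge0// addr_ge0// ltW.
  by exists k; apply: lt_trans hk _; rewrite -natrX ltr_nat ltn_expl.
(* Four terms, each with p-th power at most e / 4. *)
pose d := (e / 4) `^ p^-1.
have d0 : 0 < d by rewrite powR_gt0// divr_gt0.
have dp : d `^ p = e / 4 by rewrite -powRrM mulVf ?gt_eqF// powRr1// divr_ge0// ltW.
have q1 : 0 <= decay n s1 p < 1 by rewrite decay_ge0 decay_lt1.
have q2 : 0 <= decay m s2 p < 1 by rewrite decay_ge0 decay_lt1.
have q3 : 0 <= decay n s1 p * decay m s2 p < 1.
  by move: q1 q2 => /andP[a1 b1] /andP[a2 b2]; rewrite mulr_ge0//= mulr_ilt1.
have [J1 h1] := geo_small (M * (N * (C1 * (2 ^+ k0) ^+ s1.+1 * (4 * r) ^+ n * (C2 * 4 ^+ m))) * U0 k0 `^ p^-1) q1 d0.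
have [J2 h2] := geo_small (M * (N * (C1 * 4 ^+ n * (C2 * (2 ^+ k0) ^+ s2.+1 * (4 * r) ^+ m))) * U0 k0 `^ p^-1) q2 d0.
have [J3 h3] := geo_small (M * (N * (C1 * (2 ^+ k0) ^+ s1.+1 * (4 * r) ^+ n * (C2 * (2 ^+ k0) ^+ s2.+1 * (4 * r) ^+ m)))
   * U0 k0 `^ p^-1) q3 d0.
pose c0 := M * (C1 * 4 ^+ n * (C2 * 4 ^+ m)) * U0 k0 `^ p^-1.
have c00 : 0 <= c0.
  by rewrite !mulr_ge0 ?powR_ge0 ?exprn_ge0// ltW// ?(kp_C0 kp1) ?(kp_C0 kp2).
pose w := d / (c0 + 1); have c01 : 0 < c0 + 1 by rewrite ltr_wpDl.
have w0 : 0 < w by rewrite divr_gt0.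
have [dd dd0 hdd] := continuous_uniform (sf [::]).1 f0 w0.
have hh : 0 <= (2^-1 : R) < 1 by rewrite invr_ge0 ler0n/= invf_lt1 ?ltr1n.
have [J4 h4] := geo_small 1 hh (divr_gt0 dd0 (ltr0n R 2)).
pose J := (k0 + J1 + J2 + J3 + J4)%N.
have [kJ j1 j2 j3 j4] : [/\ (k0 <= J)%N, (J1 <= J)%N, (J2 <= J)%N, (J3 <= J)%N & (J4 <= J)%N] := sum5_le _ _ _ _ _.
(* L is chosen after J, so that the family tiles the box reached by the kernels B. *)
have [L hL] : exists L : nat, (r + 2 ^+ J) * 2 ^+ J + 1 < L%:R.
  by eexists; apply: archi_boundP; rewrite addr_ge0// mulr_ge0 ?exprn_ge0// addr_ge0 ?exprn_ge0// ltW.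
exists (Fam n m J L); first exact: undup_uniq.
pose T0 x := f x - Op2 (k1 (- J%:Z)) (k2 (- J%:Z)) f x.
pose T1 := Op2 (k1 J%:Z) (k2 (- J%:Z)) f; pose T2 := Op2 (k1 (- J%:Z)) (k2 J%:Z) f; pose T3 := Op2 (k1 J%:Z) (k2 J%:Z) f.
have -> : (fun x => f x - PF (Fam n m J L) f x) = (fun x => T0 x + T1 x + (T2 x + (-1) * T3 x)).
  by apply/funext => x; rewrite (PF_repro kp1 kp2 bf f0 (ltW hL)) /T0 /T1 /T2 /T3; ring.
have r1 := rD_kk rf J%:Z (- J%:Z); have r2 := rD_kk rf (- J%:Z) J%:Z; have r3 := rD_kk rf J%:Z J%:Z.
have rT0 : rD s1 s2 T0 := rD_sub rf (rD_kk rf (- J%:Z) (- J%:Z)).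
have r3' := rD_scale (-1) r3.
have e1 : nu T1 <= d by apply: le_trans (T1_le rf f0 fN r0 hk kJ) _; exact: h1.
have e2 : nu T2 <= d by apply: le_trans (T2_le rf f0 fN r0 hk kJ) _; exact: h2.
have e3 : nu (fun x => (-1) * T3 x) <= d.
  apply: le_trans (pnu_Z hnu (-1) r3) _; rewrite normrN1 mul1r.
  by apply: le_trans (T3_le rf f0 fN r0 hk kJ) _; exact: h3.
have e0' : nu T0 <= d.
  apply: le_trans (T0_le rf f0 hk (ltW w0) _) _.
    move=> x y hxy; apply/ltW/hdd => c; apply: le_lt_trans (hxy c) _; rewrite expN2.
    have := h4 J j4; rewrite mul1r => h; apply: le_lt_trans h _.
    by rewrite ltr_pdivrMr//; lra.
  by rewrite -/c0 /w mulrCA ger_pMr// ler_pdivrMr// mul1r lerDl.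
apply: le_trans (pnu_D hnu (rD_add rT0 r1) (rD_add r2 r3')) _.
apply: le_trans (lerD (pnu_D hnu rT0 r1) (pnu_D hnu r2 r3')) _.
have g0 := pnu_le p0 hnu rT0 e0'; have g1 := pnu_le p0 hnu r1 e1.
have g2 := pnu_le p0 hnu r2 e2; have g3 := pnu_le p0 hnu r3' e3.
rewrite dp in g0 g1 g2 g3.
apply: le_trans (lerD (lerD g0 g1) (lerD g2 g3)) _.
by rewrite le_eqVlt; apply/orP; left; apply/eqP; field.
Qed.

End Approximation.

(** * Boundedness on H^p *)

Section ComplexFunctions.
Variables (R : realType) (n m : nat).
Local Notation pt := (pt R n m).
Local Notation P := (@leb2 R n m).

Lemma complex_ext (z w : R[i]) : cre z = cre w -> cim z = cim w -> z = w.
Proof. by case: z w => [a b] [c d] /= -> ->. Qed.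

Lemma creM (z w : R[i]) : cre (z * w) = cre z * cre w - cim z * cim w.
Proof. by case: z w => [a b] [c d]. Qed.

Lemma cimM (z w : R[i]) : cim (z * w) = cre z * cim w + cim z * cre w.
Proof. by case: z w => [a b] [c d]. Qed.

Lemma creD (z w : R[i]) : cre (z + w) = cre z + cre w.
Proof. by case: z w => [a b] [c d]. Qed.

Lemma cimD (z w : R[i]) : cim (z + w) = cim z + cim w.
Proof. by case: z w => [a b] [c d]. Qed.

Lemma cre_le (z : R[i]) : `|cre z| <= cmod z.
Proof. by rewrite -sqrtr_sqr; apply: ler_wsqrtr; rewrite lerDl sqr_ge0. Qed.

Lemma cim_le (z : R[i]) : `|cim z| <= cmod z.
Proof. by rewrite -sqrtr_sqr; apply: ler_wsqrtr; rewrite lerDr sqr_ge0. Qed.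

Lemma cmod_real (c : R) : cmod (Complex c 0) = `|c|.
Proof. by rewrite /cmod /cre /cim /= expr0n addr0 sqrtr_sqr. Qed.

Lemma cmod_imag (c : R) : cmod (Complex 0 c) = `|c|.
Proof. by rewrite /cmod /cre /cim /= expr0n add0r sqrtr_sqr. Qed.

Lemma Dss_rD s1 s2 (f : pt -> R[i]) : Dss s1 s2 f ->
  rD s1 s2 (fun x => cre (f x)) /\ rD s1 s2 (fun x => cim (f x)).
Proof.
move=> [[sr [si [r hr]]] [m1 m2]].
have f0 x : ~ bbox2 r x -> f x = 0.
  move=> hx; apply: hr; apply: contrapT => /not_orP[g1 g2]; apply: hx; split => i0; rewrite leNgt; apply/negP => h.
    by apply: g1; exists i0.
  by apply: g2; exists i0.
split; split => //.
- by apply: (continuous_bx2 (sr [::]).1 (r := r)) => x /f0 h /=; rewrite h.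
- by move=> x2 al hal; have [e _] := m1 x2 al hal; rewrite /Rintegral e.
- by move=> x1 al hal; have [e _] := m2 x1 al hal; rewrite /Rintegral e.
- by apply: (continuous_bx2 (si [::]).1 (r := r)) => x /f0 h /=; rewrite h.
- by move=> x2 al hal; have [_ e] := m1 x2 al hal; rewrite /Rintegral e.
- by move=> x1 al hal; have [_ e] := m2 x1 al hal; rewrite /Rintegral e.
Qed.

End ComplexFunctions.

Section Series.
Variables (R : realType) (u : nat -> R).
Hypotheses (u0 : forall k, 0 <= u k) (hu : (\sum_(0 <= k <oo) (u k)%:E < +oo)%E).
Local Notation S := (fine (\sum_(0 <= k <oo) (u k)%:E)%E).

Let u0' k : (0 <= k)%N -> xpredT k -> (0 <= (u k)%:E)%E. Proof. by rewrite lee_fin. Qed.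
Let SE : (\sum_(0 <= k <oo) (u k)%:E = S%:E)%E.
Proof. by rewrite fineK// ge0_fin_numE//; apply: nneseries_ge0 => k _ _; rewrite lee_fin. Qed.

Lemma series_partial_le N : \sum_(0 <= k < N) u k <= S.
Proof. by rewrite -lee_fin -SE -sumEFin; exact: nneseries_lim_ge u0'. Qed.

Lemma series_partial_ge e : 0 < e -> exists N, S - e <= \sum_(0 <= k < N) u k.
Proof.
move=> e0; apply: contrapT => hN.
suff : S <= S - e by lra.
rewrite -lee_fin -[leLHS]SE; apply: lime_le; first exact: is_cvg_nneseries u0'.
apply: nearW => N; rewrite sumEFin lee_fin leNgt; apply/negP => h; apply: hN; exists N; exact: ltW.
Qed.

End Series.

Section Extension.
Variables (R : realType) (n m : nat) (p q : R) (s1 s2 : nat).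
Variables (V : lmodType R[i]) (nrm : V -> R) (T : (pt R n m -> R[i]) -> V).
Hypotheses (n0 : (0 < n)%N) (m0 : (0 < m)%N) (p0 : 0 < p) (p1 : p <= 1) (pq : p <= q).
Hypotheses (hs1 : n%:R * (p^-1 - 1) < s1.+1%:R) (hs2 : m%:R * (p^-1 - 1) < s2.+1%:R).
Hypotheses (nrm0 : forall x, 0 <= nrm x) (hT : sublinear_on (Dss s1 s2) q nrm T).
Local Notation pt := (pt R n m).
Local Notation P := (@leb2 R n m).
Local Notation hp := (boxes_pt R n m).

Let q0 : 0 < q. Proof. exact: lt_le_trans pq. Qed.

Definition nuT (g : pt -> R) : R := nrm (T (rC g)).

(** Since p <= q, the function t |-> t^(p/q) is subadditive and turns q-subadditivity into
    p-subadditivity. *)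
Lemma sublinear_p (f g : pt -> R[i]) (lam mu : R[i]) : Dss s1 s2 f -> Dss s1 s2 g -> cmod lam = 1 -> cmod mu = 1 ->
  nrm (T (lincomb lam mu f g)) `^ p <= nrm (T f) `^ p + nrm (T g) `^ p.
Proof.
move=> df dg l1 m1; have [/(_ lam mu)] := hT df dg; rewrite l1 m1 powR1 !mul1r => h _.
have a0 : 0 <= nrm (T f) `^ q + nrm (T g) `^ q by rewrite addr_ge0 ?powR_ge0.
apply: (@le_trans _ _ (((nrm (T f) `^ q + nrm (T g) `^ q) `^ q^-1) `^ p)).
  by apply: ge0_ler_powR; rewrite ?nnegrE ?powR_ge0 ?(ltW p0).
rewrite -powRrM; have t1 : 0 < q^-1 * p <= 1.
  by rewrite mulr_gt0 ?invr_gt0//= mulrC ler_pdivrMr// mul1r.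
apply: le_trans (powR_subadd _ _ t1) _; rewrite ?powR_ge0//.
by rewrite -!powRrM mulrA mulfV ?gt_eqF// mul1r.
Qed.

Lemma pnu_nuT : pnu p s1 s2 nuT.
Proof.
split; first by move=> g _; exact: nrm0.
- move=> c g /rD_Dss dg; rewrite /nuT.
  have -> : rC (fun x => c * g x) = lincomb (Complex c 0) 0 (rC g) (rC g).
    apply/funext => x; rewrite /lincomb mul0r addr0; apply: complex_ext.
      by rewrite creM /= !mul0r subr0.
    by rewrite cimM /= mulr0 mul0r addr0.
  have [/(_ (Complex c 0) 0) h _] := hT dg dg; apply: le_trans h _.
  have -> : cmod (0 : R[i]) = 0 by rewrite /cmod /cre /cim /= expr0n addr0 sqrtr0.
  rewrite [0 `^ q]powR0 ?gt_eqF// mul0r addr0 cmod_real -powRM//.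
  by rewrite -powRrM mulfV ?gt_eqF// powRr1// mulr_ge0.
- move=> f g /rD_Dss df /rD_Dss dg; rewrite /nuT.
  have -> : rC (fun x => f x + g x) = lincomb 1 1 (rC f) (rC g).
    by apply/funext => x; rewrite /lincomb !mul1r; apply: complex_ext; rewrite ?creD ?cimD //= addr0.
  have c1 : cmod (1 : R[i]) = 1 by rewrite (cmod_real 1) normr1.
  exact: sublinear_p.
Qed.

Variable M : R.
Hypotheses (M0 : 0 <= M) (hM : forall a, Dss s1 s2 a -> atom p s1 s2 a -> nrm (T a) <= M).

Let hab F : abd p s1 s2 nuT M F.
Proof. by apply: (abd_of_atoms pnu_nuT) => g /rD_Dss dg; exact: hM. Qed.

Variables (C1 C2 : R).
Variables (A1 B1 k1 : int -> n.-tuple R -> n.-tuple R -> R) (A2 B2 k2 : int -> m.-tuple R -> m.-tuple R -> R).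
Hypotheses (kp1 : kpack s1 C1 A1 B1 k1) (kp2 : kpack s2 C2 A2 B2 k2).
Local Notation PF := (PF A1 B1 A2 B2).
Local Notation Cm := (Cme n m p s1 s2 C1 C2).

(** This replaces the continuity that T lacks: f - PF F f is itself a test function, and nu of it is
    small. *)
Lemma nuT_of_PF f c : rD s1 s2 f -> (forall F, uniq F -> nuT (PF F f) `^ p <= c) -> nuT f `^ p <= c.
Proof.
move=> rf hc; apply/ler_addgt0Pr => e e0.
have [F uF hF] := reproducing n0 m0 p0 p1 hs1 hs2 kp1 kp2 pnu_nuT M0 hab rf e0.
have [_ bf _ _] := rf; have rP := rD_PF kp1 kp2 F (bxd_L2 hp bf).
have -> : f = (fun x => PF F f x + (f x - PF F f x)) by apply/funext => x; rewrite addrC subrK.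
apply: le_trans (pnu_D pnu_nuT rP (rD_sub rf rP)) _.
by apply: lerD => //; exact: hc.
Qed.

Lemma decomposition_est f (lam : nat -> R[i]) (a : nat -> pt -> R[i]) : Dss s1 s2 f ->
  (forall k, atom p s1 s2 (a k)) -> (\sum_(0 <= k <oo) (cmod (lam k) `^ p)%:E < +oo)%E -> Sconv lam a f ->
  nrm (T f) `^ p <= 4 * (M `^ p * Cm) * fine (\sum_(0 <= k <oo) (cmod (lam k) `^ p)%:E)%E.
Proof.
move=> df ha hl hS; have [rr ri] := Dss_rD df.
have [_ br _ _] := rr; have [_ bi _ _] := ri.
have Lr := bxd_L2 hp br; have Li := bxd_L2 hp bi.
set S := fine _.
have u0 k : 0 <= cmod (lam k) `^ p by exact: powR_ge0.
have lS := series_partial_le u0 hl; have Sl := series_partial_ge u0 hl.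
have ra k := atom_rat (cpart_re R n m) (ha k); have ia k := atom_rat (cpart_im R n m) (ha k).
have pa F x k : pairing (a k) (rC (KP A1 B1 A2 B2 F x)) =
    Complex (PF F (fun y => cre (a k y)) x) (PF F (fun y => cim (a k y)) x).
  by rewrite pairing_rC !(PF_KP kp1 kp2)//; exact: rat_L2f.
have pf F x : pairing f (rC (KP A1 B1 A2 B2 F x)) =
    Complex (PF F (fun y => cre (f y)) x) (PF F (fun y => cim (f y)) x).
  by rewrite pairing_rC !(PF_KP kp1 kp2).
(* Convergence in S' is tested only on the kernels y |-> KP F x y, one for each x; there it becomes
   pointwise convergence of the series of P_F a_k. *)
have cr F x : (fun N => \sum_(0 <= k < N) (cre (lam k) * PF F (fun y => cre (a k y)) x +
    (- cim (lam k)) * PF F (fun y => cim (a k y)) x)) @ \oo --> PF F (fun y => cre (f y)) x.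
  have [h _] := hS _ (schwartz_ntc (ntc_KP kp1 kp2 F x)); rewrite pf /= in h.
  rewrite (_ : (fun N => _) = (fun N => cre (\sum_(k < N) lam k * pairing (a k) (rC (KP A1 B1 A2 B2 F x)))))//.
  apply/funext => N; rewrite (cp_sum (cpart_re R n m)) big_mkord; apply: eq_bigr => k _.
  by rewrite creM pa mulNr.
have ci F x : (fun N => \sum_(0 <= k < N) (cre (lam k) * PF F (fun y => cim (a k y)) x +
    cim (lam k) * PF F (fun y => cre (a k y)) x)) @ \oo --> PF F (fun y => cim (f y)) x.
  have [_ h] := hS _ (schwartz_ntc (ntc_KP kp1 kp2 F x)); rewrite pf /= in h.
  rewrite (_ : (fun N => _) = (fun N => cim (\sum_(k < N) lam k * pairing (a k) (rC (KP A1 B1 A2 B2 F x)))))//.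
  apply/funext => N; rewrite (cp_sum (cpart_im R n m)) big_mkord; apply: eq_bigr => k _.
  by rewrite cimM pa.
have l1 k : `|cre (lam k)| <= cmod (lam k) by exact: cre_le.
have l2 k : `|cim (lam k)| <= cmod (lam k) by exact: cim_le.
have l3 k : `|- cim (lam k)| <= cmod (lam k) by rewrite normrN.
have er : nuT (fun x => cre (f x)) `^ p <= 2 * (M `^ p * Cm) * S.
  apply: nuT_of_PF => // F uF.
  exact: (limit_est n0 m0 p0 p1 hs1 hs2 kp1 kp2 ra ia l1 l3 lS Sl Lr cr pnu_nuT M0 (@hab F) uF).
have ei : nuT (fun x => cim (f x)) `^ p <= 2 * (M `^ p * Cm) * S.
  apply: nuT_of_PF => // F uF.
  exact: (limit_est n0 m0 p0 p1 hs1 hs2 kp1 kp2 ia ra l1 l2 lS Sl Li ci pnu_nuT M0 (@hab F) uF).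
have -> : f = lincomb 1 (Complex 0 1) (rC (fun x => cre (f x))) (rC (fun x => cim (f x))).
  apply/funext => x; rewrite /lincomb mul1r; apply: complex_ext.
    by rewrite creD creM /= mul0r mulr0 subr0 addr0.
  by rewrite cimD cimM /= mulr0 mul1r !add0r.
have c1 : cmod (1 : R[i]) = 1 by rewrite (cmod_real 1) normr1.
have c2 : cmod (Complex 0 1 : R[i]) = 1 by rewrite cmod_imag normr1.
apply: le_trans (sublinear_p (rD_Dss rr) (rD_Dss ri) c1 c2) _.
apply: le_trans (lerD er ei) _.
by rewrite le_eqVlt; apply/orP; left; apply/eqP; ring.
Qed.

Lemma bounded_of_atoms : exists2 c : R, 0 < c &
  forall f, Dss s1 s2 f -> ((nrm (T f))%:E <= c%:E * Hp_norm p s1 s2 f)%E.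
Proof.
(* The summand 1 keeps the constant positive when M = 0. *)
pose c := (4 * (M `^ p * Cm)) `^ p^-1 + 1.
have d0 : 0 <= 4 * (M `^ p * Cm) by rewrite !mulr_ge0 ?powR_ge0 ?Cme_ge0.
have c0 : 0 < c by rewrite ltr_wpDl ?powR_ge0.
exists c => // f df.
have H : ((nrm (T f) / c)%:E <= Hp_norm p s1 s2 f)%E.
  apply: le_ereal_inf_tmp => _ [lam [a [ha hl hS ->]]]; rewrite lee_fin ler_pdivrMr// mulrC.
  have h := decomposition_est df ha hl hS.
  set S := fine _ in h *; have S0 : 0 <= S.
    by apply: fine_ge0; apply: nneseries_ge0 => k _ _; rewrite lee_fin powR_ge0.
  have -> : nrm (T f) = (nrm (T f) `^ p) `^ p^-1 by rewrite -powRrM mulfV ?gt_eqF// powRr1.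
  apply: (@le_trans _ _ ((4 * (M `^ p * Cm) * S) `^ p^-1)).
    have i0 : 0 <= p^-1 by rewrite invr_ge0 ltW.
    have De : 0 <= 4 * (M `^ p * Cm) * S by exact: mulr_ge0.
    by apply: (ge0_ler_powR i0); rewrite ?nnegrE ?powR_ge0.
  by rewrite powRM//; apply: ler_wpM2r; rewrite ?powR_ge0// /c lerDl.
have -> : (nrm (T f))%:E = (c%:E * (nrm (T f) / c)%:E)%E by rewrite -EFinM mulrC divfK ?gt_eqF.
by apply: lee_pmul => //; rewrite lee_fin ?divr_ge0// ltW.
Qed.

End Extension.

(** * The quasi-norm of an atom *)

Section AtomNorm.
Variables (R : realType) (n m : nat) (p : R) (s1 s2 : nat).
Hypothesis p0 : 0 < p.
Local Notation pt := (pt R n m).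

(** All coefficients after the first are 0, so the atom itself may fill every place of the
    sequence. *)
Lemma Hp_norm_atom (a : pt -> R[i]) : atom p s1 s2 a -> (Hp_norm p s1 s2 a <= 1)%E.
Proof.
move=> ha; pose lam (k : nat) : R[i] := if k is 0%N then 1 else 0.
have c1 : cmod (1 : R[i]) = 1 by rewrite (cmod_real 1) normr1.
have c0 : cmod (0 : R[i]) = 0 by rewrite (cmod_real 0) normr0.
have E : (\sum_(0 <= k <oo) ((cmod (lam k)) `^ p)%:E = 1)%E.
  apply/cvg_lim => //; apply: cvg_near_cst; exists 1%N => // N /= hN.
  rewrite big_ltn// big_nat big1 ?adde0; last first.
    by case=> // k _; rewrite /lam c0 powR0// gt_eqF.
  by rewrite /lam c1 powR1.
apply: ereal_inf_lbound; exists lam, (fun=> a); split => //.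
- by rewrite E ltry.
- have key phi : \forall N \near \oo, \sum_(k < N) lam k * pairing a phi = pairing a phi.
    exists 1%N => // -[//|N] _; rewrite big_ord_recl /= mul1r big1 ?addr0// => k _; exact: mul0r.
  move=> phi _; split; apply: cvg_near_cst; apply: filterS (key phi) => N ->//.
- by rewrite E /= powR1.
Qed.

End AtomNorm.

Lemma floor_lt_succ (R : realType) (x : R) (s : nat) : Num.floor x <= s%:Z -> x < s.+1%:R.
Proof.
move=> h; apply: lt_le_trans (floorD1_gt x) _.
have : (Num.floor x + 1)%:~R <= (s%:Z + 1)%:~R :> R by rewrite ler_int lerD2r.
by rewrite [(s%:Z + 1)%:~R]rmorphD /= natr1.
Qed.

Theorem theorem1p1 (R : realType) (n m : nat) (p q : R) (s1 s2 : nat)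
    (V : lmodType R[i]) (nrm : V -> R) (T : (pt R n m -> R[i]) -> V) :
  (0 < n)%N -> (0 < m)%N ->
  0 < p <= 1 -> p <= q <= 1 ->
  qQuasiBanach q nrm ->
  Num.floor (n%:R * (p^-1 - 1)) <= s1%:Z ->
  Num.floor (m%:R * (p^-1 - 1)) <= s2%:Z ->
  sublinear_on (Dss s1 s2) q nrm T ->
  (exists2 c : R, 0 < c &
     forall f, Dss s1 s2 f -> ((nrm (T f))%:E <= c%:E * Hp_norm p s1 s2 f)%E)
  <->
  (exists M : R, forall a, Dss s1 s2 a -> atom p s1 s2 a -> nrm (T a) <= M).
Proof.
move=> n0 m0 /andP[p0 p1] /andP[pq q1] [nrm0 _ _ _ _] /floor_lt_succ hs1 /floor_lt_succ hs2 hT; split.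
  move=> [c c0 hc]; exists c => a da aa; rewrite -lee_fin; apply: le_trans (hc a da) _.
  rewrite -[leRHS]mule1; apply: lee_pmul => //; first by rewrite lee_fin ltW.
    by apply/ereal_infP => _ [lam [b [_ _ _ ->]]]; rewrite lee_fin powR_ge0.
  exact: Hp_norm_atom.
move=> [M hM].
have [C1 [A1 [B1 [k1 kp1]]]] := exists_kpack R n s1.
have [C2 [A2 [B2 [k2 kp2]]]] := exists_kpack R m s2.
(* M is only some upper bound; [|M|] is one that is visibly nonnegative, as the estimates want. *)
apply: (@bounded_of_atoms R n m p q s1 s2 V nrm T n0 m0 p0 p1 pq hs1 hs2 nrm0 hT `|M| (normr_ge0 M) _ C1 C2 A1 B1 k1 A2 B2 k2 kp1 kp2).
by move=> a da aa; apply: le_trans (hM a da aa) (ler_norm M).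
Qed.
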